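(* Let $N\ge1$ be an integer, $\alpha>0$ and $-\min(2,N)<l<N\alpha$. Let $\varphi\in L^q_\gamma(\mathbb R^N)$, where $$0<\gamma<N,\qquad\frac l\alpha<\gamma<\frac{2+l}\alpha,\qquad \frac\gamma N\le\frac1q+\frac\gamma N<1,\qquad\frac{N\alpha}{2q}+\frac{\gamma\alpha}2-\frac l2<1 .$$ Then the existence time $T_{\max}(\lambda\varphi)$ of the maximal solution of $$u(t)=e^{t\Delta}u_0+\int_0^te^{(t-\sigma)\Delta}\left(|\cdot|^l|u(\sigma)|^\alpha u(\sigma)\right)d\sigma,\qquad u_0=\lambda\varphi,$$ satisfies $$T_{\max}(\lambda\varphi)\ \ge\ C\left(\lambda\|\varphi\|_{L^q_\gamma}\right)^{-\left(\frac{2+l}{2\alpha}-\frac N{2q}-\frac\gamma2\right)^{-1}}\qquad\text{for all }\lambda>0,$$ where $C=C(\alpha,q,l,\gamma,N)>0$ is a constant.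
   Context: The integral equation is the mild formulation of the Hardy-Hénon parabolic equation $\partial_tu=\Delta u+|\cdot|^l|u|^\alpha u$ on $\mathbb R^N$, with $e^{t\Delta}$ the heat semigroup on $\mathbb R^N$. $L^q_\gamma(\mathbb R^N)$ is the space of measurable $f:\mathbb R^N\to\mathbb R$ with $|\cdot|^\gamma f\in L^q(\mathbb R^N)$, normed by $\|f\|_{L^q_\gamma}=\||\cdot|^\gamma f\|_{L^q(\mathbb R^N)}$; $q\in(1,\infty]$ and $1/\infty=0$. Under the stated conditions the equation is locally well-posed in $L^q_\gamma(\mathbb R^N)$: one fixes $0<\nu<\gamma$ with $\frac{\gamma+l}{\alpha+1}<\nu<\frac{N+l}{\alpha+1}$ and $r>q$ with $\frac1{q(\alpha+1)}-\frac{\nu(\alpha+1)-l-\gamma}{N(\alpha+1)}<\frac1r<\frac{N-\nu(\alpha+1)+l}{N(\alpha+1)}$ (with $r=\infty$ if $q=\infty$), and sets $\tilde\beta_l=\frac N2\left(\frac1q-\frac1r\right)+\frac{\gamma-\nu}2$; then there is a unique solution in $C([0,T];L^q_\gamma)$ for which $t^{\tilde\beta_l}\|u(t)\|_{L^r_\nu}$ is bounded on $(0,T]$ (if $q=\infty$, $[0,T]$ is replaced by $(0,T]$ and $\lim_{t\to0}\|u(t)-e^{t\Delta}u_0\|_{L^\infty_\gamma}=0$). It extends to a maximal interval $[0,T_{\max}(u_0))$, and either $T_{\max}(u_0)=\infty$ or $\|u(t)\|_{L^q_\gamma}\to\infty$ as $t\to T_{\max}(u_0)$. *)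

(* Defs.v *)
From HB Require Import structures.
From mathcomp Require Import all_boot all_order all_algebra.
From mathcomp Require Import all_classical all_reals all_analysis.

Set Implicit Arguments.
Unset Strict Implicit.
Unset Printing Implicit Defensive.

Import Order.TTheory GRing.Theory Num.Theory.
Import numFieldNormedType.Exports.

Local Open Scope classical_set_scope.
Local Open Scope ring_scope.

(* R^N is the type of N-tuples, which the library equips with the product
   (Borel) sigma-algebra.  Lebesgue measure is transported along
   R * R^n -> R^(n+1), starting from the unit mass on the one-point space R^0. *)
Notation Rspace R N := (N.-tuple (measurableTypeR R)).

Section LebesgueMeasureSucc.
Context (R : realType) (n : nat).
Variable mu : {sigma_finite_measure set (Rspace R n) -> \bar R}.

Definition tcons (p : measurableTypeR R * Rspace R n) : Rspace R n.+1 :=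
  [tuple of p.1 :: p.2].

Lemma measurable_tcons : measurable_fun [set: _] tcons.
Proof. exact: (measurable_cons measurable_fst measurable_snd). Qed.

Definition lebesgueS : set (Rspace R n.+1) -> \bar R :=
  pushforward (@lebesgue_measure R \x mu)%E tcons.

Let lebesgueS0 : lebesgueS set0 = 0%E.
Proof. by rewrite /lebesgueS /pushforward preimage_set0 measure0. Qed.

Let lebesgueS_ge0 A : (0 <= lebesgueS A)%E.
Proof. by rewrite /lebesgueS /pushforward. Qed.

Let lebesgueS_sigma_additive : semi_sigma_additive lebesgueS.
Proof.
move=> F mF tF mUF; rewrite /lebesgueS /pushforward preimage_bigcup.
have mpre A : measurable A -> measurable (tcons @^-1` A).
  by move=> mA; rewrite -[X in measurable X]setTI; exact: measurable_tcons.
apply: measure_semi_sigma_additive => [k||]; first exact: mpre.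
- apply/trivIsetP => i j _ _ ij; rewrite -preimage_setI.
  by move/trivIsetP : tF => /(_ _ _ I I ij) ->; rewrite preimage_set0.
- by rewrite -preimage_bigcup; exact: mpre.
Qed.

HB.instance Definition _ := isMeasure.Build _ _ _
  lebesgueS lebesgueS0 lebesgueS_ge0 lebesgueS_sigma_additive.

Let lebesgueS_sigma_finite : sigma_finite [set: Rspace R n.+1] lebesgueS.
Proof.
have /sigma_finiteP[F [TF ndF Foo]] := sigma_finiteT (@lebesgue_measure R).
have /sigma_finiteP[G [TG ndG Goo]] := sigma_finiteT mu.
pose uncons (x : Rspace R n.+1) : measurableTypeR R * Rspace R n :=
  (thead x, [tuple of behead x]).
have muncons : measurable_fun [set: _] uncons.
  by apply/measurable_fun_pairP; split;
    [exact: measurable_tnth|exact: measurable_behead].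
have tconsK p : uncons (tcons p) = p.
  by case: p => a b; rewrite /uncons theadE; congr pair; apply: val_inj.
exists (fun k => uncons @^-1` (F k `*` G k)).
  rewrite -preimage_bigcup -[LHS](preimage_setT uncons); congr (_ @^-1` _).
  rewrite -setXTT TF TG predeqE => -[x y]; split.
    move=> [/= [i _ Fix] [j _ Gjy]]; exists (maxn i j) => //; split.
    - by move: x Fix; exact/subsetPset/ndF/leq_maxl.
    - by move: y Gjy; exact/subsetPset/ndG/leq_maxr.
  by move=> [i _ []/= ? ?]; split; exists i.
move=> k; have [mF Fk] := Foo k; have [mG Gk] := Goo k; split.
  by rewrite -[X in measurable X]setTI; apply: muncons => //;
    exact: measurableX.
rewrite /lebesgueS /pushforward -comp_preimage.
rewrite (_ : uncons \o tcons = id); last by apply/funext => p /=.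
by rewrite preimage_id product_measure1E// lte_mul_pinfty// ge0_fin_numE.
Qed.

HB.instance Definition _ := Measure_isSigmaFinite.Build _ _ _
  lebesgueS lebesgueS_sigma_finite.

End LebesgueMeasureSucc.

Fixpoint lebesgueN (R : realType) (N : nat) :
    {sigma_finite_measure set (Rspace R N) -> \bar R} :=
  match N with
  | 0 => dirac ([tuple] : Rspace R 0)
  | n.+1 => lebesgueS (lebesgueN R n)
  end.

Section HardyHenon.
Context {R : realType} {N : nat}.
Implicit Types (x y : Rspace R N) (f phi : Rspace R N -> R).
Implicit Types (u : R -> Rspace R N -> R).

Definition enorm x : R := Num.sqrt (\sum_(i < N) tnth x i ^+ 2).

Definition vsub x y : Rspace R N := [tuple tnth x i - tnth y i | i < N].

Definition heat_kernel (t : R) x : R :=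
  (4 * pi * t) `^ (- (N%:R / 2)) * expR (- (enorm x ^+ 2 / (4 * t))).

(* e^(t Delta) f, for t >= 0; it is the identity at t = 0. *)
Definition heat (t : R) f x : R :=
  if t == 0 then f x
  else (\int[lebesgueN R N]_y (heat_kernel t (vsub x y) * f y))%R.

(* 1/q, with 1/oo = 0 *)
Definition rinv (q : \bar R) : R := fine (q^-1)%E.

(* ||f||_(L^q_g); for q = +oo this is an essential supremum. *)
Definition wnorm (q : \bar R) (g : R) f : \bar R :=
  Lnorm (lebesgueN R N) q (EFin \o (fun x => enorm x `^ g * f x)).

Definition wLp (q : \bar R) (g : R) : set (Rspace R N -> R) :=
  [set f | measurable_fun setT f /\ (wnorm q g f < +oo)%E].

Definition nonlin (alpha l : R) f x : R :=
  enorm x `^ l * (`|f x| `^ alpha * f x).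

(* The equation at time t, as an identity between functions of x up to null
   sets.  The time integral is taken pointwise in x, and the equation requires
   it to converge absolutely. *)
Definition mild_at (alpha l : R) phi u (t : R) : Prop :=
  {ae lebesgueN R N, forall x,
    lebesgue_measure.-integrable `[0, t]
      (fun s => (heat (t - s) (nonlin alpha l (u s)) x)%:E) /\
    u t x = heat t phi x +
      (\int[lebesgue_measure]_(s in `[0, t])
         heat (t - s) (nonlin alpha l (u s)) x)%R}.

Definition admissible (alpha l gamma : R) (q : \bar R) (nu : R) (r : \bar R) :
    Prop :=
  [/\ 0 < nu < gamma,
      (gamma + l) / (alpha + 1) < nu < (N%:R + l) / (alpha + 1),
      (q < r)%E \/ (q = +oo%E /\ r = +oo%E) &
      rinv q / (alpha + 1)
        - (nu * (alpha + 1) - l - gamma) / (N%:R * (alpha + 1))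
      < rinv r
      < (N%:R - nu * (alpha + 1) + l) / (N%:R * (alpha + 1))].

Definition beta (gamma : R) (q : \bar R) (nu : R) (r : \bar R) : R :=
  N%:R / 2 * (rinv q - rinv r) + (gamma - nu) / 2.

Definition time_dom (q : \bar R) (T : R) : set R :=
  if q == +oo%E then `]0, T]%classic else `[0, T]%classic.

Definition wcontinuous (q : \bar R) (gamma : R) (J : set R) u : Prop :=
  (forall t, J t -> wLp q gamma (u t)) /\
  (forall t, J t ->
    wnorm q gamma (u s \- u t) @[s --> within J (nbhs t)] --> 0%E).

Definition is_solution (alpha l gamma : R) (q : \bar R) (nu : R) (r : \bar R)
    phi (T : R) u : Prop :=
  [/\ wcontinuous q gamma (time_dom q T) u,
      forall t, time_dom q T t -> mild_at alpha l phi u t,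
      exists M : R, forall t, 0 < t <= T ->
        ((t `^ beta gamma q nu r)%:E * wnorm r nu (u t) <= M%:E)%E &
      q = +oo%E -> wnorm q gamma (u t \- heat t phi) @[t --> 0^'+] --> 0%E].

(* Solutions of the class above are unique on each [0, T], hence those on
   different intervals extend one another; the supremum of the T for which one
   exists is the existence time of the maximal solution. *)
Definition Tmax (alpha l gamma : R) (q : \bar R) (nu : R) (r : \bar R) phi :
    \bar R :=
  ereal_sup [set T%:E | T in [set T : R | 0 < T /\
    exists u, is_solution alpha l gamma q nu r phi T u]].

End HardyHenon.

(* Main.v *)
Require Import Defs.
From HB Require Import structures.
From mathcomp Require Import all_boot all_order all_algebra.
From mathcomp Require Import all_classical all_reals all_analysis.
From mathcomp Require Import measurable_realfun ess_sup_inf ring lra.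
Import Order.TTheory GRing.Theory Num.Theory.
Import numFieldNormedType.Exports.
Local Open Scope classical_set_scope.
Local Open Scope ring_scope.
Set Implicit Arguments.
Unset Strict Implicit.
Unset Printing Implicit Defensive.

(* Let theta = (2 + l) / (2 alpha) - N / (2 q) - gamma / 2 > 0.  If
   C2 Lambda^alpha T^(alpha theta) <= 1 with Lambda = lambda ||phi||, a solution
   exists on [0, T]; solving for T gives the bound.

   The scalar majorant equation v = e^(t Delta) |u0| + int_0^t e^((t-s) Delta)
   (|.|^l v^(alpha + 1)) ds has nonnegative monotone right-hand side, so Picard
   iterates increase to a solution, and the smallness condition keeps
   t^beta ||v(t)||_(L^rho_nu) bounded uniformly along the iteration for one pair of
   exponents (nu, rho).  The pair is chosen near the lower end of the admissible
   range: a single heat estimate then controls v in every other admissible space, so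
   that the constant does not depend on the pair in the theorem.  For signed data the
   equation for U = u + v again has a nonnegative nondecreasing source while
   |u| <= v, and is solved by the same iteration; no contraction argument is needed.

   Continuity in time for t > 0 follows from a bound on
   |G_t - G_s| by Gaussians.  At t = 0 and q < oo it amounts to
   e^(t Delta) phi -> phi in L^q_gamma. *)

(** * Integration over tuples *)

(** All estimates are made for functions with values in [0, +oo], where Tonelli and monotone
    convergence hold without conditions; signs and finite values enter only where the majorant is
    finite, hence almost everywhere. As the constant of the theorem is unspecified, Hölder's,
    Jensen's and Minkowski's inequalities are all replaced by [jensen_le], which loses a factor.
    With v of integrability 1/rho and weight nu, the source has integrability 1/(rho (alpha + 1))
    and weight nu (alpha + 1) - l. If a is the time exponent of the heat estimate back to (rho, nu)
    and b that of the source, then 1 - a - b = alpha theta - beta: this is where T^(alpha theta)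
    comes from. The obstacle is the return to L^q_gamma and to other admissible spaces. The source
    may have a larger Lebesgue exponent than the target, where smoothing alone does not help; its
    heavier weight must compensate. The function is then split at the unit ball, each part is put by
    Hölder into a space with the Lebesgue exponent of the target, and an arbitrarily small power of
    t is lost. The strict inequalities among the exponents pay for this loss. *)

Section TupleMeasure.
Context {R : realType}.
Local Notation leb := (@lebesgue_measure R).

Lemma measurable_EFinf d (T : measurableType d) (D : set T) (g : T -> R) :
  measurable_fun D g -> measurable_fun D (fun x => (g x)%:E).
Proof. by move=> mg; exact: (proj2 (measurable_EFinP _ _) mg). Qed.

Lemma measurable_powRf d (T : measurableType d) (a : R) (g : T -> R) :
  measurable_fun setT g -> measurable_fun setT (fun x => g x `^ a).
Proof. by move=> mg; exact: (measurableT_comp (@measurable_powR R a) mg). Qed.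

Lemma integral_tuple0 (f : Rspace R 0 -> \bar R) :
  measurable_fun setT f -> (\int[lebesgueN R 0]_x f x = f [tuple])%E.
Proof.
move=> mf; by rewrite /= integral_dirac//  diracT mul1e.
Qed.

Lemma measurable_comp_tcons n (f : Rspace R n.+1 -> \bar R) :
  measurable_fun setT f ->
  measurable_fun setT (fun p : measurableTypeR R * Rspace R n => f (tcons p)).
Proof. by move=> mf; exact: (measurableT_comp mf (@measurable_tcons R n)). Qed.

Lemma integral_tupleS n (f : Rspace R n.+1 -> \bar R) :
  measurable_fun setT f -> (forall x, (0 <= f x)%E) ->
  (\int[lebesgueN R n.+1]_x f x =
   \int[leb]_a \int[lebesgueN R n]_x f (tcons (a, x)))%E.
Proof.
move=> mf f0.
have -> : (\int[lebesgueN R n.+1]_x f x =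
  \int[leb \x lebesgueN R n]_p f (tcons p))%E.
  rewrite -[LHS]/(\int[pushforward (leb \x lebesgueN R n)%E (@tcons R n)]_x f x)%E.
  rewrite ge0_integral_pushforward//.
  exact: measurable_tcons.
by rewrite fubini_tonelli1//; exact: measurable_comp_tcons.
Qed.

Lemma measurable_tnth_comp d (T : measurableType d) n (g : T -> Rspace R n)
    (i : 'I_n) :
  measurable_fun setT g -> measurable_fun setT (fun p => tnth (g p) i : R).
Proof. by move=> mg; exact: (measurableT_comp (@measurable_tnth _ (measurableTypeR R) n i) mg). Qed.

Lemma tnth_tcons0 n a (x : Rspace R n) : tnth (tcons (a, x)) ord0 = a.
Proof. by []. Qed.

Lemma tnth_tconsS n a (x : Rspace R n) i :
  tnth (tcons (a, x)) (lift ord0 i) = tnth x i.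
Proof. by rewrite /tcons tnthS. Qed.

Lemma measurable_prod_tnth n (f : 'I_n -> R -> R) :
  (forall i, measurable_fun setT (f i)) ->
  measurable_fun setT (fun x : Rspace R n => (\prod_i f i (tnth x i))%R).
Proof.
move=> mf; apply: measurable_prod => i _.
by apply: (measurableT_comp (mf i)); exact: measurable_tnth_comp.
Qed.

Lemma integral_prod_tnth n (f : 'I_n -> R -> R) (c : 'I_n -> R) :
  (forall i, measurable_fun setT (f i)) -> (forall i a, 0 <= f i a) ->
  (forall i, \int[leb]_a (f i a)%:E = (c i)%:E)%E ->
  (\int[lebesgueN R n]_x (\prod_i f i (tnth x i))%:E = (\prod_i c i)%:E)%E.
Proof.
elim: n f c => [|n IH] f c mf f0 fc.
  rewrite integral_tuple0 ?big_ord0//.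
  by under eq_fun do rewrite big_ord0; exact: measurable_cst.
rewrite integral_tupleS; last 2 first.
  exact: measurable_EFinf (measurable_prod_tnth _).
  by move=> x; rewrite lee_fin prodr_ge0.
under eq_integral => a _.
  under eq_integral => x _.
    rewrite big_ord_recl tnth_tcons0 EFinM.
    under eq_bigr do rewrite tnth_tconsS.
    over.
  rewrite ge0_integralZl//=; last 3 first.
    exact: measurable_EFinf (measurable_prod_tnth (f := fun i => f (lift ord0 i)) _).
    by move=> x _; rewrite lee_fin prodr_ge0.
    by rewrite lee_fin.
  rewrite (IH (fun i => f (lift ord0 i)) (fun i => c (lift ord0 i)))//.
  over.
rewrite ge0_integralZr//=; last 3 first.
  exact: (measurable_EFinf (mf ord0)).
  by move=> x _; rewrite lee_fin.
  rewrite lee_fin prodr_ge0// => i _; rewrite -lee_fin -fc.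
  by apply: integral_ge0 => a _; rewrite lee_fin.
by rewrite fc big_ord_recl EFinM.
Qed.

(** Later only upper bounds of the one-dimensional factors are known; being finite, the integrals
    themselves can serve as constants in the exact formula. *)
Lemma le_integral_prod_tnth n (f : 'I_n -> R -> R) (c : 'I_n -> R) :
  (forall i, measurable_fun setT (f i)) -> (forall i a, 0 <= f i a) ->
  (forall i, \int[leb]_a (f i a)%:E <= (c i)%:E)%E ->
  (\int[lebesgueN R n]_x (\prod_i f i (tnth x i))%:E <= (\prod_i c i)%:E)%E.
Proof.
move=> mf f0 fc.
have i0 i : (0 <= \int[leb]_a (f i a)%:E)%E.
  by apply: integral_ge0 => a _; rewrite lee_fin.
have fin i : (\int[leb]_a (f i a)%:E)%E \is a fin_num.
  by rewrite ge0_fin_numE//; exact: le_lt_trans (fc i) (ltry _).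
rewrite (@integral_prod_tnth n f (fun i => fine (\int[leb]_a (f i a)%:E)%E))//; last first.
  by move=> i; rewrite fineK.
rewrite lee_fin; apply: ler_prod => i _; rewrite fine_ge0//=.
by rewrite -lee_fin fineK.
Qed.

(** Off the coordinate hyperplanes a singular weight |y|^(-c) is dominated by a product of
    one-dimensional weights. Induction on the dimension: over a nonzero first coordinate the slice
    of the exceptional set is the exceptional set one dimension lower, and the zero first coordinate
    is a null set. *)
Lemma ae_tnth_neq0 n :
  {ae lebesgueN R n, forall x, forall i, tnth x i != 0}.
Proof.
pose Z n := [set x : Rspace R n | exists i, tnth x i = 0].
have mZ m : measurable (Z m).
  rewrite (_ : Z m = \bigcup_(i in [set: 'I_m]) [set x | tnth x i = 0]); last first.
    by apply/seteqP; split=> x /= [i]; [exists i|exists i].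
  apply: fin_bigcup_measurable => // i _.
  rewrite -[X in measurable X]setTI.
  exact: (@measurable_tnth _ (measurableTypeR R) m i measurableT [set 0] (measurable_set1 _)).
have mi m : measurable_fun setT (fun x : Rspace R m => (\1_(Z m) x : R)%:E).
  apply: measurable_EFinf.
  exact: (measurable_indic (mZ m)).
suff Z0 : lebesgueN R n (Z n) = 0%E.
  exists (Z n); split; [exact: (mZ n)|exact: Z0|] => x /= /existsNP[i /negP]; rewrite negbK => /eqP xi.
  by exists i.
elim: n => [|n IH].
  rewrite (_ : Z 0%N = set0) ?measure0//.
  by apply/seteqP; split=> x //= -[[]].
have -> : lebesgueN R n.+1 (Z n.+1) =
    (\int[lebesgueN R n.+1]_x (\1_(Z n.+1) x)%:E)%E.
  by rewrite (integral_indic _ measurableT (mZ n.+1)) setIT.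
rewrite (integral_tupleS (mi n.+1)); last by move=> x; rewrite lee_fin.
rewrite (@ae_eq_integral _ _ _ leb setT (cst 0%E))//; first exact: integral0.
  apply: (measurable_fun_fubini_tonelli_F
    (fun p => (\1_(Z n.+1) (tcons p))%:E)) => /=.
    exact: (measurable_comp_tcons (mi n.+1)).
  by move=> x; rewrite lee_fin.
exists [set 0]; split => //; first exact: lebesgue_measure_set1.
move=> a /= /not_implyP[_]; apply: contra_notP => /eqP a0.
rewrite (eq_integral (fun x => (\1_(Z n) x)%:E)).
  by rewrite (integral_indic _ measurableT (mZ n)) setIT.
move=> x _; congr EFin; rewrite !indicE; congr (nat_of_bool _)%:R.
apply/idP/idP; rewrite !inE.
  move=> [i]; case: (unliftP ord0 i) => [j ->|->].
    by rewrite tnth_tconsS; exists j.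
  by rewrite tnth_tcons0 => /eqP; rewrite (negbTE a0).
by move=> [j xj]; exists (lift ord0 j); rewrite tnth_tconsS.
Qed.

End TupleMeasure.

(** * One-dimensional power integrals and the Gaussian density *)

Section OneDimensionalIntegrals.
Context {R : realType}.
Local Notation leb := (@lebesgue_measure R).
Implicit Types (f F : R -> R) (a b c d t M : R).

Lemma integral_itv_le_primitive f F c d M : 0 <= M ->
  (forall x, c <= x <= d -> is_derive x 1 F (f x) /\ {for x, continuous f}) ->
  (c < d -> F d - F c <= M) ->
  (\int[leb]_(x in `[c, d]) (f x)%:E <= M%:E)%E.
Proof.
move=> M0 fF FM; have [cd|dc] := ltP c d; last first.
  rewrite (@integral_Sset1 _ _ _ c) ?lee_fin// => x /=; rewrite in_itv/= => /andP[cx xd].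
  by apply/eqP; rewrite eq_le; apply/andP; split; [exact: le_trans xd dc|exact: cx].
have dF x : c <= x <= d -> derivable F x 1 by move=> /fF[[]].
have cF x : c <= x <= d -> {for x, continuous F}.
  by move=> /dF /derivable1_diffP /differentiable_continuous.
rewrite (@continuous_FTC2 _ f F c d)//.
- by rewrite -EFinB lee_fin FM.
- apply: continuous_in_subspaceT => x; rewrite inE/= in_itv/= => /fF[_].
  exact.
- split.
  + by move=> x; rewrite in_itv/= => /andP[cx xd]; apply: dF; rewrite !ltW.
  + by apply: cvg_at_right_filter; apply: cF; rewrite lexx ltW.
  + by apply: cvg_at_left_filter; apply: cF; rewrite lexx ltW.
- move=> x; rewrite in_itv/= => /andP[cx xd].
  rewrite derive1E; have [] := fF x; first by rewrite !ltW.
  by move=> /@derive_val.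
Qed.

(** Improper integrals by monotone convergence along an exhaustion by compact intervals, on each of
    which the primitive gives the same bound [M]. The first intervals of an exhaustion may be empty,
    which is why the increment is bounded only when [c i < d i]. *)
Lemma integral_bigcup_le_primitive f F (c d : nat -> R) M : 0 <= M ->
  measurable_fun setT f ->
  (forall i j, (i <= j)%N -> c j <= c i /\ d i <= d j) ->
  (forall i x, c i <= x <= d i ->
    [/\ 0 <= f x, is_derive x 1 F (f x) & {for x, continuous f}]) ->
  (forall i, c i < d i -> F (d i) - F (c i) <= M) ->
  (\int[leb]_(x in \bigcup_i `[c i, d i]%classic) (f x)%:E <= M%:E)%E.
Proof.
move=> M0 mf cd fF FM.
have h := @ge0_nondecreasing_set_cvg_integral _ (measurableTypeR R) R
  (fun i => `[c i, d i]%classic) (EFin \o f) (@lebesgue_measure R).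
rewrite -(cvg_lim _ (h _ _ _ _))//.
- apply: lime_le.
    apply/cvg_ex; eexists; apply: h => //.
    + move=> i j ij; apply/subsetPset => x /=; rewrite !in_itv/= => /andP[cx xd].
      by have [h1 h2] := cd _ _ ij; rewrite (le_trans h1 cx) (le_trans xd h2).
    + by move=> i; apply/measurable_EFinP; exact: measurable_funTS.
    + by move=> i x; rewrite /= in_itv/= => /fF[]; rewrite lee_fin.
  near=> i; apply: (@integral_itv_le_primitive f F) => //.
    by move=> x /fF[].
  exact: FM.
- move=> i j ij; apply/subsetPset => x /=; rewrite !in_itv/= => /andP[cx xd].
  by have [h1 h2] := cd _ _ ij; rewrite (le_trans h1 cx) (le_trans xd h2).
- by move=> i; apply/measurable_EFinP; exact: measurable_funTS.
- by move=> i x; rewrite /= in_itv/= => /fF[]; rewrite lee_fin.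
Unshelve. all: by end_near. Qed.

Lemma powR_continuous_pos a x : 0 < x -> {for x, continuous (fun s => s `^ a : R)}.
Proof.
by move=> x0; apply/differentiable_continuous/derivable1_diffP; have [] := is_derive1_powR a x0.
Qed.

Lemma is_derive_powR_comp (g : R -> R) a b x : 0 < g x -> is_derive x 1 g b ->
  is_derive x 1 (fun s => g s `^ a) (a * g x `^ (a - 1) * b).
Proof.
by move=> gx dg; exact: (@is_derive1_comp R (fun s => s `^ a) g x _ _ (is_derive1_powR a gx) dg).
Qed.

Lemma powR_comp_continuous (g : R -> R) a b x : 0 < g x -> is_derive x 1 g b ->
  {for x, continuous (fun s => g s `^ a)}.
Proof.
move=> gx dg; apply/differentiable_continuous/derivable1_diffP.
by have [] := is_derive_powR_comp a gx dg.
Qed.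

Lemma integral_powRN_le b t : 0 <= b < 1 -> 0 < t ->
  (\int[leb]_(s in `]0%R, t[) (s `^ (- b))%:E <= ((t `^ (1 - b)) / (1 - b))%:E)%E.
Proof.
move=> /andP[b0 b1] t0.
have b1' : 0 < 1 - b by rewrite subr_gt0.
have -> : (\int[leb]_(s in `]0%R, t[) (s `^ (- b))%:E =
    \int[leb]_(s in `]0%R, t]) (s `^ (- b))%:E)%E.
  rewrite integral_itv_bndo_bndc//; apply/measurable_EFinP.
  exact: (measurable_funTS (@measurable_powR R (- b))).
have -> : `]0, t]%classic = \bigcup_i `[(i.+1%:R)^-1, t]%classic :> set R.
  apply/seteqP; split=> x /=; rewrite in_itv/=.
    move=> /andP[x0 xt]; have [k] := ltr_add_invr x0; rewrite add0r => kx.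
    by exists k => //=; rewrite in_itv/= xt ltW.
  by move=> [i _ /=]; rewrite in_itv/= => /andP[ix ->]; rewrite andbT (lt_le_trans _ ix).
apply: (@integral_bigcup_le_primitive _ (fun s => (1 - b)^-1 * s `^ (1 - b))).
- by rewrite mulr_ge0 ?powR_ge0 ?invr_ge0 ?ltW.
- exact: measurable_powR.
- by move=> i j ij; split=> //; rewrite lef_pV2 ?posrE ?ltr0n// ler_nat ltnS.
- move=> i x /andP[ix xt]; have x0 : 0 < x by rewrite (lt_le_trans _ ix).
  split; [exact: powR_ge0| |exact: powR_continuous_pos].
  have := is_deriveZ (1 - b)^-1 (is_derive1_powR (1 - b) x0).
  rewrite /GRing.scale/= mulrA mulVf ?gt_eqF// mul1r.
  by rewrite addrAC subrr add0r.
- by move=> i _; rewrite mulrC lerBlDr lerDl mulr_ge0 ?powR_ge0 ?invr_ge0 ?ltW.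
Qed.

Lemma integral_subr_powRN_le a t : 0 <= a < 1 -> 0 < t ->
  (\int[leb]_(s in `]0%R, t[) ((t - s) `^ (- a))%:E <= ((t `^ (1 - a)) / (1 - a))%:E)%E.
Proof.
move=> /andP[b0 b1] t0.
have b1' : 0 < 1 - a by rewrite subr_gt0.
have mf : measurable_fun setT (fun s : R => (t - s) `^ (- a)).
  by apply: (@measurable_powRf _ _ (measurableTypeR R) (- a)); exact: measurable_funB.
have -> : (\int[leb]_(s in `]0%R, t[) ((t - s) `^ (- a))%:E =
    \int[leb]_(s in `[0%R, t[) ((t - s) `^ (- a))%:E)%E.
  rewrite integral_itv_obnd_cbnd//; apply/measurable_EFinP.
  exact/measurable_funTS.
have -> : `[0, t[%classic = \bigcup_i `[0, t - (i.+1%:R)^-1]%classic :> set R.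
  apply/seteqP; split=> x /=; rewrite in_itv/=.
    move=> /andP[x0 xt]; have [k kx] := ltr_add_invr xt.
    by exists k => //=; rewrite in_itv/= x0 lerBrDr ltW.
  move=> [i _ /=]; rewrite in_itv/= => /andP[-> ix]/=.
  by rewrite (le_lt_trans ix)// ltrBlDr ltrDl.
apply: (@integral_bigcup_le_primitive _ (fun s => - (1 - a)^-1 * (t - s) `^ (1 - a))).
- by rewrite mulr_ge0 ?powR_ge0 ?invr_ge0 ?ltW.
- exact: mf.
- by move=> i j ij; split=> //; rewrite lerD2l lerN2 lef_pV2 ?posrE ?ltr0n// ler_nat ltnS.
- move=> i x /andP[x0 ix].
  have tx : 0 < t - x by rewrite subr_gt0 (le_lt_trans ix)// ltrBlDr ltrDl.
  have dt : is_derive x 1 (fun s => t - s) (-1).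
    have := is_deriveB (is_derive_cst t x 1) (is_derive_id x (1:R)).
    by rewrite sub0r.
  split; [exact: powR_ge0| |].
    have := is_deriveZ (- (1 - a)^-1)
      (@is_derive_powR_comp (fun s => t - s) (1 - a) _ x tx dt).
    rewrite /GRing.scale/= mulrN1 mulrNN mulrA mulVf ?gt_eqF// mul1r.
    by rewrite addrAC subrr add0r.
  exact: (@powR_comp_continuous (fun s => t - s) (- a) _ x tx dt).
- move=> i i0; rewrite !mulNr subr0 opprK addrC mulrC.
  by rewrite lerBlDr lerDl mulr_ge0 ?powR_ge0 ?invr_ge0 ?ltW.
Qed.

Lemma integral_1D_powRN_le d : 1 < d ->
  (\int[leb]_(s in `[0%R, +oo[) ((1 + s) `^ (- d))%:E <= ((d - 1)^-1)%:E)%E.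
Proof.
move=> d1; have d1' : 0 < d - 1 by rewrite subr_gt0.
have -> : `[0, +oo[%classic = \bigcup_i `[0, i%:R]%classic :> set R.
  apply/seteqP; split=> x /=; rewrite in_itv/= ?andbT.
    move=> x0; exists (Num.bound x) => //=; rewrite in_itv/= x0/= ltW//.
    by apply: le_lt_trans (archi_boundP x0).
  by move=> [i _ /=]; rewrite in_itv/= => /andP[].
apply: (@integral_bigcup_le_primitive _ (fun s => - (d - 1)^-1 * (1 + s) `^ (1 - d))).
- by rewrite invr_ge0 ltW.
- by apply: (@measurable_powRf _ _ (measurableTypeR R) (- d)); exact: measurable_funD.
- by move=> i j ij; rewrite lexx ler_nat.
- move=> i x /andP[x0 ix].
  have tx : 0 < 1 + x by rewrite ltr_pwDl.
  have dt : is_derive x 1 (fun s => 1 + s) 1.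
    have := is_deriveD (is_derive_cst (1:R) x 1) (is_derive_id x (1:R)).
    by rewrite add0r.
  split; [exact: powR_ge0| |].
    have := is_deriveZ (- (d - 1)^-1)
      (@is_derive_powR_comp (fun s => 1 + s) (1 - d) _ x tx dt).
    rewrite /GRing.scale/= mulr1 mulrA -[1 - d]opprB mulrNN mulVf ?gt_eqF// mul1r.
    by rewrite (_ : - (d - 1) - 1 = - d) //; ring.
  exact: (@powR_comp_continuous (fun s => 1 + s) (- d) _ x tx dt).
- move=> i _; rewrite !mulNr addr0 opprK powR1 mulr1 addrC.
  by rewrite lerBlDr lerDl mulr_ge0 ?powR_ge0 ?invr_ge0 ?ltW.
Qed.

Lemma integral_even_le (f : R -> R) : measurable_fun setT f -> (forall x, 0 <= f x) ->
  (forall x, f (- x) = f x) ->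
  (\int[leb]_x (f x)%:E <= 2%:E * \int[leb]_(x in `[0%R, +oo[) (f x)%:E)%E.
Proof.
move=> mf f0 fN.
have mE : measurable_fun setT (EFin \o f) by apply/measurable_EFinP.
have -> : [set: R] = `]-oo, 0] `|` `]0, +oo[.
  by apply/seteqP; split => x //= _; rewrite !in_itv/= andbT; case: ltP; [right|left].
rewrite ge0_integral_setU//=; last 3 first.
  exact: measurable_funTS.
  by move=> x _; rewrite lee_fin.
  rewrite disj_set2E; apply/eqP/seteqP; split => x //=; rewrite !in_itv/= andbT.
  by move=> [x0]; rewrite ltNge x0.
have -> : (2%:E = 1 + 1 :> \bar R)%E by rewrite -EFinD.
rewrite ge0_muleDl// !mul1e; apply: leeD.
  rewrite (ge0_integration_by_substitution0 (f := EFin \o f))//=.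
  - by under [leRHS]eq_integral do rewrite fN.
apply: ge0_subset_integral => //=.
- exact: measurable_funTS.
- by move=> x _; rewrite lee_fin.
- by move=> x; rewrite /= !in_itv/= !andbT => /ltW.
Qed.

(** One coordinate of a singular weight near its singularity. The constant is twice the exact
    one. *)
Lemma integral_normr_powRN_le c t : 0 <= c < 1 -> 0 < t ->
  (\int[leb]_x (if `|x| < t then `|x| `^ (- c) else 0)%:E <=
    (4 * (t `^ (1 - c)) / (1 - c))%:E)%E.
Proof.
move=> c01 t0; pose f (x : R) : R := if `|x| < t then `|x| `^ (- c) else 0.
have c1 : 0 < 1 - c by rewrite subr_gt0; case/andP: c01.
have mf : measurable_fun setT f.
  apply: measurable_fun_ifT => //; first exact: measurable_fun_ltr.
  by apply: (@measurable_powRf _ _ (measurableTypeR R) (- c)).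
have f0 x : 0 <= f x by rewrite /f; case: ifP => // _; exact: powR_ge0.
apply: (le_trans (integral_even_le (f := f) mf f0 _)).
  by move=> x; rewrite /f normrN.
have -> : 4 * t `^ (1 - c) / (1 - c) = 2 * (2 * (t `^ (1 - c) / (1 - c))) by field; rewrite gt_eqF.
rewrite EFinM; apply: lee_wpmul2l; first by rewrite lee_fin.
have -> : (\int[leb]_(x in `[0%R, +oo[) (f x)%:E =
    \int[leb]_(x in `]0%R, +oo[) (f x)%:E)%E.
  rewrite integral_itv_obnd_cbnd//; apply/measurable_EFinP; exact: measurable_funTS.
rewrite [leLHS]integral_mkcond; apply: (@le_trans _ _
  (\int[leb]_(s in `]0%R, t[) (s `^ (- c))%:E)%E); last first.
  apply: (le_trans (integral_powRN_le c01 t0)); rewrite lee_fin ler_peMl ?ler1n//.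
  by rewrite divr_ge0 ?powR_ge0 ?ltW.
rewrite [leRHS]integral_mkcond le_eqVlt; apply/orP; left; apply/eqP.
apply: eq_integral => x _; rewrite !patchE !mem_setE !in_itv/= andbT /f.
have [x0|x0]//= := ltP 0 x.
by rewrite gtr0_norm//; case: ifP.
Qed.

Lemma integral_1D_normr_powRN_le d : 1 < d ->
  (\int[leb]_x ((1 + `|x|) `^ (- d))%:E <= (2 * (d - 1)^-1)%:E)%E.
Proof.
move=> d1; apply: (le_trans (integral_even_le _ _ _)).
- by apply: (@measurable_powRf _ _ (measurableTypeR R) (- d)); exact: measurable_funD.
- by move=> x; exact: powR_ge0.
- by move=> x; rewrite normrN.
rewrite EFinM; apply: lee_wpmul2l; first by rewrite lee_fin.
apply: le_trans (integral_1D_powRN_le d1).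
rewrite le_eqVlt; apply/orP; left; apply/eqP; apply: eq_integral => x.
by rewrite inE/= in_itv/= andbT => x0; rewrite ger0_norm.
Qed.

Definition gauss t a : R := (4 * pi * t) `^ (- 2^-1) * expR (- (a ^+ 2 / (4 * t))).

Lemma measurable_gauss t : measurable_fun setT (gauss t).
Proof.
apply: measurable_funM => //; apply: measurableT_comp => //.
apply: measurable_funN; apply: measurable_funM => //.
Qed.

Lemma gauss_ge0 t a : 0 <= gauss t a.
Proof. by rewrite mulr_ge0 ?powR_ge0 ?expR_ge0. Qed.

(** As a function of [y] this is the normal density of mean [x] and variance [2 * t], whose mass is
    1. *)
Lemma integral_gauss t x : 0 < t -> (\int[leb]_y (gauss t (x - y))%:E = 1)%E.
Proof.
move=> t0; rewrite -(integral_normal_pdf x (Num.sqrt (2 * t))).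
apply: eq_integral => y _; congr EFin.
have t20 : 0 < 2 * t by rewrite mulr_gt0.
rewrite normal_pdfE ?gt_eqF ?sqrtr_gt0// /normal_peak /normal_fun /gauss.
rewrite sqr_sqrtr ?ltW//; congr (_ * expR _).
  rewrite powRN powR12_sqrt; last by rewrite !mulr_ge0 ?pi_ge0 ?ltW.
  by congr ((Num.sqrt _)^-1); ring.
rewrite -mulNr; congr (- _ / _); ring.
Qed.

End OneDimensionalIntegrals.

(** * The heat kernel *)

Section HeatKernel.
Context {R : realType} {N : nat}.
Local Notation mu := (lebesgueN R N).
Local Notation X := (Rspace R N).
Implicit Types (x y z : X) (s t : R).

Lemma tnth_vsub x y i : tnth (vsub x y) i = tnth x i - tnth y i.
Proof. by rewrite tnth_mktuple. Qed.

Lemma enorm_ge0 x : 0 <= enorm x.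
Proof. exact: sqrtr_ge0. Qed.

Lemma enorm_sqr x : enorm x ^+ 2 = \sum_(i < N) tnth x i ^+ 2.
Proof. by rewrite sqr_sqrtr// sumr_ge0// => i _; exact: sqr_ge0. Qed.

Lemma enorm_vsubC x y : enorm (vsub x y) = enorm (vsub y x).
Proof.
congr Num.sqrt; apply: eq_bigr => i _.
by rewrite !tnth_vsub -sqrrN opprB.
Qed.

Lemma ler_norm_tnth x i : `|tnth x i : R| <= enorm x.
Proof.
rewrite -[leLHS]ger0_norm// -sqrtr_sqr ler_wsqrtr// real_normK ?num_real//.
by rewrite (bigD1 i)//= lerDl sumr_ge0// => j _; exact: sqr_ge0.
Qed.

Lemma enorm_vsub_le x y : enorm x ^+ 2 <= 2 * enorm (vsub x y) ^+ 2 + 2 * enorm y ^+ 2.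
Proof.
rewrite !enorm_sqr !mulr_sumr -big_split/=; apply: ler_sum => i _; rewrite tnth_vsub.
rewrite -subr_ge0 [leRHS](_ : _ = (tnth x i - 2 * tnth y i) ^+ 2) ?sqr_ge0//.
by ring.
Qed.

(* With the value [0] at nonpositive times, time integrals over [0, t] of
   [hker (t - s)] are integrals over the whole line. *)
Definition hker t z : R := if 0 < t then heat_kernel t z else 0.

Lemma hkerE t z : 0 < t -> hker t z = heat_kernel t z.
Proof. by rewrite /hker => ->. Qed.

Lemma hker_ge0 t z : 0 <= hker t z.
Proof. by rewrite /hker; case: ifP => // _; rewrite mulr_ge0 ?powR_ge0 ?expR_ge0. Qed.

Lemma hker_vsubC t x y : hker t (vsub x y) = hker t (vsub y x).
Proof. by rewrite /hker /heat_kernel enorm_vsubC. Qed.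

Section measurability.
Context d (T : measurableType d).

Lemma measurable_enorm_comp (g : T -> X) :
  measurable_fun setT g -> measurable_fun setT (fun p => enorm (g p)).
Proof.
move=> mg.
rewrite (_ : (fun p => _) =
  fun p => (\sum_(i < N) tnth (g p) i ^+ 2 : R) `^ 2^-1); last first.
  by apply/funext => p; rewrite powR12_sqrt// sumr_ge0// => i _; exact: sqr_ge0.
apply: measurable_powRf; apply: measurable_sum => i; apply: measurable_funX.
exact: measurable_tnth_comp.
Qed.

Lemma measurable_vsub_comp (g h : T -> X) :
  measurable_fun setT g -> measurable_fun setT h ->
  measurable_fun setT (fun p => vsub (g p) (h p)).
Proof.
move=> mg mh; apply/measurable_fun_tnthP => i.
rewrite (_ : _ \o _ = (fun p => tnth (g p) i - tnth (h p) i)); last first.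
  by apply/funext => p /=; rewrite tnth_vsub.
by apply: measurable_funB; exact: measurable_tnth_comp.
Qed.

Lemma measurable_hker_comp (tau : T -> R) (g : T -> X) :
  measurable_fun setT tau -> measurable_fun setT g ->
  measurable_fun setT (fun p => hker (tau p) (g p)).
Proof.
move=> mt mg.
(* On the branch [0 < tau p] the inverse of [4 * tau p] is its power -1, so that measurability
   reduces to that of real powers. *)
rewrite (_ : (fun p => _) = fun p => if 0 < tau p then
    (4 * pi * tau p) `^ (- (N%:R / 2)) *
    expR (- (enorm (g p) ^+ 2 * (4 * tau p) `^ (-1))) else 0); last first.
  apply/funext => p; rewrite /hker /heat_kernel; case: ifP => // tp.
  by rewrite powR_inv1// mulr_ge0 ?ltW.
apply: measurable_fun_ifT => //; first exact: measurable_fun_ltr.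
apply: measurable_funM.
  by apply: measurable_powRf; exact: measurable_funM.
apply: measurableT_comp => //; apply: measurable_funN; apply: measurable_funM.
  by apply: measurable_funX; exact: measurable_enorm_comp.
by apply: measurable_powRf; exact: measurable_funM.
Qed.

End measurability.

Lemma measurable_enorm : measurable_fun setT (enorm : X -> R).
Proof. exact: (@measurable_enorm_comp _ X id). Qed.

Lemma measurable_vsub x : measurable_fun setT (fun y : X => vsub x y).
Proof. by apply: measurable_vsub_comp. Qed.

Lemma measurable_hker_vsub t x : measurable_fun setT (fun y : X => hker t (vsub x y)).
Proof. by apply: measurable_hker_comp => //; exact: measurable_vsub. Qed.

Lemma hker_prod t z : 0 < t -> hker t z = \prod_(i < N) gauss t (tnth z i).
Proof.
move=> t0; rewrite hkerE// /heat_kernel big_split/= prodr_const card_ord.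
have p0 : 0 <= 4 * pi * t by rewrite !mulr_ge0 ?pi_ge0 ?ltW.
congr (_ * _); first by rewrite -powR_mulrn ?powR_ge0// -powRrM mulNr [_^-1 * _]mulrC.
rewrite -expR_sum; congr expR.
by rewrite sumrN enorm_sqr mulr_suml.
Qed.

Lemma integral_hker t x : 0 < t -> (\int[mu]_y (hker t (vsub x y))%:E = 1)%E.
Proof.
move=> t0; under eq_integral => y _.
  rewrite hker_prod//; under eq_bigr do rewrite tnth_vsub.
  over.
rewrite (@integral_prod_tnth R N (fun i a => gauss t (tnth x i - a)) (fun=> 1))//.
- by rewrite big1.
- move=> i; apply: (measurableT_comp (measurable_gauss t)).
  exact: (@measurable_funB _ (measurableTypeR R)).
- by move=> i a; exact: gauss_ge0.
- by move=> i; exact: integral_gauss.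
Qed.

Lemma integral_hkerr t y : 0 < t -> (\int[mu]_x (hker t (vsub x y))%:E = 1)%E.
Proof.
by move=> t0; under eq_integral do rewrite hker_vsubC; exact: integral_hker.
Qed.

Lemma hker_le t z : 0 < t -> hker t z <= (4 * pi * t) `^ (- (N%:R / 2)).
Proof.
move=> t0; rewrite hkerE// ler_piMr ?powR_ge0//.
by rewrite expR_le1 oppr_le0 divr_ge0 ?sqr_ge0// mulr_ge0 ?ltW.
Qed.

(** Doubling the time costs 2^(N/2) in the prefactor and only increases the exponential. *)
Lemma hker_le_double t z : 0 < t -> hker t z <= 2 `^ (N%:R / 2) * hker (2 * t) z.
Proof.
move=> t0; have t20 : 0 < 2 * t by rewrite mulr_gt0.
rewrite !hkerE// /heat_kernel mulrA.
have -> : 4 * pi * (2 * t) = 2 * (4 * pi * t) :> R by ring.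
rewrite (powRM (x := 2)) ?ler0n//; last by rewrite !mulr_ge0 ?pi_ge0 ?ltW.
rewrite mulrA -powRD; last by rewrite pnatr_eq0 implybT.
rewrite subrr powRr0 mul1r ler_wpM2l ?powR_ge0// ler_expR lerN2.
rewrite ler_wpM2l ?sqr_ge0// lef_pV2 ?posrE ?mulr_gt0//.
by rewrite ler_pM2l// ler_peMl ?(ltW t0)// ler1n.
Qed.

(** Raise v <= e^v, with v = u / m, to the power m. For m = 0 the convention 0^0 = 1 makes the
    constant 1. *)
Lemma powR_le_expR (m u : R) : 0 <= m -> 0 <= u -> u `^ m <= m `^ m * expR u.
Proof.
rewrite le_eqVlt => /predU1P[<-|m0] u0.
  by rewrite !powRr0 mul1r -expR0 ler_expR.
set v := u / m.
have v0 : 0 <= v by rewrite divr_ge0// ltW.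
have -> : u = m * v by rewrite /v mulrCA divff ?gt_eqF// mulr1.
have -> : expR (m * v) = expR v `^ m by rewrite /powR gt_eqF ?expR_gt0// expRK.
rewrite powRM ?(ltW m0)// ler_wpM2l ?powR_ge0// ge0_ler_powR ?nnegrE ?expR_ge0 ?(ltW m0)//.
by apply: ltW; apply: lt_le_trans (expR_ge1Dx _); rewrite ltrDr.
Qed.

(* Polynomial weights are absorbed by doubling the time. *)
Lemma powR_enorm_hker_le s : 0 <= s -> exists2 C : R, 0 <= C &
  forall t z, 0 < t -> enorm z `^ s * hker t z <= C * t `^ (s / 2) * hker (2 * t) z.
Proof.
move=> s0; exists (2 `^ (N%:R / 2) * (8 `^ (s / 2) * (s / 2) `^ (s / 2))).
  by rewrite !mulr_ge0 ?powR_ge0.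
move=> t z t0; have t20 : 0 < 2 * t by rewrite mulr_gt0.
(* Half of the Gaussian exponent |z|^2 / (4 t): it is spent on the power of |z|, while the other
   half is what remains in [hker (2 * t)]. *)
set u := enorm z ^+ 2 / (8 * t).
have u0 : 0 <= u by rewrite divr_ge0 ?sqr_ge0// mulr_ge0 ?ltW.
have zu : enorm z `^ s = (8 * t) `^ (s / 2) * u `^ (s / 2).
  have t80 : 0 < 8 * t by rewrite mulr_gt0.
  rewrite -powRM ?(ltW t80)// /u [_ * (_ / _)]mulrC divfK ?gt_eqF//.
  rewrite -powR_mulrn ?enorm_ge0// -powRrM; congr (_ `^ _); by field.
have hE : hker t z = 2 `^ (N%:R / 2) * (hker (2 * t) z * expR (- u)).
  rewrite !hkerE// /heat_kernel.
  have -> : 4 * pi * (2 * t) = 2 * (4 * pi * t) :> R by ring.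
  rewrite (powRM (x := 2)) ?ler0n//; last by rewrite !mulr_ge0 ?pi_ge0 ?ltW.
  rewrite !mulrA -powRD; last by rewrite pnatr_eq0 implybT.
  rewrite subrr powRr0 mul1r -[RHS]mulrA -expRD; congr (_ * expR _).
  by rewrite /u; field; rewrite ?gt_eqF.
rewrite zu hE powRM ?(ltW t0)//.
have -> : 8 `^ (s / 2) * t `^ (s / 2) * u `^ (s / 2) * (2 `^ (N%:R / 2) * (hker (2 * t) z * expR (- u)))
  = 2 `^ (N%:R / 2) * 8 `^ (s / 2) * t `^ (s / 2) * hker (2 * t) z * (u `^ (s / 2) * expR (- u)) by ring.
have -> : 2 `^ (N%:R / 2) * (8 `^ (s / 2) * (s / 2) `^ (s / 2)) * t `^ (s / 2) * hker (2 * t) z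
  = 2 `^ (N%:R / 2) * 8 `^ (s / 2) * t `^ (s / 2) * hker (2 * t) z * (s / 2) `^ (s / 2) by ring.
rewrite ler_wpM2l ?mulr_ge0 ?powR_ge0 ?hker_ge0//.
rewrite expRN ler_pdivrMr ?expR_gt0//; apply: powR_le_expR => //.
by rewrite divr_ge0.
Qed.

End HeatKernel.

(** * Jensen's inequality up to a constant *)

Section Jensen.
Context {R : realType}.
Local Open Scope ereal_scope.

Lemma le_poweR (x y : \bar R) (r : R) : (0 <= r)%R -> 0 <= x -> x <= y ->
  x `^ r <= y `^ r.
Proof.
move=> r0 x0 xy; apply: gt0_ler_poweR => //; rewrite in_itv/= leey andbT//.
exact: le_trans xy.
Qed.

(* Jensen's inequality up to a factor, without convexity: integrate
   [f <= a + a ^ (1 - p) f ^ p] against [k] and optimise in [a > 0]. *)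
Lemma jensen_le d (T : measurableType d) (m : {measure set T -> \bar R})
    (f k : T -> \bar R) (p K : R) :
  measurable_fun setT f -> measurable_fun setT k ->
  (forall x, 0 <= f x) -> (forall x, 0 <= k x) -> (1 <= p)%R -> (0 < K)%R ->
  \int[m]_x k x <= K%:E ->
  (\int[m]_x (f x * k x)) `^ p <=
    (2 `^ p * K `^ (p - 1))%:E * \int[m]_x (f x `^ p * k x).
Proof.
move=> mf mk f0 k0 p1 K0 kK; have p0 : (0 < p)%R by rewrite (lt_le_trans _ p1).
have mfk : measurable_fun setT (fun x => f x * k x) by exact: emeasurable_funM.
have mfp : measurable_fun setT (fun x => f x `^ p).
  exact: (measurableT_comp (measurable_poweR p) mf).
have mfpk : measurable_fun setT (fun x => f x `^ p * k x) by exact: emeasurable_funM.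
set I := \int[m]_x (f x `^ p * k x).
have I0 : 0 <= I by apply: integral_ge0 => x _; rewrite mule_ge0 ?poweR_ge0.
have C0 : (0 < 2 `^ p * K `^ (p - 1))%R by rewrite mulr_gt0 ?powR_gt0.
have key (a : R) : (0 < a)%R ->
    \int[m]_x (f x * k x) <= (a * K)%:E + (a `^ (1 - p))%:E * I.
  move=> a0.
  apply: (@le_trans _ _ (\int[m]_x (a%:E * k x + (a `^ (1 - p))%:E * (f x `^ p * k x)))).
    apply: ge0_le_integral => //.
    - by move=> x _; rewrite mule_ge0.
    - by apply: emeasurable_funD; exact: measurable_funeM.
    - move=> x _; rewrite muleA -ge0_muleDl ?lee_fin ?mule_ge0 ?lee_fin ?powR_ge0 ?poweR_ge0 ?(ltW a0)//.
      apply: lee_wpmul2r => //; move: (f0 x); case: (f x) => [r| |]//=.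
      + rewrite lee_fin => r0; rewrite -EFinM -EFinD lee_fin.
        (* Values r up to [a] are bounded by [a]; above [a] one has r = r^(1-p) r^p <= a^(1-p) r^p
           because 1 - p <= 0. *)
        have [ra|ar] := leP r a; first by rewrite (le_trans ra)// lerDl mulr_ge0 ?powR_ge0.
        have r0' : (0 < r)%R by rewrite (lt_trans a0).
        apply: (@le_trans _ _ (a `^ (1 - p) * r `^ p)%R); last by rewrite lerDr ltW.
        rewrite [leLHS](_ : r = r `^ (1 - p) * r `^ p)%R; last first.
          by rewrite -powRD ?subrK ?powRr1// (gt_eqF r0') implybT.
        rewrite ler_wpM2r ?powR_ge0// -[X in (_ `^ X <= _)%R]opprB -[X in (_ <= _ `^ X)%R]opprB.
        rewrite !powRN lef_pV2 ?posrE ?powR_gt0// ge0_ler_powR ?nnegrE ?subr_ge0 ?(ltW a0) ?(ltW ar)//.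
      + by move=> _; rewrite (gt_eqF p0) gt0_muley ?lte_fin ?powR_gt0.
  rewrite ge0_integralD//.
  - rewrite ge0_integralZl ?lee_fin ?(ltW a0)//.
    rewrite ge0_integralZl ?lee_fin ?powR_ge0//; last by move=> x _; rewrite mule_ge0 ?poweR_ge0.
    by rewrite leeD2r// EFinM lee_wpmul2l ?lee_fin ?(ltW a0).
  - by move=> x _; rewrite mule_ge0 ?lee_fin ?(ltW a0).
  - exact: measurable_funeM.
  - by move=> x _; rewrite !mule_ge0 ?lee_fin ?powR_ge0 ?poweR_ge0.
  - exact: measurable_funeM.
have J0 : 0 <= \int[m]_x (f x * k x) by apply: integral_ge0 => x _; rewrite mule_ge0.
move: I0 key; case: I => [i| |]//; last first.
  by move=> _ _; rewrite gt0_muley ?lte_fin// leey.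
rewrite lee_fin le_eqVlt => /predU1P[<-|i0] key.
  (* For I = 0 there is no optimal [a]; the bound a K holds for every a > 0 and forces the left side
     to vanish. *)
  rewrite mule0; suff -> : \int[m]_x (f x * k x) = 0 by rewrite poweR0r ?gt_eqF.
  apply/eqP; rewrite eq_le J0 andbT; apply/lee_addgt0Pr => e e0; rewrite add0e.
  have := key (e / K)%R (divr_gt0 e0 K0); rewrite mule0 adde0.
  by rewrite divfK ?gt_eqF.
have ik0 : (0 < i / K)%R by rewrite divr_gt0.
(* This choice makes the two terms a K and a^(1-p) I equal. *)
set a := ((i / K) `^ p^-1)%R; have a0 : (0 < a)%R by rewrite powR_gt0.
have aE : (a `^ (1 - p) * i = a * K)%R.
  rewrite powRD; last by rewrite (gt_eqF a0) implybT.
  rewrite powRr1 ?(ltW a0)// powRN.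
  have -> : (a `^ p = i / K)%R by rewrite -powRrM mulVf ?gt_eqF// powRr1// ltW.
  by field; rewrite !gt_eqF.
have J2 : \int[m]_x (f x * k x) <= (2 * (a * K))%:E.
  by rewrite mulr_natl mulr2n EFinD -[X in _ + X]/((a * K)%:E) -{2}aE EFinM; exact: key.
apply: (@le_trans _ _ ((2 * (a * K))%:E `^ p)).
  apply: gt0_ler_poweR; rewrite ?(ltW p0)//; rewrite in_itv/= ?J0 ?leey//.
  by rewrite lee_fin !mulr_ge0 ?(ltW a0) ?(ltW K0).
rewrite poweR_EFin -EFinM lee_fin powRM ?mulr_ge0 ?(ltW a0) ?(ltW K0)//.
rewrite powRM ?(ltW a0) ?(ltW K0)//.
have -> : (a `^ p = i / K)%R by rewrite -powRrM mulVf ?gt_eqF// powRr1// ltW.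
rewrite powRB; last by rewrite (gt_eqF K0) implybT.
by rewrite powRr1 ?(ltW K0)// le_eqVlt; apply/orP; left; apply/eqP; field; rewrite gt_eqF.
Qed.

End Jensen.

(** * Convolution of nonnegative functions *)

Section Convolution.
Context {R : realType} {N : nat}.
Local Notation mu := (lebesgueN R N).
Local Notation X := (Rspace R N).
Implicit Types (x y z : X) (s t : R) (k : X -> R) (f g : X -> \bar R).
Local Open Scope ereal_scope.

(** Extended-valued, so that for nonnegative arguments it is always meaningful; the integral [heat]
    is recovered from it by splitting into positive and negative parts. *)
Definition conv k f x : \bar R := \int[mu]_y ((k (vsub x y))%:E * f y).

Lemma conv_ge0 k f x : (forall z, 0 <= k z)%R -> (forall y, 0 <= f y) -> 0 <= conv k f x.
Proof. by move=> k0 f0; apply: integral_ge0 => y _; rewrite mule_ge0 ?lee_fin. Qed.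

Lemma measurable_conv_integrand k f x : measurable_fun setT k -> measurable_fun setT f ->
  measurable_fun setT (fun y => (k (vsub x y))%:E * f y).
Proof.
move=> mk mf; apply: emeasurable_funM => //; apply: measurable_EFinf.
exact: (measurableT_comp mk (measurable_vsub x)).
Qed.

Lemma le_conv k k' f f' x : measurable_fun setT k -> measurable_fun setT k' ->
  measurable_fun setT f -> measurable_fun setT f' ->
  (forall z, 0 <= k z)%R -> (forall y, 0 <= f y) ->
  (forall z, k z <= k' z)%R -> (forall y, f y <= f' y) ->
  conv k f x <= conv k' f' x.
Proof.
move=> mk mk' mf mf' k0 f0 kk' ff'; apply: ge0_le_integral => //.
- by move=> y _; rewrite mule_ge0 ?lee_fin.
- exact: measurable_conv_integrand.
- exact: measurable_conv_integrand.
- by move=> y _; apply: lee_pmul; rewrite ?lee_fin.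
Qed.

Lemma ae_le_conv k f f' x : measurable_fun setT k ->
  measurable_fun setT f -> measurable_fun setT f' ->
  (forall z, 0 <= k z)%R -> (forall y, 0 <= f y) -> (forall y, 0 <= f' y) ->
  {ae mu, forall y, f y <= f' y} ->
  conv k f x <= conv k f' x.
Proof.
move=> mk mf mf' k0 f0 f'0 ff'; apply: ae_ge0_le_integral => //.
- by move=> y _; rewrite mule_ge0 ?lee_fin.
- exact: measurable_conv_integrand.
- by move=> y _; rewrite mule_ge0 ?lee_fin.
- exact: measurable_conv_integrand.
- by apply: filterS ff' => y yy' _; apply: lee_pmul; rewrite ?lee_fin.
Qed.

Lemma eq_conv k f f' x : f =1 f' -> conv k f x = conv k f' x.
Proof. by move=> ff'; apply: eq_integral => y _; rewrite ff'. Qed.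

Lemma convD k f g x : measurable_fun setT k ->
  measurable_fun setT f -> measurable_fun setT g ->
  (forall z, 0 <= k z)%R -> (forall y, 0 <= f y) -> (forall y, 0 <= g y) ->
  conv k (fun y => f y + g y) x = conv k f x + conv k g x.
Proof.
move=> mk mf mg k0 f0 g0; rewrite /conv -ge0_integralD//.
- by apply: eq_integral => y _; rewrite ge0_muleDr.
- by move=> y _; rewrite mule_ge0 ?lee_fin.
- exact: measurable_conv_integrand.
- by move=> y _; rewrite mule_ge0 ?lee_fin.
- exact: measurable_conv_integrand.
Qed.

Lemma convDl k k' f x : measurable_fun setT k -> measurable_fun setT k' ->
  measurable_fun setT f ->
  (forall z, 0 <= k z)%R -> (forall z, 0 <= k' z)%R -> (forall y, 0 <= f y) ->
  conv (fun z => k z + k' z)%R f x = conv k f x + conv k' f x.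
Proof.
move=> mk mk' mf k0 k'0 f0; rewrite /conv -ge0_integralD//.
- by apply: eq_integral => y _; rewrite EFinD ge0_muleDl ?lee_fin.
- by move=> y _; rewrite mule_ge0 ?lee_fin.
- exact: measurable_conv_integrand.
- by move=> y _; rewrite mule_ge0 ?lee_fin.
- exact: measurable_conv_integrand.
Qed.

Lemma convZ k f (c : R) x : (0 <= c)%R -> measurable_fun setT k ->
  measurable_fun setT f -> (forall z, 0 <= k z)%R -> (forall y, 0 <= f y) ->
  conv k (fun y => c%:E * f y) x = c%:E * conv k f x.
Proof.
move=> c0 mk mf k0 f0; rewrite /conv -ge0_integralZl//.
- by apply: eq_integral => y _; rewrite muleCA.
- exact: measurable_conv_integrand.
- by move=> y _; rewrite mule_ge0 ?lee_fin.
Qed.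

Lemma convZl k f (c : R) x : (0 <= c)%R -> measurable_fun setT k ->
  measurable_fun setT f -> (forall z, 0 <= k z)%R -> (forall y, 0 <= f y) ->
  conv (fun z => c * k z)%R f x = c%:E * conv k f x.
Proof.
move=> c0 mk mf k0 f0; rewrite /conv -ge0_integralZl//.
- by apply: eq_integral => y _; rewrite EFinM muleA.
- exact: measurable_conv_integrand.
- by move=> y _; rewrite mule_ge0 ?lee_fin.
Qed.

Lemma measurable_hker t : measurable_fun setT (hker t : X -> R).
Proof. exact: (@measurable_hker_comp _ _ _ X (fun=> t) id). Qed.

Lemma measurable_conv2 k f : measurable_fun setT k -> measurable_fun setT f ->
  measurable_fun setT (fun p : X * X => (k (vsub p.1 p.2))%:E * f p.2).
Proof.
move=> mk mf; apply: emeasurable_funM; last exact: (measurableT_comp mf measurable_snd).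
apply: measurable_EFinf; apply: (measurableT_comp mk).
exact: (@measurable_vsub_comp _ _ _ (X * X)%type fst snd).
Qed.

Lemma measurable_conv k f : measurable_fun setT k -> measurable_fun setT f ->
  (forall z, 0 <= k z)%R -> (forall y, 0 <= f y) -> measurable_fun setT (conv k f).
Proof.
move=> mk mf k0 f0.
apply: (measurable_fun_fubini_tonelli_F (fun p : X * X => (k (vsub p.1 p.2))%:E * f p.2)).
  exact: measurable_conv2.
by move=> p; rewrite mule_ge0 ?lee_fin.
Qed.

Lemma integral_conv_hker t f : (0 < t)%R -> measurable_fun setT f ->
  (forall y, 0 <= f y) -> \int[mu]_x conv (hker t) f x = \int[mu]_y f y.
Proof.
move=> t0 mf f0.
rewrite /conv (fubini_tonelli (fun p : X * X => (hker t (vsub p.1 p.2))%:E * f p.2))/=.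
- apply: eq_integral => y _; rewrite ge0_integralZr//.
  + by rewrite integral_hkerr// mul1e.
  + apply: measurable_EFinf; apply: measurable_hker_comp => //.
    exact: (@measurable_vsub_comp _ _ _ X id (fun=> y)).
  + by move=> x _; rewrite lee_fin hker_ge0.
- by apply: measurable_conv2 => //; exact: measurable_hker.
- by move=> p; rewrite mule_ge0 ?lee_fin ?hker_ge0.
Qed.

Lemma conv_hker_cst t (c : R) x : (0 < t)%R -> (0 <= c)%R ->
  conv (hker t) (fun=> c%:E) x = c%:E.
Proof.
move=> t0 c0; rewrite /conv ge0_integralZr//=.
- by rewrite integral_hker// mul1e.
- exact: measurable_EFinf (measurable_hker_vsub t x).
- by move=> y _; rewrite lee_fin hker_ge0.
Qed.

Lemma conv_hker_le t f x : (0 < t)%R -> measurable_fun setT f ->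
  (forall y, 0 <= f y) ->
  conv (hker t) f x <= ((4 * pi * t) `^ (- (N%:R / 2)))%:E * \int[mu]_y f y.
Proof.
move=> t0 mf f0; rewrite -ge0_integralZl//; last by rewrite lee_fin powR_ge0.
apply: ge0_le_integral => //.
- by move=> y _; rewrite mule_ge0 ?lee_fin ?hker_ge0.
- by apply: measurable_conv_integrand => //; exact: measurable_hker.
- exact: measurable_funeM.
- by move=> y _; apply: lee_wpmul2r => //; rewrite lee_fin hker_le.
Qed.

End Convolution.

Section AlmostEverywhere.
Context d (T : measurableType d) (R : realType) (m : {measure set T -> \bar R}).

Lemma ae_mono (P Q : T -> Prop) : (forall x, P x -> Q x) ->
  {ae m, forall x, P x} -> {ae m, forall x, Q x}.
Proof.
by move=> PQ [A [mA A0 sA]]; exists A; split => // x nQ; apply: sA => /PQ.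
Qed.

Lemma ae_and (P Q : T -> Prop) : {ae m, forall x, P x} -> {ae m, forall x, Q x} ->
  {ae m, forall x, P x /\ Q x}.
Proof.
move=> hP hQ; have := negligibleU hP hQ; apply: negligibleS => x /= nPQ.
have [Px|nP] := pselect (P x); last by left.
by right => Qx; exact: nPQ.
Qed.

End AlmostEverywhere.

(** * Heat estimates in weighted spaces *)

Section WeightedKernel.
Context {R : realType} {N : nat}.
Hypothesis N0 : (0 < N)%N.
Local Notation leb := (@lebesgue_measure R).
Local Notation mu := (lebesgueN R N).
Local Notation X := (Rspace R N).
Implicit Types (x y z : X) (s t : R) (k : X -> R) (f g : X -> \bar R).
Local Open Scope ereal_scope.

Let N0' : (0 < N%:R :> R)%R. Proof. by rewrite ltr0n. Qed.

Lemma ae_enorm_gt0 : {ae mu, forall y, (0 < enorm y)%R}.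
Proof.
apply: ae_mono (ae_tnth_neq0 (R := R) N) => y yn0.
apply: lt_le_trans (ler_norm_tnth y (Ordinal N0)).
by rewrite normr_gt0.
Qed.

Lemma measurable_powR_enorm b : measurable_fun setT (fun y => (enorm y `^ b)%R).
Proof. by apply: measurable_powRf; exact: measurable_enorm. Qed.

Lemma powRN_le (a b c : R) : (0 <= c)%R -> (0 < a)%R -> (a <= b)%R ->
  (b `^ (- c) <= a `^ (- c))%R.
Proof.
move=> c0 a0 ab; have b0 := lt_le_trans a0 ab.
rewrite !powRN lef_pV2 ?posrE ?powR_gt0// ge0_ler_powR ?nnegrE ?(ltW a0) ?(ltW b0)//.
Qed.

Lemma powR_prod (a c : R) : (0 <= a)%R -> (a `^ c = \prod_(i < N) (a `^ (c / N%:R)))%R.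
Proof.
move=> a0; rewrite prodr_const card_ord -powR_mulrn ?powR_ge0// -powRrM divfK//.
by rewrite gt_eqF.
Qed.

(** |y| >= |y_i| for each i; each of the N factors of |y|^(-c) is compared with its own coordinate.
    An exponent c < N thus becomes a one-dimensional exponent c / N < 1. *)
Lemma enorm_powRN_le_prod y c : (0 <= c)%R -> (forall i, tnth y i != 0%R) ->
  (enorm y `^ (- c) <= \prod_(i < N) (`|tnth y i : R| `^ (- (c / N%:R))))%R.
Proof.
move=> c0 yn0; rewrite powR_prod ?enorm_ge0//; apply: ler_prod => i _.
rewrite powR_ge0/= mulNr powRN_le ?divr_ge0 ?normr_gt0 ?yn0//.
exact: ler_norm_tnth.
Qed.

(** Split at |a| = sqrt t. Inside, the Gaussian is bounded by its peak and |a|^(-c) is integrated;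
    outside, |a|^(-c) <= t^(-c/2) and the Gaussian has mass 1. The bound is uniform in the centre
    [x]. *)
Lemma integral_gauss_powRN_le c : (0 <= c < 1)%R -> exists2 C : R, (0 < C)%R &
  forall t (x : R), (0 < t)%R ->
  \int[leb]_a (gauss t (x - a) * `|a| `^ (- c))%:E <= (C * t `^ (- (c / 2)))%:E.
Proof.
move=> c01; have [c0 c1] := andP c01; have c1' : (0 < 1 - c)%R by rewrite subr_gt0.
exists ((4 * pi) `^ (- 2^-1) * (4 / (1 - c)) + 1)%R.
  by rewrite ltr_wpDl// mulr_ge0 ?powR_ge0 ?divr_ge0// ltW.
move=> t x t0; have pt : (0 <= 4 * pi * t)%R by rewrite !mulr_ge0 ?pi_ge0 ?ltW.
set h := fun a : R => (if `|a| < Num.sqrt t then `|a| `^ (- c) else 0)%R.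
have mh : measurable_fun [set: measurableTypeR R] h.
  apply: measurable_fun_ifT => //; first exact: measurable_fun_ltr.
  by apply: (@measurable_powRf _ _ (measurableTypeR R) (- c)).
have h0 a : (0 <= h a)%R by rewrite /h; case: ifP => // _; exact: powR_ge0.
have mg : measurable_fun [set: measurableTypeR R] (fun a : R => gauss t (x - a)).
  apply: (measurableT_comp (measurable_gauss t)).
  exact: (@measurable_funB _ (measurableTypeR R)).
apply: (@le_trans _ _ (\int[leb]_a (((4 * pi * t) `^ (- 2^-1))%:E * (h a)%:E +
    (t `^ (- (c / 2)))%:E * (gauss t (x - a))%:E))).
  apply: ge0_le_integral => //.
  - by move=> a _; rewrite lee_fin mulr_ge0 ?gauss_ge0 ?powR_ge0.
  - apply: measurable_EFinf; apply: measurable_funM => //.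
    by apply: (@measurable_powRf _ _ (measurableTypeR R) (- c)).
  - apply: emeasurable_funD; apply: measurable_funeM; exact: measurable_EFinf.
  - move=> a _; rewrite -!EFinM -EFinD lee_fin /h; case: ltP => at_.
      apply: (@le_trans _ _ ((4 * pi * t) `^ (- 2^-1) * `|a| `^ (- c))%R).
        rewrite ler_wpM2r ?powR_ge0// ler_piMr ?powR_ge0// expR_le1 oppr_le0.
        by rewrite divr_ge0 ?sqr_ge0 ?mulr_ge0 ?(ltW t0).
      by rewrite lerDl mulr_ge0 ?powR_ge0 ?gauss_ge0.
    rewrite mulr0 add0r mulrC ler_wpM2r ?gauss_ge0//.
    rewrite (_ : t `^ _ = Num.sqrt t `^ (- c))%R.
      by rewrite powRN_le// sqrtr_gt0.
    by rewrite -powR12_sqrt ?(ltW t0)// -powRrM mulrN mulrC.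
rewrite ge0_integralD//; last 4 first.
  by move=> a _; rewrite mule_ge0 ?lee_fin ?powR_ge0.
  by apply: measurable_funeM; exact: measurable_EFinf.
  by move=> a _; rewrite mule_ge0 ?lee_fin ?powR_ge0 ?gauss_ge0.
  by apply: measurable_funeM; exact: measurable_EFinf.
rewrite ge0_integralZl ?lee_fin ?powR_ge0//; last 2 first.
  exact: measurable_EFinf.
  by move=> a _; rewrite lee_fin.
rewrite ge0_integralZl ?lee_fin ?powR_ge0//; last 2 first.
  exact: measurable_EFinf.
  by move=> a _; rewrite lee_fin gauss_ge0.
have G1 := integral_gauss x t0.
set A := ((4 * pi) `^ (- 2^-1) * (4 / (1 - c)))%R; set B := (t `^ (- (c / 2)))%R.
have -> : ((A + 1) * B)%:E = (A * B)%:E + B%:E by rewrite -EFinD mulrDl mul1r.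
apply: leeD; last first.
  by rewrite -[leRHS]mule1 -G1; exact: lexx.
have st0 : (0 < Num.sqrt t)%R by rewrite sqrtr_gt0.
apply: (@le_trans _ _ (((4 * pi * t) `^ (- 2^-1))%:E *
    (4 * (Num.sqrt t `^ (1 - c)) / (1 - c))%:E)).
  by apply: lee_wpmul2l; rewrite ?lee_fin ?powR_ge0// integral_normr_powRN_le.
rewrite -EFinM lee_fin powRM ?mulr_ge0 ?pi_ge0 ?(ltW t0)// /A /B.
rewrite -powR12_sqrt ?(ltW t0)// -powRrM.
rewrite (_ : - (c / 2) = - 2^-1 + 2^-1 * (1 - c))%R; last by field.
rewrite powRD; last by rewrite (gt_eqF t0) implybT.
by rewrite le_eqVlt; apply/orP; left; apply/eqP; field; rewrite gt_eqF.
Qed.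

Lemma conv_hker_powRN_le b : (0 <= b < N%:R)%R -> exists2 C : R, (0 < C)%R &
  forall t x, (0 < t)%R ->
  conv (hker t) (fun y => (enorm y `^ (- b))%:E) x <= (C * t `^ (- (b / 2)))%:E.
Proof.
move=> /andP[b0 bN]; have c01 : (0 <= b / N%:R < 1)%R.
  by rewrite divr_ge0//= ltr_pdivrMr// mul1r.
have [C C0 HC] := integral_gauss_powRN_le c01.
exists (C ^+ N)%R; first exact: exprn_gt0.
move=> t x t0; pose c := (b / N%:R)%R.
pose F (i : 'I_N) (a : R) : R := (gauss t (tnth x i - a) * `|a| `^ (- c))%R.
have mF i : measurable_fun setT (F i).
  apply: measurable_funM.
    apply: (measurableT_comp (measurable_gauss t)).
    exact: (@measurable_funB _ (measurableTypeR R)).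
  by apply: (@measurable_powRf _ _ (measurableTypeR R) (- c)).
have F0 i a : (0 <= F i a)%R by rewrite mulr_ge0 ?gauss_ge0 ?powR_ge0.
have -> : (C ^+ N * t `^ (- (b / 2)) = \prod_(i < N) (C * t `^ (- (c / 2))))%R.
  rewrite big_split/= prodr_const card_ord; congr (_ * _)%R.
  rewrite powR_prod ?(ltW t0)//; apply: eq_bigr => i _; congr (_ `^ _)%R.
  by rewrite /c; field; rewrite gt_eqF.
apply: le_trans (le_integral_prod_tnth (R := R) (n := N) mF F0 _); last first.
  by move=> i; exact: HC.
apply: ae_ge0_le_integral => //.
- by move=> y _; rewrite -EFinM lee_fin mulr_ge0 ?hker_ge0 ?powR_ge0.
- apply: measurable_conv_integrand; first exact: measurable_hker.
  exact: measurable_EFinf (measurable_powR_enorm _).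
- by move=> y _; rewrite lee_fin prodr_ge0.
- exact: measurable_EFinf (measurable_prod_tnth mF).
- apply: ae_mono (ae_tnth_neq0 (R := R) N) => y yn0 _.
  rewrite -EFinM lee_fin hker_prod//.
  rewrite [leRHS](_ : _ = \prod_(i < N) gauss t (tnth (vsub x y) i) *
     \prod_(i < N) (`|tnth y i : R| `^ (- c)))%R; last first.
    by rewrite -big_split; apply: eq_bigr => i _; rewrite /F tnth_vsub.
  rewrite ler_wpM2l//; last exact: enorm_powRN_le_prod.
  by rewrite prodr_ge0// => i _; exact: gauss_ge0.
Qed.

Lemma powR_enorm_triangle s x y : (0 <= s)%R ->
  (enorm x `^ s <= 2 `^ s * (enorm (vsub x y) `^ s + enorm y `^ s))%R.
Proof.
move=> s0; set m := Num.max (enorm (vsub x y)) (enorm y).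
have m0 : (0 <= m)%R by rewrite le_max enorm_ge0.
have xm : (enorm x <= 2 * m)%R.
  rewrite -(@ler_pXn2r _ 2)// ?nnegrE ?enorm_ge0 ?mulr_ge0// (le_trans (enorm_vsub_le x y))//.
  rewrite exprMn (_ : 2 ^+ 2 * m ^+ 2 = 2 * m ^+ 2 + 2 * m ^+ 2)%R; last by ring.
  rewrite lerD// ler_wpM2l// ler_pXn2r ?nnegrE ?enorm_ge0//.
  - by rewrite le_max lexx.
  - by rewrite le_max lexx orbT.
apply: (@le_trans _ _ ((2 * m) `^ s)%R).
  by rewrite ge0_ler_powR ?nnegrE ?enorm_ge0 ?mulr_ge0.
rewrite powRM// ler_wpM2l ?powR_ge0// /m; case: (leP (enorm (vsub x y)) (enorm y)) => _.
  by rewrite lerDr powR_ge0.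
by rewrite lerDl powR_ge0.
Qed.

(** The heat estimate for the extremal function |y|^(-s1). Distribute |x|^s2 by the triangle
    inequality: the part |x - y|^s2 is absorbed by the kernel at doubled time and yields t^(s2/2),
    the part |y|^s2 lowers the singularity to |y|^(-(s1 - s2)). *)
Lemma weighted_kernel_le s1 s2 : (0 <= s2 <= s1)%R -> (s1 < N%:R)%R ->
  exists2 C : R, (0 < C)%R & forall t x, (0 < t)%R ->
  (enorm x `^ s2)%:E * conv (hker t) (fun y => (enorm y `^ (- s1))%:E) x <=
  (C * t `^ (- ((s1 - s2) / 2)))%:E.
Proof.
move=> /andP[s20 s21] s1N; have s10 := le_trans s20 s21.
have [C1 C10 HC1] := @conv_hker_powRN_le s1 (introT andP (conj s10 s1N)).
have h21 : (0 <= s1 - s2 < N%:R)%R.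
  by rewrite subr_ge0 s21/= (le_lt_trans _ s1N)// gerBl.
have [C2 C20 HC2] := conv_hker_powRN_le h21.
have [C3 C30 HC3] := powR_enorm_hker_le (N := N) s20.
have mw b : measurable_fun setT (fun y : X => (enorm y `^ b)%:E).
  exact: measurable_EFinf (measurable_powR_enorm _).
have w0 b (y : X) : 0 <= (enorm y `^ b)%:E by rewrite lee_fin powR_ge0.
exists (2 `^ s2 * (C3 * (C1 * 2 `^ (- (s1 / 2))) + C2))%R.
  by rewrite mulr_gt0 ?powR_gt0// ltr_wpDl// !mulr_ge0 ?powR_ge0// ltW.
move=> t x t0; have t20 : (0 < 2 * t)%R by rewrite mulr_gt0.
have mh := @measurable_hker R N t; have h0 := @hker_ge0 R N t.
have mh2 := @measurable_hker R N (2 * t); have h20 := @hker_ge0 R N (2 * t).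
pose a1 := (C3 * t `^ (s2 / 2))%R.
have a10 : (0 <= a1)%R by rewrite mulr_ge0 ?powR_ge0.
have ma1 : measurable_fun setT (fun z : X => (a1 * hker (2 * t) z)%R).
  exact: measurable_funM.
apply: (@le_trans _ _ ((2 `^ s2)%:E *
   (a1%:E * conv (hker (2 * t)) (fun y => (enorm y `^ (- s1))%:E) x +
   conv (hker t) (fun y => (enorm y `^ (- (s1 - s2)))%:E) x))).
  rewrite -[a1%:E * _]convZl// /conv -ge0_integralD//; last 4 first.
    by move=> y _; rewrite mule_ge0// lee_fin mulr_ge0.
    exact: (measurable_conv_integrand (k := fun z => (a1 * hker (2 * t) z)%R) x ma1).
    by move=> y _; rewrite mule_ge0// lee_fin.
    exact: measurable_conv_integrand.
  have mI1 := measurable_conv_integrand (k := fun z => (a1 * hker (2 * t) z)%R) x ma1 (mw (- s1)%R).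
  have mI2 := measurable_conv_integrand x mh (mw (- (s1 - s2))%R).
  have mI3 := measurable_conv_integrand x mh (mw (- s1)%R).
  have I1 y : 0 <= (a1 * hker (2 * t) (vsub x y))%:E * (enorm y `^ (- s1))%:E.
    by rewrite mule_ge0// lee_fin mulr_ge0.
  have I2 y : 0 <= (hker t (vsub x y))%:E * (enorm y `^ (- (s1 - s2)))%:E.
    by rewrite mule_ge0// lee_fin.
  have I3 y : 0 <= (hker t (vsub x y))%:E * (enorm y `^ (- s1))%:E.
    by rewrite mule_ge0// lee_fin.
  rewrite -[leLHS]ge0_integralZl//.
  rewrite -[leRHS]ge0_integralZl ?lee_fin ?powR_ge0//; last 2 first.
  - exact: emeasurable_funD.
  - by move=> y _; rewrite adde_ge0.
  apply: ge0_le_integral => //.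
  - by move=> y _; rewrite mule_ge0.
  - exact: measurable_funeM.
  - by apply: measurable_funeM; exact: emeasurable_funD.
  move=> y _; rewrite -!EFinM lee_fin.
  have := powR_enorm_triangle x y s20; set E := (enorm x `^ s2)%R; set z := vsub x y => Ez.
  have hw : (0 <= hker t z * enorm y `^ (- s1))%R by rewrite mulr_ge0 ?powR_ge0.
  apply: le_trans (ler_wpM2r hw Ez) _.
  rewrite -mulrA ler_wpM2l ?powR_ge0// mulrDl; apply: lerD.
    rewrite mulrA ler_wpM2r ?powR_ge0// /a1; exact: HC3.
  rewrite mulrCA ler_wpM2l//.
  (* At the origin exponents do not add. There 0^s2 is 1 for s2 = 0, when both sides agree, and 0
     otherwise. *)
  have [->|y0] := eqVneq (enorm y) 0%R.
    have [->|s2n0] := eqVneq s2 0%R; first by rewrite subr0 powRr0 mul1r.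
    by rewrite powR0// mul0r powR_ge0.
  by rewrite -powRD ?y0 ?implybT// opprB.
rewrite -[(2 `^ s2 * _ * _)%R]mulrA [leRHS]EFinM; apply: lee_wpmul2l; first by rewrite lee_fin powR_ge0.
rewrite [X in _ <= X%:E]mulrDl [leRHS]EFinD; apply: leeD; last exact: HC2.
apply: (@le_trans _ _ (a1%:E * (C1 * (2 * t) `^ (- (s1 / 2)))%:E)).
  by apply: lee_wpmul2l; [rewrite lee_fin|exact: HC1].
rewrite -EFinM lee_fin powRM ?(ltW t0)// /a1.
rewrite (_ : - ((s1 - s2) / 2) = s2 / 2 + - (s1 / 2))%R; last by field.
rewrite powRD; last by rewrite (gt_eqF t0) implybT.
by rewrite le_eqVlt; apply/orP; left; apply/eqP; ring.
Qed.

End WeightedKernel.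

Lemma measurable_poweRf d (T : measurableType d) (R : realType) (h : T -> \bar R) (p : R) :
  measurable_fun setT h -> measurable_fun setT (fun x => (h x `^ p)%E).
Proof. by move=> mh; exact: (measurableT_comp (measurable_poweR p) mh). Qed.

Section WeightedBounds.
Context {R : realType} {N : nat}.
Hypothesis N0 : (0 < N)%N.
Local Notation mu := (lebesgueN R N).
Local Notation X := (Rspace R N).
Implicit Types (x y z : X) (s t w A B C rho : R) (k : X -> R) (f g : X -> \bar R).
Local Open Scope ereal_scope.

Definition wmul w f x : \bar R := (enorm x `^ w)%:E * f x.

(* [f] has norm at most [A] in the weighted space of exponent [1 / rho] and
   weight [w]; for [rho = 0] the bound is required everywhere. *)
Definition bnd rho w f A : Prop :=
  if rho == 0%R then forall x, wmul w f x <= A%:E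
  else \int[mu]_x (wmul w f x `^ rho^-1) <= (A `^ rho^-1)%:E.

Lemma wmul_ge0 w f : (forall x, 0 <= f x) -> forall x, 0 <= wmul w f x.
Proof. by move=> f0 x; rewrite mule_ge0 ?lee_fin ?powR_ge0. Qed.

Lemma measurable_wmul w f : measurable_fun setT f -> measurable_fun setT (wmul w f).
Proof.
move=> mf; apply: emeasurable_funM => //.
exact: measurable_EFinf (measurable_powR_enorm _).
Qed.

Lemma bnd_le rho w f g A B : (0 <= rho)%R -> (0 <= A <= B)%R ->
  measurable_fun setT f -> measurable_fun setT g ->
  (forall x, 0 <= f x) -> (forall x, f x <= g x) ->
  bnd rho w g A -> bnd rho w f B.
Proof.
move=> rho0 /andP[A0 AB] mf mg f0 fg.
have wfg x : wmul w f x <= wmul w g x by apply: lee_wpmul2l => //; rewrite lee_fin powR_ge0.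
rewrite /bnd; case: eqP => [_ h x|/eqP rn0 h].
  by rewrite (le_trans (wfg x))// (le_trans (h x))// lee_fin.
have ri : (0 <= rho^-1)%R by rewrite invr_ge0.
apply: (@le_trans _ _ (A `^ rho^-1)%:E); last first.
  by rewrite lee_fin ge0_ler_powR ?nnegrE// (le_trans A0).
apply: le_trans h; apply: ge0_le_integral => //.
- by move=> x _; exact: poweR_ge0.
- by apply: measurable_poweRf; exact: measurable_wmul.
- by apply: measurable_poweRf; exact: measurable_wmul.
- by move=> x _; apply: le_poweR => //; exact: wmul_ge0.
Qed.

Lemma bndZ rho w f (c : R) A : (0 <= rho)%R -> (0 <= c)%R -> (0 <= A)%R ->
  measurable_fun setT f -> (forall x, 0 <= f x) ->
  bnd rho w f A -> bnd rho w (fun x => c%:E * f x) (c * A).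
Proof.
move=> rho0 c0 A0 mf f0; rewrite /bnd.
have wE x : wmul w (fun x => c%:E * f x) x = c%:E * wmul w f x by rewrite /wmul muleCA.
case: eqP => [_ h x|/eqP rn0 h].
  by rewrite wE EFinM; apply: lee_wpmul2l.
under eq_integral do rewrite wE poweRM ?wmul_ge0// poweR_EFin.
rewrite ge0_integralZl//.
- by rewrite powRM// EFinM; apply: lee_wpmul2l; rewrite ?lee_fin ?powR_ge0.
- by apply: measurable_poweRf; exact: measurable_wmul.
- by move=> x _; exact: poweR_ge0.
- by rewrite lee_fin powR_ge0.
Qed.

Lemma poweR_add_le (a b : \bar R) (p : R) : (0 <= p)%R -> 0 <= a -> 0 <= b ->
  (a + b) `^ p <= (2 `^ p)%:E * (a `^ p + b `^ p).
Proof.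
move=> p0; wlog ab : a b / a <= b => [hw a0 b0|a0 b0].
  by have /orP[ab|ba] := le_total a b; [|rewrite addeC [X in _ * X]addeC]; exact: hw.
apply: (@le_trans _ _ ((2%:E * b) `^ p)).
  apply: le_poweR => //; first exact: adde_ge0.
  have -> : (2%:E = 1 + 1 :> \bar R) by rewrite -EFinD.
  by rewrite ge0_muleDl// mul1e leeD2r.
rewrite poweRM// poweR_EFin; apply: lee_wpmul2l; first by rewrite lee_fin powR_ge0.
by rewrite leeDr// poweR_ge0.
Qed.

(** Minkowski with the constant 4 instead of 1. With p = 1 / rho the two losses are 2^p, from (a +
    b)^p <= 2^p (a^p + b^p), and 2, from A^p + B^p <= 2 (A + B)^p; since p >= 1, their product is at
    most 4^p. *)
Lemma bndD rho w f g A B : (0 <= rho <= 1)%R -> (0 <= A)%R -> (0 <= B)%R ->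
  measurable_fun setT f -> measurable_fun setT g ->
  (forall x, 0 <= f x) -> (forall x, 0 <= g x) ->
  bnd rho w f A -> bnd rho w g B -> bnd rho w (fun x => f x + g x) (4 * (A + B)).
Proof.
move=> /andP[rho0 rho1] A0 B0 mf mg f0 g0; rewrite /bnd.
have wE x : wmul w (fun x => f x + g x) x = wmul w f x + wmul w g x.
  by rewrite /wmul ge0_muleDr.
case: eqP => [_ hf hg x|/eqP rn0 hf hg].
  rewrite wE; apply: (@le_trans _ _ (A + B)%:E); first by rewrite EFinD leeD.
  by rewrite lee_fin ler_peMl ?addr_ge0 ?ler1n.
have r0 : (0 < rho)%R by rewrite lt_neqAle eq_sym rn0.
have ri : (0 <= rho^-1)%R by rewrite invr_ge0.
have mwf := measurable_poweRf rho^-1 (measurable_wmul w mf).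
have mwg := measurable_poweRf rho^-1 (measurable_wmul w mg).
apply: (@le_trans _ _ (\int[mu]_x ((2 `^ rho^-1)%:E *
    (wmul w f x `^ rho^-1 + wmul w g x `^ rho^-1)))).
  apply: ge0_le_integral => //.
  - by move=> x _; exact: poweR_ge0.
  - apply: measurable_poweRf; apply: measurable_wmul; exact: emeasurable_funD.
  - by apply: measurable_funeM; exact: emeasurable_funD.
  - by move=> x _; rewrite wE poweR_add_le// wmul_ge0.
rewrite ge0_integralZl ?lee_fin ?powR_ge0//; last 2 first.
- exact: emeasurable_funD.
- by move=> x _; rewrite adde_ge0 ?poweR_ge0.
rewrite ge0_integralD//; last 2 first.
- by move=> x _; exact: poweR_ge0.
- by move=> x _; exact: poweR_ge0.
have AB : (0 <= A + B)%R by rewrite addr_ge0.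
apply: (@le_trans _ _ ((2 `^ rho^-1)%:E * (2 * (A + B) `^ rho^-1)%:E)).
  apply: lee_wpmul2l; first by rewrite lee_fin powR_ge0.
  apply: (le_trans (leeD hf hg)); rewrite -EFinD lee_fin mulr_natl mulr2n.
  by rewrite lerD// ge0_ler_powR ?nnegrE// ?lerDl ?lerDr.
rewrite -EFinM lee_fin mulrA (powRM _ _ AB)// ler_wpM2r ?powR_ge0//.
have -> : (4 = 2 * 2 :> R)%R by rewrite -natrM.
rewrite [leRHS]powRM// ler_wpM2l ?powR_ge0//.
by rewrite le1r_powR ?ler1n// -invr1 lef_pV2 ?posrE.
Qed.

(** Jensen with p = 1 / rho for the measure of density G_t(x - y) |y|^(-s1 p'), against which
    |y|^(s1 p') f is integrated. By [weighted_kernel_le] with both weights multiplied by p' its mass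
    is at most a constant times |x|^(-s2 p') t^(-(s1 - s2) p' / 2). *)
Lemma heat_pointwise rho s1 s2 : (0 < rho < 1)%R -> (0 <= s2 <= s1)%R ->
  (s1 + N%:R * rho < N%:R)%R ->
  exists2 C : R, (0 < C)%R & forall t f x, (0 < t)%R ->
    measurable_fun setT f -> (forall y, 0 <= f y) ->
    wmul s2 (conv (hker t) f) x `^ rho^-1 <=
      (C * t `^ (- ((s1 - s2) / 2) * rho^-1))%:E *
      conv (hker t) (fun y => wmul s1 f y `^ rho^-1) x.
Proof.
move=> /andP[r0 r1] /andP[s20 s21] sN; have s10 := le_trans s20 s21.
have r1' : (0 < 1 - rho)%R by rewrite subr_gt0.
(* The conjugate exponent of p = 1 / rho. The identity p' (p - 1) = p below makes all the powers of
   |x|, |y| and t match, and s1 p' < N is exactly the hypothesis on [s1]. *)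
pose p' := ((1 - rho)^-1)%R; have p'0 : (0 < p')%R by rewrite invr_gt0.
have N0' : (0 < N%:R :> R)%R by rewrite ltr0n.
have h12 : (0 <= s2 * p' <= s1 * p')%R by rewrite mulr_ge0 ?(ltW p'0)//= ler_wpM2r// ltW.
have s1N : (s1 * p' < N%:R)%R.
  by rewrite ltr_pdivrMr// mulrBr mulr1 ltrBrDr.
have [C1 C10 HC] := weighted_kernel_le N0 h12 s1N.
pose p := (rho^-1)%R; have p0 : (0 < p)%R by rewrite invr_gt0.
have p1 : (1 <= p)%R by rewrite -invr1 lef_pV2 ?posrE// ltW.
have pp' : (p' * (p - 1) = p)%R by rewrite /p /p'; field; rewrite !gt_eqF.
exists (2 `^ p * C1 `^ (p - 1))%R; first by rewrite mulr_gt0 ?powR_gt0.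
move=> t f x t0 mf f0; rewrite -/p.
set Q := conv _ _ x.
have mh := @measurable_hker R N t; have h0 := @hker_ge0 R N t.
have Q0 : 0 <= Q by apply: conv_ge0 => // y; exact: poweR_ge0.
have E0 := enorm_ge0 x.
(* At x = 0 with s2 nonzero one cannot divide by the weight, but the left side is then 0. *)
have [x0|xn0] := eqVneq (enorm x `^ s2)%R 0%R.
  by rewrite /wmul x0 mul0e poweR0r ?gt_eqF// mule_ge0// lee_fin !mulr_ge0 ?powR_ge0.
have x1 : (0 < enorm x `^ (s2 * p'))%R.
  rewrite lt_neqAle powR_ge0 eq_sym andbT; apply: contra xn0.
  rewrite !powR_eq0 mulf_eq0 negb_or => /andP[-> /andP[-> _]]//.
pose K := (C1 * t `^ (- ((s1 * p' - s2 * p') / 2)))%R.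
have K0 : (0 < K)%R by rewrite mulr_gt0 ?powR_gt0.
pose Kx := (K / enorm x `^ (s2 * p'))%R; have Kx0 : (0 < Kx)%R by rewrite divr_gt0.
pose kk y : \bar R := (hker t (vsub x y))%:E * (enorm y `^ (- (s1 * p')))%:E.
have mkk : measurable_fun setT kk.
  by apply: measurable_conv_integrand => //; exact: measurable_EFinf (measurable_powR_enorm _).
have kk0 y : 0 <= kk y by rewrite mule_ge0 ?lee_fin ?powR_ge0.
have kkK : \int[mu]_y kk y <= Kx%:E.
  have := HC t x t0; rewrite -/K -lee_pdivlMl// => /le_trans; apply.
  by rewrite -EFinM lee_fin /Kx mulrC.
have mF : measurable_fun setT (wmul (s1 * p') f) by exact: measurable_wmul.
have := jensen_le mF mkk (wmul_ge0 _ f0) kk0 p1 Kx0 kkK.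
have -> : \int[mu]_y (wmul (s1 * p') f y * kk y) = conv (hker t) f x.
  apply: ge0_ae_eq_integral => //.
  - exact: emeasurable_funM.
  - exact: measurable_conv_integrand.
  - by move=> y _; rewrite mule_ge0// wmul_ge0.
  - by move=> y _; rewrite mule_ge0 ?lee_fin.
  - apply: ae_mono (ae_enorm_gt0 N0) => y y0 _.
    rewrite /wmul /kk muleC -muleA [X in _ * X]muleA -EFinM -powRD ?(gt_eqF y0) ?implybT//.
    by rewrite addNr powRr0 mul1e.
have -> : \int[mu]_y (wmul (s1 * p') f y `^ p * kk y) = Q.
  apply: ge0_ae_eq_integral => //.
  - by apply: emeasurable_funM => //; exact: measurable_poweRf.
  - apply: measurable_conv_integrand => //; apply: measurable_poweRf; exact: measurable_wmul.
  - by move=> y _; rewrite mule_ge0// poweR_ge0.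
  - by move=> y _; rewrite mule_ge0 ?lee_fin// poweR_ge0.
  - apply: ae_mono (ae_enorm_gt0 N0) => y y0 _.
    rewrite /wmul /kk !poweRM ?lee_fin ?powR_ge0// !poweR_EFin muleC -muleA; congr (_ * _).
    rewrite muleA -EFinM -!powRrM -powRD ?(gt_eqF y0) ?implybT//.
    congr ((_ `^ _)%:E * _); rewrite -{2}pp'; ring.
move=> J; rewrite {1}/wmul poweRM ?lee_fin ?powR_ge0 ?conv_ge0// poweR_EFin.
apply: (le_trans (lee_wpmul2l _ J)); first by rewrite lee_fin powR_ge0.
rewrite muleA -EFinM; apply: lee_wpmul2r => //; rewrite lee_fin.
rewrite /Kx powRM ?(ltW K0) ?invr_ge0 ?(ltW x1)//.
rewrite -powR_inv1 ?(ltW x1)// -!powRrM.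
rewrite [X in (X <= _)%R](_ : _ = 2 `^ p * K `^ (p - 1) * (enorm x `^ (s2 * p) * enorm x `^ (s2 * p' * (-1 * (p - 1)))))%R; last by ring.
rewrite (_ : s2 * p' * (-1 * (p - 1)) = - (s2 * p))%R; last by rewrite -{2}pp'; ring.
have xx : (enorm x `^ (s2 * p) * enorm x `^ (- (s2 * p)) = 1)%R.
  rewrite powRN divff// powR_eq0 mulf_eq0 (gt_eqF p0) orbF.
  by move: xn0; rewrite powR_eq0.
rewrite xx mulr1 /K powRM ?powR_ge0 ?(ltW C10)// -powRrM.
rewrite (_ : - ((s1 * p' - s2 * p') / 2) * (p - 1) = - ((s1 - s2) / 2) * p)%R; last by rewrite -{2}pp'; ring.
by rewrite mulrA.
Qed.

End WeightedBounds.

(** * Smoothing between weighted spaces, and Minkowski's inequality in time *)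

Section HeatEstimate.
Context {R : realType} {N : nat}.
Hypothesis N0 : (0 < N)%N.
Local Notation leb := (@lebesgue_measure R).
Local Notation mu := (lebesgueN R N).
Local Notation X := (Rspace R N).
Implicit Types (x y z : X) (s t w A B C rho : R) (k : X -> R) (f g : X -> \bar R).
Local Open Scope ereal_scope.

Lemma poweR_le_inv (a : \bar R) (B p : R) : (0 < p)%R -> 0 <= a -> (0 <= B)%R ->
  a `^ p <= (B `^ p)%:E -> a <= B%:E.
Proof.
move=> p0 a0 B0 h.
have := le_poweR (r := p^-1) _ (poweR_ge0 a p) h.
rewrite poweR_EFin -poweRrM -powRrM mulfV ?gt_eqF// poweRe1// powRr1//.
by apply; rewrite invr_ge0 ltW.
Qed.

Lemma integral_poweR_le f (B D r : R) : (1 <= r)%R -> (0 <= B)%R -> (0 <= D)%R ->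
  measurable_fun setT f -> (forall x, 0 <= f x) -> (forall x, f x <= B%:E) ->
  \int[mu]_x f x <= D%:E -> \int[mu]_x (f x `^ r) <= (B `^ (r - 1) * D)%:E.
Proof.
move=> r1 B0 D0 mf f0 fB fD; have r0 : (0 < r)%R by rewrite (lt_le_trans _ r1).
apply: (@le_trans _ _ (\int[mu]_x ((B `^ (r - 1))%:E * f x))).
  apply: ge0_le_integral => //.
  - by move=> x _; exact: poweR_ge0.
  - exact: measurable_poweRf.
  - exact: measurable_funeM.
  - move=> x _; move: (f0 x) (fB x); case: (f x) => // a; rewrite !lee_fin => a0 aB.
    rewrite -(mulr_powRB1 a0 r0) mulrC ler_wpM2r//.
    by rewrite ge0_ler_powR ?nnegrE// subr_ge0.
rewrite ge0_integralZl ?lee_fin ?powR_ge0// EFinM.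
by apply: lee_wpmul2l; rewrite ?lee_fin ?powR_ge0.
Qed.

(** After [heat_pointwise] the question is unweighted: Q, the heat evolution of (|y|^s1 f)^p with p
    = 1 / rho1, has integral at most A^p and supremum at most (4 pi t)^(-N/2) A^p. Interpolating,
    the power rho1 / rho2 of Q is integrable; for rho2 = 0 the supremum suffices. *)
Lemma heat_bnd rho1 rho2 s1 s2 : (0 <= rho2 <= rho1)%R -> (0 <= s2 <= s1)%R ->
  (s1 + N%:R * rho1 < N%:R)%R ->
  exists2 C : R, (0 < C)%R & forall t f A, (0 < t)%R -> (0 <= A)%R ->
    measurable_fun setT f -> (forall y, 0 <= f y) -> bnd rho1 s1 f A ->
    bnd rho2 s2 (conv (hker t) f)
      (C * t `^ (- (N%:R / 2 * (rho1 - rho2) + (s1 - s2) / 2)) * A).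
Proof.
move=> /andP[r20 r21] /andP[s20 s21] sN; have s10 := le_trans s20 s21.
have N0' : (0 < N%:R :> R)%R by rewrite ltr0n.
(* Here rho2 = 0 as well, f <= A |y|^(-s1) off the origin, and [weighted_kernel_le] is the whole
   claim. *)
have [r10|r1n0] := eqVneq rho1 0%R.
  have r2E : rho2 = 0%R by apply/eqP; rewrite eq_le r20 andbT -r10.
  have s1N : (s1 < N%:R)%R by move: sN; rewrite r10 mulr0 addr0.
  have [C C0 HC] := weighted_kernel_le N0 (introT andP (conj s20 s21)) s1N.
  exists C => // t f A t0 A0 mf f0; rewrite /bnd r10 r2E eqxx => fA x.
  have mw : measurable_fun setT (fun y : X => (enorm y `^ (- s1))%:E).
    exact: measurable_EFinf (measurable_powR_enorm _).
  have mh := @measurable_hker R N t; have h0 := @hker_ge0 R N t.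
  have w0 y : 0 <= (enorm y `^ (- s1))%:E by rewrite lee_fin powR_ge0.
  rewrite subr0 mulr0 add0r mulrC EFinM.
  apply: (@le_trans _ _ (A%:E * wmul s2 (conv (hker t) (fun y => (enorm y `^ (- s1))%:E)) x)).
    rewrite /wmul muleCA; apply: lee_wpmul2l; first by rewrite lee_fin powR_ge0.
    rewrite -convZ//; apply: ae_le_conv => //.
    - exact: measurable_funeM.
    - by move=> y; rewrite mule_ge0.
    - apply: ae_mono (ae_enorm_gt0 N0) => y y0.
      have yp : (0 < enorm y `^ s1)%R by rewrite powR_gt0.
      have := fA y; rewrite /wmul -lee_pdivlMl//; rewrite muleC => /le_trans; apply.
      by rewrite powRN.
  by apply: lee_wpmul2l => //; exact: HC.
have r10 : (0 < rho1)%R by rewrite lt_neqAle eq_sym r1n0 (le_trans r20).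
have r11 : (rho1 < 1)%R.
  have := le_lt_trans (_ : N%:R * rho1 <= s1 + N%:R * rho1)%R sN.
  by rewrite lerDr s10 gtr_pMr//; apply.
have [C C0 HC] := heat_pointwise N0 (introT andP (conj r10 r11)) (introT andP (conj s20 s21)) sN.
pose p := (rho1^-1)%R; have p0 : (0 < p)%R by rewrite invr_gt0.
have p1 : (1 <= p)%R by rewrite -invr1 lef_pV2 ?posrE// ltW.
pose K := ((4 * pi) `^ (- (N%:R / 2) * (rho1 - rho2)))%R.
have pi4 : (0 < 4 * pi :> R)%R by rewrite mulr_gt0 ?pi_gt0.
have K0 : (0 < K)%R by rewrite powR_gt0.
exists (C `^ rho1 * K)%R; first by rewrite mulr_gt0 ?powR_gt0.
move=> t f A t0 A0 mf f0; rewrite {1}/bnd gt_eqF// => fA.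
have mh := @measurable_hker R N t; have h0 := @hker_ge0 R N t.
have mwf := measurable_wmul s1 mf; have wf0 := wmul_ge0 s1 f0.
have mg := measurable_poweRf p mwf.
have g0 y : 0 <= wmul s1 f y `^ p by exact: poweR_ge0.
pose Q := conv (hker t) (fun y => wmul s1 f y `^ p).
have mQ : measurable_fun setT Q by exact: measurable_conv.
have Q0 x : 0 <= Q x by exact: conv_ge0.
pose B := ((4 * pi * t) `^ (- (N%:R / 2)) * A `^ p)%R.
have B0 : (0 <= B)%R by rewrite mulr_ge0 ?powR_ge0.
have QB x : Q x <= B%:E.
  apply: (le_trans (conv_hker_le x t0 mg g0)); rewrite /B EFinM.
  by apply: lee_wpmul2l; rewrite ?lee_fin ?powR_ge0.
have QA : \int[mu]_x Q x <= (A `^ p)%:E by rewrite integral_conv_hker.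
pose D := (C * t `^ (- ((s1 - s2) / 2) * p))%R.
have D0 : (0 <= D)%R by rewrite mulr_ge0 ?powR_ge0// ltW.
have PW x : wmul s2 (conv (hker t) f) x `^ p <= D%:E * Q x by exact: HC.
have mcf : measurable_fun setT (conv (hker t) f) by exact: measurable_conv.
have cf0 x : 0 <= conv (hker t) f x by exact: conv_ge0.
have pr1 : (p * rho1 = 1)%R by rewrite mulVf.
have cst : ((C `^ rho1 * K * t `^ (- (N%:R / 2 * (rho1 - rho2) + (s1 - s2) / 2)) * A) `^ p
   = D * ((4 * pi * t) `^ (- (N%:R / 2) * (1 - rho2 * p)) * A `^ p))%R.
  have t4 : ((4 * pi * t) `^ (- (N%:R / 2) * (1 - rho2 * p)) =
     K `^ p * t `^ (- (N%:R / 2) * (1 - rho2 * p)) :> R)%R.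
    rewrite powRM ?(ltW pi4) ?(ltW t0)// /K -powRrM; congr ((_ `^ _) * _)%R.
    by rewrite -pr1; ring.
  rewrite t4 !powRM ?mulr_ge0 ?powR_ge0 ?(ltW K0)// -!powRrM [(rho1 * p)%R]mulrC pr1.
  rewrite powRr1 ?(ltW C0)// /D.
  rewrite (_ : - (N%:R / 2 * (rho1 - rho2) + (s1 - s2) / 2) * p =
     - ((s1 - s2) / 2) * p + - (N%:R / 2) * (1 - rho2 * p))%R; last by rewrite -pr1; ring.
  rewrite [in LHS]powRD ?(gt_eqF t0) ?implybT//; ring.
rewrite /bnd; case: eqP => [r2E x|/eqP r2n0].
  apply: (@poweR_le_inv _ _ p) => //; first exact: wmul_ge0.
    by rewrite !mulr_ge0 ?powR_ge0 ?(ltW K0).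
  rewrite cst r2E mul0r subr0 mulr1; apply: (le_trans (PW x)).
  by rewrite [leRHS]EFinM; apply: lee_wpmul2l; rewrite ?lee_fin.
have r20' : (0 < rho2)%R by rewrite lt_neqAle eq_sym r2n0.
pose r := (rho1 / rho2)%R.
have r1 : (1 <= r)%R by rewrite ler_pdivlMr// mul1r.
have r0 : (0 <= r)%R by rewrite (le_trans _ r1).
have pr : (p * r = rho2^-1)%R by rewrite /r mulrA pr1 mul1r.
rewrite -pr; apply: (@le_trans _ _ (\int[mu]_x ((D `^ r)%:E * Q x `^ r))).
  apply: ge0_le_integral => //.
  - by move=> x _; exact: poweR_ge0.
  - by apply: measurable_poweRf; exact: measurable_wmul.
  - by apply: measurable_funeM; exact: measurable_poweRf.
  - move=> x _; rewrite poweRrM -poweR_EFin -poweRM//.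
    by apply: le_poweR => //; exact: poweR_ge0.
rewrite ge0_integralZl ?lee_fin ?powR_ge0//; last 2 first.
- exact: measurable_poweRf.
- by move=> x _; exact: poweR_ge0.
rewrite (powRrM _ p r) cst (@powRM _ D _ r D0) ?mulr_ge0 ?powR_ge0// [leRHS]EFinM.
apply: lee_wpmul2l; first by rewrite lee_fin powR_ge0.
apply: (le_trans (integral_poweR_le r1 B0 (powR_ge0 _ _) mQ Q0 QB QA)).
rewrite lee_fin /B; move: (4 * pi * t)%R => P.
rewrite !powRM ?powR_ge0// -!powRrM -mulrA -powRD; last first.
  rewrite (_ : _ + _ = p * r)%R; last by ring.
  by rewrite gt_eqF// pr invr_gt0.
rewrite (_ : p * (r - 1) + p = p * r)%R; last by ring.
rewrite (_ : - (N%:R / 2) * (r - 1) = - (N%:R / 2) * (1 - rho2 * p) * r)%R//.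
rewrite -mulrA; congr (_ * _)%R; rewrite mulrBl mul1r -mulrA; congr (_ - _)%R.
by rewrite pr divff.
Qed.

(* Minkowski's integral inequality up to a factor, from [jensen_le] for the
   measure of density [kap]. *)
Lemma bnd_time_integral rho w (F : R -> X -> \bar R) (kap : R -> R) (K : R) :
  (0 <= rho <= 1)%R -> (0 < K)%R ->
  measurable_fun setT (fun p : measurableTypeR R * X => F p.1 p.2) ->
  measurable_fun setT kap ->
  (forall s x, 0 <= F s x) -> (forall s, 0 <= kap s)%R ->
  (forall s, kap s = 0%R -> forall x, F s x = 0) ->
  (forall s, bnd rho w (F s) (kap s)) ->
  \int[leb]_s (kap s)%:E <= K%:E ->
  bnd rho w (fun x => \int[leb]_s F s x) (2 * K).
Proof.
move=> /andP[rho0 rho1] K0 mF mk F0 k0 kF0 Fk kK.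
have mk' : measurable_fun [set: measurableTypeR R] (fun s => (kap s)%:E).
  exact: measurable_EFinf.
have mFx x : measurable_fun [set: measurableTypeR R] (fun s => F s x).
  exact: (measurableT_comp mF (measurable_pair2 x)).
have mFs s : measurable_fun setT (F s).
  exact: (measurableT_comp mF (measurable_pair1 s)).
have wE x : wmul w (fun x => \int[leb]_s F s x) x = \int[leb]_s (wmul w (F s) x).
  by rewrite /wmul ge0_integralZl// lee_fin powR_ge0.
have mwFx x : measurable_fun [set: measurableTypeR R] (fun s => wmul w (F s) x).
  exact: measurable_funeM.
have wF0 s x : 0 <= wmul w (F s) x by exact: wmul_ge0.
rewrite /bnd; have [r0|rn0] := eqVneq rho 0%R.
  move=> x; rewrite wE; apply: (@le_trans _ _ (\int[leb]_s (kap s)%:E)).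
    apply: ge0_le_integral => //.
    by move=> s _; have := Fk s; rewrite /bnd r0 eqxx; exact.
  by apply: (le_trans kK); rewrite lee_fin ler_peMl ?ler1n// ltW.
have r0 : (0 < rho)%R by rewrite lt_neqAle eq_sym rn0.
pose p := (rho^-1)%R; have p0 : (0 < p)%R by rewrite invr_gt0.
have p1 : (1 <= p)%R by rewrite -invr1 lef_pV2 ?posrE.
rewrite -/p.
have mki : measurable_fun [set: measurableTypeR R] (fun s => ((kap s) `^ (-1))%R%:E).
  by apply: measurable_EFinf; exact: measurable_powRf.
have mwF : measurable_fun setT (fun q : measurableTypeR R * X => wmul w (F q.1) q.2).
  apply: emeasurable_funM => //; apply: measurable_EFinf; apply: measurable_powRf.
  exact: (@measurable_enorm_comp _ _ _ (measurableTypeR R * X)%type snd).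
pose G s x := (((kap s) `^ (-1))%R%:E * wmul w (F s) x) `^ p * (kap s)%:E.
have mG : measurable_fun setT (fun q : measurableTypeR R * X => G q.1 q.2).
  apply: emeasurable_funM; last exact: (measurableT_comp mk' measurable_fst).
  apply: measurable_poweRf; apply: emeasurable_funM => //.
  exact: (measurableT_comp mki measurable_fst).
have G0 s x : 0 <= G s x by rewrite mule_ge0 ?poweR_ge0 ?lee_fin.
have J x : wmul w (fun x => \int[leb]_s F s x) x `^ p <=
    (2 `^ p * K `^ (p - 1))%:E * \int[leb]_s G s x.
  rewrite wE.
  (* Insert the density and its inverse. Where [kap s = 0] the inverse is the default value 0, but
     [F s] vanishes there by hypothesis. *)
  rewrite (_ : \int[leb]_s wmul w (F s) x = \int[leb]_s
    ((((kap s) `^ (-1))%R%:E * wmul w (F s) x) * (kap s)%:E)); last first.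
    apply: eq_integral => s _; have [ks0|ksn0] := eqVneq (kap s) 0%R.
      by rewrite /wmul kF0// !mule0 mul0e.
    rewrite muleAC -EFinM powR_inv1// mulVf// mul1e//.
  apply: jensen_le => //.
  - by apply: emeasurable_funM.
  - by move=> s; rewrite mule_ge0 ?lee_fin ?powR_ge0.
apply: (@le_trans _ _ (\int[mu]_x ((2 `^ p * K `^ (p - 1))%:E * \int[leb]_s G s x))).
  apply: ge0_le_integral => //.
  - by move=> x _; exact: poweR_ge0.
  - apply: measurable_poweRf; apply: measurable_wmul.
    exact: (measurable_fun_fubini_tonelli_G (m1 := leb) (fun q : measurableTypeR R * X => F q.1 q.2) mF (fun q => F0 q.1 q.2)).
  - apply: measurable_funeM.
    exact: (measurable_fun_fubini_tonelli_G (m1 := leb) (fun q : measurableTypeR R * X => G q.1 q.2) mG (fun q => G0 q.1 q.2)).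
rewrite ge0_integralZl//; last 3 first.
- exact: (measurable_fun_fubini_tonelli_G (m1 := leb) (fun q : measurableTypeR R * X => G q.1 q.2) mG (fun q => G0 q.1 q.2)).
- by move=> x _; exact: integral_ge0.
- by rewrite lee_fin mulr_ge0 ?powR_ge0.
rewrite powRM ?(ltW K0)// -[in leRHS](mulr_powRB1 (ltW K0) p0) [(K * _)%R]mulrC mulrA [leRHS]EFinM.
apply: lee_wpmul2l; first by rewrite lee_fin mulr_ge0 ?powR_ge0.
rewrite -(fubini_tonelli (m1 := leb) (fun q : measurableTypeR R * X => G q.1 q.2) mG (fun q => G0 q.1 q.2))/=.
apply: le_trans kK; apply: ge0_le_integral => //.
- by move=> s _; exact: integral_ge0.
- exact: (measurable_fun_fubini_tonelli_F (fun q : measurableTypeR R * X => G q.1 q.2) mG (fun q => G0 q.1 q.2)).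
move=> s _; have [ks0|ksn0] := eqVneq (kap s) 0%R.
  by rewrite /G ks0 integral0_eq// => x _; rewrite mule0.
have ks : (0 < kap s)%R by rewrite lt_neqAle eq_sym ksn0 k0.
rewrite /G; under eq_integral => x _.
  rewrite poweRM ?lee_fin ?powR_ge0// poweR_EFin -powRrM muleAC -EFinM.
  over.
rewrite ge0_integralZl//; last 3 first.
- by apply: measurable_poweRf; exact: measurable_wmul.
- by move=> x _; exact: poweR_ge0.
- by rewrite lee_fin mulr_ge0 ?powR_ge0.
have := Fk s; rewrite /bnd (negbTE rn0) -/p => Fks.
apply: (le_trans (lee_wpmul2l _ Fks)); first by rewrite lee_fin mulr_ge0 ?powR_ge0.
rewrite -EFinM lee_fin mulrAC -powRD ?(gt_eqF ks) ?implybT//.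
by rewrite mulN1r addNr powRr0 mul1r.
Qed.

End HeatEstimate.

(** * Duhamel integrals *)

Section TimeIntegrals.
Context {R : realType}.
Local Notation leb := (@lebesgue_measure R).
Implicit Types (a b s t : R).

(** The integrand of the Beta integral, extended by 0 so that all time integrals run over the whole
    line. *)
Definition tker a b t s : R :=
  if (0 < s) && (s < t) then (t - s) `^ (- a) * s `^ (- b) else 0.

Lemma tker_ge0 a b t s : 0 <= tker a b t s.
Proof. by rewrite /tker; case: ifP => // _; rewrite mulr_ge0 ?powR_ge0. Qed.

Lemma measurable_tker a b t : measurable_fun [set: measurableTypeR R] (tker a b t).
Proof.
apply: measurable_fun_ifT => //.
  by apply: measurable_and; exact: measurable_fun_ltr.
apply: measurable_funM; apply: (@measurable_powRf _ _ (measurableTypeR R)) => //.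
exact: measurable_funB.
Qed.

(** Split at t / 2: on each half one of the two factors is nonsingular and at most its value at t /
    2, and the other is integrated. *)
Lemma integral_tker_le a b : 0 <= a < 1 -> 0 <= b < 1 ->
  exists2 C : R, 0 < C & forall t, 0 < t ->
    (\int[leb]_s (tker a b t s)%:E <= (C * t `^ (1 - a - b))%:E)%E.
Proof.
move=> a01 b01; have [a0 a1] := andP a01; have [b0 b1] := andP b01.
have a1' : 0 < 1 - a by rewrite subr_gt0.
have b1' : 0 < 1 - b by rewrite subr_gt0.
exists (2 `^ a / (1 - b) + 2 `^ b / (1 - a)).
  by rewrite addr_gt0// divr_gt0 ?powR_gt0.
move=> t t0; have t20 : 0 < t / 2 by rewrite divr_gt0.
pose f1 s : R := if (0 < s) && (s < t) then s `^ (- b) else 0.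
pose f2 s : R := if (0 < s) && (s < t) then (t - s) `^ (- a) else 0.
have mc : measurable_fun [set: measurableTypeR R] (fun s : R => (0 < s) && (s < t)).
  by apply: measurable_and; exact: measurable_fun_ltr.
have m1 : measurable_fun [set: measurableTypeR R] f1.
  exact: measurable_fun_ifT.
have m2 : measurable_fun [set: measurableTypeR R] f2.
  apply: measurable_fun_ifT => //.
  apply: (@measurable_powRf _ _ (measurableTypeR R)) => //.
  exact: measurable_funB.
have f10 s : 0 <= f1 s by rewrite /f1; case: ifP => // _; exact: powR_ge0.
have f20 s : 0 <= f2 s by rewrite /f2; case: ifP => // _; exact: powR_ge0.
apply: (@le_trans _ _ (\int[leb]_s (((t / 2) `^ (- a))%:E * (f1 s)%:E +
    ((t / 2) `^ (- b))%:E * (f2 s)%:E))%E).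
  apply: ge0_le_integral => //.
  - by move=> s _; rewrite lee_fin tker_ge0.
  - exact: measurable_EFinf (measurable_tker _ _ _).
  - by apply: emeasurable_funD; apply: measurable_funeM; exact: measurable_EFinf.
  - move=> s _; rewrite -!EFinM lee_fin /tker /f1 /f2.
    case: ifPn => [/andP[s0 st]|_]; last by rewrite !mulr0 addr0.
    have ts0 : 0 < t - s by rewrite subr_gt0.
    have [st2|st2] := leP s (t / 2).
      apply: (@le_trans _ _ ((t / 2) `^ (- a) * s `^ (- b))); last first.
        by rewrite lerDl mulr_ge0 ?powR_ge0.
      rewrite ler_wpM2r ?powR_ge0// powRN_le//; lra.
    apply: (@le_trans _ _ ((t / 2) `^ (- b) * (t - s) `^ (- a))); last first.
      by rewrite lerDr mulr_ge0 ?powR_ge0.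
    by rewrite mulrC ler_wpM2r ?powR_ge0// powRN_le// ltW.
rewrite ge0_integralD//; last 4 first.
- by move=> s _; rewrite mule_ge0 ?lee_fin ?powR_ge0.
- by apply: measurable_funeM; exact: measurable_EFinf.
- by move=> s _; rewrite mule_ge0 ?lee_fin ?powR_ge0.
- by apply: measurable_funeM; exact: measurable_EFinf.
rewrite ge0_integralZl ?lee_fin ?powR_ge0//; last 2 first.
- exact: measurable_EFinf.
- by move=> s _; rewrite lee_fin.
rewrite ge0_integralZl ?lee_fin ?powR_ge0//; last 2 first.
- exact: measurable_EFinf.
- by move=> s _; rewrite lee_fin.
have mkc (g : R -> R) : (\int[leb]_s (if (0 < s) && (s < t) then g s else 0%R)%:E =
    \int[leb]_(s in `]0%R, t[) (g s)%:E)%E.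
  rewrite [RHS]integral_mkcond; apply: eq_integral => s _.
  by rewrite patchE mem_setE in_itv/=; case: ifP.
have I1 : (\int[leb]_s (f1 s)%:E <= ((t `^ (1 - b)) / (1 - b))%:E)%E.
  by rewrite /f1 mkc; exact: integral_powRN_le.
have I2 : (\int[leb]_s (f2 s)%:E <= ((t `^ (1 - a)) / (1 - a))%:E)%E.
  by rewrite /f2 mkc; exact: integral_subr_powRN_le.
apply: (@le_trans _ _ (((t / 2) `^ (- a))%:E * ((t `^ (1 - b)) / (1 - b))%:E +
   ((t / 2) `^ (- b))%:E * ((t `^ (1 - a)) / (1 - a))%:E)%E).
  by apply: leeD; apply: lee_wpmul2l; rewrite ?lee_fin ?powR_ge0.
rewrite -!EFinM lee_fin.
have h2 c : (t / 2) `^ (- c) = 2 `^ c * t `^ (- c).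
  by rewrite powRM ?(ltW t0)// -powR_inv1// -powRrM mulN1r opprK mulrC.
rewrite !h2 [1 - a - b](_ : _ = - a + (1 - b)); last by ring.
rewrite mulrDl; apply: lerD.
  rewrite [in leRHS]powRD ?(gt_eqF t0) ?implybT//; rewrite le_eqVlt; apply/orP; left; apply/eqP; ring.
rewrite [- a + (1 - b)](_ : _ = - b + (1 - a)); last by ring.
by rewrite [in leRHS]powRD ?(gt_eqF t0) ?implybT//; rewrite le_eqVlt; apply/orP; left; apply/eqP; ring.
Qed.

End TimeIntegrals.

(** * Duhamel integrals of nonnegative sources *)

Section Duhamel.
Context {R : realType} {N : nat}.
Hypothesis N0 : (0 < N)%N.
Local Notation leb := (@lebesgue_measure R).
Local Notation mu := (lebesgueN R N).
Local Notation X := (Rspace R N).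
Local Notation TX := (measurableTypeR R * X)%type.
Implicit Types (x y z : X) (s t w A B C rho : R) (g v : R -> X -> \bar R).
Local Open Scope ereal_scope.

(** Joint measurability in time and space, with a general target so as to cover both real kernels
    and extended-valued sources. *)
Definition jmeas (U : measurableType default_measure_display) (v : R -> X -> U) :=
  measurable_fun setT (fun p : TX => v p.1 p.2).

(** The kernel family is a parameter: [hker (t - s)] gives the usual integral, and kernel
    differences or truncated kernels give its increments in time. The limits of integration are
    encoded by where the kernel or the source vanishes. *)
Definition duh (k : R -> X -> R) g x : \bar R := \int[leb]_s conv (k s) (g s) x.

Lemma measurable_int_param d (T : measurableType d) (h : T -> X -> \bar R) :
  measurable_fun setT (fun p : T * X => h p.1 p.2) -> (forall q y, 0 <= h q y) ->
  measurable_fun setT (fun q => \int[mu]_y h q y).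
Proof.
move=> mh h0.
exact: (measurable_fun_fubini_tonelli_F (fun p : T * X => h p.1 p.2) mh (fun p => h0 p.1 p.2)).
Qed.

Lemma measurable_int_time d (T : measurableType d) (h : T -> R -> \bar R) :
  measurable_fun setT (fun p : T * measurableTypeR R => h p.1 p.2) ->
  (forall q s, 0 <= h q s) -> measurable_fun setT (fun q => \int[leb]_s h q s).
Proof.
move=> mh h0.
exact: (measurable_fun_fubini_tonelli_F (m2 := leb) (fun p : T * measurableTypeR R => h p.1 p.2) mh (fun p => h0 p.1 p.2)).
Qed.

Lemma jmeas_slice v s : jmeas v -> measurable_fun setT (v s).
Proof. by move=> mv; exact: (measurableT_comp mv (measurable_pair1 s)). Qed.

Lemma jmeas_conv (k : R -> X -> R) g :
  jmeas k -> jmeas g -> (forall s z, 0 <= k s z)%R -> (forall s y, 0 <= g s y) ->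
  jmeas (fun s => conv (k s) (g s)).
Proof.
move=> mk mg k0 g0.
apply: (measurable_int_param (T := TX) (h := fun q y => (k q.1 (vsub q.2 y))%:E * g q.1 y)).
- apply: emeasurable_funM.
    apply: measurable_EFinf.
    have mm : measurable_fun setT (fun p : TX * X => (p.1.1, vsub p.1.2 p.2) : TX).
      apply/measurable_fun_pairP; split => /=; first exact: (measurableT_comp measurable_fst measurable_fst).
      apply: measurable_vsub_comp => //; exact: (measurableT_comp measurable_snd measurable_fst).
    exact: (measurableT_comp mk mm).
  have mm : measurable_fun setT (fun p : TX * X => (p.1.1, p.2) : TX).
    apply/measurable_fun_pairP; split => /=; last exact: measurable_snd.
    exact: (measurableT_comp measurable_fst measurable_fst).
  exact: (measurableT_comp mg mm).
- by move=> q y; rewrite mule_ge0 ?lee_fin.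
Qed.

Lemma jmeas_hker t : jmeas (fun s => hker (t - s) : X -> R).
Proof. by apply: measurable_hker_comp => //; exact: measurable_funB. Qed.

Lemma duh_ge0 k g x : (forall s z, 0 <= k s z)%R -> (forall s y, 0 <= g s y) -> 0 <= duh k g x.
Proof. by move=> k0 g0; apply: integral_ge0 => s _; exact: conv_ge0. Qed.

Lemma measurable_duh (k : R -> X -> R) g :
  jmeas k -> jmeas g -> (forall s z, 0 <= k s z)%R -> (forall s y, 0 <= g s y) ->
  measurable_fun setT (duh k g).
Proof.
move=> mk mg k0 g0.
exact: (measurable_fun_fubini_tonelli_G (m1 := leb)
  (fun q : TX => conv (k q.1) (g q.1) q.2) (jmeas_conv mk mg k0 g0)
  (fun q => conv_ge0 q.2 (k0 q.1) (g0 q.1))).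
Qed.

Lemma jmeas_duh_hker g : jmeas g -> (forall s y, 0 <= g s y) ->
  jmeas (fun t => duh (fun s => hker (t - s)) g).
Proof.
move=> mg g0.
apply: (measurable_int_time (T := TX) (h := fun q s => conv (hker (q.1 - s)) (g s) q.2)).
  apply: (measurable_int_param (T := (TX * measurableTypeR R)%type)
    (h := fun q y => (hker (q.1.1 - q.2) (vsub q.1.2 y))%:E * g q.2 y)).
  - have m11 : measurable_fun setT (fun p : TX * measurableTypeR R * X => p.1.1).
      exact: (measurableT_comp measurable_fst measurable_fst).
    have m12 : measurable_fun setT (fun p : TX * measurableTypeR R * X => p.1.2 : measurableTypeR R).
      exact: (measurableT_comp measurable_snd measurable_fst).
    apply: emeasurable_funM.
      apply: measurable_EFinf; apply: measurable_hker_comp.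
        by apply: measurable_funB => //; exact: (measurableT_comp measurable_fst m11).
      apply: measurable_vsub_comp => //; exact: (measurableT_comp measurable_snd m11).
    have mm : measurable_fun setT (fun p : TX * measurableTypeR R * X => (p.1.2, p.2) : TX).
      by apply/measurable_fun_pairP; split => /=; [exact: m12|exact: measurable_snd].
    exact: (measurableT_comp mg mm).
  - by move=> q y; rewrite mule_ge0 ?lee_fin ?hker_ge0.
by move=> q s; apply: conv_ge0 => // z; exact: hker_ge0.
Qed.

Lemma bnd0 rho w : bnd (N := N) rho w (fun=> 0 : \bar R) 0.
Proof.
rewrite /bnd; case: eqP => [_ x|/eqP r0]; first by rewrite /wmul mule0.
rewrite (eq_integral (fun=> 0)); first by rewrite integral0 powR0 ?invr_eq0.
by move=> x _; rewrite /wmul mule0 poweR0r ?invr_eq0.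
Qed.

Lemma conv0 (k : X -> R) (f : X -> \bar R) x : (forall y, f y = 0) \/ (forall z, k z = 0%R) ->
  conv k f x = 0.
Proof.
by move=> h; apply: integral0_eq => y _; case: h => ->; rewrite ?mule0 ?mul0e.
Qed.

Lemma hker0 t z : (t <= 0)%R -> hker t z = 0%R :> R.
Proof. by rewrite /hker ltNge => ->. Qed.

(** A spatial estimate of singularity (t - s)^(-a) against a source of singularity s^(-b):
    [bnd_time_integral] adds the pieces with weight [D * M * tker a b t], whose integral is the Beta
    bound. Both singularities stay symbolic because the Hölder estimates reuse this with modified
    kernels. *)
Lemma bnd_duh rho1 s1 rho2 s2 (k : R -> X -> R) g (D M t a b Cb : R) :
  (0 <= rho2 <= 1)%R -> (0 < D)%R -> (0 < M)%R -> (0 < t)%R ->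
  jmeas k -> jmeas g -> (forall s z, 0 <= k s z)%R -> (forall s y, 0 <= g s y) ->
  (forall s, ~~ (0 < s < t)%R -> (forall y, g s y = 0) \/ (forall z, k s z = 0%R)) ->
  (forall s A, (0 < s < t)%R -> (0 <= A)%R -> bnd rho1 s1 (g s) A ->
    bnd rho2 s2 (conv (k s) (g s)) (D * (t - s) `^ (- a) * A)) ->
  (forall s, (0 < s < t)%R -> bnd rho1 s1 (g s) (M * s `^ (- b))) ->
  (0 < Cb)%R -> \int[leb]_s (tker a b t s)%:E <= (Cb * t `^ (1 - a - b))%:E ->
  bnd rho2 s2 (duh k g) (2 * (D * M * (Cb * t `^ (1 - a - b)))).
Proof.
move=> rho2b D0 M0 t0 mk mg k0 g0 out Hk Hg C0 HC.
have DM0 : (0 < D * M)%R by rewrite mulr_gt0.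
apply: (@bnd_time_integral R N rho2 s2 (fun s => conv (k s) (g s)) (fun s => D * M * tker a b t s)%R) => //.
- by rewrite !mulr_gt0 ?powR_gt0.
- exact: jmeas_conv.
- by apply: measurable_funM => //; exact: measurable_tker.
- by move=> s x; exact: conv_ge0.
- by move=> s; rewrite mulr_ge0 ?tker_ge0 ?(ltW DM0).
- move=> s ks0 x; apply: conv0; apply: out; apply: contraPN ks0 => st; apply/eqP.
  rewrite mulf_neq0 ?(gt_eqF DM0)// /tker st; case/andP: st => s0 st.
  by rewrite gt_eqF// mulr_gt0 ?powR_gt0 ?subr_gt0.
- move=> s; rewrite /tker; case: ifPn => st.
    rewrite (_ : _ * _ = D * (t - s) `^ (- a) * (M * s `^ (- b)))%R; last by ring.
    by apply: Hk => //; [rewrite mulr_ge0 ?powR_ge0 ?(ltW M0)|exact: Hg].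
  rewrite mulr0 (_ : conv _ _ = fun=> 0); first exact: bnd0.
  by apply/funext => x; apply: conv0; exact: out.
- under eq_integral do rewrite EFinM.
  rewrite ge0_integralZl//.
  + by rewrite [leRHS]EFinM; apply: lee_wpmul2l; rewrite ?lee_fin ?(ltW DM0).
  + exact: measurable_EFinf (measurable_tker _ _ _).
  + by move=> s _; rewrite lee_fin tker_ge0.
  + by rewrite lee_fin ltW.
Qed.

Definition src (l al : R) v s y : \bar R := (enorm y `^ l)%:E * v s y `^ (al + 1).

Lemma src_ge0 l al v s y : 0 <= src l al v s y.
Proof. by rewrite mule_ge0 ?lee_fin ?powR_ge0 ?poweR_ge0. Qed.

Lemma jmeas_src l al v : jmeas v -> jmeas (src l al v).
Proof.
move=> mv; apply: emeasurable_funM; last exact: measurable_poweRf.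
apply: measurable_EFinf; apply: measurable_powRf.
exact: (@measurable_enorm_comp _ _ _ TX snd).
Qed.

Lemma bnd_src l al v s rho nu A : (0 < al)%R -> (0 <= rho)%R ->
  (0 < nu * (al + 1) - l)%R -> (0 <= A)%R ->
  jmeas v -> (forall s y, 0 <= v s y) ->
  bnd rho nu (v s) A -> bnd (rho * (al + 1)) (nu * (al + 1) - l) (src l al v s) (A `^ (al + 1)).
Proof.
move=> al0 rho0 s10 A0 mv v0; have al1 : (0 < al + 1)%R by rewrite addr_gt0.
have W y : wmul (nu * (al + 1) - l) (src l al v s) y <= wmul nu (v s) y `^ (al + 1).
  rewrite /wmul /src poweRM ?lee_fin ?powR_ge0// poweR_EFin -powRrM muleA -EFinM.
  (* Away from the origin there is equality. At the origin the left side is 0 because the weight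
     exponent is positive, so only an inequality holds. *)
  have [y0|y0] := eqVneq (enorm y) 0%R.
    rewrite y0 powR0 ?(gt_eqF s10)// mul0r mul0e mule_ge0 ?lee_fin ?powR_ge0 ?poweR_ge0//.
  by rewrite -powRD ?y0 ?implybT// subrK.
rewrite /bnd mulf_eq0 (gt_eqF al1) orbF; case: eqP => [_ h y|/eqP r0 h].
  apply: (le_trans (W y)); rewrite -poweR_EFin; apply: le_poweR => //; first exact: ltW.
  exact: wmul_ge0.
have pE : ((al + 1) * (rho * (al + 1))^-1 = rho^-1)%R by field; rewrite r0 gt_eqF.
rewrite -powRrM pE; apply: le_trans h.
have mvs := jmeas_slice s mv.
apply: ge0_le_integral => //.
- by move=> y _; exact: poweR_ge0.
- by apply: measurable_poweRf; apply: measurable_wmul; exact: jmeas_slice (jmeas_src _ _ mv).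
- by apply: measurable_poweRf; exact: measurable_wmul.
- move=> y _; rewrite -[in leRHS]pE poweRrM; apply: le_poweR => //.
    by rewrite invr_ge0 mulr_ge0 ?(ltW al1).
  by apply: wmul_ge0 => z; exact: src_ge0.
Qed.

End Duhamel.

(** * Local estimates and differences of kernels *)

Section Splitting.
Context {R : realType} {N : nat}.
Hypothesis N0 : (0 < N)%N.
Local Notation mu := (lebesgueN R N).
Local Notation X := (Rspace R N).
Implicit Types (x y z : X) (s t w A B C rho : R) (f : X -> \bar R) (S : set X).
Local Open Scope ereal_scope.

Let N0' : (0 < N%:R :> R)%R. Proof. by rewrite ltr0n. Qed.

Definition nearS : set X := [set y | (enorm y < 1)%R].

Lemma measurable_nearS : measurable nearS.
Proof.
rewrite -[nearS]setTI.
exact: (measurable_fun_ltr measurable_enorm (@measurable_cst _ _ _ _ setT (1%R : R)) measurableT (Y := [set true])).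
Qed.

Lemma integral_near_le b : (0 <= b < N%:R)%R -> exists2 K : R, (0 < K)%R &
  \int[mu]_y (\1_nearS y * enorm y `^ (- b))%:E <= K%:E.
Proof.
move=> /andP[b0 bN]; set c := (b / N%:R)%R.
have c01 : (0 <= c < 1)%R by rewrite divr_ge0//= ltr_pdivrMr// mul1r.
pose h (a : R) : R := (if `|a| < 1 then `|a| `^ (- c) else 0)%R.
have mh : measurable_fun [set: R] h.
  apply: measurable_fun_ifT => //; first exact: measurable_fun_ltr.
  by apply: (@measurable_powRf _ _ (measurableTypeR R) (- c)).
have h0 a : (0 <= h a)%R by rewrite /h; case: ifP => // _; exact: powR_ge0.
exists (\prod_(i < N) (4 * (1 `^ (1 - c)) / (1 - c)))%R.
  by apply: prodr_gt0 => i _; rewrite powR1 mulr1 divr_gt0// subr_gt0; case/andP: c01.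
apply: le_trans (le_integral_prod_tnth (R := R) (n := N) (f := fun=> h) (fun=> mh) (fun=> h0) _); last first.
  by move=> i; exact: integral_normr_powRN_le.
apply: ae_ge0_le_integral => //.
- by move=> y _; rewrite lee_fin mulr_ge0 ?powR_ge0.
- apply: measurable_EFinf; apply: measurable_funM; last exact: measurable_powR_enorm.
  exact: (measurable_indic measurable_nearS).
- by move=> y _; rewrite lee_fin prodr_ge0.
- exact: measurable_EFinf (measurable_prod_tnth (fun=> mh)).
- apply: ae_mono (ae_tnth_neq0 (R := R) N) => y yn0 _; rewrite lee_fin indicE.
  have [yS|yS] := boolP (y \in nearS); last by rewrite mul0r prodr_ge0.
  rewrite mul1r (le_trans (enorm_powRN_le_prod N0 b0 yn0))//.
  rewrite le_eqVlt; apply/orP; left; apply/eqP; apply: eq_bigr => i _; rewrite /h.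
  by rewrite (le_lt_trans (ler_norm_tnth y i))//; move: yS; rewrite inE.
Qed.

Lemma integral_far_le b : (N%:R < b)%R -> exists2 K : R, (0 < K)%R &
  \int[mu]_y ((1 + enorm y) `^ (- b))%:E <= K%:E.
Proof.
move=> bN; have b0 : (0 < b)%R by rewrite (lt_trans N0').
set c := (b / N%:R)%R; have c1 : (1 < c)%R by rewrite ltr_pdivlMr// mul1r.
pose h (a : R) : R := ((1 + `|a|) `^ (- c))%R.
have mh : measurable_fun [set: R] h.
  by apply: (@measurable_powRf _ _ (measurableTypeR R) (- c)); exact: measurable_funD.
have h0 a : (0 <= h a)%R by exact: powR_ge0.
exists (\prod_(i < N) (2 * (c - 1)^-1))%R.
  by apply: prodr_gt0 => i _; rewrite mulr_gt0// invr_gt0 subr_gt0.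
apply: le_trans (le_integral_prod_tnth (R := R) (n := N) (f := fun=> h) (fun=> mh) (fun=> h0) _); last first.
  by move=> i; exact: integral_1D_normr_powRN_le.
apply: ge0_le_integral => //.
- by move=> y _; rewrite lee_fin powR_ge0.
- apply: measurable_EFinf; apply: measurable_powRf; apply: measurable_funD => //.
  exact: measurable_enorm.
- exact: measurable_EFinf (measurable_prod_tnth (fun=> mh)).
- move=> y _; rewrite lee_fin (powR_prod N0) ?addr_ge0 ?enorm_ge0//; apply: ler_prod => i _.
  rewrite powR_ge0/= mulNr powRN_le ?(le_trans ler01 (ltW c1)) ?ltr_pwDl//.
  by rewrite lerD2l ler_norm_tnth.
Qed.

(** Outside the unit ball |y| >= (1 + |y|) / 2, which replaces the weight by one without
    singularity. *)
Lemma integral_far_restrict_le b : (N%:R < b)%R -> exists2 K : R, (0 < K)%R &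
  \int[mu]_y (\1_(~` nearS) y * enorm y `^ (- b))%:E <= K%:E.
Proof.
move=> bN; have [K2 K20 HK2] := integral_far_le bN.
have b0 : (0 <= b)%R by rewrite ltW// (lt_trans N0').
exists (2 `^ b * K2)%R; first by rewrite mulr_gt0 ?powR_gt0.
have mfar : measurable (~` nearS) by apply: measurableC; exact: measurable_nearS.
rewrite EFinM; apply: (@le_trans _ _ ((2 `^ b)%:E * \int[mu]_y ((1 + enorm y) `^ (- b))%:E)).
  have mw : measurable_fun setT (fun y : X => ((1 + enorm y) `^ (- b))%:E).
    apply: measurable_EFinf; apply: measurable_powRf; apply: measurable_funD => //.
    exact: measurable_enorm.
  have w0 (y : X) : setT y -> 0 <= ((1 + enorm y) `^ (- b))%:E.
    by rewrite lee_fin powR_ge0.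
  have c0 : 0 <= (2 `^ b)%:E by rewrite lee_fin powR_ge0.
  rewrite -[leRHS](ge0_integralZl mu measurableT mw w0 c0).
  apply: ge0_le_integral => //.
  - by move=> y _; rewrite lee_fin mulr_ge0 ?powR_ge0.
  - apply: measurable_EFinf; apply: measurable_funM; last exact: measurable_powR_enorm.
    exact: (measurable_indic mfar).
  - exact: measurable_funeM.
  - move=> y _; rewrite -EFinM lee_fin indicE.
    have [yS|yS] := boolP (y \in ~` nearS); last by rewrite mul0r mulr_ge0 ?powR_ge0.
    have y1 : (1 <= enorm y)%R by move: yS; rewrite inE/= => /negP; rewrite -leNgt.
    have y1' : (0 < 1 + enorm y)%R by rewrite ltr_pwDl// enorm_ge0.
    have -> : (2 `^ b * (1 + enorm y) `^ (- b) =
        ((1 + enorm y) / 2) `^ (- b))%R.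
      rewrite powRM ?(ltW y1')// [RHS]mulrC -[(2^-1)%R]powR_inv1// -powRrM mulrNN mul1r//.
    by rewrite mul1r powRN_le//; [rewrite divr_gt0|rewrite ler_pdivrMr// mulr_natr mulr2n lerD2r].
  by apply: lee_wpmul2l; rewrite ?lee_fin ?powR_ge0.
Qed.

(** Hölder on a set where |y|^(-b) is integrable: integrability is lowered from 1 / rho1 to 1 / rho
    at the price of b (rho - rho1) in the weight. Near the origin any b < N is allowed, at infinity
    any b > N. *)
Lemma bnd_restrict S b K rho1 rho s1 : measurable S -> (0 < rho1 < rho)%R -> (0 < K)%R ->
  \int[mu]_y (\1_S y * enorm y `^ (- b))%:E <= K%:E ->
  exists2 C : R, (0 < C)%R & forall f A, (0 <= A)%R ->
    measurable_fun setT f -> (forall y, 0 <= f y) -> bnd rho1 s1 f A ->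
    bnd rho (s1 - b * (rho - rho1)) (fun y => (\1_S y)%:E * f y) (C * A).
Proof.
move=> mS /andP[r10 r1r] K0 hK; have r0 := lt_trans r10 r1r.
pose p := (rho / rho1)%R; have p0 : (0 < p)%R by rewrite divr_gt0.
have p1 : (1 <= p)%R by rewrite ler_pdivlMr// mul1r ltW.
pose D := (2 `^ p * K `^ (p - 1))%R; have D0 : (0 < D)%R by rewrite mulr_gt0 ?powR_gt0.
exists (D `^ rho1)%R; first by rewrite powR_gt0.
move=> f A A0 mf f0; rewrite /bnd !gt_eqF// => fA; set s := (s1 - b * (rho - rho1))%R.
have m1S : measurable_fun setT (\1_S : X -> R) by exact: (measurable_indic mS).
have mk : measurable_fun setT (fun y : X => (\1_S y * enorm y `^ (- b))%:E).
  by apply: measurable_EFinf; apply: measurable_funM => //; exact: measurable_powR_enorm.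
have k0 y : 0 <= (\1_S y * enorm y `^ (- b))%:E by rewrite lee_fin mulr_ge0 ?powR_ge0.
(* The target integrand divided by the density |y|^(-b); its power p = rho / rho1 times the density
   is again |y|^(s1/rho1) f^(1/rho1). *)
pose F y := (enorm y `^ (s / rho + b))%:E * f y `^ rho^-1.
have mF : measurable_fun setT F.
  apply: emeasurable_funM; last exact: measurable_poweRf.
  exact: measurable_EFinf (measurable_powR_enorm _).
have F0 y : 0 <= F y by rewrite mule_ge0 ?lee_fin ?powR_ge0 ?poweR_ge0.
have mg : measurable_fun setT (fun y => (\1_S y)%:E * f y).
  by apply: emeasurable_funM => //; exact: measurable_EFinf.
have g0 y : 0 <= (\1_S y)%:E * f y by rewrite mule_ge0 ?lee_fin.
have E1 : \int[mu]_y (wmul s (fun y => (\1_S y)%:E * f y) y `^ rho^-1) =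
    \int[mu]_y (F y * (\1_S y * enorm y `^ (- b))%:E).
  apply: ge0_ae_eq_integral => //.
  - by apply: measurable_poweRf; exact: measurable_wmul.
  - exact: emeasurable_funM.
  - by move=> y _; exact: poweR_ge0.
  - by move=> y _; rewrite mule_ge0.
  - apply: ae_mono (ae_enorm_gt0 N0) => y y0 _; rewrite /wmul /F !poweRM ?lee_fin ?powR_ge0//.
    rewrite !poweR_EFin -powRrM EFinM powRD ?(gt_eqF y0) ?implybT//.
    have -> : ((\1_S y) `^ rho^-1 = \1_S y :> R)%R.
      by rewrite indicE; case: (y \in S); rewrite ?powR1// powR0// invr_eq0 gt_eqF.
    rewrite muleA -!EFinM [RHS]muleAC -EFinM; congr (_%:E * _).
    have hb : (enorm y `^ b * enorm y `^ (- b) = 1)%R.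
      by rewrite -powRD ?(gt_eqF y0) ?implybT// subrr powRr0.
    by rewrite -mulrA [(_ * (\1_S y * _))%R]mulrCA hb mulr1.
rewrite E1; have J := jensen_le mF mk F0 k0 p1 K0 hK.
have E2 : \int[mu]_y (F y `^ p * (\1_S y * enorm y `^ (- b))%:E) <= (A `^ rho1^-1)%:E.
  apply: le_trans fA; apply: ae_ge0_le_integral => //.
  - by move=> y _; rewrite mule_ge0 ?poweR_ge0.
  - by apply: emeasurable_funM => //; exact: measurable_poweRf.
  - by move=> y _; exact: poweR_ge0.
  - by apply: measurable_poweRf; exact: measurable_wmul.
  - apply: ae_mono (ae_enorm_gt0 N0) => y y0 _; rewrite /F /wmul !poweRM ?lee_fin ?powR_ge0 ?poweR_ge0//.
    rewrite !poweR_EFin -!powRrM -poweRrM.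
    have -> : (rho^-1 * p = rho1^-1)%R by rewrite /p; field; rewrite !gt_eqF.
    rewrite muleAC -EFinM; apply: lee_wpmul2r; first exact: poweR_ge0.
    rewrite lee_fin mulrCA -powRD ?(gt_eqF y0) ?implybT//.
    have -> : ((s / rho + b) * p - b = s1 * rho1^-1)%R.
      by rewrite /s /p; field; rewrite !gt_eqF.
    by rewrite ler_piMl ?powR_ge0// indicE; case: (y \in S).
set I := \int[mu]_y _ in J *.
apply: (@poweR_le_inv _ I _ p) => //.
- by apply: integral_ge0 => y _; rewrite mule_ge0.
- exact: powR_ge0.
apply: (le_trans J); apply: (le_trans (lee_wpmul2l _ E2)); first by rewrite lee_fin ltW.
rewrite -EFinM lee_fin powRM ?powR_ge0// -!powRrM.
have -> : (rho1 * rho^-1)%R = p^-1%R by rewrite /p invf_div.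
rewrite powRM ?powR_ge0// -!powRrM mulVf ?gt_eqF// powRr1 ?(ltW D0)//.
rewrite (_ : rho^-1 * p = rho1^-1)%R//.
by rewrite /p; field; rewrite !gt_eqF.
Qed.

Lemma bnd_mono rho w f A B : (0 <= rho)%R -> (0 <= A <= B)%R ->
  measurable_fun setT f -> (forall x, 0 <= f x) -> bnd rho w f A -> bnd rho w f B.
Proof. by move=> r0 AB mf f0; apply: bnd_le. Qed.

(* From [L^{1/rho1}_{s1}] to [L^{1/rho}_w] with [rho1 < rho]: the part of [f] near
   the origin and the part at infinity are placed in two nearby weighted spaces of
   exponent [1/rho]. *)
Lemma heat_bnd_local rho1 s1 rho w (T e : R) :
  (rho1 = rho \/ (0 < rho1 < rho)%R) -> (0 <= rho < 1)%R -> (0 <= w <= s1)%R ->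
  (w + N%:R * rho < s1 + N%:R * rho1 < N%:R)%R -> (0 < T)%R -> (0 < e)%R ->
  exists a C : R, [/\ (0 <= a < N%:R / 2 * (rho1 - rho) + (s1 - w) / 2 + e)%R, (0 < C)%R &
    forall t f A, (0 < t <= T)%R -> (0 <= A)%R ->
    measurable_fun setT f -> (forall y, 0 <= f y) -> bnd rho1 s1 f A ->
    bnd rho w (conv (hker t) f) (C * t `^ (- a) * A)].
Proof.
move=> rr /andP[r0 r1] /andP[w0 ws] /andP[wN sN] T0 e0.
case: rr => [rE|rr].
  have h1 : (0 <= rho <= rho1)%R by rewrite rE lexx r0.
  have [C C0 HC] := heat_bnd N0 h1 (introT andP (conj w0 ws)) sN.
  exists ((s1 - w) / 2)%R, C; split => //.
    by rewrite divr_ge0 ?subr_ge0//= rE subrr mulr0 add0r ltrDl.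
  move=> t f A /andP[t0 _] A0 mf f0 fA.
  have := HC t f A t0 A0 mf f0 fA.
  by rewrite rE subrr mulr0 add0r.
have [r10 r1r] := andP rr; have d0 : (0 < rho - rho1)%R by rewrite subr_gt0.
(* Three kinds of room: the permitted loss [e], the distance of the near weight to the integrability
   limit N, and the distance of the far weight to [w]. *)
pose e1 := Num.min e (Num.min ((N%:R - (s1 + N%:R * rho1)) / 2)
   (s1 + N%:R * rho1 - (w + N%:R * rho)))%R.
have e10 : (0 < e1)%R by rewrite /e1 !lt_min e0 divr_gt0 ?subr_gt0//= wN.
have e1e : (e1 <= e)%R by rewrite /e1 ge_min lexx.
have e1N : (e1 <= (N%:R - (s1 + N%:R * rho1)) / 2)%R by rewrite /e1 !ge_min lexx orbT.
have e1w : (e1 <= s1 + N%:R * rho1 - (w + N%:R * rho))%R by rewrite /e1 !ge_min lexx !orbT.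
(* The exponents N - dl and N + dl lie on the two sides of the critical N. They shift the weight by
   dl (rho - rho1) <= e1 up or down from the scale-invariant value. *)
pose dl := (Num.min (N%:R / 2) (e1 / (rho - rho1)))%R.
have dl0 : (0 < dl)%R by rewrite lt_min !divr_gt0.
have dlN : (dl <= N%:R / 2)%R by rewrite ge_min lexx.
have dle : (dl * (rho - rho1) <= e1)%R by rewrite -ler_pdivlMr// ge_min lexx orbT.
have dd0 : (0 < dl * (rho - rho1))%R by rewrite mulr_gt0.
have hb1 : (0 <= N%:R - dl < N%:R)%R by apply/andP; split; lra.
have hb2 : (N%:R < N%:R + dl)%R by lra.
have [K1 K10 HK1] := integral_near_le hb1.
have mfar : measurable (~` nearS) by apply: measurableC; exact: measurable_nearS.
have [K2 K20 HK2] := integral_far_restrict_le hb2.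
have [C1 C10 HC1] := bnd_restrict s1 measurable_nearS rr K10 HK1.
have [C2 C20 HC2] := bnd_restrict s1 mfar rr K20 HK2.
set w1 := (s1 - (N%:R - dl) * (rho - rho1))%R in HC1.
set w2 := (s1 - (N%:R + dl) * (rho - rho1))%R in HC2.
have w1E : (w1 + N%:R * rho = s1 + N%:R * rho1 + dl * (rho - rho1))%R by rewrite /w1; ring.
have w2E : (w2 + N%:R * rho = s1 + N%:R * rho1 - dl * (rho - rho1))%R by rewrite /w2; ring.
have w1w : (0 <= w <= w1)%R by rewrite w0/=; clear -w1E dd0 wN; lra.
have w2w : (0 <= w <= w2)%R by rewrite w0/=; clear -w2E dle e1w; lra.
have w1N : (w1 + N%:R * rho < N%:R)%R by clear -w1E dle e1N sN; lra.
have w2N : (w2 + N%:R * rho < N%:R)%R by clear -w2E dd0 sN; lra.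
have rr0 : (0 <= rho <= rho)%R by rewrite r0 lexx.
have [D1 D10 HD1] := heat_bnd N0 rr0 w1w w1N.
have [D2 D20 HD2] := heat_bnd N0 rr0 w2w w2N.
(* The near part has the stronger singularity in time, [a2 <= a1]; for t <= T the far part is
   brought to the same power at the cost of T^(a1 - a2). *)
pose a1 := ((w1 - w) / 2)%R; pose a2 := ((w2 - w) / 2)%R.
have a20 : (0 <= a2)%R by rewrite divr_ge0// subr_ge0; case/andP: w2w.
have a21 : (a2 <= a1)%R by clear -a1 a2 w1E w2E dd0; rewrite /a1 /a2; lra.
exists a1, (4 * (D1 * C1 + D2 * C2 * T `^ (a1 - a2)))%R; split.
- rewrite (le_trans a20 a21)/= /a1.
  have : (dl * (rho - rho1) / 2 < e)%R by clear -dle dd0 e1e; lra.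
  by clear -w1; rewrite /w1; lra.
- by rewrite mulr_gt0// addr_gt0// !mulr_gt0// powR_gt0.
move=> t f A /andP[t0 tT] A0 mf f0 fA.
have m1 S : measurable S -> measurable_fun setT (fun y => (\1_S y)%:E * f y).
  by move=> mS; apply: emeasurable_funM => //; apply: measurable_EFinf; exact: (measurable_indic mS).
have g0 S y : 0 <= (\1_S y)%:E * f y by rewrite mule_ge0 ?lee_fin.
have mn := m1 _ measurable_nearS; have mf' := m1 _ mfar.
have h0 := @hker_ge0 R N t; have mh := @measurable_hker R N t.
have H1 := HD1 t _ (C1 * A)%R t0 (mulr_ge0 (ltW C10) A0) mn (g0 _) (HC1 f A A0 mf f0 fA).
have H2 := HD2 t _ (C2 * A)%R t0 (mulr_ge0 (ltW C20) A0) mf' (g0 _) (HC2 f A A0 mf f0 fA).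
rewrite subrr mulr0 add0r -/a1 in H1; rewrite subrr mulr0 add0r -/a2 in H2.
have r01 : (0 <= rho <= 1)%R by rewrite r0 ltW.
have q10 : (0 <= D1 * t `^ (- a1) * (C1 * A))%R by rewrite !mulr_ge0 ?powR_ge0 ?(ltW D10) ?(ltW C10).
have q20 : (0 <= D2 * t `^ (- a2) * (C2 * A))%R by rewrite !mulr_ge0 ?powR_ge0 ?(ltW D20) ?(ltW C20).
have := bndD r01 q10 q20 (measurable_conv mh mn h0 (g0 _)) (measurable_conv mh mf' h0 (g0 _))
  (fun x => conv_ge0 x h0 (g0 _)) (fun x => conv_ge0 x h0 (g0 _)) H1 H2.
rewrite (_ : (fun x => _) = conv (hker t) f); last first.
  apply/funext => x; rewrite -convD//; apply: eq_conv => y.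
  rewrite -ge0_muleDl ?lee_fin// -EFinD !indicE in_setC.
  by case: (y \in nearS); rewrite ?addr0 ?add0r mul1e.
apply: bnd_mono => //; last 2 first.
- exact: measurable_conv.
- by move=> x; exact: conv_ge0.
rewrite mulr_ge0 ?addr_ge0//= -!mulrA ler_pM2l// mulrDl; apply: lerD.
  by rewrite le_eqVlt; apply/orP; left; apply/eqP; ring.
have -> : (D2 * (t `^ (- a2) * (C2 * A)) = D2 * C2 * A * t `^ (- a2))%R by ring.
have -> : (D2 * (C2 * T `^ (a1 - a2)) * (t `^ (- a1) * A) = D2 * C2 * A * (T `^ (a1 - a2) * t `^ (- a1)))%R by ring.
rewrite ler_wpM2l ?mulr_ge0 ?(ltW D20) ?(ltW C20)//.
have -> : (t `^ (- a2) = t `^ (a1 - a2) * t `^ (- a1))%R.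
  by rewrite -powRD ?(gt_eqF t0) ?implybT//; congr (_ `^ _)%R; ring.
rewrite ler_wpM2r ?powR_ge0//.
by rewrite ge0_ler_powR ?nnegrE ?subr_ge0 ?(ltW t0) ?(ltW T0).
Qed.

End Splitting.

Opaque bnd.

(** * Differences of heat kernels and Hölder estimates in time *)

Section KernelDifference.
Context {R : realType} {N : nat}.
Hypothesis N0 : (0 < N)%N.
Local Notation leb := (@lebesgue_measure R).
Local Notation X := (Rspace R N).
Implicit Types (x y z : X) (s t w A B C rho : R).

Lemma powR_divM (h r e a : R) : 0 <= h -> 0 < r ->
  (h / r) `^ e * r `^ (- a) = h `^ e * r `^ (- (a + e)).
Proof.
move=> h0 r0; rewrite (@powRM _ h r^-1 e) ?invr_ge0 ?(ltW r0)//.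
rewrite -[r^-1]powR_inv1 ?(ltW r0)// -powRrM mulN1r -mulrA -powRD ?(gt_eqF r0) ?implybT//.
by rewrite opprD [- a + _]addrC.
Qed.

Lemma bernoulli_le (x : R) n : 0 <= x <= 1 -> 1 - x ^+ n <= n%:R * (1 - x).
Proof.
move=> /andP[x0 x1]; elim: n => [|n IH]; first by rewrite expr0 subrr mul0r.
rewrite exprS (_ : 1 - x * x ^+ n = (1 - x) + x * (1 - x ^+ n)); last by ring.
rewrite -addn1 natrD mulrDl mul1r addrC lerD2r; apply: le_trans IH.
by rewrite ler_piMl// subr_ge0 exprn_ile1.
Qed.

(** With u = (t - s) / s the difference is at most L times min(1, u) times the two Gaussians, and
    min(1, u) <= u^eta. Being a bound by Gaussians, it carries every heat estimate over to kernel
    differences. *)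
Lemma hker_diff_le : exists2 L : R, 0 < L & forall s t z (eta : R),
  0 < s < t -> 0 <= eta <= 1 ->
  `|hker t z - hker s z| <= L * ((t - s) / s) `^ eta * (hker s z + hker (2 * t) z).
Proof.
pose L := N%:R + 2 * 2 `^ (N%:R / 2) : R.
have p2 : 1 <= 2 `^ (N%:R / 2) :> R.
  by rewrite -[leLHS](powRr0 2) ler_powR ?ler1n// divr_ge0.
have L1 : 1 <= L by rewrite /L; have : 0 <= N%:R :> R by []; lra.
have L0 : 0 < L by rewrite (lt_le_trans ltr01).
exists L => // s t z eta /andP[s0 st] /andP[e0 e1].
have t0 := lt_trans s0 st; have t20 : 0 < 2 * t by rewrite mulr_gt0.
set u := (t - s) / s; have u0 : 0 < u by rewrite divr_gt0// subr_gt0.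
set S := hker s z + hker (2 * t) z; have S0 : 0 <= S by rewrite addr_ge0 ?hker_ge0.
suff [h1 h2] : `|hker t z - hker s z| <= L * S /\ `|hker t z - hker s z| <= L * u * S.
  have [u1|u1] := leP 1 u.
    apply: (le_trans h1); rewrite -mulrA ler_wpM2l ?(ltW L0)// ler_peMl//.
    by rewrite -[leLHS](powRr0 u) ler_powR.
  apply: (le_trans h2); rewrite ler_wpM2r// ler_wpM2l ?(ltW L0)//.
  by rewrite ger1_powR// u0 ltW.
have ht := hker_le_double z t0; split.
  apply: (le_trans (ler_normB _ _)); rewrite !ger0_norm ?hker_ge0// /S mulrDr addrC.
  apply: lerD; first by rewrite ler_peMl ?hker_ge0.
  apply: (le_trans ht); rewrite ler_wpM2r ?hker_ge0// /L.
  have : 0 <= N%:R :> R by []. lra.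
have pi4 : 0 < 4 * pi :> R by rewrite mulr_gt0// pi_gt0.
set E := enorm z ^+ 2 / 4; have E0 : 0 <= E by rewrite divr_ge0// sqr_ge0.
pose P r : R := (4 * pi * r) `^ (- (N%:R / 2)).
have hE r : 0 < r -> hker r z = P r * expR (- (E / r)).
  by move=> r0; rewrite hkerE// /heat_kernel /E invfM mulrA.
have P0 r : 0 <= P r by exact: powR_ge0.
have h4t : 0 <= 4 * pi * t by rewrite mulr_ge0 ?(ltW pi4) ?(ltW t0).
have x01 : 0 <= s / t <= 1.
  by rewrite divr_ge0 ?(ltW s0) ?(ltW t0)//= ler_pdivrMr// mul1r ltW.
have tsu : 1 - s / t <= u.
  rewrite (_ : 1 - s / t = (t - s) / t); last by field; rewrite gt_eqF.
  by rewrite ler_pM2l ?subr_gt0// lef_pV2 ?posrE// ltW.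
(* The prefactors differ by 1 - (s/t)^(N/2) <= 1 - (s/t)^N, which Bernoulli bounds by N (1 - s/t) <=
   N u. *)
have PE : P t = P s * (s / t) `^ (N%:R / 2).
  rewrite /P (_ : 4 * pi * s = 4 * pi * t * (s / t)); last by field; rewrite gt_eqF.
  have hst : 0 <= s / t by case/andP: x01.
  rewrite [X in _ = X * _]powRM//.
  rewrite -[RHS]mulrA -powRD; last by rewrite (gt_eqF (divr_gt0 s0 t0)) implybT.
  by rewrite addNr powRr0 mulr1.
have P1 : `|P t - P s| <= N%:R * u * P s.
  rewrite PE -[X in _ - X]mulr1 -mulrBr normrM ger0_norm// mulrC ler_wpM2r//.
  have xle : (s / t) `^ (N%:R / 2) <= 1.
    have /andP[q0 q1] := x01; apply: (@le_trans _ _ (1 `^ (N%:R / 2))); last by rewrite powR1.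
    by rewrite ge0_ler_powR ?nnegrE// divr_ge0.
  rewrite distrC ger0_norm ?subr_ge0//.
  apply: (@le_trans _ _ (1 - (s / t) ^+ N)).
    rewrite lerD2l lerN2 -powR_mulrn; last by case/andP: x01.
    rewrite ger_powR//; first by rewrite divr_gt0//=; case/andP: x01.
    by rewrite ler_pdivrMr// ler_peMr// ler1n.
  apply: (le_trans (bernoulli_le N x01)); rewrite ler_wpM2l//.
have P2 : P t * `|expR (- (E / t)) - expR (- (E / s))| <= 2 * 2 `^ (N%:R / 2) * u * hker (2 * t) z.
  have Ets : E / t <= E / s by rewrite ler_wpM2l// lef_pV2 ?posrE// ltW.
  rewrite ger0_norm ?subr_ge0 ?ler_expR ?lerN2//.
  have -> : 2 * 2 `^ (N%:R / 2) * u * hker (2 * t) z = P t * (u * (2 * expR (- (E / (2 * t))))).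
    rewrite hE// /P (_ : 4 * pi * (2 * t) = 2 * (4 * pi * t)); last by ring.
    rewrite (@powRM _ 2)//.
    rewrite (_ : 2 * 2 `^ (N%:R / 2) * u *
      (2 `^ (- (N%:R / 2)) * (4 * pi * t) `^ (- (N%:R / 2)) * expR (- (E / (2 * t)))) =
      (2 `^ (N%:R / 2) * 2 `^ (- (N%:R / 2))) * ((4 * pi * t) `^ (- (N%:R / 2)) * (u * (2 * expR (- (E / (2 * t))))))); last by ring.
    by rewrite -powRD ?pnatr_eq0 ?implybT// subrr powRr0 mul1r.
  rewrite ler_wpM2l//.
  have -> : expR (- (E / t)) - expR (- (E / s)) =
      expR (- (E / t)) * (1 - expR (- (E / s - E / t))).
    by rewrite mulrBr mulr1 -expRD; congr (_ - expR _); ring.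
  have h1 : 1 - expR (- (E / s - E / t)) <= u * (E / t).
    have := expR_ge1Dx (- (E / s - E / t)).
    rewrite (_ : u * (E / t) = E / s - E / t); last by rewrite /u; field; rewrite !gt_eqF.
    lra.
  apply: (le_trans (ler_wpM2l (expR_ge0 _) h1)).
  rewrite mulrCA ler_wpM2l ?(ltW u0)//.
  (* The factor E / t produced by 1 - e^(-x) <= x is absorbed by half of the Gaussian through v
     e^(-v) <= 1; the other half is the Gaussian at time 2 t. *)
  set v := E / (2 * t); have v0 : 0 <= v by rewrite divr_ge0 ?(ltW t20).
  have -> : E / t = 2 * v by rewrite /v; field; rewrite gt_eqF.
  have hv : expR (- v) * v <= 1.
    rewrite expRN mulrC ler_pdivrMr ?expR_gt0// mul1r.
    by apply: le_trans (expR_ge1Dx v); rewrite lerDr.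
  rewrite (_ : - (2 * v) = - v + - v); last by ring.
  rewrite expRD (_ : _ * (2 * v) = 2 * expR (- v) * (expR (- v) * v)); last by ring.
  by rewrite ler_piMr// mulr_ge0 ?expR_ge0.
rewrite !(hE t) // (hE s)//.
rewrite (_ : P t * expR (- (E / t)) - P s * expR (- (E / s)) =
  (P t - P s) * expR (- (E / s)) + P t * (expR (- (E / t)) - expR (- (E / s)))); last by ring.
apply: (le_trans (ler_normD _ _)); rewrite normrM [`|P t * _|]normrM [`|P t|]ger0_norm//.
rewrite [`|expR _|]ger0_norm ?expR_ge0//.
apply: (le_trans (lerD (ler_wpM2r (expR_ge0 _) P1) P2)).
rewrite -[X in X + _ <= _]mulrA -(hE s s0) /S mulrDr; apply: lerD.
  rewrite ler_wpM2r ?hker_ge0// ler_wpM2r ?(ltW u0)// /L lerDl.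
  by rewrite mulr_ge0 ?powR_ge0.
rewrite ler_wpM2r ?hker_ge0// ler_wpM2r ?(ltW u0)// /L lerDr.
by [].
Qed.

Local Open Scope ereal_scope.
Implicit Types (f : X -> \bar R).

Definition hdiff t s : X -> R := fun z => `|hker t z - hker s z|%R.

Lemma hdiff_ge0 t s z : (0 <= hdiff t s z)%R.
Proof. exact: normr_ge0. Qed.

Lemma measurable_hdiff t s : measurable_fun setT (hdiff t s).
Proof.
by apply: measurableT_comp => //; apply: measurable_funB; exact: measurable_hker.
Qed.

Lemma conv_hdiff_bnd : exists2 L : R, (0 < L)%R &
  forall rho w s t (eta : R) f A B,
  (0 <= rho <= 1)%R -> (0 < s < t)%R -> (0 <= eta <= 1)%R -> (0 <= A)%R -> (0 <= B)%R ->
  measurable_fun setT f -> (forall y, 0 <= f y) ->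
  bnd rho w (conv (hker s) f) A -> bnd rho w (conv (hker (2 * t)) f) B ->
  bnd rho w (conv (hdiff t s) f) (L * ((t - s) / s) `^ eta * (4 * (A + B))).
Proof.
have [L L0 HL] := hker_diff_le; exists L => // rho w s t eta f A B.
move=> r01 st eta01 A0 B0 mf f0 H1 H2.
have [r0 r1] := andP r01.
have hs0 := @hker_ge0 R N s; have ms := @measurable_hker R N s.
have ht0 := @hker_ge0 R N (2 * t); have mt := @measurable_hker R N (2 * t).
set U := (((t - s) / s) `^ eta)%R; have U0 : (0 <= U)%R by exact: powR_ge0.
have m1 := measurable_conv ms mf hs0 f0; have m2 := measurable_conv mt mf ht0 f0.
have H := bndD r01 A0 B0 m1 m2 (fun x => conv_ge0 x hs0 f0) (fun x => conv_ge0 x ht0 f0) H1 H2.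
have LU0 : (0 <= L * U)%R by rewrite mulr_ge0 ?(ltW L0).
have m12 : measurable_fun setT (fun x => conv (hker s) f x + conv (hker (2 * t)) f x).
  exact: (emeasurable_funD m1 m2).
have p12 x : 0 <= conv (hker s) f x + conv (hker (2 * t)) f x.
  by rewrite adde_ge0// conv_ge0.
have q3 : (0 <= 4 * (A + B))%R by rewrite mulr_ge0// addr_ge0.
apply: (bnd_le r0 _ (measurable_conv (measurable_hdiff t s) mf (@hdiff_ge0 t s) f0)
  (measurable_funeM _ m12) (fun x => conv_ge0 x (@hdiff_ge0 t s) f0) _
  (bndZ r0 LU0 q3 m12 p12 H)); first by rewrite mulr_ge0 ?lexx.
move=> x; rewrite -convDl// -convZl//.
- apply: le_conv => //.
  + exact: measurable_hdiff.
  + by apply: measurable_funM => //; exact: measurable_funD.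
  + exact: hdiff_ge0.
  + by move=> z; exact: HL.
- exact: measurable_funD.
- by move=> z; rewrite addr_ge0.
Qed.

Lemma heat_bnd_diff rho1 s1 rho w (T e : R) :
  (rho1 = rho \/ (0 < rho1 < rho)%R) -> (0 <= rho < 1)%R -> (0 <= w <= s1)%R ->
  (w + N%:R * rho < s1 + N%:R * rho1 < N%:R)%R -> (0 < T)%R -> (0 < e)%R ->
  exists a C : R, [/\ (0 <= a < N%:R / 2 * (rho1 - rho) + (s1 - w) / 2 + e)%R, (0 < C)%R,
    forall t f A, (0 < t <= T)%R -> (0 <= A)%R ->
    measurable_fun setT f -> (forall y, 0 <= f y) -> bnd rho1 s1 f A ->
    bnd rho w (conv (hker t) f) (C * t `^ (- a) * A) &
    forall s t (eta : R) f A, (0 < s < t)%R -> (t <= T)%R -> (0 <= eta <= 1)%R ->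
    (0 <= A)%R -> measurable_fun setT f -> (forall y, 0 <= f y) -> bnd rho1 s1 f A ->
    bnd rho w (conv (hdiff t s) f) (C * ((t - s) / s) `^ eta * s `^ (- a) * A)].
Proof.
move=> h1 h2 h3 h4 T0 e0; have T20 : (0 < 2 * T)%R by rewrite mulr_gt0.
(* On (0, 2 T], because the bound on the kernel difference involves the time 2 t. *)
have [a [C [a0e C0 HC]]] := heat_bnd_local N0 h1 h2 h3 h4 T20 e0.
have [L L0 HL] := conv_hdiff_bnd.
have C80 : (0 < C + 8 * L * C)%R by rewrite addr_gt0 ?mulr_gt0.
have [r0 r1] := andP h2; have [a0 _] := andP a0e.
exists a, (C + 8 * L * C)%R; split => //.
  move=> t f A /andP[t0 tT] A0 mf f0 fA.
  have tT2 : (0 < t <= 2 * T)%R by rewrite t0/= (le_trans tT)// ler_peMl ?ler1n// ltW.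
  have := HC t f A tT2 A0 mf f0 fA; apply: bnd_mono => //.
  - rewrite !mulr_ge0 ?powR_ge0 ?(ltW C0)//= -!mulrA ler_wpM2r ?mulr_ge0 ?powR_ge0//.
    by rewrite lerDl !mulr_ge0 ?(ltW L0) ?(ltW C0).
  - by apply: measurable_conv => //; [exact: measurable_hker|exact: hker_ge0].
  - by move=> x; apply: conv_ge0 => //; exact: hker_ge0.
move=> s t eta f A st tT eta01 A0 mf f0 fA; have [s0 st'] := andP st.
have t0 := lt_trans s0 st'; have t20 : (0 < 2 * t)%R by rewrite mulr_gt0.
have sT2 : (0 < s <= 2 * T)%R.
  by rewrite s0/= (le_trans (ltW st'))// (le_trans tT)// ler_peMl ?ler1n// ltW.
have tT2 : (0 < 2 * t <= 2 * T)%R by rewrite t20/= ler_pM2l.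
have H1 := HC s f A sT2 A0 mf f0 fA; have H2 := HC (2 * t)%R f A tT2 A0 mf f0 fA.
have q1 : (0 <= C * s `^ (- a) * A)%R by rewrite !mulr_ge0 ?powR_ge0 ?(ltW C0).
have q2 : (0 <= C * (2 * t) `^ (- a) * A)%R by rewrite !mulr_ge0 ?powR_ge0 ?(ltW C0).
have r01 : (0 <= rho <= 1)%R by rewrite r0 ltW.
have := HL _ _ _ _ _ _ _ _ r01 st eta01 q1 q2 mf f0 H1 H2.
have mh := measurable_conv (measurable_hdiff t s) mf (@hdiff_ge0 t s) f0.
have h0 x := conv_ge0 x (@hdiff_ge0 t s) f0.
set U := (((t - s) / s) `^ eta)%R; have U0 : (0 <= U)%R by exact: powR_ge0.
have LU0 : (0 <= L * U)%R by rewrite mulr_ge0 ?(ltW L0).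
apply: bnd_mono => //; apply/andP; split.
  by apply: mulr_ge0 => //; apply: mulr_ge0 => //; exact: addr_ge0.
have tas : ((2 * t) `^ (- a) <= s `^ (- a))%R.
  by rewrite powRN_le// (le_trans (ltW st'))// ler_peMl ?ler1n// ltW.
have -> : ((C + 8 * L * C) * U * s `^ (- a) * A = C * U * s `^ (- a) * A +
   L * U * (4 * (C * s `^ (- a) * A + C * s `^ (- a) * A)))%R by ring.
apply: (@le_trans _ _ (L * U * (4 * (C * s `^ (- a) * A + C * s `^ (- a) * A)))%R).
  by rewrite ler_wpM2l// ler_wpM2l// lerD2l ler_wpM2r// ler_wpM2l// ltW.
by rewrite lerDr !mulr_ge0 ?powR_ge0 ?(ltW C0).
Qed.

Lemma measurable_conv_time (k : R -> X -> R) (g : R -> X -> \bar R) x :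
  jmeas k -> jmeas g -> (forall s z, 0 <= k s z)%R -> (forall s y, 0 <= g s y) ->
  measurable_fun [set: measurableTypeR R] (fun s => conv (k s) (g s) x).
Proof.
move=> mk mg k0 g0.
exact: (measurableT_comp (jmeas_conv mk mg k0 g0) (measurable_pair2 x)).
Qed.

Lemma duhDl (k k' : R -> X -> R) (g : R -> X -> \bar R) x :
  jmeas k -> jmeas k' -> jmeas g -> (forall s z, 0 <= k s z)%R ->
  (forall s z, 0 <= k' s z)%R -> (forall s y, 0 <= g s y) ->
  duh (fun s z => k s z + k' s z)%R g x = duh k g x + duh k' g x.
Proof.
move=> mk mk' mg k0 k'0 g0; rewrite /duh -ge0_integralD//.
- apply: eq_integral => s _; rewrite convDl//.
  + exact: (measurableT_comp mk (measurable_pair1 s)).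
  + exact: (measurableT_comp mk' (measurable_pair1 s)).
  + exact: jmeas_slice.
- by move=> s _; exact: conv_ge0.
- exact: measurable_conv_time.
- by move=> s _; exact: conv_ge0.
- exact: measurable_conv_time.
Qed.

Lemma jmeas_hdiff t r : jmeas (fun s => hdiff (t - s) (r - s)).
Proof.
apply: measurableT_comp => //; apply: measurable_funB; exact: jmeas_hker.
Qed.

Lemma jmeas_if_lt (k k' : R -> X -> R) r : jmeas k -> jmeas k' ->
  jmeas (fun s z => if (s < r)%R then k s z else k' s z).
Proof.
move=> mk mk'; apply: measurable_fun_ifT => //.
by apply: measurable_fun_ltr => //; exact: measurable_fst.
Qed.

Lemma duh_bnd_hker rho1 s1 rho w (T a b C K : R) (g : R -> X -> \bar R) (M : R) :
  (0 <= rho <= 1)%R -> (0 < C)%R -> (0 < K)%R -> (0 < M)%R ->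
  (forall t f A, (0 < t <= T)%R -> (0 <= A)%R ->
    measurable_fun setT f -> (forall y, 0 <= f y) -> bnd rho1 s1 f A ->
    bnd rho w (conv (hker t) f) (C * t `^ (- a) * A)) ->
  (forall t, (0 < t)%R -> \int[leb]_s (tker a b t s)%:E <= (K * t `^ (1 - a - b))%:E) ->
  jmeas g -> (forall s y, 0 <= g s y) -> (forall s y, (s <= 0)%R -> g s y = 0) ->
  (forall s, (0 < s <= T)%R -> bnd rho1 s1 (g s) (M * s `^ (- b))) ->
  forall t, (0 < t <= T)%R ->
  bnd rho w (duh (fun s => hker (t - s)) g) (2 * (C * M * (K * t `^ (1 - a - b)))).
Proof.
move=> r01 C0 K0 M0 HC HK mg g0 gN gM t /andP[t0 tT].
apply: (@bnd_duh R N rho1 s1 rho w (fun s => hker (t - s)) g C M t a b K) => //.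
- exact: jmeas_hker.
- by move=> s z; exact: hker_ge0.
- move=> s; rewrite negb_and -!leNgt => /orP[s0|st]; [left|right] => z.
    exact: gN.
  by rewrite hker0// subr_le0.
- move=> s A /andP[s0 st] A0; apply: HC => //.
    by rewrite subr_gt0 st/= (le_trans _ tT)// gerBl ltW.
  exact: jmeas_slice.
- by move=> s /andP[s0 st]; apply: gM; rewrite s0/= (le_trans (ltW st)).
- exact: HK.
Qed.

(** A power (t - r)^e is gained by making the time singularity of the kernel worse from a to a + e,
    which is harmless as long as a + e + b <= 1. *)
Lemma duh_bnd_hdiff rho1 s1 rho w (T a b e C K : R) (g : R -> X -> \bar R) (M : R) :
  (0 <= rho <= 1)%R -> (0 < C)%R -> (0 < K)%R -> (0 < M)%R -> (0 <= e <= 1)%R ->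
  (0 <= 1 - (a + e) - b)%R ->
  (forall t f A, (0 < t <= T)%R -> (0 <= A)%R ->
    measurable_fun setT f -> (forall y, 0 <= f y) -> bnd rho1 s1 f A ->
    bnd rho w (conv (hker t) f) (C * t `^ (- a) * A)) ->
  (forall s t (eta : R) f A, (0 < s < t)%R -> (t <= T)%R -> (0 <= eta <= 1)%R ->
    (0 <= A)%R -> measurable_fun setT f -> (forall y, 0 <= f y) -> bnd rho1 s1 f A ->
    bnd rho w (conv (hdiff t s) f) (C * ((t - s) / s) `^ eta * s `^ (- a) * A)) ->
  (forall t, (0 < t)%R ->
    \int[leb]_s (tker (a + e) b t s)%:E <= (K * t `^ (1 - (a + e) - b))%:E) ->
  jmeas g -> (forall s y, 0 <= g s y) -> (forall s y, (s <= 0)%R -> g s y = 0) ->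
  (forall s, (0 < s <= T)%R -> bnd rho1 s1 (g s) (M * s `^ (- b))) ->
  forall r t, (0 < r < t)%R -> (t <= T)%R ->
  bnd rho w (duh (fun s => hdiff (t - s) (r - s)) g)
    (16 * (C * K * T `^ (1 - (a + e) - b)) * M * (t - r) `^ e).
Proof.
move=> r01 C0 K0 M0 e01 k0 HC HD HK mg g0 gN gM r t /andP[r0 rt] tT.
have t0 := lt_trans r0 rt; have [e0 e1] := andP e01; have [rho0 _] := andP r01.
have [h hE] : exists h : R, h = (t - r)%R by exists (t - r)%R.
have h0 : (0 < h)%R by rewrite hE subr_gt0.
rewrite -hE.
have Ch : (0 < C * h `^ e)%R by rewrite mulr_gt0 ?powR_gt0.
pose z0 (s : R) (z : X) : R := 0%R.
have mz0 : jmeas z0 by exact: measurable_cst.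
(* Before [r] there is a true kernel difference, estimated by ((t - r) / (r - s))^e. From [r] on
   [hker (r - s)] vanishes and only the kernel at time t - s is left. *)
pose k1 s z := (if (s < r)%R then hdiff (t - s) (r - s) z else z0 s z).
pose k2 s z := (if (s < r)%R then z0 s z else hker (t - s) z).
have mk1 : jmeas k1 by apply: jmeas_if_lt => //; exact: jmeas_hdiff.
have mk2 : jmeas k2 by apply: jmeas_if_lt => //; exact: jmeas_hker.
have k10 s z : (0 <= k1 s z)%R by rewrite /k1; case: ifP => // _; exact: hdiff_ge0.
have k20 s z : (0 <= k2 s z)%R by rewrite /k2; case: ifP => // _; exact: hker_ge0.
have kE : (fun s => hdiff (t - s) (r - s)) = (fun s z => k1 s z + k2 s z)%R :> (R -> X -> R).
  apply/funext => s; apply/funext => z; rewrite /k1 /k2 /z0.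
  case: ltP => sr; first by rewrite addr0.
  by rewrite add0r /hdiff (@hker0 _ _ (r - s)) ?subr_le0// subr0 ger0_norm// hker_ge0.
have B1 : bnd rho w (duh k1 g) (2 * (C * h `^ e * M * (K * r `^ (1 - (a + e) - b)))).
  apply: (@bnd_duh R N rho1 s1 rho w k1 g _ M r (a + e)%R b K) => //.
  - move=> s; rewrite negb_and -!leNgt => /orP[s0|st]; [left|right] => z.
      exact: gN.
    by rewrite /k1 ltNge st.
  - move=> s A /andP[s0 sr] A0 fA.
    rewrite (_ : k1 s = hdiff (t - s) (r - s)); last first.
      by apply/funext => z; rewrite /k1 sr.
    have rs0 : (0 < r - s)%R by rewrite subr_gt0.
    have := HD (r - s)%R (t - s)%R e (g s) A.
    rewrite rs0 ltrD2r rt => /(_ isT).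
    rewrite (le_trans (_ : _ <= t)%R tT) ?gerBl ?(ltW s0)// => /(_ isT e01 A0).
    move=> /(_ (jmeas_slice s mg) (g0 s) fA).
    have -> : (t - s - (r - s) = h)%R by rewrite hE; ring.
    by rewrite -[(C * _ * _)%R]mulrA powR_divM ?(ltW h0)// mulrA.
  - move=> s /andP[s0 sr]; apply: gM; rewrite s0/=.
    by rewrite (le_trans (ltW sr))// (le_trans (ltW rt)).
  - exact: HK.
have B2 : bnd rho w (duh k2 g) (2 * (C * h `^ e * M * (K * t `^ (1 - (a + e) - b)))).
  apply: (@bnd_duh R N rho1 s1 rho w k2 g _ M t (a + e)%R b K) => //.
  - move=> s; rewrite negb_and -!leNgt => /orP[s0|st]; [left|right] => z.
      exact: gN.
    by rewrite /k2 ltNge (le_trans (ltW rt) st)/= hker0// subr_le0.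
  - move=> s A /andP[s0 st] A0 fA; have ts0 : (0 < t - s)%R by rewrite subr_gt0.
    have q0 : (0 <= C * h `^ e * (t - s) `^ (- (a + e)) * A)%R.
      by rewrite !mulr_ge0 ?powR_ge0 ?(ltW C0).
    have mgs := jmeas_slice s mg.
    have [sr|rs] := ltP s r.
      rewrite (_ : conv _ _ = fun=> 0); last first.
        by apply/funext => x; apply: conv0; right => z; rewrite /k2 sr.
      by apply: (bnd_mono rho0 _ _ _ (bnd0 _ _)); rewrite ?lexx//; exact: measurable_cst.
    rewrite (_ : k2 s = hker (t - s)); last first.
      by apply/funext => z; rewrite /k2 ltNge rs.
    have tsT : (0 < t - s <= T)%R by rewrite ts0 (le_trans _ tT)// gerBl ltW.
    have := HC (t - s)%R (g s) A tsT A0 mgs (g0 s) fA.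
    have mh := measurable_conv (measurable_hker (t - s)) mgs (@hker_ge0 R N (t - s)) (g0 s).
    apply: (bnd_mono rho0 _ mh (fun x => conv_ge0 x (@hker_ge0 R N (t - s)) (g0 s))).
    (* For s >= r one has t - s <= t - r, hence (t - s)^(-a) <= (t - r)^e (t - s)^(-(a + e)). *)
    rewrite !mulr_ge0 ?powR_ge0 ?(ltW C0)//= ler_wpM2r// -mulrA ler_wpM2l ?(ltW C0)//.
    rewrite opprD [(- a + _)%R]addrC powRD; last by rewrite (gt_eqF ts0) implybT.
    rewrite mulrA ler_peMl ?powR_ge0// powRN ler_pdivlMr ?powR_gt0// mul1r.
    by rewrite ge0_ler_powR ?nnegrE ?(ltW h0) ?(ltW ts0)// hE lerD2l lerN2.
  - by move=> s /andP[s0 st]; apply: gM; rewrite s0/= (le_trans (ltW st)).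
  - exact: HK.
have md1 := measurable_duh mk1 mg k10 g0; have md2 := measurable_duh mk2 mg k20 g0.
have q1 : (0 <= 2 * (C * h `^ e * M * (K * r `^ (1 - (a + e) - b))))%R.
  by rewrite !mulr_ge0 ?powR_ge0 ?(ltW C0) ?(ltW M0) ?(ltW K0).
have q2 : (0 <= 2 * (C * h `^ e * M * (K * t `^ (1 - (a + e) - b))))%R.
  by rewrite !mulr_ge0 ?powR_ge0 ?(ltW C0) ?(ltW M0) ?(ltW K0).
have := bndD r01 q1 q2 md1 md2 (fun x => duh_ge0 x k10 g0) (fun x => duh_ge0 x k20 g0) B1 B2.
rewrite kE (_ : (fun x => _) = duh (fun s z => k1 s z + k2 s z)%R g); last first.
  by apply/funext => x; rewrite duhDl.
have mk12 : jmeas (fun s z => k1 s z + k2 s z)%R by exact: measurable_funD.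
have k120 s z : (0 <= k1 s z + k2 s z)%R by rewrite addr_ge0.
apply: (bnd_mono rho0 _ (measurable_duh mk12 mg k120 g0) (fun x => duh_ge0 x k120 g0)).
rewrite mulr_ge0 ?addr_ge0//=.
set c := (C * h `^ e * M * K)%R; have c0 : (0 <= c)%R.
  by rewrite !mulr_ge0 ?powR_ge0 ?(ltW C0) ?(ltW M0) ?(ltW K0).
set ex := (1 - (a + e) - b)%R in k0 *.
rewrite (_ : 16 * _ * M * _ = 4 * (2 * (c * T `^ ex) + 2 * (c * T `^ ex)))%R; last by rewrite /c; ring.
have pT p : (0 < p <= T)%R -> (p `^ ex <= T `^ ex)%R.
  by move=> /andP[p0 pT]; rewrite ge0_ler_powR ?nnegrE ?(ltW p0)// (le_trans (ltW p0)).
rewrite ler_pM2l// !(mulrA _ K) -/c; apply: lerD; rewrite ler_pM2l// ler_wpM2l//; apply: pT.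
- by rewrite r0/= (le_trans (ltW rt)).
- by rewrite t0.
Qed.

Lemma duh_bnd_local rho1 s1 rho w (T b : R) :
  (rho1 = rho \/ (0 < rho1 < rho)%R) -> (0 <= rho < 1)%R -> (0 <= w <= s1)%R ->
  (w + N%:R * rho < s1 + N%:R * rho1 < N%:R)%R -> (0 < T)%R -> (0 <= b)%R ->
  (0 <= N%:R / 2 * (rho1 - rho) + (s1 - w) / 2)%R ->
  (N%:R / 2 * (rho1 - rho) + (s1 - w) / 2 + b < 1)%R ->
  exists C kap eta : R, [/\ (0 < C)%R, (0 < kap)%R, (0 < eta)%R &
    forall (g : R -> X -> \bar R) (M : R), jmeas g -> (forall s y, 0 <= g s y) ->
    (forall s y, (s <= 0)%R -> g s y = 0) -> (0 < M)%R ->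
    (forall s, (0 < s <= T)%R -> bnd rho1 s1 (g s) (M * s `^ (- b))) ->
    (forall t, (0 < t <= T)%R ->
      bnd rho w (duh (fun s => hker (t - s)) g) (C * M * t `^ kap)) /\
    (forall r t, (0 < r < t)%R -> (t <= T)%R ->
      bnd rho w (duh (fun s => hdiff (t - s) (r - s)) g) (C * M * (t - r) `^ eta))].
Proof.
move=> h1 h2 h3 h4 T0 b0 a00 ab1; set a0 := (N%:R / 2 * _ + _)%R in a00 ab1.
have [r0 r1] := andP h2; have r01 : (0 <= rho <= 1)%R by rewrite r0 ltW.
have [e [e0 e1 e2]] : exists e : R, [/\ (0 < e)%R, (0 <= e <= 1)%R & (a0 + e + e + b < 1)%R].
  (* The room 1 - a0 - b is spent twice: once on the loss of [heat_bnd_local], once on the Hölder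
     exponent. *)
  by exists ((1 - a0 - b) / 4)%R; split; [lra|apply/andP; split; lra|lra].
have [a [C [/andP[aa0 ae] C0 HC HD]]] := heat_bnd_diff h1 h2 h3 h4 T0 e0.
rewrite -/a0 in ae.
have abe : (a + e + b < 1)%R by apply: lt_trans e2; rewrite !ltrD2r.
have a1e : (a + e < 1)%R by apply: le_lt_trans abe; rewrite lerDl.
have a1 : (0 <= a < 1)%R by rewrite aa0/=; apply: le_lt_trans a1e; rewrite lerDl ltW.
have ae1 : (0 <= a + e < 1)%R by rewrite addr_ge0 ?(ltW e0).
have b1 : (0 <= b < 1)%R.
  by rewrite b0/=; apply: le_lt_trans abe; rewrite lerDr addr_ge0 ?(ltW e0).
have [K1 K10 HK1] := integral_tker_le a1 b1.
have [K2 K20 HK2] := integral_tker_le ae1 b1.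
have k20 : (0 <= 1 - (a + e) - b)%R by rewrite -addrA -opprD subr_ge0 ltW.
have k10 : (0 < 1 - a - b)%R.
  by rewrite -addrA -opprD subr_gt0; apply: le_lt_trans abe; rewrite lerD2r lerDl ltW.
pose B1 := (2 * (C * K1))%R; pose B2 := (16 * (C * K2 * T `^ (1 - (a + e) - b)))%R.
have B10 : (0 < B1)%R by rewrite !mulr_gt0.
have B20 : (0 < B2)%R by rewrite !mulr_gt0 ?powR_gt0.
exists (B1 + B2)%R, (1 - a - b)%R, e; split; [exact: addr_gt0|exact: k10|exact: e0|].
move=> g M mg g0 gN M0 gM; split.
  move=> t tT; have := duh_bnd_hker r01 C0 K10 M0 HC HK1 mg g0 gN gM tT.
  have hk0 s (z : X) := hker_ge0 (t - s) z.
  apply: (bnd_mono r0 _ (measurable_duh (jmeas_hker t) mg hk0 g0) (fun x => duh_ge0 x hk0 g0)).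
  rewrite !mulr_ge0 ?powR_ge0 ?(ltW C0) ?(ltW M0) ?(ltW K10)//=.
  rewrite (_ : 2 * _ = B1 * M * t `^ (1 - a - b))%R; last by rewrite /B1; ring.
  by rewrite ler_wpM2r ?powR_ge0// ler_wpM2r ?(ltW M0)// lerDl ltW.
move=> r t rt tT; have := duh_bnd_hdiff r01 C0 K20 M0 e1 k20 HC HD HK2 mg g0 gN gM rt tT.
have hk0 s (z : X) := hdiff_ge0 (t - s) (r - s) z.
apply: (bnd_mono r0 _ (measurable_duh (jmeas_hdiff t r) mg hk0 g0) (fun x => duh_ge0 x hk0 g0)).
rewrite -/B2 !mulr_ge0 ?powR_ge0 ?(ltW M0) ?(ltW C0) ?(ltW K20)//=.
by rewrite ler_wpM2r ?powR_ge0// ler_wpM2r ?(ltW M0)// lerDr ltW.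
Qed.

End KernelDifference.

(** * Monotone iteration *)

Section MonotoneLimits.
Local Open Scope ereal_scope.

(** A supremum instead of a limit: it exists without a convergence proof, and for nondecreasing
    sequences it is the limit. *)
Definition esupn (T : Type) (R : realType) (f : nat -> T -> \bar R) (x : T) : \bar R :=
  ereal_sup (range (fun n => f n x)).

Lemma esupn_ge (T : Type) (R : realType) (f : nat -> T -> \bar R) n x : f n x <= esupn f x.
Proof. by apply: ereal_sup_ubound; exists n. Qed.

Lemma esupn_le (T : Type) (R : realType) (f : nat -> T -> \bar R) x M :
  (forall n, f n x <= M) -> esupn f x <= M.
Proof. by move=> h; apply: ge_ereal_sup => _ [n _ <-]. Qed.

Lemma ereal_sup_rangeZ (R : realType) (c : R) (a : nat -> \bar R) : (0 <= c)%R ->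
  c%:E * ereal_sup (range a) = ereal_sup (range (fun n => c%:E * a n)).
Proof.
move=> c0; rewrite -ereal_supZl//; last by apply/set0P; exists (a 0%N); exists 0%N.
by rewrite image_comp.
Qed.

Context d (T : measurableType d) (R : realType).
Variables (m : {measure set T -> \bar R}) (f : nat -> T -> \bar R).
Hypotheses (mf : forall n, measurable_fun setT (f n)) (f0 : forall n x, 0 <= f n x)
  (ndf : forall n x, f n x <= f n.+1 x).

Lemma nondecreasing_slice x : nondecreasing_seq (f ^~ x).
Proof. by apply/nondecreasing_seqP => n; exact: ndf. Qed.

Lemma esupn_cvg x : f n x @[n --> \oo] --> esupn f x.
Proof. exact/ereal_nondecreasing_cvgn/nondecreasing_slice. Qed.

Lemma measurable_esupn : measurable_fun setT (esupn f).
Proof. by apply: emeasurable_fun_cvg mf _ => x _; exact: esupn_cvg. Qed.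

Lemma integral_esupn : \int[m]_x esupn f x = ereal_sup (range (fun n => \int[m]_x f n x)).
Proof.
have -> : esupn f = (fun x => limn (f ^~ x)).
  by apply/funext => x; rewrite (cvg_lim _ (esupn_cvg (x := x))).
rewrite monotone_convergence//; last by move=> x _; exact: nondecreasing_slice.
apply/cvg_lim => //; apply: ereal_nondecreasing_cvgn; apply/nondecreasing_seqP => n.
by apply: ge0_le_integral.
Qed.

End MonotoneLimits.

(** * Monotone Picard iteration for a general source *)

Section Picard.
Context {R : realType} {N : nat}.
Local Notation leb := (@lebesgue_measure R).
Local Notation X := (Rspace R N).
Implicit Types (x y z : X) (s t w A B C rho : R) (k : R -> X -> R) (f : X -> \bar R).
Local Open Scope ereal_scope.

Transparent bnd.

Lemma bnd_esupn rho w (f : nat -> X -> \bar R) A : (0 <= rho)%R ->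
  (forall n, measurable_fun setT (f n)) -> (forall n x, 0 <= f n x) ->
  (forall n x, f n x <= f n.+1 x) -> (forall n, bnd rho w (f n) A) ->
  bnd rho w (esupn f) A.
Proof.
move=> r0 mf f0 ndf; have e0 (x : X) : (0 <= enorm x `^ w)%R by exact: powR_ge0.
have supE x : wmul w (esupn f) x = esupn (fun n => wmul w (f n)) x.
  by rewrite /wmul /esupn ereal_sup_rangeZ.
rewrite /bnd; case: ifPn => [_ h x|rn0 h].
  by rewrite supE; apply: esupn_le => n; exact: h.
have ri0 : (0 < rho^-1)%R by rewrite invr_gt0 lt_neqAle eq_sym rn0.
(* A positive power commutes with suprema. For the inequality that monotonicity does not give, apply
   the inverse power. *)
have -> : (fun x => wmul w (esupn f) x `^ rho^-1) =
    esupn (fun n x => wmul w (f n) x `^ rho^-1).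
  apply/funext => x; apply/eqP; rewrite eq_le; apply/andP; split; last first.
    apply: esupn_le => n; apply: le_poweR; rewrite ?(ltW ri0)//; first exact: wmul_ge0.
    by rewrite supE; exact: (esupn_ge (fun n => wmul w (f n))).
  rewrite -[leRHS]poweRe1; last by apply: (le_trans _ (esupn_ge _ 0%N x)); exact: poweR_ge0.
  rewrite -[X in _ <= _ `^ X](divff rn0) poweRrM.
  apply: le_poweR; rewrite ?(ltW ri0)//; first by apply: wmul_ge0 => y; exact: (le_trans (f0 0%N y) (esupn_ge f 0%N y)).
  rewrite supE; apply: esupn_le => n.
  have -> : wmul w (f n) x = (wmul w (f n) x `^ rho^-1) `^ rho.
    by rewrite -poweRrM mulVf// poweRe1 ?(wmul_ge0 _ (f0 n)).
  apply: le_poweR => //; first exact: poweR_ge0.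
  exact: (esupn_ge (fun n x => wmul w (f n) x `^ rho^-1)).
rewrite integral_esupn.
- by apply: ge_ereal_sup => _ [n _ <-]; exact: h.
- by move=> n; apply: measurable_poweRf; exact: measurable_wmul.
- by move=> n x; exact: poweR_ge0.
- move=> n x; apply: le_poweR; rewrite ?(ltW ri0)//; first exact: wmul_ge0.
  by rewrite /wmul lee_wpmul2l ?lee_fin.
Qed.

Opaque bnd.

Lemma le_duh k (g g' : R -> X -> \bar R) x : jmeas k -> jmeas g -> jmeas g' ->
  (forall s z, 0 <= k s z)%R -> (forall s y, 0 <= g s y) ->
  (forall s y, g s y <= g' s y) -> duh k g x <= duh k g' x.
Proof.
move=> mk mg mg' k0 g0 gg'; have g'0 s y := le_trans (g0 s y) (gg' s y).
apply: ge0_le_integral => //.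
- by move=> s _; exact: conv_ge0.
- exact: measurable_conv_time.
- exact: measurable_conv_time.
- move=> s _; have mks := measurableT_comp mk (measurable_pair1 s).
  by apply: le_conv => //; exact: jmeas_slice.
Qed.

Lemma duh_esupn k (g : nat -> R -> X -> \bar R) x : jmeas k -> (forall n, jmeas (g n)) ->
  (forall s z, 0 <= k s z)%R -> (forall n s y, 0 <= g n s y) ->
  (forall n s y, g n s y <= g n.+1 s y) ->
  duh k (fun s y => esupn (fun n => g n s) y) x = ereal_sup (range (fun n => duh k (g n) x)).
Proof.
move=> mk mg k0 g0 ndg.
have mks s : measurable_fun setT (k s) := measurableT_comp mk (measurable_pair1 s).
have -> : duh k (fun s y => esupn (fun n => g n s) y) x =
    \int[leb]_s esupn (fun n s => conv (k s) (g n s) x) s.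
  apply: eq_integral => s _; rewrite /conv.
  have -> : (fun y => (k s (vsub x y))%:E * esupn (fun n => g n s) y) =
      esupn (fun n y => (k s (vsub x y))%:E * g n s y).
    by apply/funext => y; rewrite /esupn ereal_sup_rangeZ.
  rewrite integral_esupn//.
  - by move=> n; apply: measurable_conv_integrand => //; exact: jmeas_slice.
  - by move=> n y; rewrite mule_ge0// lee_fin.
  - by move=> n y; rewrite lee_wpmul2l// lee_fin.
rewrite integral_esupn//.
- by move=> n; exact: measurable_conv_time.
- by move=> n s; exact: conv_ge0.
- by move=> n s; apply: le_conv => //; exact: jmeas_slice.
Qed.

Variables (S : R -> X -> \bar R -> \bar R) (A : R -> X -> \bar R).
Hypotheses (mA : jmeas A) (A0 : forall t x, 0 <= A t x).
Hypothesis mS : forall v, jmeas v -> (forall s y, 0 <= v s y) ->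
  jmeas (fun s y => S s y (v s y)).
Hypothesis S0 : forall s y a, 0 <= a -> 0 <= S s y a.
Hypothesis leS : forall s y a b, 0 <= a -> a <= b -> S s y a <= S s y b.
(** Continuity of the source from below. Together with [leS] it makes the source commute with the
    supremum of the iterates. *)
Hypothesis supS : forall s y (a : nat -> \bar R) D,
  (forall n, 0 <= a n) -> (forall n, a n <= a n.+1) ->
  (forall n, S s y (a n) <= D) -> S s y (ereal_sup (range a)) <= D.

Definition picstep (v : R -> X -> \bar R) t x : \bar R :=
  A t x + duh (fun s => hker (t - s)) (fun s y => S s y (v s y)) x.

Fixpoint picard n : R -> X -> \bar R :=
  if n is n'.+1 then picstep (picard n') else fun _ _ => 0.

Definition picsol t x := esupn (fun n => picard n t) x.

Lemma jmeas_picstep v : jmeas v -> (forall s y, 0 <= v s y) -> jmeas (picstep v).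
Proof.
move=> mv v0; apply: emeasurable_funD => //.
by apply: jmeas_duh_hker; [exact: mS|move=> s y; exact: S0].
Qed.

Lemma picstep_ge0 v t x : (forall s y, 0 <= v s y) -> 0 <= picstep v t x.
Proof.
move=> v0; rewrite adde_ge0//; apply: duh_ge0 => [s z|s y]; [exact: hker_ge0|exact: S0].
Qed.

Lemma picard_ge0 n t x : 0 <= picard n t x.
Proof. by elim: n t x => //= n IH t x; exact: picstep_ge0. Qed.

Lemma jmeas_picard n : jmeas (picard n).
Proof.
elim: n => [|n IH]; first exact: measurable_cst.
by apply: jmeas_picstep => // s y; exact: picard_ge0.
Qed.

Lemma le_picstep v v' t x : jmeas v -> jmeas v' -> (forall s y, 0 <= v s y) ->
  (forall s y, v s y <= v' s y) -> picstep v t x <= picstep v' t x.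
Proof.
move=> mv mv' v0 vv'; have v'0 s y := le_trans (v0 s y) (vv' s y).
apply: leeD2l; apply: (le_duh _ (jmeas_hker t) (mS mv v0) (mS mv' v'0)).
- by move=> s z; exact: hker_ge0.
- by move=> s y; exact: S0.
- by move=> s y; exact: leS.
Qed.

Lemma picard_nd n t x : picard n t x <= picard n.+1 t x.
Proof.
elim: n t x => [|n IH] t x; first exact: (picard_ge0 1).
exact: (le_picstep t x (jmeas_picard n) (jmeas_picard n.+1) (picard_ge0 n) IH).
Qed.

Lemma jmeas_picsol : jmeas picsol.
Proof.
exact: (@measurable_esupn _ (measurableTypeR R * X)%type R
  (fun n p => picard n p.1 p.2) jmeas_picard (fun n p => picard_nd n p.1 p.2)).
Qed.

Lemma picsol_ge0 t x : 0 <= picsol t x.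
Proof. exact: (le_trans (picard_ge0 0 t x) (esupn_ge (fun n => picard n t) 0%N x)). Qed.

Lemma picsolE t x : picsol t x = picstep picsol t x.
Proof.
have hk0 s (z : X) := hker_ge0 (t - s) z.
have mP n := jmeas_picard n; have P0 n := picard_ge0 n.
have mSP n : jmeas (fun s y => S s y (picard n s y)) by exact: mS.
have SP0 n s y : 0 <= S s y (picard n s y) by exact: S0.
have ndS n s y : S s y (picard n s y) <= S s y (picard n.+1 s y).
  by apply: leS => //; exact: picard_nd.
have E1 : (fun s y => S s y (picsol s y)) =
    (fun s y => esupn (fun n y => S s y (picard n s y)) y).
  apply/funext => s; apply/funext => y; apply/eqP; rewrite eq_le; apply/andP; split.
    apply: supS => n //; first exact: picard_nd.
    exact: (esupn_ge (fun n y => S s y (picard n s y))).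
  apply: esupn_le => n; apply: leS => //; exact: (esupn_ge (fun n => picard n s)).
have E2 := duh_esupn x (jmeas_hker t) mSP hk0 SP0 ndS.
apply/eqP; rewrite eq_le; apply/andP; split.
  apply: esupn_le => -[|n]; first by apply: picstep_ge0; exact: picsol_ge0.
  apply: (le_picstep t x (mP n) jmeas_picsol (P0 n)) => s y.
  exact: (esupn_ge (fun n => picard n s)).
rewrite /picstep E1 E2.
have Ab : A t x <= picsol t x.
  apply: le_trans (esupn_ge (fun n => picard n t) 1%N x).
  rewrite /= /picstep leeDl//; apply: (duh_ge0 x hk0 _) => s y; exact: S0.
(* To move [A t x] to the other side it must be finite; it is at most the solution, and where the
   solution is infinite nothing remains to be shown. *)
have [->|poo] := eqVneq (picsol t x) +oo; first by rewrite leey.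
have Pfin : picsol t x \is a fin_num by rewrite ge0_fin_numE ?picsol_ge0// lt_neqAle poo leey.
have Afin : A t x \is a fin_num.
  by rewrite ge0_fin_numE// (le_lt_trans Ab)// lt_neqAle poo leey.
rewrite addeC -leeBrDr//; apply: ge_ereal_sup => _ [n _ <-].
rewrite leeBrDr// addeC; exact: (esupn_ge (fun n => picard n t) n.+1).
Qed.

Lemma picard_time_le0 : (forall t x, (t <= 0)%R -> A t x = 0) ->
  (forall s y, (s <= 0)%R -> S s y 0 = 0) ->
  forall t x, (t <= 0)%R -> picsol t x = 0.
Proof.
move=> HA HS t x t0; apply/eqP; rewrite eq_le picsol_ge0 andbT; apply: esupn_le => n.
suff -> : picard n t x = 0 by [].
elim: n t x t0 => //= n IH t x t0; rewrite /picstep HA// add0e /duh.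
rewrite integral0_eq// => s _; apply: conv0.
have [s0|s0] := leP s 0%R; [left => y|right => z]; first by rewrite IH// HS.
by rewrite hker0// subr_le0 (le_trans t0)// ltW.
Qed.

End Picard.

(** * The majorant *)

Section Exponents.
Context {R : realFieldType}.
Local Open Scope ring_scope.

Lemma exists_between (a1 a2 b1 b2 b3 : R) : a1 < b1 -> a1 < b2 -> a1 < b3 ->
  a2 < b1 -> a2 < b2 -> a2 < b3 ->
  exists x, [/\ a1 < x, a2 < x, x < b1, x < b2 & x < b3].
Proof.
move=> h1 h2 h3 h4 h5 h6; pose a := Num.max a1 a2; pose b := Num.min b1 (Num.min b2 b3).
have ab : a < b by rewrite gt_max !lt_min h1 h2 h3 h4 h5 h6.
have [ha hb] := midf_lt ab; exists ((a + b) / 2%:R).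
move: ha hb; rewrite gt_max !lt_min => /andP[-> ->] /andP[-> /andP[-> ->]].
by split.
Qed.

(* [nu] and [rho] are taken so close to their lower bounds that the last clause
   holds: one application of the heat semigroup then leads from the source to
   every other admissible pair, of scaling dimension [d]. *)
Lemma exists_exponents (n al l g qi : R) : 0 < n -> 0 < al -> - n < l -> - 2 < l ->
  0 < g -> l < g * al -> 0 <= qi -> g + n * qi < n -> al * (n * qi + g) < 2 + l ->
  exists nu rho, [/\ 0 < nu < g, g < nu * (al + 1) - l,
    0 <= rho /\ (qi = 0 /\ rho = 0 \/ 0 < rho * (al + 1) < qi),
    n * qi + g < nu * (al + 1) - l + n * (rho * (al + 1)) < n &
    forall d, 0 < d -> n * qi + g + l < (al + 1) * d ->
      n * (rho * (al + 1)) + nu * (al + 1) - l - d < 2].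
Proof.
move=> n0 al0 ln l2 g0 lg qi0 gq sub.
have al1 : 0 < al + 1 by rewrite addr_gt0.
(* An upper limit for (al + 1)(n rho + nu), which the last clause wants below 2 + l + d. The least
   admissible d is (n qi + g + l) / (al + 1) if that is nonnegative, and 0 otherwise. Subcriticality
   leaves room above n qi + g + l. *)
have [D [D0 D1 D2]] : exists D, [/\ 0 < D, n * qi + g + l < D &
    forall d, 0 < d -> n * qi + g + l < (al + 1) * d -> D <= 2 + l + d].
  have [h|h] := leP 0 (n * qi + g + l); last first.
    by exists (2 + l); split=> [||d d0 _]; lra.
  exists (2 + l + (n * qi + g + l) / (al + 1)); split.
  - have : 0 <= (n * qi + g + l) / (al + 1) by rewrite divr_ge0// ltW.
    lra.
  - suff : (n * qi + g - 2) * (al + 1) < n * qi + g + l.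
      by rewrite -ltr_pdivlMr//; lra.
    nra.
  - move=> d d0 hd; rewrite lerD2l ler_pdivrMr//; lra.
(* p stands for nu (al + 1); the bounds encode, in order, nu > 0, weight of the source above g, nu <
   g, weight of the source below n, and the limit D. *)
have [p [p0 p1 p2 p3 p4]] : exists p, [/\ 0 < p, g + l < p, p < g * (al + 1), p < n + l & p < D].
  apply: exists_between => //; try lra.
  - by rewrite mulr_gt0.
  - have : 0 <= n * qi by rewrite mulr_ge0// ltW.
    lra.
  - have : 0 <= n * qi by rewrite mulr_ge0// ltW.
    lra.
have pE : p / (al + 1) * (al + 1) = p by rewrite divfK// gt_eqF.
have nu1 : 0 < p / (al + 1) < g by rewrite divr_gt0//= ltr_pdivrMr.
exists (p / (al + 1)); rewrite pE.
have [qi00|qi00] := eqVneq qi 0.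
  exists 0; rewrite mul0r mulr0 addr0; split => //.
  - lra.
  - by split=> //; left.
  - by rewrite qi00 mulr0 add0r; apply/andP; split; lra.
  - by move=> d d0 hd; have := D2 _ d0 hd; lra.
have nqi : 0 < n * qi by rewrite mulr_gt0// lt_neqAle eq_sym qi00.
(* r stands for n rho (al + 1), under the conditions left once p is fixed. For qi = 0 it had to be
   0, since rho (al + 1) may not exceed qi. *)
have [r [r0 r1 r2 r3 r4]] : exists r, [/\ 0 < r, n * qi + g + l - p < r, r < n * qi, r < n + l - p & r < D - p].
  by apply: exists_between => //; lra.
have rE : n * (r / n / (al + 1) * (al + 1)) = r.
  by rewrite divfK ?gt_eqF// mulrC divfK// gt_eqF.
exists (r / n / (al + 1)); split => //.
- lra.
- split; first by rewrite !divr_ge0// ltW.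
  right; rewrite divfK ?gt_eqF// divr_gt0//= ltr_pdivrMr// mulrC; lra.
- by rewrite rE; apply/andP; split; lra.
- by rewrite rE => d d0 hd; have := D2 _ d0 hd; lra.
Qed.

End Exponents.

Section Majorant.
Context {R : realType} {N : nat}.
Hypothesis N0 : (0 < N)%N.
Local Notation mu := (lebesgueN R N).
Local Notation X := (Rspace R N).
Implicit Types (x y z : X) (s t : R) (f : X -> \bar R).
Local Open Scope ereal_scope.

Definition powsrc (l al : R) (s : R) y (a : \bar R) : \bar R :=
  (enorm y `^ l)%:E * a `^ (al + 1).

Definition lin f t x : \bar R := conv (hker t) f x.

Definition majorant (l al : R) f : R -> X -> \bar R := picsol (powsrc l al) (lin f).

Lemma jmeas_lin f : measurable_fun setT f -> (forall y, 0 <= f y) -> jmeas (lin f).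
Proof.
move=> mf f0; apply: (jmeas_conv (k := fun t => hker t) (g := fun _ => f)) => //.
- by apply: measurable_hker_comp; [exact: measurable_fst|exact: measurable_snd].
- exact: (measurableT_comp mf measurable_snd).
- by move=> s z; exact: hker_ge0.
Qed.

Lemma lin_ge0 f t x : (forall y, 0 <= f y) -> 0 <= lin f t x.
Proof. by move=> f0; apply: conv_ge0 => // z; exact: hker_ge0. Qed.

Lemma lin_le0 f t x : (t <= 0)%R -> lin f t x = 0.
Proof. by move=> t0; apply: conv0; right => z; exact: hker0. Qed.

Lemma powsrc_ge0 l al s y a : 0 <= powsrc l al s y a.
Proof. by rewrite mule_ge0 ?lee_fin ?powR_ge0 ?poweR_ge0. Qed.

Lemma le_powsrc l al s y a b : (0 <= al + 1)%R -> 0 <= a -> a <= b ->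
  powsrc l al s y a <= powsrc l al s y b.
Proof.
by move=> al1 a0 ab; rewrite lee_wpmul2l ?lee_fin ?powR_ge0// le_poweR.
Qed.

Lemma poweR_ereal_sup (p : R) (a : nat -> \bar R) : (0 < p)%R -> (forall n, 0 <= a n) ->
  ereal_sup (range a) `^ p <= ereal_sup (range (fun n => a n `^ p)).
Proof.
move=> p0 a0; set D := ereal_sup (range (fun n => a n `^ p)).
have aD n : a n `^ p <= D by rewrite /D; apply: ereal_sup_ubound; exists n.
have D0 : 0 <= D := le_trans (poweR_ge0 (a 0%N) p) (aD 0%N).
rewrite -[leRHS]poweRe1// -[X in _ <= _ `^ X](mulVf (lt0r_neq0 p0)) poweRrM.
apply: le_poweR; rewrite ?(ltW p0)//.
  by apply: (le_trans (a0 0%N)); apply: ereal_sup_ubound; exists 0%N.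
apply: ge_ereal_sup => _ [n _ <-].
rewrite -[leLHS]poweRe1// -[X in _ `^ X <= _](mulfV (lt0r_neq0 p0)) poweRrM.
by apply: le_poweR; rewrite ?invr_ge0 ?(ltW p0)// poweR_ge0.
Qed.

Lemma powsrc_sup l al s y (a : nat -> \bar R) D : (0 < al + 1)%R -> (forall n, 0 <= a n) ->
  (forall n, a n <= a n.+1) ->
  (forall n, powsrc l al s y (a n) <= D) -> powsrc l al s y (ereal_sup (range a)) <= D.
Proof.
move=> al1 a0 nda h; rewrite /powsrc.
apply: (@le_trans _ _ ((enorm y `^ l)%:E * ereal_sup (range (fun n => a n `^ (al + 1))))).
  by rewrite lee_wpmul2l ?lee_fin ?powR_ge0// poweR_ereal_sup.
by rewrite ereal_sup_rangeZ ?powR_ge0//; apply: ge_ereal_sup => _ [n _ <-]; exact: h.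
Qed.

Section Solution.
Variables (l al : R) (f : X -> \bar R).
Hypotheses (al0 : (0 < al)%R) (mf : measurable_fun setT f) (f0 : forall y, 0 <= f y).
Let al1 : (0 < al + 1)%R. Proof. by rewrite addr_gt0. Qed.
Let v := majorant l al f.

Let mS (u : R -> X -> \bar R) : jmeas u -> (forall s y, 0 <= u s y) ->
  jmeas (fun s y => powsrc l al s y (u s y)).
Proof. by move=> mu u0; exact: jmeas_src. Qed.

Lemma jmeas_majorant : jmeas v.
Proof.
apply: jmeas_picsol.
- exact: jmeas_lin.
- by move=> t x; exact: lin_ge0.
- exact: mS.
- by move=> *; exact: powsrc_ge0.
- by move=> s y a b; apply: le_powsrc; exact: ltW.
Qed.

Lemma majorant_ge0 t x : 0 <= v t x.
Proof.
by apply: picsol_ge0 => *; [exact: lin_ge0|exact: powsrc_ge0].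
Qed.

Lemma majorantE t x : v t x = lin f t x + duh (fun s => hker (t - s)) (src l al v) x.
Proof.
rewrite {1}/v /majorant picsolE//.
- exact: jmeas_lin.
- by move=> *; exact: lin_ge0.
- by move=> *; exact: powsrc_ge0.
- by move=> s y a b; apply: le_powsrc; exact: ltW.
- by move=> s y a D; exact: powsrc_sup.
Qed.

Lemma majorant_le0 t x : (t <= 0)%R -> v t x = 0.
Proof.
apply: picard_time_le0 => //.
- by move=> *; exact: lin_ge0.
- by move=> *; exact: powsrc_ge0.
- by move=> *; exact: lin_le0.
- by move=> s y _; rewrite /powsrc poweR0r ?mule0// gt_eqF.
Qed.

Lemma majorant_bnd rho nu (B : R -> R) (T : R) : (0 <= rho)%R ->
  (forall n, (forall t, (0 < t <= T)%R -> bnd rho nu (picard (powsrc l al) (lin f) n t) (B t)) ->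
    (forall t, (0 < t <= T)%R -> bnd rho nu (picard (powsrc l al) (lin f) n.+1 t) (B t))) ->
  (forall t, (0 <= B t)%R) ->
  forall t, (0 < t <= T)%R -> bnd rho nu (v t) (B t).
Proof.
move=> r0 H B0 t tT; rewrite /v /majorant /picsol.
have mA : jmeas (lin f) by exact: jmeas_lin.
have A0 (t' : R) (x : X) : 0 <= lin f t' x by exact: lin_ge0.
have S0 s y a : 0 <= a -> 0 <= powsrc l al s y a by move=> _; exact: powsrc_ge0.
have leS s y a b : 0 <= a -> a <= b -> powsrc l al s y a <= powsrc l al s y b.
  by apply: le_powsrc; exact: ltW.
have mP := jmeas_picard mA A0 mS S0.
apply: bnd_esupn => //.
- by move=> n; apply: jmeas_slice; exact: mP.
- by move=> n x; exact: picard_ge0.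
- by move=> n x; exact: picard_nd.
- move=> n; elim: n t tT => [|n IH]; last by apply: H; exact: IH.
  move=> t tT; apply: (bnd_mono r0 _ _ _ (bnd0 rho nu)) => //.
    by rewrite lexx B0.
Qed.

End Solution.

Lemma duh_src_bnd l al rho nu qi : (0 < al)%R ->
  (0 <= rho <= 1)%R -> (0 < nu * (al + 1) - l)%R -> (nu <= nu * (al + 1) - l)%R -> (0 <= nu)%R ->
  (nu * (al + 1) - l + N%:R * (rho * (al + 1)) < N%:R)%R ->
  forall a b : R, a = (N%:R / 2 * (rho * (al + 1) - rho) + (nu * (al + 1) - l - nu) / 2)%R ->
  b = (qi * (al + 1))%R -> (0 <= a < 1)%R -> (0 <= b < 1)%R ->
  exists2 C : R, (0 < C)%R & forall (T M : R) (v : R -> X -> \bar R), jmeas v ->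
    (forall s y, 0 <= v s y) -> (forall s y, (s <= 0)%R -> v s y = 0) -> (0 < M)%R ->
    (forall t, (0 < t <= T)%R -> bnd rho nu (v t) (M * t `^ (- qi))) ->
    forall t, (0 < t <= T)%R -> bnd rho nu (duh (fun s => hker (t - s)) (src l al v))
      (C * M `^ (al + 1) * t `^ (1 - a - b)).
Proof.
move=> al0 r01 s10 nus nu0 sub a b aE bE a01 b01.
have al1 : (0 < al + 1)%R by rewrite addr_gt0.
have [rho0 rho1] := andP r01.
have rr : (0 <= rho <= rho * (al + 1))%R by rewrite rho0/= ler_peMr// lerDr ltW.
have nn : (0 <= nu <= nu * (al + 1) - l)%R by rewrite nu0.
have [C0 C00 HC] := heat_bnd N0 rr nn sub; rewrite -aE in HC.
have [K K0 HK] := integral_tker_le a01 b01.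
exists (2 * (C0 * K))%R; first by rewrite !mulr_gt0.
move=> T M v mv v0 vN M0 vM t tT.
have Mp : (0 < M `^ (al + 1))%R by rewrite powR_gt0.
rewrite (_ : _ * _ = 2 * (C0 * M `^ (al + 1) * (K * t `^ (1 - a - b))))%R; last by ring.
apply: (duh_bnd_hker (T := T) r01 C00 K0 Mp _ HK (jmeas_src l al mv) _ _ _ tT).
- by move=> t' g A /andP[t'0 _]; exact: HC.
- by move=> s y; exact: src_ge0.
- by move=> s y s0; rewrite /src vN// poweR0r ?mule0// gt_eqF.
- move=> s sT; have s0 : (0 <= s)%R by case/andP: sT => /ltW.
  have := bnd_src al0 rho0 s10 _ mv v0 (vM s sT).
  rewrite (@powRM _ M) ?(ltW M0) ?powR_ge0// -powRrM mulNr -bE; apply.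
  by rewrite mulr_ge0 ?powR_ge0 ?(ltW M0).
Qed.

(** 8 C0 L is the radius of the invariant ball: the linear and the Duhamel part are each at most C0
    L in the weighted norm, and [bndD] turns the two into 4 (C0 L + C0 L). *)
Lemma smallness (al C0 C1 L T k : R) : (0 < al)%R -> (0 < C0)%R -> (0 < C1)%R ->
  (0 < L)%R -> (0 < T)%R ->
  (C1 * 8 `^ (al + 1) * C0 `^ al * (L `^ al * T `^ k) <= 1)%R ->
  (C1 * (8 * (C0 * L)) `^ (al + 1) * T `^ k <= C0 * L)%R.
Proof.
move=> al0 C00 C10 L0 T0 h; have CL0 : (0 < C0 * L)%R by rewrite mulr_gt0.
rewrite (@powRM _ 8) ?(ltW CL0)// [X in (8 `^ _ * X)%R]powRD; last first.
  by rewrite (gt_eqF CL0) implybT.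
rewrite powRr1 ?(ltW CL0)// (@powRM _ C0) ?(ltW C00) ?(ltW L0)//.
rewrite (_ : _ * _ = (C1 * 8 `^ (al + 1) * C0 `^ al * (L `^ al * T `^ k)) * (C0 * L))%R; last by ring.
by rewrite ler_piMl// ltW.
Qed.

(** The bound with constant 8 C0 L and time weight t^(-bt) is preserved by each Picard step under
    the smallness condition, and survives the supremum. The exponent of T is the subcriticality
    gap. *)
Lemma majorant_estimate l al rho nu qi g : (0 < al)%R ->
  (0 <= rho <= qi)%R -> (0 <= nu <= g)%R -> (g < nu * (al + 1) - l)%R ->
  (nu * (al + 1) - l + N%:R * (rho * (al + 1)) < N%:R)%R -> (g + N%:R * qi < N%:R)%R ->
  (N%:R * qi + g < nu * (al + 1) - l + N%:R * (rho * (al + 1)))%R ->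
  (al * (N%:R * qi + g) < 2 + l)%R ->
  exists2 C : R, (0 < C)%R & forall (T L : R) (f : X -> \bar R), (0 < T)%R -> (0 < L)%R ->
    (C * (L `^ al * T `^ (1 - (al * (N%:R * qi + g) - l) / 2)) <= 1)%R ->
    measurable_fun setT f -> (forall y, 0 <= f y) -> bnd qi g f L ->
    exists2 M : R, (0 < M)%R & forall t, (0 < t <= T)%R ->
      bnd rho nu (majorant l al f t) (M * t `^ (- (N%:R / 2 * (qi - rho) + (g - nu) / 2))).
Proof.
move=> al0 rq ng gs sub gq low up; have al1 : (0 < al + 1)%R by rewrite addr_gt0.
have [r0 rq'] := andP rq; have [nu0 nug] := andP ng.
have N1 : (0 < N%:R :> R)%R by rewrite ltr0n.
set bt := (N%:R / 2 * (qi - rho) + (g - nu) / 2)%R.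
have bt0 : (0 <= bt)%R by rewrite addr_ge0 ?divr_ge0 ?mulr_ge0 ?subr_ge0// ltW.
have [C0 C00 HC] := heat_bnd N0 rq ng gq; rewrite -/bt in HC.
set kk := (1 - _ / 2)%R.
have q1 : (qi < 1)%R.
  have : (N%:R * qi < N%:R * 1)%R by rewrite mulr1; lra.
  by rewrite ltr_pM2l.
have r01 : (0 <= rho <= 1)%R by rewrite r0/= (le_trans rq')// ltW.
have s10 : (0 < nu * (al + 1) - l)%R by apply: le_lt_trans gs; exact: le_trans nug.
have nus : (nu <= nu * (al + 1) - l)%R by rewrite (le_trans nug)// ltW.
pose a := (N%:R / 2 * (rho * (al + 1) - rho) + (nu * (al + 1) - l - nu) / 2)%R.
pose b := (bt * (al + 1))%R.
have a0 : (0 <= a)%R.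
  rewrite /a addr_ge0 ?mulr_ge0 ?invr_ge0 ?subr_ge0// ?(ltW N1)//.
  by rewrite ler_peMr// lerDr ltW.
have b0 : (0 <= b)%R by rewrite mulr_ge0// ltW.
have d0 : (N%:R * rho + nu <= N%:R * qi + g)%R by rewrite lerD// ler_wpM2l// ltW.
have alN : (al * (N%:R * rho + nu) <= al * (N%:R * qi + g))%R by rewrite ler_wpM2l// ltW.
have a1 : (a < 1)%R.
  have -> : a = ((al * (N%:R * rho + nu) - l) / 2)%R by rewrite /a; field.
  rewrite ltr_pdivrMr//; lra.
have b1 : (b < 1)%R.
  have -> : b = ((al * (N%:R * qi + g) - l
     - (nu * (al + 1) - l + N%:R * (rho * (al + 1)) - (N%:R * qi + g)) - l + l) / 2)%R.
    by rewrite /b /bt; field.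
  rewrite ltr_pdivrMr//; lra.
(* Scaling: one Duhamel step reproduces t^(-bt) up to the factor t^kk, and kk > 0 allows replacing
   it by T^kk. *)
have abE : (1 - a - b = kk - bt)%R by rewrite /a /b /bt /kk; field.
have [C1 C10 HD] := duh_src_bnd al0 r01 s10 nus nu0 sub (erefl a) (erefl b)
  (introT andP (conj a0 a1)) (introT andP (conj b0 b1)).
have k0 : (0 <= kk)%R by clear -kk up; rewrite /kk; lra.
exists (C1 * 8 `^ (al + 1) * C0 `^ al)%R; first by rewrite !mulr_gt0 ?powR_gt0.
move=> T L f T0 L0 small mf f0 fL.
have CL0 : (0 < C0 * L)%R by rewrite mulr_gt0.
have M0 : (0 < 8 * (C0 * L))%R by rewrite mulr_gt0.
exists (8 * (C0 * L))%R => //.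
have mA : jmeas (lin f) by exact: jmeas_lin.
have A0 t x : 0 <= lin f t x by exact: lin_ge0.
have S0 (s : R) (y : X) (c : \bar R) : 0 <= c -> 0 <= powsrc l al s y c by move=> _; exact: powsrc_ge0.
have mS (u : R -> X -> \bar R) : jmeas u -> (forall s y, 0 <= u s y) ->
  jmeas (fun s y => powsrc l al s y (u s y)) by move=> mu' _; exact: jmeas_src.
have mP := jmeas_picard mA A0 mS S0.
apply: majorant_bnd => //; last by move=> t; rewrite mulr_ge0 ?powR_ge0 ?(ltW M0).
move=> n IH t tT; have [t0 tT'] := andP tT.
have P0 s y : 0 <= picard (powsrc l al) (lin f) n s y by exact: picard_ge0.
have PN s y : (s <= 0)%R -> picard (powsrc l al) (lin f) n s y = 0.
  move=> s0; apply/eqP; rewrite eq_le P0 andbT -[leRHS](majorant_le0 l al0 f0 y s0).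
  exact: (esupn_ge (fun n => picard (powsrc l al) (lin f) n s) n).
have H2 := HD T (8 * (C0 * L))%R _ (mP n) P0 PN M0 IH t tT.
have H1 := HC t f L t0 (ltW L0) mf f0 fL.
have tb0 : (0 <= t `^ (- bt))%R by exact: powR_ge0.
have q1' : (0 <= C0 * t `^ (- bt) * L)%R by rewrite !mulr_ge0 ?(ltW C00) ?(ltW L0).
have q2 : (0 <= C1 * (8 * (C0 * L)) `^ (al + 1) * t `^ (1 - a - b))%R.
  by rewrite !mulr_ge0 ?powR_ge0 ?(ltW C10).
have hk0 s (z : X) := hker_ge0 (t - s) z.
have sg0 s y : 0 <= src l al (picard (powsrc l al) (lin f) n) s y by exact: src_ge0.
have md := measurable_duh (jmeas_hker t) (jmeas_src l al (mP n)) hk0 sg0.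
have mh := jmeas_slice t mA.
have := bndD r01 q1' q2 mh md (fun x => A0 t x) (fun x => duh_ge0 x hk0 sg0) H1 H2.
apply: (bnd_mono r0 _ (jmeas_slice t (mP n.+1))).
  apply/andP; split; first by rewrite mulr_ge0 ?addr_ge0.
  rewrite abE [(t `^ (kk - bt))%R]powRD; last by rewrite (gt_eqF t0) implybT.
  have tk : (t `^ kk <= T `^ kk)%R by rewrite ge0_ler_powR ?nnegrE ?(ltW t0) ?(ltW T0).
  have hs := smallness al0 C00 C10 L0 T0 small.
  have hs' : (C1 * (8 * (C0 * L)) `^ (al + 1) * t `^ kk <= C0 * L)%R.
    by apply: le_trans hs; rewrite ler_wpM2l// mulr_ge0 ?powR_ge0 ?(ltW C10).
  by clear -hs' tb0; have := ler_wpM2r tb0 hs'; lra.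
by move=> x; exact: picard_ge0.
Qed.

End Majorant.

(** * The majorant in the other admissible spaces and in the space of the data *)

Section Estimates.
Context {R : realType} {N : nat}.
Hypothesis N0 : (0 < N)%N.
Local Notation X := (Rspace R N).
Implicit Types (x y z : X) (s t : R) (f : X -> \bar R).
Local Open Scope ereal_scope.
Variables (l al g qi nu rho : R).
Hypotheses (al0 : (0 < al)%R) (g0 : (0 < g)%R) (qi0 : (0 <= qi)%R)
  (gq : (g + N%:R * qi < N%:R)%R) (sub : (al * (N%:R * qi + g) < 2 + l)%R)
  (nug : (0 < nu < g)%R) (gs : (g < nu * (al + 1) - l)%R)
  (rhoq : (0 <= rho)%R /\ ((qi = 0 /\ rho = 0) \/ 0 < rho * (al + 1) < qi)%R)
  (low : (N%:R * qi + g < nu * (al + 1) - l + N%:R * (rho * (al + 1)) < N%:R)%R)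
  (other : forall d : R, (0 < d)%R -> (N%:R * qi + g + l < (al + 1) * d)%R ->
      (N%:R * (rho * (al + 1)) + nu * (al + 1) - l - d < 2)%R).

Let bt : R := (N%:R / 2 * (qi - rho) + (g - nu) / 2)%R.
Let kk : R := (1 - (al * (N%:R * qi + g) - l) / 2)%R.

Lemma rho_le_qi : (0 <= rho <= qi)%R.
Proof.
have [r0 h] := rhoq; rewrite r0/=; case: h => [[-> ->]//|/andP[_ h]].
by apply: (le_trans _ (ltW h)); rewrite ler_peMr// lerDr ltW.
Qed.

Lemma qi_ge0_lt1 : (0 <= qi < 1)%R.
Proof.
have N1 : (0 < N%:R :> R)%R by rewrite ltr0n.
by rewrite qi0/= -(ltr_pM2l N1) mulr1 (lt_trans _ gq)// ltrDr.
Qed.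

Lemma srcexp_gt0 : (0 < nu * (al + 1) - l)%R.
Proof. exact: lt_trans gs. Qed.

Lemma bt_ge0 : (0 <= bt)%R.
Proof.
have /andP[_ h] := rho_le_qi; have /andP[_ h'] := nug.
by rewrite addr_ge0 ?divr_ge0 ?mulr_ge0 ?subr_ge0// ltW.
Qed.

Lemma bt_src_lt1 : (0 <= bt * (al + 1) < 1)%R.
Proof.
rewrite mulr_ge0 ?bt_ge0 ?addr_ge0 ?(ltW al0)//=.
have /andP[lo _] := low.
have -> : (bt * (al + 1) = (al * (N%:R * qi + g) - l
     - (nu * (al + 1) - l + N%:R * (rho * (al + 1)) - (N%:R * qi + g))) / 2)%R.
  by rewrite /bt; field.
by rewrite ltr_pdivrMr//; have := sub; lra.
Qed.

Lemma majorant_exists : exists2 C : R, (0 < C)%R & forall (T L : R) (f : X -> \bar R),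
    (0 < T)%R -> (0 < L)%R ->
    (C * (L `^ al * T `^ kk) <= 1)%R ->
    measurable_fun setT f -> (forall y, 0 <= f y) -> bnd qi g f L ->
    exists2 M : R, (0 < M)%R & forall t, (0 < t <= T)%R ->
      bnd rho nu (majorant l al f t) (M * t `^ (- bt)).
Proof.
have [lo up] := andP low; have [nu0 nug'] := andP nug.
apply: majorant_estimate => //; first exact: rho_le_qi.
by rewrite !ltW.
Qed.

Lemma src_time_bnd (T M : R) (v : R -> X -> \bar R) : jmeas v ->
  (forall s y, 0 <= v s y) -> (0 < M)%R ->
  (forall t, (0 < t <= T)%R -> bnd rho nu (v t) (M * t `^ (- bt))) ->
  forall s, (0 < s <= T)%R -> bnd (rho * (al + 1)) (nu * (al + 1) - l)
     (src l al v s) (M `^ (al + 1) * s `^ (- (bt * (al + 1)))).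
Proof.
move=> mv v0 M0 vM s sT; have [r0 _] := rhoq.
have := bnd_src al0 r0 srcexp_gt0 _ mv v0 (vM s sT).
rewrite (@powRM _ M) ?(ltW M0) ?powR_ge0// -powRrM mulNr; apply.
by rewrite mulr_ge0 ?powR_ge0 ?(ltW M0).
Qed.

(** If p <= rho (al + 1), ordinary smoothing applies without loss. Otherwise [heat_bnd_local] is
    used; then the source exponent is positive, since for qi = 0 also p = 0. *)
Lemma heat_bnd_any (p w T e : R) : (0 <= p <= qi)%R -> (0 < w < g)%R ->
  (0 < T)%R -> (0 < e)%R ->
  let a0 := (N%:R / 2 * (rho * (al + 1) - p) + (nu * (al + 1) - l - w) / 2)%R in
  exists a C : R, [/\ (0 <= a < a0 + e)%R, (0 < C)%R &
    forall t f A, (0 < t <= T)%R -> (0 <= A)%R ->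
    measurable_fun setT f -> (forall y, 0 <= f y) ->
    bnd (rho * (al + 1)) (nu * (al + 1) - l) f A ->
    bnd p w (conv (hker t) f) (C * t `^ (- a) * A)].
Proof.
move=> /andP[p0 pq] /andP[w0 wg] T0 e0 a0.
have [lo up] := andP low; have [r0 rq] := rhoq.
have ws : (0 <= w <= nu * (al + 1) - l)%R by rewrite (ltW w0)/= ltW// (lt_trans wg).
have N1 : (0 < N%:R :> R)%R by rewrite ltr0n.
have /andP[_ qi1] := qi_ge0_lt1.
have [pr|rp] := leP p (rho * (al + 1))%R.
  have pr' : (0 <= p <= rho * (al + 1))%R by rewrite p0.
  have [C C0 HC] := heat_bnd N0 pr' ws up.
  exists a0, C; split => //.
    rewrite ltrDl e0 andbT addr_ge0 ?mulr_ge0 ?divr_ge0 ?subr_ge0// ?(ltW N1)//.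
    by case/andP: ws.
  by move=> t f A /andP[t0 _]; exact: HC.
have h1 : (rho * (al + 1) = p \/ 0 < rho * (al + 1) < p)%R.
  right; rewrite rp andbT; case: rq => [[q00 r00]|/andP[]//].
  by move: rp pq; rewrite q00 r00 mul0r => /lt_le_trans h /h; rewrite ltxx.
have h2 : (0 <= p < 1)%R by rewrite p0 (le_lt_trans pq).
have h4 : (w + N%:R * p < nu * (al + 1) - l + N%:R * (rho * (al + 1)) < N%:R)%R.
  rewrite up andbT (lt_trans _ lo)// addrC ler_ltD//.
  by rewrite ler_wpM2l// ltW.
exact: (heat_bnd_local N0 h1 h2 ws h4 T0 e0).
Qed.

(** The source is known from the auxiliary pair (rho, nu) alone, and a single heat estimate leads to
    (p, w). Its exponent is below 1 precisely by the clause [other], with d = N p + w. *)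
Lemma duh_bnd_other (p w T M : R) (v : R -> X -> \bar R) :
  (0 <= p <= qi)%R -> (0 < w < g)%R -> (N%:R * qi + g + l < (al + 1) * (N%:R * p + w))%R ->
  (0 < T)%R -> jmeas v -> (forall s y, 0 <= v s y) -> (forall s y, (s <= 0)%R -> v s y = 0) ->
  (0 < M)%R -> (forall t, (0 < t <= T)%R -> bnd rho nu (v t) (M * t `^ (- bt))) ->
  exists2 K : R, (0 < K)%R & forall t, (0 < t <= T)%R ->
    bnd p w (duh (fun s => hker (t - s)) (src l al v))
      (K * t `^ (- (N%:R / 2 * (qi - p) + (g - w) / 2))).
Proof.
move=> pq wg hd T0 mv v0 vN M0 vM; have [w0 wg'] := andP wg; have [p0 pq'] := andP pq.
have [lo up] := andP low; have [b0 b1] := andP bt_src_lt1.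
have N1 : (0 < N%:R :> R)%R by rewrite ltr0n.
have d0 : (0 < N%:R * p + w)%R by rewrite ltr_wpDl// mulr_ge0.
have h := other d0 hd.
set a0 := (N%:R / 2 * (rho * (al + 1) - p) + (nu * (al + 1) - l - w) / 2)%R.
have a01 : (a0 < 1)%R.
  have -> : a0 = ((N%:R * (rho * (al + 1)) + nu * (al + 1) - l - (N%:R * p + w)) / 2)%R.
    by rewrite /a0; field.
  by rewrite ltr_pdivrMr// mul1r.
have k0 : (0 < kk)%R by rewrite /kk; have := sub; lra.
(* e < 1 - a0 keeps the time singularity integrable; e < kk leaves a nonnegative power of t beside
   t^(-bt'), to be bounded by a power of T. *)
have [e [e0 _ e1 e2 _]] : exists e : R, [/\ (0 < e)%R, (0 < e)%R, (e < 1 - a0)%R, (e < kk)%R & (e < 1)%R].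
  by apply: exists_between; rewrite ?(subr_gt0 a0)//; exact: ltr01.
have [a [C [/andP[aa0 ae] C0 HC]]] := heat_bnd_any pq wg T0 e0.
rewrite -/a0 in ae.
have a1 : (0 <= a < 1)%R by rewrite aa0/= (lt_trans ae)//; lra.
have [K K0 HK] := integral_tker_le a1 bt_src_lt1.
set bt' := (N%:R / 2 * (qi - p) + (g - w) / 2)%R.
have abE : (1 - a0 - bt * (al + 1) = kk - bt')%R by rewrite /a0 /bt /kk /bt'; field.
have ex0 : (0 <= 1 - a - bt * (al + 1) + bt')%R.
  by lra.
have Mp : (0 < M `^ (al + 1))%R by rewrite powR_gt0.
have /andP[_ q1] := qi_ge0_lt1.
have p01 : (0 <= p <= 1)%R by rewrite p0 (le_trans pq')// ltW.
have sM := src_time_bnd mv v0 M0 vM.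
have sg0 s y : 0 <= src l al v s y by exact: src_ge0.
have sN s y : (s <= 0)%R -> src l al v s y = 0.
  by move=> s0; rewrite /src vN// poweR0r ?mule0// gt_eqF// addr_gt0.
have HD := duh_bnd_hker p01 C0 K0 Mp HC HK (jmeas_src l al mv) sg0 sN sM.
exists (2 * (C * M `^ (al + 1) * K) * T `^ (1 - a - bt * (al + 1) + bt'))%R.
  by rewrite !mulr_gt0 ?powR_gt0.
move=> t tT; have [t0 tT'] := andP tT.
have hk0 s (z : X) := hker_ge0 (t - s) z.
apply: (bnd_mono p0 _ (measurable_duh (jmeas_hker t) (jmeas_src l al mv) hk0 sg0)
  (fun x => duh_ge0 x hk0 sg0) (HD t tT)).
have c0 : (0 <= 2 * (C * M `^ (al + 1) * K))%R by rewrite !mulr_ge0 ?(ltW C0) ?(ltW K0) ?(ltW Mp).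
have -> : (2 * (C * M `^ (al + 1) * (K * t `^ (1 - a - bt * (al + 1)))) =
  2 * (C * M `^ (al + 1) * K) * t `^ (1 - a - bt * (al + 1)))%R by ring.
rewrite mulr_ge0 ?powR_ge0//= -(mulrA (2 * _)%R) ler_wpM2l//.
have -> : (1 - a - bt * (al + 1) = (1 - a - bt * (al + 1) + bt') + - bt')%R by ring.
rewrite [leLHS]powRD; last by rewrite (gt_eqF t0) implybT.
rewrite addrNK ler_wpM2r ?powR_ge0//.
by rewrite ge0_ler_powR ?nnegrE ?(ltW t0) ?(ltW T0).
Qed.

Lemma majorant_bnd_other (p w T M L : R) f :
  (0 <= p <= qi)%R -> (0 < w < g)%R -> (N%:R * qi + g + l < (al + 1) * (N%:R * p + w))%R ->
  (0 < T)%R -> (0 < L)%R -> measurable_fun setT f -> (forall y, 0 <= f y) -> bnd qi g f L ->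
  (0 < M)%R -> (forall t, (0 < t <= T)%R -> bnd rho nu (majorant l al f t) (M * t `^ (- bt))) ->
  exists2 K : R, (0 < K)%R & forall t, (0 < t <= T)%R ->
    bnd p w (majorant l al f t) (K * t `^ (- (N%:R / 2 * (qi - p) + (g - w) / 2))).
Proof.
move=> pq wg hd T0 L0 mf f0 fL M0 vM; have [w0 wg'] := andP wg; have [p0 pq'] := andP pq.
have mv := jmeas_majorant l al0 mf f0.
have v0 := majorant_ge0 l al f0.
have [K K0 HK] := duh_bnd_other pq wg hd T0 mv v0 (majorant_le0 l al0 f0) M0 vM.
have ww : (0 <= w <= g)%R by rewrite !ltW.
have [C C0 HC] := heat_bnd N0 pq ww gq.
have N1 : (0 < N%:R :> R)%R by rewrite ltr0n.
have /andP[_ q1] := qi_ge0_lt1.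
have p01 : (0 <= p <= 1)%R by rewrite p0 (le_trans pq')// ltW.
exists (4 * (C * L + K))%R; first by rewrite mulr_gt0// addr_gt0 ?mulr_gt0.
set bt' := (N%:R / 2 * (qi - p) + (g - w) / 2)%R in HC HK *.
move=> t tT; have [t0 tT'] := andP tT.
have hk0 s (z : X) := hker_ge0 (t - s) z.
have sg0 s y : 0 <= src l al (majorant l al f) s y by exact: src_ge0.
have q1' : (0 <= C * t `^ (- bt') * L)%R by rewrite !mulr_ge0 ?powR_ge0 ?(ltW C0) ?(ltW L0).
have q2 : (0 <= K * t `^ (- bt'))%R by rewrite !mulr_ge0 ?powR_ge0 ?(ltW K0).
have H := bndD p01 q1' q2 (jmeas_slice t (jmeas_lin mf f0))
  (measurable_duh (jmeas_hker t) (jmeas_src l al mv) hk0 sg0)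
  (fun x => lin_ge0 t x f0) (fun x => duh_ge0 x hk0 sg0) (HC t f L t0 (ltW L0) mf f0 fL) (HK t tT).
rewrite (_ : majorant l al f t = fun x => lin f t x + duh (fun s => hker (t - s)) (src l al (majorant l al f)) x); last first.
  by apply/funext => x; rewrite majorantE.
rewrite (_ : _ * _ = 4 * (C * t `^ (- bt') * L + K * t `^ (- bt')))%R; last by ring.
exact: H.
Qed.

(** In the space of the data the exponents a and b sum to (al (N qi + g) - l) / 2 < 1, so the
    Duhamel part carries positive powers: t^kap gives the behaviour at time 0 and (t - r)^eta the
    continuity afterwards. *)
Lemma duh_bnd_qg (T : R) : (0 < T)%R ->
  exists C kap eta : R, [/\ (0 < C)%R, (0 < kap)%R, (0 < eta)%R &
    forall (M : R) (v : R -> X -> \bar R), jmeas v -> (forall s y, 0 <= v s y) ->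
    (forall s y, (s <= 0)%R -> v s y = 0) -> (0 < M)%R ->
    (forall t, (0 < t <= T)%R -> bnd rho nu (v t) (M * t `^ (- bt))) ->
    (forall t, (0 < t <= T)%R ->
      bnd qi g (duh (fun s => hker (t - s)) (src l al v)) (C * M `^ (al + 1) * t `^ kap)) /\
    (forall r t, (0 < r < t)%R -> (t <= T)%R ->
      bnd qi g (duh (fun s => hdiff (t - s) (r - s)) (src l al v))
        (C * M `^ (al + 1) * (t - r) `^ eta))].
Proof.
move=> T0; have [r0 rq] := rhoq; have [lo up] := andP low; have [b0 b1] := andP bt_src_lt1.
have N1 : (0 < N%:R :> R)%R by rewrite ltr0n.
have /andP[_ q1] := qi_ge0_lt1.
have h1 : (rho * (al + 1) = qi \/ 0 < rho * (al + 1) < qi)%R.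
  by case: rq => [[-> ->]|]; [left; rewrite mul0r|right].
have h2 : (0 <= qi < 1)%R by rewrite qi0.
have h3 : (0 <= g <= nu * (al + 1) - l)%R by rewrite !ltW.
have h4 : (g + N%:R * qi < nu * (al + 1) - l + N%:R * (rho * (al + 1)) < N%:R)%R by rewrite addrC low.
have aE : (N%:R / 2 * (rho * (al + 1) - qi) + (nu * (al + 1) - l - g) / 2 =
  (nu * (al + 1) - l + N%:R * (rho * (al + 1)) - (N%:R * qi + g)) / 2)%R by field.
have h5 : (0 <= N%:R / 2 * (rho * (al + 1) - qi) + (nu * (al + 1) - l - g) / 2)%R.
  by rewrite aE divr_ge0// subr_ge0 ltW.
have h6 : (N%:R / 2 * (rho * (al + 1) - qi) + (nu * (al + 1) - l - g) / 2 + bt * (al + 1) < 1)%R.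
  have -> : (N%:R / 2 * (rho * (al + 1) - qi) + (nu * (al + 1) - l - g) / 2 + bt * (al + 1) =
     (al * (N%:R * qi + g) - l) / 2)%R by rewrite /bt; field.
  by rewrite ltr_pdivrMr//; have := sub; lra.
have [C [kap [eta [C0 kap0 eta0 H]]]] := duh_bnd_local N0 h1 h2 h3 h4 T0 b0 h5 h6.
exists C, kap, eta; split; [exact: C0|exact: kap0|exact: eta0|move=> M v mv v0 vN M0 vM].
have Mp : (0 < M `^ (al + 1))%R by rewrite powR_gt0.
apply: (H _ _ (jmeas_src l al mv) _ _ Mp (src_time_bnd mv v0 M0 vM)).
- by move=> s y; exact: src_ge0.
- by move=> s y s0; rewrite /src vN// poweR0r ?mule0// gt_eqF// addr_gt0.
Qed.

Lemma lin_bnd_diff : exists2 C : R, (0 < C)%R & forall s t f A, (0 < s < t)%R ->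
  (0 <= A)%R -> measurable_fun setT f -> (forall y, 0 <= f y) -> bnd qi g f A ->
  bnd qi g (conv (hdiff t s) f) (C * ((t - s) / s) * A).
Proof.
have qq : (0 <= qi <= qi)%R by rewrite qi0 lexx.
have gg : (0 <= g <= g)%R by rewrite (ltW g0) lexx.
have [C C0 HC] := heat_bnd N0 qq gg gq; have [L L0 HL] := @conv_hdiff_bnd R N.
exists (8 * L * C)%R; first by rewrite !mulr_gt0.
move=> s t f A st A0 mf f0 fA; have [s0 st'] := andP st.
have t20 : (0 < 2 * t)%R by rewrite mulr_gt0// (lt_trans s0).
have := HC s f A s0 A0 mf f0 fA; have := HC (2 * t)%R f A t20 A0 mf f0 fA.
rewrite !subrr mulr0 mul0r addr0 oppr0 !powRr0 mulr1 => H2 H1.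
have qi1 : (0 <= qi <= 1)%R.
  have N1 : (0 < N%:R :> R)%R by rewrite ltr0n.
  rewrite qi0/= -(ler_pM2l N1) mulr1 (le_trans _ (ltW gq))// lerDr ltW//.
have CA : (0 <= C * A)%R by rewrite mulr_ge0// ltW.
have eta01 : (0 <= (1 : R) <= 1)%R by rewrite ler01 lexx.
have := HL qi g s t 1%R f (C * A)%R (C * A)%R qi1 st eta01 CA CA mf f0 H1 H2.
have u0 : (0 <= (t - s) / s)%R by rewrite divr_ge0 ?subr_ge0 ?(ltW s0) ?(ltW st').
rewrite powRr1//; congr bnd; ring.
Qed.

End Estimates.

(** * The signed solution *)

Section OddPower.
Context {R : realType}.
Local Open Scope ring_scope.

Definition opow (al a : R) : R := `|a| `^ al * a.

Lemma opowE_ge0 al a : 0 < al -> 0 <= a -> opow al a = a `^ (al + 1).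
Proof.
move=> al0 a0; rewrite /opow ger0_norm//.
have [->|an0] := eqVneq a 0; first by rewrite mulr0 powR0// gt_eqF// addr_gt0.
by rewrite powRD ?powRr1// an0 implybT.
Qed.

Lemma opowN al a : opow al (- a) = - opow al a.
Proof. by rewrite /opow normrN mulrN. Qed.

Lemma opow_mono al a b : 0 < al -> a < b -> opow al a < opow al b.
Proof.
move=> al0; have al1 : 0 < al + 1 by rewrite addr_gt0.
have pos x y : 0 <= x -> x < y -> opow al x < opow al y.
  move=> x0 xy; rewrite !opowE_ge0 ?(le_trans x0 (ltW xy))//.
  by rewrite gt0_ltr_powR ?nnegrE ?(le_trans x0 (ltW xy)).
move=> ab; have [a0|a0] := leP 0 a; first exact: pos.
have [b0|b0] := leP b 0.
  by rewrite -[a]opprK -[b]opprK !(opowN _ (- _)) ltrN2 pos ?ltrN2 ?oppr_ge0.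
apply: (@lt_trans _ _ 0).
  by rewrite pmulr_rlt0// powR_gt0// normr_gt0 lt_eqF.
by rewrite mulr_gt0// powR_gt0// normr_gt0 gt_eqF.
Qed.

Lemma opow_le al a b : 0 < al -> a <= b -> opow al a <= opow al b.
Proof.
by move=> al0; rewrite le_eqVlt => /predU1P[->//|ab]; rewrite ltW// opow_mono.
Qed.

(** Lets a bound on the source be turned into a bound on the unknown, in the proof of continuity
    from below. *)
Lemma opow_surj al d : 0 < al -> exists h, opow al h = d.
Proof.
move=> al0; have al1 : al + 1 != 0 by rewrite gt_eqF// addr_gt0.
have pos c : 0 <= c -> opow al (c `^ (al + 1)^-1) = c.
  by move=> c0; rewrite opowE_ge0 ?powR_ge0// -powRrM mulVf// powRr1.
have [d0|d0] := leP 0 d; first by exists (d `^ (al + 1)^-1); exact: pos.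
by exists (- ((- d) `^ (al + 1)^-1)); rewrite opowN pos ?opprK// oppr_ge0 ltW.
Qed.

Lemma normr_opow al a : 0 < al -> `|opow al a| = `|a| `^ (al + 1).
Proof.
move=> al0; rewrite -opowE_ge0// /opow normr_id normrM.
by rewrite (ger0_norm (powR_ge0 _ _)).
Qed.

Lemma measurable_opow d (T : measurableType d) al (f : T -> R) :
  measurable_fun setT f -> measurable_fun setT (fun x => opow al (f x)).
Proof.
move=> mf; apply: measurable_funM => //.
by apply: measurable_powRf; exact: measurableT_comp.
Qed.

End OddPower.

Section SignedSource.
Context {R : realType} {N : nat}.
Local Notation X := (Rspace R N).
Implicit Types (x y z : X) (s t : R) (f : X -> \bar R).
Local Open Scope ereal_scope.

(* [U] stands for [u + v] with [|u| <= v]: this is [u], capped at [|u| <= v], and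
   equal to the junk value [0] where [v = +oo]. *)
Definition dev (v U : \bar R) : R := (fine (mine U (2 * fine v)%:E) - fine v)%R.

Definition shift_src (l al : R) (v : R -> X -> \bar R) s y (U : \bar R) : \bar R :=
  (enorm y `^ l * (fine (v s y) `^ (al + 1) + opow al (dev (v s y) U)))%:E.

Lemma fine_mine_bounds (a : R) (U : \bar R) : (0 <= a)%R -> 0 <= U ->
  (0 <= fine (mine U (2 * a)%:E) <= 2 * a)%R.
Proof.
move=> a0; have a20 : (0 <= 2 * a)%R by rewrite mulr_ge0.
case: U => [r| |]//; last by move=> _; rewrite min_r ?leey//= a20 lexx.
rewrite lee_fin => r0; rewrite -EFin_min /=.
by rewrite le_min r0 a20/= ge_min lexx orbT.
Qed.

Lemma fin_num_mine (a : R) (U : \bar R) : (0 <= a)%R -> 0 <= U ->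
  mine U (2 * a)%:E \is a fin_num.
Proof.
move=> a0 U0; have m0 : 0 <= mine U (2 * a)%:E by rewrite le_min U0 lee_fin mulr_ge0.
by rewrite ge0_fin_numE// gt_min ltry orbT.
Qed.

Lemma dev_bound v U : 0 <= v -> 0 <= U -> (`|dev v U| <= fine v)%R.
Proof.
move=> v0 U0; have /andP[h1 h2] := fine_mine_bounds (fine_ge0 v0) U0.
by rewrite /dev ler_norml; move: h1 h2; set a := fine v; set b := fine _; lra.
Qed.

Lemma dev_le v U U' : 0 <= v -> 0 <= U -> U <= U' -> (dev v U <= dev v U')%R.
Proof.
move=> v0 U0 UU'; rewrite lerB// fine_le//.
- by rewrite fin_num_mine// fine_ge0.
- by rewrite fin_num_mine ?fine_ge0// (le_trans U0).
- by rewrite le_min ge_min UU' /= ge_min lexx orbT.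
Qed.

Variables (l al : R) (v : R -> X -> \bar R).
Hypotheses (al0 : (0 < al)%R) (mv : jmeas v) (v0 : forall s y, 0 <= v s y).
Let al1 : (0 < al + 1)%R. Proof. by rewrite addr_gt0. Qed.

Lemma shift_src_ge0 s y U : 0 <= U -> 0 <= shift_src l al v s y U.
Proof.
move=> U0; rewrite lee_fin mulr_ge0 ?powR_ge0//.
have := dev_bound (v0 s y) U0; rewrite ler_norml => /andP[h _].
have := opow_le al0 h; rewrite opowN (opowE_ge0 al0 (fine_ge0 (v0 s y))); lra.
Qed.

Lemma le_shift_src s y U U' : 0 <= U -> U <= U' ->
  shift_src l al v s y U <= shift_src l al v s y U'.
Proof.
move=> U0 UU'; rewrite lee_fin ler_wpM2l ?powR_ge0// lerD2l.
by rewrite opow_le// dev_le.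
Qed.

Lemma shift_src_le s y U : 0 <= U -> shift_src l al v s y U <= 2%:E * src l al v s y.
Proof.
move=> U0; rewrite /src; have := v0 s y; rewrite /shift_src => vsy0.
have : (fine (v s y) `^ (al + 1) + opow al (dev (v s y) U) <= 2 * fine (v s y) `^ (al + 1))%R.
  have := dev_bound vsy0 U0; rewrite ler_norml => /andP[_ h].
  by have := opow_le al0 h; rewrite (opowE_ge0 al0 (fine_ge0 vsy0)); lra.
case: (v s y) vsy0 => [a| |]//= a0 h.
  by rewrite -!EFinM lee_fin mulrCA ler_wpM2l ?powR_ge0.
rewrite /dev/= mulr0 subr0 min_r ?leey//=.
by rewrite powR0 ?gt_eqF// add0r /opow mulr0 mulr0 mule_ge0// mule_ge0 ?poweR_ge0// lee_fin powR_ge0.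
Qed.

Lemma jmeas_dev (U : R -> X -> \bar R) : jmeas U -> jmeas (fun s y => dev (v s y) (U s y)).
Proof.
move=> mU; have mf : jmeas (fun s y => fine (v s y)).
  by apply: (measurableT_comp _ mv); exact: fine_measurable.
apply: measurable_funB => //.
apply: (@measurableT_comp _ _ _ _ _ _ fine); first exact: fine_measurable.
by apply: measurable_mine => //; apply: measurable_EFinf; exact: measurable_funM.
Qed.

Lemma jmeas_shift_src (U : R -> X -> \bar R) : jmeas U ->
  jmeas (fun s y => shift_src l al v s y (U s y)).
Proof.
move=> mU; apply: measurable_EFinf; apply: measurable_funM.
  by apply: measurable_powRf; apply: measurable_enorm_comp; exact: measurable_snd.
apply: measurable_funD; last by apply: measurable_opow; exact: jmeas_dev.
apply: measurable_powRf; apply: (measurableT_comp _ mv); exact: fine_measurable.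
Qed.

(** Continuity from below without limits: if the source at the supremum exceeded D, invert the odd
    power at level D to get k. Then the supremum, hence some [U n], exceeds k + v while staying
    compatible with the cap, contradicting the bound for that n. *)
Lemma shift_src_sup s y (U : nat -> \bar R) D : (forall n, 0 <= U n) ->
  (forall n, U n <= U n.+1) ->
  (forall n, shift_src l al v s y (U n) <= D) ->
  shift_src l al v s y (ereal_sup (range U)) <= D.
Proof.
move=> U0 _ h; rewrite leNgt; apply/negP => Dlt.
have US0 : 0 <= ereal_sup (range U).
  by apply: (le_trans (U0 0%N)); apply: ereal_sup_ubound; exists 0%N.
have [c0|c0] := eqVneq (enorm y `^ l)%R 0%R.
  by move: Dlt (h 0%N); rewrite /shift_src c0 !mul0r => /lt_le_trans H /H; rewrite ltxx.
have cp : (0 < enorm y `^ l)%R by rewrite lt_neqAle eq_sym c0 powR_ge0.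
case: D h Dlt => [d| |] h Dlt; last 2 first.
- by move: Dlt; rewrite ltNge leey.
- by have := h 0%N; rewrite leNgt ltNyr.
set a := fine (v s y) in h Dlt *; have a0 : (0 <= a)%R by exact: fine_ge0.
have [k kE] := opow_surj (d / enorm y `^ l - a `^ (al + 1)) al0.
have hn n : (dev (v s y) (U n) <= k)%R.
  rewrite leNgt; apply/negP => /(opow_mono al0); apply/negP; rewrite -leNgt kE.
  have := h n; rewrite lee_fin mulrC -ler_pdivlMr// -/a; lra.
have hs : (k < dev (v s y) (ereal_sup (range U)))%R.
  rewrite ltNge; apply/negP => /(opow_le al0); apply/negP; rewrite -ltNge kE.
  move: Dlt; rewrite lte_fin mulrC -ltr_pdivrMr// -/a; lra.
have /andP[_ b2] := fine_mine_bounds a0 US0.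
have bfin := fin_num_mine a0 US0.
have kb : (k + a)%:E < mine (ereal_sup (range U)) (2 * a)%:E.
  by rewrite -(fineK bfin) lte_fin; move: hs; rewrite /dev -/a; lra.
move: kb; rewrite lt_min => /andP[/ereal_sup_gt[_ [n _ <-] kn] k2].
have := hn n; rewrite leNgt => /negP; apply; rewrite /dev -/a ltrBrDr -lte_fin fineK.
  by rewrite lt_min kn k2.
exact: fin_num_mine.
Qed.

End SignedSource.

Section PosNegParts.
Context {T : Type} {R : realType}.
Local Open Scope ereal_scope.
Implicit Type h : T -> R.

Definition posp h y : \bar R := (Num.max (h y) 0%R)%:E.
Definition negp h y : \bar R := (Num.max (- h y)%R 0%R)%:E.
Definition absp h y : \bar R := `|h y|%:E.

Lemma posp_ge0 h y : 0 <= posp h y.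
Proof. by rewrite lee_fin le_max lexx orbT. Qed.

Lemma negp_ge0 h y : 0 <= negp h y.
Proof. by rewrite lee_fin le_max lexx orbT. Qed.

Lemma abspE h y : absp h y = posp h y + negp h y.
Proof.
rewrite -EFinD /absp; congr EFin; case: (leP 0%R (h y)) => h0.
  have -> : Num.max (- h y)%R 0%R = 0%R by apply/max_idPr; rewrite oppr_le0.
  by rewrite ger0_norm// addr0.
have -> : Num.max (- h y)%R 0%R = (- h y)%R by apply/max_idPl; rewrite oppr_ge0 ltW.
by rewrite ltr0_norm// add0r.
Qed.

Lemma posp_le h y : posp h y <= absp h y.
Proof. by rewrite abspE leeDl// negp_ge0. Qed.

Lemma negp_le h y : negp h y <= absp h y.
Proof. by rewrite abspE leeDr// posp_ge0. Qed.

Lemma posp_sub_negp h y : posp h y - negp h y = (h y)%:E.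
Proof.
rewrite -EFinB; congr EFin; case: (leP 0%R (h y)) => h0.
  have -> : Num.max (- h y)%R 0%R = 0%R by apply/max_idPr; rewrite oppr_le0.
  by rewrite subr0.
have -> : Num.max (- h y)%R 0%R = (- h y)%R by apply/max_idPl; rewrite oppr_ge0 ltW.
by rewrite sub0r opprK.
Qed.

End PosNegParts.

Lemma measurable_posp d (T : measurableType d) (R : realType) (h : T -> R) :
  measurable_fun setT h -> measurable_fun setT (posp h).
Proof. by move=> mh; apply: measurable_EFinf; exact: measurable_maxr. Qed.

Lemma measurable_negp d (T : measurableType d) (R : realType) (h : T -> R) :
  measurable_fun setT h -> measurable_fun setT (negp h).
Proof.
move=> mh; apply: measurable_EFinf; apply: measurable_maxr => //.
exact: measurableT_comp.
Qed.

Lemma measurable_absp d (T : measurableType d) (R : realType) (h : T -> R) :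
  measurable_fun setT h -> measurable_fun setT (absp h).
Proof. by move=> mh; apply: measurable_EFinf; exact: measurableT_comp. Qed.

(** The arithmetic of [sol_formula]: a, b are the linear parts of phi+ and phi-, c, d the Duhamel
    parts of the positive and negative nonlinearity, e that of the majorant's source and h that of
    the shifted source. Finiteness of V makes every term finite, and then U - V = (a - b) + (h - e)
    = (a - b) + (c - d). *)
Lemma dev_arith (R : realType) (a b c d e h V U : \bar R) :
  (0 <= a -> 0 <= b -> 0 <= c -> 0 <= d -> 0 <= h ->
  h + d = c + e -> c <= e -> d <= e -> V = a + b + e -> V < +oo ->
  U = 2%:E * a + h -> U <= 2%:E * V ->
  [/\ a < +oo, b < +oo, c < +oo, d < +oo &
    dev V U = (fine a - fine b + (fine c - fine d))%R])%E.
Proof.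
case: a => [a| |]//; case: b => [b| |]//; case: c => [c| |]//; case: d => [d| |]//;
case: e => [e| |]//; case: h => [h| |]// _ _ _ _ _ // hE _ _ -> // _ ->.
rewrite -!EFinM -!EFinD lee_fin => hU; rewrite !ltry; split => //.
rewrite /dev /= min_l ?lee_fin//=.
by case: hE; lra.
Qed.

(** * The shifted equation and the representation of the signed solution *)

Section SignedSolution.
Context {R : realType} {N : nat}.
Local Notation mu := (lebesgueN R N).
Local Notation X := (Rspace R N).
Implicit Types (x y z : X) (s t : R).
Local Open Scope ereal_scope.
Variables (l al : R) (phi : X -> R).
Hypotheses (al0 : (0 < al)%R) (mphi : measurable_fun setT phi).

Definition dom : R -> X -> \bar R := majorant l al (absp phi).

(* [U = u + v] solves an equation whose source [|y|^l (v^(al+1) + |u|^al u)] is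
   nonnegative and nondecreasing in [U], so monotone iteration applies again; the
   linear part is [e^(t Delta) (phi + |phi|) = 2 e^(t Delta) phi^+]. *)
Definition shifted : R -> X -> \bar R :=
  picsol (shift_src l al dom) (fun t x => 2%:E * lin (posp phi) t x).

Definition sol t x : R := dev (dom t x) (shifted t x).

Let al1 : (0 < al + 1)%R. Proof. by rewrite addr_gt0. Qed.
Let mabs := measurable_absp mphi.
Let mpos := measurable_posp mphi.
Let mneg := measurable_negp mphi.
Let abs0 y : 0 <= absp phi y. Proof. by rewrite lee_fin. Qed.
Let pos0 := posp_ge0 phi.
Let neg0 := negp_ge0 phi.
Let hk0 t s (z : X) := hker_ge0 (t - s) z.

Lemma jmeas_dom : jmeas dom. Proof. exact: jmeas_majorant. Qed.
Lemma dom_ge0 t x : 0 <= dom t x. Proof. exact: majorant_ge0. Qed.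
Lemma dom_le0 t x : (t <= 0)%R -> dom t x = 0. Proof. exact: majorant_le0. Qed.
Lemma domE t x : dom t x =
  lin (absp phi) t x + duh (fun s => hker (t - s)) (src l al dom) x.
Proof. exact: majorantE. Qed.

Let mS (u : R -> X -> \bar R) : jmeas u -> (forall s y, 0 <= u s y) ->
  jmeas (fun s y => shift_src l al dom s y (u s y)).
Proof. by move=> mu0 u0; apply: jmeas_shift_src => //; exact: jmeas_dom. Qed.
Let mA : jmeas (fun t x => 2%:E * lin (posp phi) t x).
Proof. by apply: measurable_funeM; exact: jmeas_lin. Qed.
Let A0 t x : 0 <= 2%:E * lin (posp phi) t x.
Proof. by rewrite mule_ge0// lin_ge0. Qed.
Let S0 s y a : 0 <= a -> 0 <= shift_src l al dom s y a.
Proof. by move=> a0; apply: shift_src_ge0 => //; exact: dom_ge0. Qed.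
Let leS s y a b : 0 <= a -> a <= b -> shift_src l al dom s y a <= shift_src l al dom s y b.
Proof. by move=> a0 ab; apply: le_shift_src => //; exact: dom_ge0. Qed.

Lemma jmeas_shifted : jmeas shifted.
Proof. exact: jmeas_picsol. Qed.

Lemma shifted_ge0 t x : 0 <= shifted t x.
Proof. exact: picsol_ge0. Qed.

Definition shsrc s y : \bar R := shift_src l al dom s y (shifted s y).

Lemma jmeas_shsrc : jmeas shsrc.
Proof. by apply: mS; [exact: jmeas_shifted|exact: shifted_ge0]. Qed.

Lemma shsrc_ge0 s y : 0 <= shsrc s y.
Proof. by apply: S0; exact: shifted_ge0. Qed.

Lemma shiftedE t x : shifted t x =
  2%:E * lin (posp phi) t x + duh (fun s => hker (t - s)) shsrc x.
Proof.
rewrite {1}/shifted picsolE// => s y a D a0 nda h.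
by apply: shift_src_sup => //; exact: dom_ge0.
Qed.

Lemma duhZ (k : R -> X -> R) (c : R) (w : R -> X -> \bar R) x : (0 <= c)%R ->
  jmeas k -> jmeas w -> (forall s z, 0 <= k s z)%R -> (forall s y, 0 <= w s y) ->
  duh k (fun s y => c%:E * w s y) x = c%:E * duh k w x.
Proof.
move=> c0 mk mw k0 w0; rewrite /duh -ge0_integralZl//.
- apply: eq_integral => s _; rewrite convZ//; last exact: jmeas_slice.
  exact: (measurableT_comp mk (measurable_pair1 s)).
- exact: measurable_conv_time.
- by move=> s _; exact: conv_ge0.
Qed.

Lemma ae_eq_conv (k : X -> R) (f g : X -> \bar R) x : measurable_fun setT k ->
  measurable_fun setT f -> measurable_fun setT g -> (forall z, 0 <= k z)%R ->
  (forall y, 0 <= f y) -> (forall y, 0 <= g y) -> {ae mu, forall y, f y = g y} ->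
  conv k f x = conv k g x.
Proof.
move=> mk mf mg k0 f0 g0 fg; apply/eqP; rewrite eq_le; apply/andP; split.
  by apply: ae_le_conv => //; apply: ae_mono fg => y ->.
by apply: ae_le_conv => //; apply: ae_mono fg => y ->.
Qed.

Lemma duhD (k : R -> X -> R) (g h : R -> X -> \bar R) x : jmeas k -> jmeas g -> jmeas h ->
  (forall s z, 0 <= k s z)%R -> (forall s y, 0 <= g s y) -> (forall s y, 0 <= h s y) ->
  duh k (fun s y => g s y + h s y) x = duh k g x + duh k h x.
Proof.
move=> mk mg mh k0 g0 h0; rewrite /duh -ge0_integralD//.
- apply: eq_integral => s _; rewrite convD//; try exact: jmeas_slice.
  exact: (measurableT_comp mk (measurable_pair1 s)).
- by move=> s _; exact: conv_ge0.
- exact: measurable_conv_time.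
- by move=> s _; exact: conv_ge0.
- exact: measurable_conv_time.
Qed.

(** Hence the cap in [dev] never acts where v is finite, and [sol] is there the true difference U -
    v. It holds along the iteration, since phi+ <= |phi| and the shifted source is at most twice
    that of v. *)
Lemma shifted_le t x : shifted t x <= 2%:E * dom t x.
Proof.
have md := jmeas_dom; have d0 := dom_ge0.
have msrc := jmeas_src l al md.
have src0 s y : 0 <= src l al dom s y by exact: src_ge0.
have mP := jmeas_picard mA A0 mS S0.
have D0 : 0 <= duh (fun s => hker (t - s)) (src l al dom) x by apply: duh_ge0 => //; exact: hk0.
apply: esupn_le => n; rewrite domE ge0_muleDr ?lin_ge0//.
elim: n => [|n _] /=; first by rewrite adde_ge0// mule_ge0// lin_ge0.
rewrite /picstep; apply: leeD.
  rewrite lee_wpmul2l// /lin; apply: le_conv => //; first exact: measurable_hker.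
  - exact: measurable_hker.
  - by move=> z; exact: hker_ge0.
  - by move=> y; exact: posp_le.
rewrite -(duhZ x (ler0n R 2) (jmeas_hker t) msrc (hk0 t) src0); apply: le_duh.
- exact: jmeas_hker.
- by apply: (mS (mP n)) => s y; exact: picard_ge0.
- exact: measurable_funeM.
- exact: hk0.
- by move=> s y; apply: S0; exact: picard_ge0.
- by move=> s y; apply: shift_src_le => //; exact: picard_ge0.
Qed.

Lemma jmeas_sol : jmeas sol.
Proof. by apply: jmeas_dev; [exact: jmeas_dom|exact: jmeas_shifted]. Qed.

Lemma sol_bound t x : (`|sol t x| <= fine (dom t x))%R.
Proof. by apply: dev_bound; [exact: dom_ge0|exact: shifted_ge0]. Qed.

Lemma sol_le0 t x : (t <= 0)%R -> sol t x = 0%R.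
Proof.
by move=> t0; apply/eqP; rewrite -normr_le0; have := sol_bound t x; rewrite dom_le0.
Qed.

Definition nl s y : R := nonlin al l (sol s) y.

Lemma nlE s y : nl s y = (enorm y `^ l * opow al (sol s y))%R.
Proof. by []. Qed.

Lemma jmeas_nl : jmeas nl.
Proof.
apply: measurable_funM; last by apply: measurable_opow; exact: jmeas_sol.
by apply: measurable_powRf; apply: measurable_enorm_comp; exact: measurable_snd.
Qed.

Lemma nl_le0 s y : (s <= 0)%R -> nl s y = 0%R.
Proof. by move=> s0; rewrite nlE sol_le0// /opow !mulr0. Qed.

Lemma absp_nl_le s y : absp (nl s) y <= src l al dom s y.
Proof.
rewrite /absp nlE normrM normr_opow// ger0_norm ?powR_ge0// EFinM.
rewrite /src lee_wpmul2l ?lee_fin ?powR_ge0//.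
have d0 := dom_ge0 s y; have := sol_bound s y.
case: (dom s y) d0 => [a| |]//= a0 h.
  by rewrite lee_fin ge0_ler_powR ?nnegrE ?(ltW al1).
by rewrite gt_eqF// leey.
Qed.

(** The relation source of U = nonlinearity + source of v, with the negative part moved across, so
    that both sides are nonnegative and can be convolved. *)
Lemma shsrc_nl s y : dom s y < +oo ->
  shsrc s y + negp (nl s) y = posp (nl s) y + src l al dom s y.
Proof.
have d0 := dom_ge0 s y; move=> dfin.
have E : shsrc s y = (nl s y)%:E + src l al dom s y.
  rewrite /shsrc /shift_src nlE /src /sol.
  case: (dom s y) d0 dfin => [a| |]//= a0 _.
  by rewrite -EFinM -EFinD; congr EFin; ring.
rewrite E -(posp_sub_negp (nl s)) -addeA [src _ _ _ _ _ + _]addeC addeA subeK//.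
Qed.

Lemma jmeas_posp_nl : jmeas (fun s => posp (nl s)).
Proof. exact: (measurable_posp jmeas_nl). Qed.

Lemma jmeas_negp_nl : jmeas (fun s => negp (nl s)).
Proof. exact: (measurable_negp jmeas_nl). Qed.

(** Only the point (t, x) itself needs a finite majorant; at earlier times finiteness almost
    everywhere is enough, because convolutions ignore null sets. *)
Lemma sol_formula t x : dom t x < +oo ->
  (forall s, (0 < s < t)%R -> {ae mu, forall y, dom s y < +oo}) ->
  let Dp := duh (fun s => hker (t - s)) (fun s => posp (nl s)) x in
  let Dm := duh (fun s => hker (t - s)) (fun s => negp (nl s)) x in
  [/\ lin (posp phi) t x < +oo, lin (negp phi) t x < +oo, Dp < +oo, Dm < +oo &
   sol t x = (fine (lin (posp phi) t x) - fine (lin (negp phi) t x) + (fine Dp - fine Dm))%R].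
Proof.
move=> dfin aefin Dp Dm.
have jp := jmeas_posp_nl; have jm := jmeas_negp_nl; have jd := jmeas_dom.
have js := jmeas_src l al jd; have jh := jmeas_shsrc.
have p0 s y : 0 <= posp (nl s) y by exact: posp_ge0.
have m0 s y : 0 <= negp (nl s) y by exact: negp_ge0.
have s0 s y : 0 <= src l al dom s y by exact: src_ge0.
have ae_fin s : (s < t)%R -> {ae mu, forall y, dom s y < +oo}.
  move=> st; have [s0'|s0'] := leP s 0%R; last by apply: aefin; rewrite s0'.
  by apply: aeW => y; rewrite dom_le0.
have mk s : measurable_fun setT (hker (t - s) : X -> R) by exact: measurable_hker.
set Ds := duh (fun s => hker (t - s)) (src l al dom) x.
set Dh := duh (fun s => hker (t - s)) shsrc x.
have E : Dh + Dm = Dp + Ds.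
  rewrite -[LHS](duhD x (jmeas_hker t) jh jm (hk0 t) shsrc_ge0 m0).
  rewrite -[RHS](duhD x (jmeas_hker t) jp js (hk0 t) p0 s0).
  apply: eq_integral => s _.
  have [ts|st] := leP t s.
    by rewrite !conv0//; right => z; rewrite hker0// subr_le0.
  have ea := ae_fin s st.
  apply: ae_eq_conv => //.
  - exact: (emeasurable_funD (jmeas_slice s jh) (jmeas_slice s jm)).
  - exact: (emeasurable_funD (jmeas_slice s jp) (jmeas_slice s js)).
  - by move=> y; apply: adde_ge0; [exact: shsrc_ge0|exact: m0].
  - by move=> y; apply: adde_ge0; [exact: p0|exact: s0].
  - by apply: ae_mono ea => y dy; exact: shsrc_nl.
have lp0 := lin_ge0 t x pos0; have lm0 := lin_ge0 t x neg0.
have lE : lin (absp phi) t x = lin (posp phi) t x + lin (negp phi) t x.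
  rewrite /lin -(convD x (measurable_hker t) mpos mneg (@hker_ge0 R N t) pos0 neg0).
  by apply: eq_conv => y; exact: abspE.
have Dp0 : 0 <= Dp := duh_ge0 x (hk0 t) p0.
have Dm0 : 0 <= Dm := duh_ge0 x (hk0 t) m0.
have Ds0 : 0 <= Ds := duh_ge0 x (hk0 t) s0.
have Dh0 : 0 <= Dh := duh_ge0 x (hk0 t) shsrc_ge0.
have DE := domE t x; rewrite -/Ds lE in DE.
have DpS : Dp <= Ds.
  apply: (le_duh x (jmeas_hker t) jp js (hk0 t) p0).
  by move=> s y; exact: le_trans (posp_le _ _) (absp_nl_le s y).
have DmS : Dm <= Ds.
  apply: (le_duh x (jmeas_hker t) jm js (hk0 t) m0).
  by move=> s y; exact: le_trans (negp_le _ _) (absp_nl_le s y).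
exact: (dev_arith lp0 lm0 Dp0 Dm0 Dh0 E DpS DmS DE dfin (shiftedE t x) (shifted_le t x)).
Qed.

End SignedSolution.

Section TimeIntegralSigned.
Context {R : realType}.
Local Notation leb := (@lebesgue_measure R).
Local Notation TR := (measurableTypeR R).
Local Open Scope ereal_scope.

Lemma ae_neq_point (a : R) : {ae leb, forall s, s != a}.
Proof.
exists [set a]; split => //; first exact: lebesgue_measure_set1.
by move=> s /= /negP; rewrite negbK => /eqP.
Qed.

(** Passes from two finite nonnegative integrals over the line to the absolutely convergent integral
    over [0, t] required by [mild_at]. *)
Lemma time_integral_signed (t P M : R) (cp cm : R -> \bar R) (q : R -> R) :
  (0 < t)%R -> measurable_fun [set: TR] cp -> measurable_fun [set: TR] cm ->
  (forall s, 0 <= cp s) -> (forall s, 0 <= cm s) ->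
  (forall s, ~~ (0 < s < t)%R -> cp s = 0 /\ cm s = 0) ->
  \int[leb]_s cp s = P%:E -> \int[leb]_s cm s = M%:E ->
  (forall s, (0 < s < t)%R -> q s = fine (cp s - cm s)) ->
  leb.-integrable `[0%R, t] (fun s => (q s)%:E) /\
  (\int[leb]_(s in `[0, t]) q s)%R = (P - M)%R.
Proof.
move=> t0 mp mm p0 m0 out iP iM qE.
have ip : leb.-integrable setT cp.
  by apply/integrableP; split => //; under eq_integral do rewrite gee0_abs//; rewrite iP ltry.
have im : leb.-integrable setT cm.
  by apply/integrableP; split => //; under eq_integral do rewrite gee0_abs//; rewrite iM ltry.
have ipm := integrableB measurableT ip im.
pose f := (fun s => (q s)%:E) \_ `[0%R, t].
(* The integrand is prescribed only inside (0, t). At s = t the heat operator is the identity and at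
   s = 0 the value is arbitrary, so the two endpoints are kept as explicit values; they do not
   affect the integral. *)
have fE : f = fun s => (if (0 < s)%R && (s < t)%R then fine (cp s - cm s) else
    if s == 0%R then q 0%R else if s == t then q t else 0%R)%:E.
  apply/funext => s; rewrite /f patchE mem_setE in_itv/=.
  have [->|s0] := eqVneq s 0%R; first by rewrite ltxx lexx (ltW t0).
  have [->|st] := eqVneq s t; first by rewrite ltxx andbF lexx (ltW t0).
  rewrite !le_eqVlt eq_sym (negbTE s0) (negbTE st) /=; case: ifPn => // h.
  by rewrite qE.
have mf : measurable_fun [set: TR] f.
  rewrite fE; apply: measurable_EFinf; apply: measurable_fun_ifT.
  - by apply: measurable_and; exact: measurable_fun_ltr.
  - apply: (@measurableT_comp _ _ _ _ _ _ fine); first exact: fine_measurable.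
    exact: emeasurable_funB.
  - by do 2! (apply: measurable_fun_ifT => //; first exact: measurable_fun_eqr).
have fae : ae_eq leb setT f (fun s => cp s - cm s).
  have h1 := integrable_ae measurableT ip; have h2 := integrable_ae measurableT im.
  apply: ae_mono (ae_and (ae_and h1 h2) (ae_and (ae_neq_point 0%R) (ae_neq_point t))).
  move=> s [[/(_ I) fp /(_ I) fm] [s0 st]] _; rewrite fE (negbTE s0) (negbTE st).
  case: ifPn => [_|h]; first by rewrite fineK// fin_numB fp fm.
  by have [-> ->] := out s h; rewrite sube0.
have ifn : leb.-integrable setT f.
  apply/integrableP; split => //.
  have /integrableP[mpm fin] := ipm.
  have -> : \int[leb]_s `|f s| = \int[leb]_s `|cp s - cm s|.
    apply: ae_eq_integral => //.
    - exact: measurableT_comp.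
    - exact: measurableT_comp.
    - by apply: ae_mono fae => s h /h ->.
  exact: fin.
split; first by apply/integrable_mkcond.
rewrite /Rintegral integral_mkcond -/f.
have -> : \int[leb]_s f s = \int[leb]_s (cp s - cm s).
  by apply: ae_eq_integral => //; case/integrableP: ipm.
by rewrite integralB// iP iM.
Qed.

End TimeIntegralSigned.

Lemma fineK_ge0 (R : realType) (a : \bar R) : (0 <= a -> a < +oo -> (fine a)%:E = a)%E.
Proof. by case: a => [a| |]. Qed.

Lemma fineB_ge0 (R : realType) (a b : \bar R) : (0 <= a -> a < +oo -> 0 <= b -> b < +oo ->
  fine (a - b) = (fine a - fine b)%R)%E.
Proof. by case: a b => [a| |] [b| |]. Qed.

Section Mild.
Context {R : realType} {N : nat}.
Local Notation mu := (lebesgueN R N).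
Local Notation X := (Rspace R N).
Implicit Types (x y z : X) (s t : R).
Local Open Scope ereal_scope.

(** The kernel is nonnegative, so it passes through positive and negative parts. *)
Lemma heatE (h : X -> R) t x : (0 < t)%R -> measurable_fun setT h ->
  heat t h x = fine (lin (posp h) t x - lin (negp h) t x).
Proof.
move=> t0 mh; rewrite /heat (gt_eqF t0) /Rintegral integralE; congr (fine (_ - _)).
  apply: eq_integral => y _; rewrite funeposE /posp hkerE//.
  rewrite -EFin_max -EFinM; congr EFin.
  by rewrite maxr_pMr ?mulr0// -hkerE// hker_ge0.
apply: eq_integral => y _; rewrite funenegE /negp hkerE//.
rewrite -EFinN -EFin_max -EFinM; congr EFin.
by rewrite -mulrN maxr_pMr ?mulr0// -hkerE// hker_ge0.
Qed.

Lemma ae_eq_heat (h h' : X -> R) t x : (0 < t)%R -> measurable_fun setT h ->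
  measurable_fun setT h' -> {ae mu, forall y, h y = h' y} -> heat t h x = heat t h' x.
Proof.
move=> t0 mh mh' hh'; rewrite !heatE//; congr (fine (_ - _)); apply: ae_eq_conv.
- exact: measurable_hker.
- exact: measurable_posp.
- exact: measurable_posp.
- by move=> z; exact: hker_ge0.
- exact: posp_ge0.
- exact: posp_ge0.
- by apply: ae_mono hh' => y; rewrite /posp => ->.
- exact: measurable_hker.
- exact: measurable_negp.
- exact: measurable_negp.
- by move=> z; exact: hker_ge0.
- exact: negp_ge0.
- exact: negp_ge0.
- by apply: ae_mono hh' => y; rewrite /negp => ->.
Qed.

(** [phi0] is the given datum and [phi] a representative for which the bounds hold everywhere; [w]
    agrees with the constructed solution only at positive times, because its value at time 0 will be
    [phi0]. *)
Lemma sol_mild (l al : R) (phi phi0 : X -> R) (w : R -> X -> R) t : (0 < al)%R ->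
  measurable_fun setT phi -> measurable_fun setT phi0 ->
  {ae mu, forall y, phi0 y = phi y} -> (0 < t)%R ->
  (forall s, (0 < s)%R -> w s = sol l al phi s) ->
  (forall s, (0 < s <= t)%R -> {ae mu, forall y, dom l al phi s y < +oo}) ->
  mild_at al l phi0 w t.
Proof.
move=> al0 mphi mphi0 pp t0 wE aefin.
have aet : {ae mu, forall y, dom l al phi t y < +oo} by apply: aefin; rewrite t0 lexx.
apply: ae_mono aet => x dx.
have [lp lm fp fm sE] := sol_formula al0 mphi dx (fun s h =>
  aefin s (introT andP (conj (proj1 (andP h)) (ltW (proj2 (andP h)))))).
set Dp := duh _ (fun s => posp _) x in fp sE; set Dm := duh _ (fun s => negp _) x in fm sE.
have jp := jmeas_posp_nl l al0 mphi; have jm := jmeas_negp_nl l al0 mphi.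
have hk0 s (z : X) := hker_ge0 (t - s) z.
have p0 s y : 0 <= posp (nl l al phi s) y by exact: posp_ge0.
have m0 s y : 0 <= negp (nl l al phi s) y by exact: negp_ge0.
have Dp0 : 0 <= Dp by exact: duh_ge0.
have Dm0 : 0 <= Dm by exact: duh_ge0.
have KDp := fineK_ge0 Dp0 fp.
have KDm := fineK_ge0 Dm0 fm.
have := @time_integral_signed R t (fine Dp) (fine Dm)
  (fun s => conv (hker (t - s)) (posp (nl l al phi s)) x)
  (fun s => conv (hker (t - s)) (negp (nl l al phi s)) x)
  (fun s => heat (t - s) (nonlin al l (w s)) x) t0.
move=> /(_ (measurable_conv_time x (jmeas_hker t) jp hk0 p0)).
move=> /(_ (measurable_conv_time x (jmeas_hker t) jm hk0 m0)).
move=> /(_ (fun s => conv_ge0 x (hk0 s) (p0 s)) (fun s => conv_ge0 x (hk0 s) (m0 s))).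
case.
- move=> s; rewrite negb_and -!leNgt => /orP[s0|ts]; split; apply: conv0.
  + by left => y; rewrite /posp nl_le0// maxxx.
  + by left => y; rewrite /negp nl_le0// oppr0 maxxx.
  + by right => z; rewrite hker0// subr_le0.
  + by right => z; rewrite hker0// subr_le0.
- exact: esym KDp.
- exact: esym KDm.
- move=> s /andP[s0 st]; rewrite heatE ?subr_gt0//; last first.
    rewrite wE//; exact: (measurableT_comp (jmeas_nl l al0 mphi) (measurable_pair1 s)).
  by rewrite wE.
move=> ii iE; split; first exact: ii.
rewrite iE (wE t t0) sE (ae_eq_heat x t0 mphi0 mphi pp) (heatE x t0 mphi).
by rewrite (fineB_ge0 (lin_ge0 t x (posp_ge0 phi)) lp (lin_ge0 t x (negp_ge0 phi)) lm).
Qed.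

End Mild.

Lemma fine_dist_le (R : realType) (a b d : \bar R) : (0 <= a -> a < +oo -> 0 <= b -> b < +oo ->
  a <= b + d -> b <= a + d -> `|fine a - fine b|%:E <= d)%E.
Proof.
case: a b => [a| |] [b| |]//= _ _ _ _; case: d => [d| |]//.
by rewrite -!EFinD !lee_fin => h1 h2; rewrite ler_norml; apply/andP; split; lra.
by move=> _ _; exact: leey.
Qed.

(** * Continuity in time *)

Section Differences.
Context {R : realType} {N : nat}.
Local Notation mu := (lebesgueN R N).
Local Notation X := (Rspace R N).
Implicit Types (x y z : X) (s t r : R).
Local Open Scope ereal_scope.

Lemma hker_le_hdiff t r z : (hker t z <= hker r z + hdiff t r z)%R.
Proof. by rewrite -lerBlDl ler_norm. Qed.

Lemma hdiffC t r : hdiff t r = hdiff r t :> (X -> R).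
Proof. by apply/funext => z; rewrite /hdiff distrC. Qed.

Lemma lin_dist_le (f : X -> \bar R) t r x : measurable_fun setT f -> (forall y, 0 <= f y) ->
  lin f t x < +oo -> lin f r x < +oo ->
  `|fine (lin f t x) - fine (lin f r x)|%:E <= conv (hdiff t r) f x.
Proof.
move=> mf f0 ft fr.
have k0 t' := @hker_ge0 R N t'; have d0 t' r' := @hdiff_ge0 R N t' r'.
have mk t' := @measurable_hker R N t'; have md t' r' := @measurable_hdiff R N t' r'.
have key t' r' : lin f t' x <= lin f r' x + conv (hdiff t' r') f x.
  rewrite /lin -convDl//; apply: le_conv => //; first exact: measurable_funD.
  by move=> z; exact: hker_le_hdiff.
have kr := key r t; rewrite hdiffC in kr.
exact: (fine_dist_le (lin_ge0 t x f0) ft (lin_ge0 r x f0) fr (key t r) kr).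
Qed.

Lemma duh_dist_le (g : R -> X -> \bar R) t r x : jmeas g -> (forall s y, 0 <= g s y) ->
  duh (fun s => hker (t - s)) g x < +oo -> duh (fun s => hker (r - s)) g x < +oo ->
  `|fine (duh (fun s => hker (t - s)) g x) - fine (duh (fun s => hker (r - s)) g x)|%:E <=
    duh (fun s => hdiff (t - s) (r - s)) g x.
Proof.
move=> mg g0 ft fr.
have k0 t' s (z : X) := hker_ge0 (t' - s) z; have d0 t' r' s (z : X) := hdiff_ge0 (t' - s) (r' - s) z.
have mk t' := @jmeas_hker R N t'; have md t' r' := @jmeas_hdiff R N t' r'.
have key t' r' : duh (fun s => hker (t' - s)) g x <=
    duh (fun s => hker (r' - s)) g x + duh (fun s => hdiff (t' - s) (r' - s)) g x.
  rewrite -(duhDl x (mk r') (md t' r') mg (k0 r') (d0 t' r') g0).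
  have mkd : jmeas (fun s (z : X) => hker (r' - s) z + hdiff (t' - s) (r' - s) z)%R.
    exact: (measurable_funD (mk r') (md t' r')).
  apply: ge0_le_integral => //.
  - by move=> s _; exact: conv_ge0.
  - exact: (measurable_conv_time x (mk t') mg (k0 t') g0).
  - by apply: (measurable_conv_time x mkd mg _ g0) => s z; rewrite addr_ge0.
  - move=> s _; apply: le_conv => //.
    + exact: measurable_hker.
    + by apply: measurable_funD; [exact: measurable_hker|exact: measurable_hdiff].
    + exact: jmeas_slice.
    + exact: jmeas_slice.
    + by move=> z; exact: hker_le_hdiff.
have hE : (fun s => hdiff (r - s) (t - s)) = (fun s => hdiff (t - s) (r - s)) :> (R -> X -> R).
  by apply/funext => s; rewrite hdiffC.
have kr := key r t; rewrite hE in kr.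
exact: (fine_dist_le (duh_ge0 x (k0 t) g0) ft (duh_ge0 x (k0 r) g0) fr (key t r) kr).
Qed.

Lemma norm4_le (a a' b b' c c' d d' : R) (A B C D E F : \bar R) :
  `|a - a'|%:E <= A -> `|b - b'|%:E <= B -> `|c - c'|%:E <= C -> `|d - d'|%:E <= D ->
  A + B <= E -> C + D <= F ->
  `|a - b + (c - d) - (a' - b' + (c' - d'))|%:E <= E + F.
Proof.
move=> hA hB hC hD hE hF.
apply: (@le_trans _ _ (`|a - a'|%:E + `|b - b'|%:E + (`|c - c'|%:E + `|d - d'|%:E))); last first.
  by apply: leeD; [apply: le_trans hE|apply: le_trans hF]; apply: leeD.
rewrite -!EFinD lee_fin.
rewrite (_ : _ - _ = (a - a') - (b - b') + ((c - c') - (d - d')))%R; last by ring.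
by apply: (le_trans (ler_normD _ _)); apply: lerD; exact: ler_normB.
Qed.

Section Solution.
Variables (l al : R) (phi : X -> R).
Hypotheses (al0 : (0 < al)%R) (mphi : measurable_fun setT phi).
Local Notation u := (sol l al phi).
Local Notation v := (dom l al phi).

Lemma src_nl_split (k : R -> X -> R) x : jmeas k -> (forall s z, 0 <= k s z)%R ->
  duh k (fun s => posp (nl l al phi s)) x + duh k (fun s => negp (nl l al phi s)) x <=
  duh k (src l al v) x.
Proof.
move=> mk k0.
have jp := jmeas_posp_nl l al0 mphi; have jm := jmeas_negp_nl l al0 mphi.
have p0 s y : 0 <= posp (nl l al phi s) y by exact: posp_ge0.
have m0 s y : 0 <= negp (nl l al phi s) y by exact: negp_ge0.
rewrite -(duhD x mk jp jm k0 p0 m0).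
have mpm : jmeas (fun s y => posp (nl l al phi s) y + negp (nl l al phi s) y).
  exact: (emeasurable_funD jp jm).
apply: (le_duh x mk mpm (jmeas_src l al (jmeas_dom l al0 mphi)) k0) => s y.
  exact: adde_ge0.
by rewrite -abspE; exact: absp_nl_le.
Qed.

(** The four differences in [sol_formula] are bounded by kernel differences separately and
    recombined, positive with negative parts, into |phi| and the source of v. *)
Lemma sol_dist_le r t x : (0 < r < t)%R ->
  (forall s, (0 < s <= t)%R -> {ae mu, forall y, v s y < +oo}) ->
  v t x < +oo -> v r x < +oo ->
  `|u t x - u r x|%:E <= conv (hdiff t r) (absp phi) x +
     duh (fun s => hdiff (t - s) (r - s)) (src l al v) x.
Proof.
move=> /andP[r0 rt] aefin vt vr.
have ae1 s : (0 < s < t)%R -> {ae mu, forall y, v s y < +oo}.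
  by move=> /andP[s0 st]; apply: aefin; rewrite s0 ltW.
have ae2 s : (0 < s < r)%R -> {ae mu, forall y, v s y < +oo}.
  by move=> /andP[s0 st]; apply: aefin; rewrite s0 ltW// (lt_trans st).
have [lpt lmt Dpt Dmt ->] := sol_formula al0 mphi vt ae1.
have [lpr lmr Dpr Dmr ->] := sol_formula al0 mphi vr ae2.
have jp := jmeas_posp_nl l al0 mphi; have jm := jmeas_negp_nl l al0 mphi.
have p0 s y : 0 <= posp (nl l al phi s) y by exact: posp_ge0.
have m0 s y : 0 <= negp (nl l al phi s) y by exact: negp_ge0.
have h1 := lin_dist_le (measurable_posp mphi) (posp_ge0 phi) lpt lpr.
have h2 := lin_dist_le (measurable_negp mphi) (negp_ge0 phi) lmt lmr.
have h3 := duh_dist_le jp p0 Dpt Dpr.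
have h4 := duh_dist_le jm m0 Dmt Dmr.
have hd0 s (z : X) := hdiff_ge0 (t - s) (r - s) z.
have h6 := src_nl_split x (jmeas_hdiff t r) hd0.
have h5 : conv (hdiff t r) (posp phi) x + conv (hdiff t r) (negp phi) x <=
    conv (hdiff t r) (absp phi) x.
  rewrite -(convD x (measurable_hdiff t r) (measurable_posp mphi) (measurable_negp mphi)
    (@hdiff_ge0 R N t r) (posp_ge0 phi) (negp_ge0 phi)).
  rewrite (@eq_conv R N _ _ (absp phi))// => y; exact: esym (abspE phi y).
exact: (norm4_le h1 h2 h3 h4 h5 h6).
Qed.

Lemma sol_lin_dist_le t x : (0 < t)%R ->
  (forall s, (0 < s <= t)%R -> {ae mu, forall y, v s y < +oo}) -> v t x < +oo ->
  lin (absp phi) t x < +oo /\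
  `|u t x - heat t phi x|%:E <= duh (fun s => hker (t - s)) (src l al v) x.
Proof.
move=> t0 aefin vt.
have ae1 s : (0 < s < t)%R -> {ae mu, forall y, v s y < +oo}.
  by move=> /andP[s0 st]; apply: aefin; rewrite s0 ltW.
have [lp lm Dp Dm ->] := sol_formula al0 mphi vt ae1.
have hk0 s (z : X) := hker_ge0 (t - s) z.
have p0 s y : 0 <= posp (nl l al phi s) y by exact: posp_ge0.
have m0 s y : 0 <= negp (nl l al phi s) y by exact: negp_ge0.
split.
  apply: le_lt_trans vt; rewrite domE// leeDl//; apply: (duh_ge0 x hk0) => s y.
  exact: src_ge0.
rewrite heatE// (fineB_ge0 (lin_ge0 t x (posp_ge0 phi)) lp (lin_ge0 t x (negp_ge0 phi)) lm).
apply: le_trans (src_nl_split x (jmeas_hker t) hk0).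
move: Dp Dm (duh_ge0 x hk0 p0) (duh_ge0 x hk0 m0).
case: (duh _ _ x) => [a| |]//; case: (duh _ _ x) => [b| |]// _ _ a0 b0.
rewrite -EFinD lee_fin /= addrC addKr (le_trans (ler_normB _ _))//.
by rewrite !ger0_norm.
Qed.

End Solution.

End Differences.

Transparent bnd.

(** * Comparison of the bounds with the norms of the theorem *)

Section WeightedNorms.
Context {R : realType} {N : nat}.
Hypothesis N0 : (0 < N)%N.
Local Notation mu := (lebesgueN R N).
Local Notation X := (Rspace R N).
Implicit Types (x y z : X) (g A : R).
Local Open Scope ereal_scope.

(** The norm of exponent +oo is an essential supremum only on a space of positive measure. A null
    space could not carry a heat kernel of mass 1. *)
Lemma lebesgueN_gt0 : 0 < mu [set: X].
Proof.
rewrite lt_neqAle measure_ge0 andbT eq_sym; apply/eqP => mu0.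
have := @integral_hker R N 1%R [tuple 0%R | i < N] ltr01.
suff -> : \int[mu]_y (hker 1 (vsub [tuple 0%R | i < N] y))%:E = 0.
  by move/eqP; rewrite eq_sym; apply/negP; rewrite gt_eqF.
by apply: null_set_integral => //; exact: measurable_EFinf (measurable_hker_vsub _ _).
Qed.

Lemma rinvE (p : R) : (1 < p)%R -> rinv p%:E = p^-1%R.
Proof. by move=> p1; rewrite /rinv inver (gt_eqF (lt_trans ltr01 p1)). Qed.

Lemma rinvy : rinv +oo = 0%R :> R.
Proof. by rewrite /rinv invey. Qed.

Lemma wnorm_le q g (h : X -> R) (W : X -> \bar R) A : 1 < q -> measurable_fun setT h ->
  measurable_fun setT W -> (forall x, 0 <= W x) -> {ae mu, forall x, `|h x|%:E <= W x} ->
  (0 <= A)%R -> bnd (rinv q) g W A -> wnorm q g h <= A%:E.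
Proof.
move=> q1 mh mW W0 hW A0; have hm x : `|h x|%:E <= W x ->
    `|(enorm x `^ g * h x)%:E| <= wmul g W x.
  move=> hx; rewrite abse_EFin normrM ger0_norm ?powR_ge0// EFinM.
  by rewrite lee_wpmul2l ?lee_fin ?powR_ge0.
have mwh : measurable_fun setT (fun x => (enorm x `^ g * h x)%:E).
  by apply: measurable_EFinf; apply: measurable_funM => //; exact: measurable_powR_enorm.
rewrite /wnorm unlock /Lnorm; case: q q1 => [p| |]//.
- rewrite lte_fin => p1; rewrite rinvE// /bnd.
  have p0 : (0 < p)%R := lt_trans ltr01 p1.
  rewrite gt_eqF ?invr_gt0// invrK => H.
  rewrite -[leRHS]poweRe1 ?lee_fin// -[X in _ <= _ `^ X](mulfV (lt0r_neq0 p0)) poweRrM.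
  apply: le_poweR; rewrite ?invr_ge0 ?(ltW p0)//.
    by apply: integral_ge0 => x _; exact: poweR_ge0.
  rewrite poweR_EFin; apply: le_trans H; apply: ae_ge0_le_integral => //.
  + by move=> x _; exact: poweR_ge0.
  + by apply: measurable_poweRf; exact: measurableT_comp.
  + by move=> x _; exact: poweR_ge0.
  + by apply: measurable_poweRf; exact: measurable_wmul.
  + apply: ae_mono hW => x hx _; apply: le_poweR; rewrite ?(ltW p0)//; exact: hm.
- move=> _; rewrite rinvy /bnd eqxx => H; rewrite lebesgueN_gt0.
  apply/ess_supP; apply: ae_mono hW => x hx; exact: le_trans (hm x hx) (H x).
Qed.

(** For q = +oo the norm controls the function only almost everywhere, while [bnd] with exponent 0
    asks for a bound everywhere; the function is set to 0 where the bound fails. *)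
Lemma wnorm_representative q g (h : X -> R) A : 1 < q -> measurable_fun setT h ->
  (0 <= A)%R -> wnorm q g h <= A%:E ->
  exists h', [/\ measurable_fun setT h', {ae mu, forall x, h x = h' x} &
    bnd (rinv q) g (absp h') A].
Proof.
move=> q1 mh A0; rewrite /wnorm unlock /Lnorm.
have hE x : `|(enorm x `^ g * h x)%:E| = wmul g (absp h) x.
  by rewrite abse_EFin normrM ger0_norm ?powR_ge0// EFinM.
case: q q1 => [p| |]//.
- rewrite lte_fin => p1 H; have p0 : (0 < p)%R := lt_trans ltr01 p1.
  exists h; split => //; first exact: aeW.
  rewrite rinvE// /bnd gt_eqF ?invr_gt0// invrK.
  under eq_integral do rewrite -hE.
  rewrite -[leLHS]poweRe1; last by apply: integral_ge0 => x _; exact: poweR_ge0.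
  rewrite -[X in _ `^ X <= _](mulVf (lt0r_neq0 p0)) poweRrM -poweR_EFin.
  by apply: le_poweR H; rewrite ?(ltW p0) ?poweR_ge0.
- move=> _; rewrite lebesgueN_gt0 => /ess_supP H.
  exists (fun x => if (enorm x `^ g * `|h x| <= A)%R then h x else 0%R); split.
  + apply: measurable_fun_ifT => //; apply: measurable_fun_ler => //.
    by apply: measurable_funM; [exact: measurable_powR_enorm|exact: measurableT_comp].
  + apply: ae_mono H => x Hx; have := Hx; rewrite /= -abse_EFin hE /wmul /absp -EFinM lee_fin.
    by move=> ->.
  + rewrite rinvy /bnd eqxx => x; rewrite /wmul /absp -EFinM lee_fin.
    by case: ifPn => //; rewrite normr0 mulr0.
Qed.

Lemma bnd_ae_fin rho g (f : X -> \bar R) A : (0 <= rho)%R -> measurable_fun setT f ->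
  (forall x, 0 <= f x) -> bnd rho g f A -> {ae mu, forall x, f x < +oo}.
Proof.
move=> r0 mf f0; have key x : (0 < enorm x)%R -> wmul g f x < +oo -> f x < +oo.
  move=> ex; rewrite /wmul; have := f0 x; case: (f x) => [a _ _| _ |]//; first exact: ltry.
  by rewrite gt0_muley ?lte_fin ?powR_gt0.
rewrite /bnd; case: ifPn => [_ H|rn0 H].
  apply: ae_mono (ae_enorm_gt0 N0) => x ex; apply: key => //.
  by apply: le_lt_trans (H x) _; rewrite ltry.
have rp : (0 < rho^-1)%R by rewrite invr_gt0 lt_neqAle eq_sym rn0.
have mw : measurable_fun setT (fun x => wmul g f x `^ rho^-1).
  by apply: measurable_poweRf; exact: measurable_wmul.
have ii : mu.-integrable setT (fun x => wmul g f x `^ rho^-1).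
  apply/integrableP; split => //; apply: le_lt_trans (ltry (A `^ rho^-1)%R).
  by under eq_integral do rewrite gee0_abs ?poweR_ge0//.
apply: ae_mono (ae_and (ae_enorm_gt0 N0) (integrable_ae measurableT ii)) => x [ex /(_ I) fx].
apply: key => //; have := wmul_ge0 g f0 x; move: fx; case: (wmul g f x) => [a| |]//.
  by rewrite ltry.
by rewrite poweRyr// gt_eqF.
Qed.

End WeightedNorms.

Opaque bnd.

(** * Strong continuity of the heat semigroup at time zero *)

Section Vanishing.
Context {R : realType}.
Local Open Scope ereal_scope.
Implicit Types (F G H : R -> \bar R).

(** A one-sided limit 0 at time 0. The requirement [d <= 1] allows using estimates that hold only
    for times up to 1. *)
Definition vanishes F := forall e : R, (0 < e)%R ->
  exists2 d : R, (0 < d <= 1)%R & forall t, (0 < t < d)%R -> F t <= e%:E.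

Lemma vanishes_le2 (c : R) F G H : (0 < c)%R ->
  (forall t, (0 < t <= 1)%R -> F t <= c%:E * (G t + H t)) ->
  (forall t, 0 <= G t) -> (forall t, 0 <= H t) ->
  vanishes G -> vanishes H -> vanishes F.
Proof.
move=> c0 FGH G0 H0 vG vH e e0.
have e2 : (0 < e / (2 * c))%R by rewrite divr_gt0 ?mulr_gt0.
have [d1 /andP[d10 d11] h1] := vG _ e2; have [d2 /andP[d20 d21] h2] := vH _ e2.
exists (Num.min d1 d2) => [|t]; first by rewrite lt_min d10 d20 ge_min d11.
rewrite lt_min => /andP[t0 /andP[td1 td2]].
apply: le_trans (FGH t _) _; first by rewrite t0/= (le_trans (ltW td1)).
apply: (@le_trans _ _ (c%:E * ((e / (2 * c))%:E + (e / (2 * c))%:E))).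
  rewrite lee_wpmul2l ?lee_fin ?(ltW c0)//; apply: leeD; [apply: h1|apply: h2]; exact/andP.
by rewrite -EFinD -EFinM lee_fin le_eqVlt; apply/orP; left; apply/eqP; field; rewrite gt_eqF.
Qed.

Lemma vanishes0 : vanishes (fun=> 0).
Proof. by move=> e e0; exists 1%R; [rewrite ltr01 lexx|move=> t _; rewrite lee_fin ltW]. Qed.

Lemma vanishes_powR (C k : R) : (0 < k)%R -> vanishes (fun t => (C * t `^ k)%:E).
Proof.
move=> k0 e e0.
have C1 : (0 < `|C| + 1)%R by rewrite ltr_pwDr.
have q0 : (0 < e / (`|C| + 1))%R by rewrite divr_gt0.
exists (Num.min 1 ((e / (`|C| + 1)) `^ k^-1))%R.
  by rewrite lt_min ltr01 powR_gt0//= ge_min lexx.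
move=> t; rewrite lt_min => /andP[t0 /andP[_ td]]; rewrite lee_fin.
have tk : (t `^ k <= e / (`|C| + 1))%R.
  rewrite -[leRHS]powRr1 ?(ltW q0)// -[X in (_ <= _ `^ X)%R](mulVf (lt0r_neq0 k0)) powRrM.
  by rewrite ge0_ler_powR ?nnegrE ?powR_ge0 ?(ltW k0) ?(ltW t0) ?(ltW td).
apply: (@le_trans _ _ ((`|C| + 1) * t `^ k)%R).
  by rewrite ler_wpM2r ?powR_ge0// (le_trans (ler_norm _))// lerDl.
by rewrite mulrC -ler_pdivlMr.
Qed.

Lemma vanishes_tail F (c : R) : (0 < c)%R -> (forall e : R, (0 < e)%R -> exists G : R -> \bar R,
    [/\ vanishes G, (forall t, 0 <= G t) & forall t, (0 < t <= 1)%R -> F t <= c%:E * (G t + e%:E)]) ->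
  vanishes F.
Proof.
move=> c0 h e e0; have e2 : (0 < e / (2 * c))%R by rewrite divr_gt0 ?mulr_gt0.
have [G [vG G0 FG]] := h _ e2; have [d /andP[d0 d1] hd] := vG _ e2.
exists d => [|t /andP[t0 td]]; first by rewrite d0.
apply: le_trans (FG t _) _; first by rewrite t0/= (le_trans (ltW td)).
apply: (@le_trans _ _ (c%:E * ((e / (2 * c))%:E + (e / (2 * c))%:E))).
  by rewrite lee_wpmul2l ?lee_fin ?(ltW c0)// leeD2r// hd// t0.
by rewrite -EFinD -EFinM lee_fin le_eqVlt; apply/orP; left; apply/eqP; field; rewrite gt_eqF.
Qed.

End Vanishing.

(** Monotone convergence in the form of a small integral of the remainder; the integral of F is
    finite and can be subtracted. *)
Lemma monotone_tail d (T : measurableType d) (R : realType)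
    (m : {measure set T -> \bar R}) (f : nat -> T -> R) (F : T -> R) (e : R) :
  (forall n, measurable_fun setT (f n)) -> measurable_fun setT F ->
  (forall n x, 0 <= f n x)%R -> (forall n x, f n x <= f n.+1 x)%R ->
  (forall n x, f n x <= F x)%R ->
  (forall x, (F x)%:E <= ereal_sup (range (fun n => (f n x)%:E)))%E ->
  (\int[m]_x (F x)%:E < +oo)%E -> (0 < e)%R ->
  exists n, (\int[m]_x (F x - f n x)%:E <= e%:E)%E.
Proof.
move=> mf mF f0 ndf fF supF Foo e0.
have F0 x : (0 <= F x)%R := le_trans (f0 0%N x) (fF 0%N x).
have mfE n : measurable_fun setT (EFin \o f n) by exact: measurable_EFinf.
have supE : (fun x => (F x)%:E) = esupn (fun n x => (f n x)%:E).
  apply/funext => x; apply/eqP; rewrite eq_le supF/=.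
  by apply: esupn_le => n; rewrite lee_fin.
have := @integral_esupn _ _ _ m (fun n x => (f n x)%:E) mfE.
move=> /(_ (fun n x => f0 n x) (fun n x => ndf n x)); rewrite -supE => iE.
have iF0 : (0 <= \int[m]_x (F x)%:E)%E by apply: integral_ge0 => x _; rewrite lee_fin.
have fin : (\int[m]_x (F x)%:E)%E \is a fin_num by rewrite ge0_fin_numE.
have : (\int[m]_x (F x)%:E - e%:E < ereal_sup (range (fun n => \int[m]_x (f n x)%:E)))%E.
  by rewrite -iE lteBlDr// lteDl// lte_fin.
move=> /ereal_sup_gt[_ [n _ <-] hn]; exists n.
have ifn : (\int[m]_x (f n x)%:E <= \int[m]_x (F x)%:E)%E.
  apply: ge0_le_integral => //.
  - by move=> x _; rewrite lee_fin.
  - exact: mfE.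
  - exact: measurable_EFinf.
  - by move=> x _; rewrite lee_fin.
have fn0 : (0 <= \int[m]_x (f n x)%:E)%E by apply: integral_ge0 => x _; rewrite lee_fin.
have ffin : (\int[m]_x (f n x)%:E)%E \is a fin_num.
  by rewrite ge0_fin_numE// (le_lt_trans ifn).
have E : (\int[m]_x (F x)%:E = \int[m]_x (f n x)%:E + \int[m]_x (F x - f n x)%:E)%E.
  rewrite -ge0_integralD//.
  - by apply: eq_integral => x _; rewrite -EFinD subrKC.
  - by move=> x _; rewrite lee_fin.
  - exact: mfE.
  - by move=> x _; rewrite lee_fin subr_ge0.
  - by apply: measurable_EFinf; exact: measurable_funB.
have i0 : (0 <= \int[m]_x (F x - f n x)%:E)%E.
  by apply: integral_ge0 => x _; rewrite lee_fin subr_ge0.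
move: E hn fin ffin i0 {iE iF0 ifn fn0 Foo}.
case: (\int[m]_x (F x)%:E)%E => [a| |]//; case: (\int[m]_x (f n x)%:E)%E => [b| |]//.
case: (\int[m]_x (F x - f n x)%:E)%E => [c| |]// [->].
by rewrite -EFinB lte_fin lee_fin => h _ _ _; rewrite ltrBlDr ltrD2l in h; exact: ltW.
Qed.

(** * Mean oscillation and a slowly varying weight *)

Section Oscillation.
Context {R : realType} {N : nat}.
Hypothesis N0 : (0 < N)%N.
Local Notation mu := (lebesgueN R N).
Local Notation X := (Rspace R N).
Implicit Types (x y z : X) (t : R) (h : X -> R).
Local Open Scope ereal_scope.

(* The mean oscillation bounds [|e^(t Delta) h - h|], and unlike the latter it is
   monotone under contractions of [h]. *)
Definition osc h t x : \bar R := conv (hker t) (fun y => `|h y - h x|%:E) x.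

Lemma osc_ge0 h t x : 0 <= osc h t x.
Proof. by apply: conv_ge0 => [z|y]; [exact: hker_ge0|rewrite lee_fin]. Qed.

Lemma measurable_osc h t : measurable_fun setT h -> measurable_fun setT (osc h t).
Proof.
move=> mh; rewrite /osc /conv.
apply: (measurable_int_param (h := fun x y => (hker t (vsub x y))%:E * `|h y - h x|%:E)).
- apply: emeasurable_funM; apply: measurable_EFinf.
    by apply: measurable_hker_comp => //; apply: measurable_vsub_comp.
  apply: measurableT_comp => //; apply: measurable_funB.
    exact: (measurableT_comp mh measurable_snd).
  exact: (measurableT_comp mh measurable_fst).
- by move=> x y; rewrite mule_ge0 ?lee_fin ?hker_ge0.
Qed.

Lemma measurable_osc_slice h x : measurable_fun setT h ->
  measurable_fun setT (fun y => `|h y - h x|%:E).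
Proof.
by move=> mh; apply: measurable_EFinf; apply: measurableT_comp => //; exact: measurable_funB.
Qed.

Lemma osc_le2 h h1 h2 t x : measurable_fun setT h -> measurable_fun setT h1 ->
  measurable_fun setT h2 ->
  (forall x y, `|h y - h x| <= `|h1 y - h1 x| + `|h2 y - h2 x|)%R ->
  osc h t x <= osc h1 t x + osc h2 t x.
Proof.
move=> mh m1 m2 hh; have k0 := @hker_ge0 R N t; have mk := @measurable_hker R N t.
rewrite /osc -convD//; try exact: measurable_osc_slice.
apply: le_conv => //; try exact: measurable_osc_slice.
  by apply: emeasurable_funD; exact: measurable_osc_slice.
by move=> y; rewrite -EFinD lee_fin.
Qed.

Lemma osc_crude h t x : (0 < t)%R -> measurable_fun setT h ->
  osc h t x <= conv (hker t) (absp h) x + absp h x.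
Proof.
move=> t0 mh; have k0 := @hker_ge0 R N t; have mk := @measurable_hker R N t.
have mah := measurable_absp mh; have a0 y : 0 <= absp h y by rewrite lee_fin.
rewrite -[X in _ + X](conv_hker_cst x t0 (normr_ge0 (h x))) -convD//.
apply: le_conv => //; first exact: measurable_osc_slice.
  by apply: emeasurable_funD.
by move=> y; rewrite -EFinD lee_fin ler_normB.
Qed.

(** The first absolute moment of the heat kernel is of order sqrt t. *)
Lemma osc_lipschitz (L : R) h : (0 <= L)%R -> measurable_fun setT h ->
  (forall x y, `|h y - h x| <= L * enorm (vsub x y))%R ->
  exists2 C : R, (0 <= C)%R & forall t x, (0 < t)%R -> osc h t x <= (C * t `^ (1 / 2))%:E.
Proof.
move=> L0 mh hL; have [C C0 HC] := @powR_enorm_hker_le R N 1 ler01.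
exists (L * C)%R => [|t x t0]; first exact: mulr_ge0.
have t20 : (0 < 2 * t)%R by rewrite mulr_gt0.
have ct : (0 <= L * (C * t `^ (1 / 2)))%R by rewrite !mulr_ge0 ?powR_ge0.
apply: (@le_trans _ _ (conv (hker (2 * t)) (fun=> (L * (C * t `^ (1 / 2)))%:E) x)).
  apply: ge0_le_integral => //.
  - by move=> y _; rewrite mule_ge0 ?lee_fin ?hker_ge0.
  - by apply: measurable_conv_integrand; [exact: measurable_hker|exact: measurable_osc_slice].
  - by apply: measurable_conv_integrand; [exact: measurable_hker|exact: measurable_cst].
  - move=> y _; rewrite -!EFinM lee_fin.
    apply: (@le_trans _ _ (hker t (vsub x y) * (L * enorm (vsub x y)))%R).
      by rewrite ler_wpM2l ?hker_ge0.
    have := HC t (vsub x y) t0; rewrite powRr1 ?enorm_ge0// => H.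
    by rewrite mulrCA [leRHS]mulrCA ler_wpM2l// [leLHS]mulrC [leRHS]mulrC.
by rewrite conv_hker_cst// mulrA.
Qed.

(** Any exponent above N makes [slow] integrable. *)
Let b : R := N.+1%:R.

(* An integrable weight that varies slowly enough to be almost preserved by the
   heat semigroup. *)
Definition slow x : R := ((1 + enorm x `^ b)^-1)%R.

Let b0 : (0 <= b)%R. Proof. by []. Qed.

Lemma slow_gt0 x : (0 < slow x)%R.
Proof. by rewrite invr_gt0 ltr_pwDl ?powR_ge0. Qed.

Lemma measurable_slow : measurable_fun setT slow.
Proof.
have -> : slow = (fun x => (1 + enorm x `^ b) `^ (- 1))%R.
  by apply/funext => x; rewrite powR_inv1// addr_ge0 ?powR_ge0.
by apply: measurable_powRf; apply: measurable_funD => //; exact: measurable_powR_enorm.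
Qed.

Lemma integral_slow : \int[mu]_x (slow x)%:E < +oo.
Proof.
have Nb : (N%:R < b)%R by rewrite ltr_nat.
have [K K0 HK] := @integral_far_le R N N0 b Nb.
apply: (@le_lt_trans _ _ (\int[mu]_x ((2 `^ b)%:E * ((1 + enorm x) `^ (- b))%:E))).
  apply: ge0_le_integral => //.
  - by move=> x _; rewrite lee_fin ltW ?slow_gt0.
  - exact: measurable_EFinf measurable_slow.
  - apply: measurable_funeM; apply: measurable_EFinf; apply: measurable_powRf.
    by apply: measurable_funD => //; exact: measurable_enorm.
  - move=> x _; rewrite -EFinM lee_fin /slow powRN -lef_pV2 ?posrE; last 2 first.
    + by rewrite mulr_gt0 ?invr_gt0 ?powR_gt0// ltr_pwDl ?enorm_ge0.
    + by rewrite invr_gt0 ltr_pwDl ?powR_ge0.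
    rewrite invfM !invrK mulrC ler_pdivrMr ?powR_gt0// mulrC.
    have [ex|ex] := leP (enorm x) 1%R.
      apply: (@le_trans _ _ (2 `^ b)%R); last by rewrite ler_peMr ?powR_ge0// lerDl powR_ge0.
      by rewrite ge0_ler_powR ?nnegrE ?addr_ge0 ?enorm_ge0//; lra.
    apply: (@le_trans _ _ (2 `^ b * enorm x `^ b)%R); last first.
      by rewrite ler_wpM2l ?powR_ge0// lerDr.
    rewrite -powRM ?enorm_ge0//.
    by rewrite ge0_ler_powR ?nnegrE ?addr_ge0 ?mulr_ge0 ?enorm_ge0//; lra.
rewrite ge0_integralZl//; last 2 first.
- apply: measurable_EFinf; apply: measurable_powRf.
  by apply: measurable_funD => //; exact: measurable_enorm.
- by move=> x _; rewrite lee_fin powR_ge0.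
by apply: le_lt_trans (lee_wpmul2l _ HK) _; rewrite ?lee_fin ?powR_ge0// -EFinM ltry.
Qed.

(** Peetre's inequality: moving the weight from x to y costs a polynomial in |x - y|, which the
    kernel can absorb. *)
Lemma slow_vary x y : (slow x <= 2 `^ b * (1 + enorm (vsub x y) `^ b) * slow y)%R.
Proof.
have gt0 z : (0 < 1 + enorm z `^ b)%R by rewrite ltr_pwDl ?powR_ge0.
rewrite /slow ler_pdivlMr ?gt0// mulrC ler_pdivrMr ?gt0//.
have := powR_enorm_triangle y x b0; rewrite enorm_vsubC.
have b1 : (1 <= 2 `^ b :> R)%R by rewrite -[leLHS](powRr0 2) ler_powR// ler1n.
set p := (enorm (vsub x y) `^ b)%R; set q := (enorm x `^ b)%R; set c := (2 `^ b)%R in b1 *.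
have p0 : (0 <= p)%R by exact: powR_ge0.
have q0 : (0 <= q)%R by exact: powR_ge0.
move=> h; apply: (@le_trans _ _ (1 + c * (p + q))%R); first by rewrite lerD2l.
have cpq : (0 <= c * p * q)%R := mulr_ge0 (mulr_ge0 (le_trans ler01 b1) p0) q0.
rewrite (_ : c * (1 + p) * (1 + q) = c + c * (p + q) + c * p * q)%R; last by ring.
by rewrite -addrA lerD// lerDl.
Qed.

Lemma integral_slow_hker : exists2 C : R, (0 <= C)%R & forall t y, (0 < t <= 1)%R ->
  \int[mu]_x ((slow x)%:E * (hker t (vsub x y))%:E) <= (C * slow y)%:E.
Proof.
have [C C0 HC] := @powR_enorm_hker_le R N b b0.
exists (2 `^ b * (1 + C))%R => [|t y /andP[t0 t1]].
  by rewrite mulr_ge0 ?powR_ge0// addr_ge0.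
have t20 : (0 < 2 * t)%R by rewrite mulr_gt0.
have mkv s : measurable_fun setT (fun x : X => hker s (vsub x y)).
  by apply: measurable_hker_comp => //; apply: measurable_vsub_comp.
have c0 : (0 <= 2 `^ b * slow y)%R by rewrite mulr_ge0 ?powR_ge0 ?(ltW (slow_gt0 _)).
apply: (@le_trans _ _ (\int[mu]_x ((2 `^ b * slow y)%:E * ((hker t (vsub x y))%:E
    + C%:E * (hker (2 * t) (vsub x y))%:E)))).
  apply: ge0_le_integral => //.
  - by move=> x _; rewrite mule_ge0 ?lee_fin ?hker_ge0 ?(ltW (slow_gt0 _)).
  - by apply: emeasurable_funM; apply: measurable_EFinf => //; exact: measurable_slow.
  - apply: measurable_funeM; apply: emeasurable_funD; first exact: measurable_EFinf.
    by apply: measurable_funeM; exact: measurable_EFinf.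
  - move=> x _; rewrite -!EFinM lee_fin.
    apply: (le_trans (ler_wpM2r (hker_ge0 _ _) (slow_vary x y))).
    have h1 := HC t (vsub x y) t0.
    have h2 : (C * t `^ (b / 2) * hker (2 * t) (vsub x y) <= C * hker (2 * t) (vsub x y))%R.
      rewrite ler_wpM2r ?hker_ge0// ler_piMr//.
      apply: (@le_trans _ _ (1 `^ (b / 2))%R); last by rewrite powR1.
      by rewrite ge0_ler_powR ?nnegrE ?(ltW t0) ?divr_ge0.
    have h3 := le_trans h1 h2; set p := hker t _ in h1 h3 *; set q := hker _ _ in h2 h3 *.
    rewrite (_ : _ * p = (2 `^ b * slow y) * (p + enorm (vsub x y) `^ b * p))%R; last by ring.
    by rewrite ler_wpM2l// lerD2l.
rewrite ge0_integralZl//; last 2 first.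
- apply: emeasurable_funD; first exact: measurable_EFinf.
  by apply: measurable_funeM; exact: measurable_EFinf.
- by move=> x _; rewrite adde_ge0 ?mule_ge0 ?lee_fin ?hker_ge0.
rewrite ge0_integralD//; last 4 first.
- by move=> x _; rewrite lee_fin hker_ge0.
- exact: measurable_EFinf.
- by move=> x _; rewrite mule_ge0 ?lee_fin ?hker_ge0.
- by apply: measurable_funeM; exact: measurable_EFinf.
rewrite ge0_integralZl//; last 2 first.
- exact: measurable_EFinf.
- by move=> x _; rewrite lee_fin hker_ge0.
rewrite !integral_hkerr// mule1 -EFinD -EFinM lee_fin.
by rewrite le_eqVlt; apply/orP; left; apply/eqP; ring.
Qed.

Definition wosc h t : \bar R := \int[mu]_x ((slow x)%:E * osc h t x).

Lemma wosc_ge0 h t : 0 <= wosc h t.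
Proof. by apply: integral_ge0 => x _; rewrite mule_ge0 ?osc_ge0// lee_fin ltW ?slow_gt0. Qed.

Lemma wosc_le2 h h1 h2 t : measurable_fun setT h -> measurable_fun setT h1 ->
  measurable_fun setT h2 ->
  (forall x y, `|h y - h x| <= `|h1 y - h1 x| + `|h2 y - h2 x|)%R ->
  wosc h t <= wosc h1 t + wosc h2 t.
Proof.
move=> mh m1 m2 hh; have ms : measurable_fun setT (fun x => (slow x)%:E).
  exact: measurable_EFinf measurable_slow.
have s0 x : 0 <= (slow x)%:E by rewrite lee_fin ltW ?slow_gt0.
rewrite /wosc -ge0_integralD//; last 4 first.
- by move=> x _; rewrite mule_ge0 ?osc_ge0.
- by apply: emeasurable_funM => //; exact: measurable_osc.
- by move=> x _; rewrite mule_ge0 ?osc_ge0.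
- by apply: emeasurable_funM => //; exact: measurable_osc.
apply: ge0_le_integral => //.
- by move=> x _; rewrite mule_ge0 ?osc_ge0.
- by apply: emeasurable_funM => //; exact: measurable_osc.
- by apply: emeasurable_funD; apply: emeasurable_funM => //; exact: measurable_osc.
- move=> x _; rewrite -ge0_muleDr ?osc_ge0//.
  by rewrite lee_wpmul2l// osc_le2.
Qed.

(** The weighted oscillation is controlled by the weighted L^1 norm uniformly for t <= 1. By Tonelli
    the heat evolution is moved onto the weight, which it preserves up to a constant. This makes the
    vanishing of the oscillation stable under L^1 limits. *)
Lemma wosc_crude : exists2 C : R, (0 < C)%R & forall h t, (0 < t <= 1)%R ->
  measurable_fun setT h -> wosc h t <= C%:E * \int[mu]_x (slow x * `|h x|)%:E.
Proof.
have [C C0 HC] := integral_slow_hker; exists (C + 1)%R; first by rewrite ltr_wpDl.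
move=> h t t01 mh; have [t0 t1] := andP t01.
have ms : measurable_fun setT (fun x => (slow x)%:E).
  exact: measurable_EFinf measurable_slow.
have s0 x : 0 <= (slow x)%:E by rewrite lee_fin ltW ?slow_gt0.
have mah := measurable_absp mh.
have a0 x : 0 <= absp h x by rewrite lee_fin.
have k0 := @hker_ge0 R N t; have mk := @measurable_hker R N t.
have mc := measurable_conv mk mah k0 a0.
have c0 x : 0 <= conv (hker t) (absp h) x by exact: conv_ge0.
have intE : \int[mu]_x (slow x * `|h x|)%:E = \int[mu]_x ((slow x)%:E * absp h x).
  by apply: eq_integral => x _; rewrite EFinM.
rewrite intE; set I := \int[mu]_x ((slow x)%:E * absp h x).
have I0 : 0 <= I by apply: integral_ge0 => x _; rewrite mule_ge0.
apply: (@le_trans _ _ (\int[mu]_x ((slow x)%:E * conv (hker t) (absp h) x + (slow x)%:E * absp h x))).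
  apply: ge0_le_integral => //.
  - by move=> x _; rewrite mule_ge0 ?osc_ge0.
  - by apply: emeasurable_funM => //; exact: measurable_osc.
  - by apply: emeasurable_funD; exact: emeasurable_funM.
  - by move=> x _; rewrite -ge0_muleDr// lee_wpmul2l// osc_crude.
rewrite ge0_integralD//; last 4 first.
- by move=> x _; rewrite mule_ge0.
- exact: emeasurable_funM.
- by move=> x _; rewrite mule_ge0.
- exact: emeasurable_funM.
rewrite EFinD ge0_muleDl// mul1e leeD2r//.
have -> : \int[mu]_x ((slow x)%:E * conv (hker t) (absp h) x) =
    \int[mu]_y (absp h y * \int[mu]_x ((slow x)%:E * (hker t (vsub x y))%:E)).
  transitivity (\int[mu]_x \int[mu]_y ((slow x)%:E * ((hker t (vsub x y))%:E * absp h y))).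
    apply: eq_integral => x _; rewrite ge0_integralZl//.
    - exact: measurable_conv_integrand.
    - by move=> y _; rewrite mule_ge0// lee_fin.
  rewrite (fubini_tonelli (fun p : X * X => (slow p.1)%:E * ((hker t (vsub p.1 p.2))%:E * absp h p.2)))/=; last 2 first.
  - apply: emeasurable_funM; first exact: (measurableT_comp ms measurable_fst).
    exact: measurable_conv2.
  - by move=> [x y] /=; rewrite !mule_ge0// lee_fin.
  apply: eq_integral => y _; rewrite -ge0_integralZl//.
  - by apply: eq_integral => x _; rewrite [RHS]muleC -muleA.
  - apply: emeasurable_funM => //; apply: measurable_EFinf.
    by apply: measurable_hker_comp => //; apply: measurable_vsub_comp.
  - by move=> x _; rewrite mule_ge0// lee_fin.
rewrite -ge0_integralZl//; last 2 first.
- exact: emeasurable_funM.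
- by move=> x _; rewrite mule_ge0.
apply: ge0_le_integral => //.
- move=> y _; rewrite mule_ge0//; apply: integral_ge0 => x _.
  by rewrite mule_ge0// lee_fin.
- apply: emeasurable_funM => //.
  apply: (measurable_int_param (h := fun y x => (slow x)%:E * (hker t (vsub x y))%:E)).
  + apply: emeasurable_funM; first exact: (measurableT_comp ms measurable_snd).
    by apply: measurable_EFinf; apply: measurable_hker_comp => //; apply: measurable_vsub_comp.
  + by move=> y x; rewrite mule_ge0// lee_fin.
- by apply: measurable_funeM; exact: emeasurable_funM.
- move=> y _; rewrite muleA [leRHS]muleC; apply: lee_wpmul2l => //.
  exact: HC.
Qed.

End Oscillation.

Lemma dist_min_le (R : realDomainType) (c a b : R) :
  `|Num.min c a - Num.min c b| <= `|a - b|.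
Proof.
wlog ab : a b / a <= b.
  by move=> H; case/orP: (le_total a b) => h; [|rewrite distrC (distrC a)]; exact: H.
rewrite distrC (distrC a) [leRHS]ger0_norm ?subr_ge0// ger0_norm ?subr_ge0 ?le_min2//.
by case: (leP c a); case: (leP c b) => *; lra.
Qed.

Lemma dist_max_le (R : realDomainType) (c a b : R) :
  `|Num.max a c - Num.max b c| <= `|a - b|.
Proof.
wlog ab : a b / a <= b.
  by move=> H; case/orP: (le_total a b) => h; [|rewrite distrC (distrC a)]; exact: H.
rewrite distrC (distrC a) [leRHS]ger0_norm ?subr_ge0// ger0_norm ?subr_ge0 ?le_max2//.
by case: (leP a c); case: (leP b c) => *; lra.
Qed.

(** * Functions of vanishing oscillation: from Lipschitz functions to Borel sets *)

Section SmallOscillation.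
Context {R : realType} {N : nat}.
Hypothesis N0 : (0 < N)%N.
Local Notation mu := (lebesgueN R N).
Local Notation X := (Rspace R N).
Implicit Types (x y z : X) (t : R) (h : X -> R) (A B : set X).
Local Open Scope ereal_scope.

Definition calm h : Prop := vanishes (wosc h).

Lemma calm_le2 h h1 h2 : measurable_fun setT h -> measurable_fun setT h1 ->
  measurable_fun setT h2 ->
  (forall x y, `|h y - h x| <= `|h1 y - h1 x| + `|h2 y - h2 x|)%R ->
  calm h1 -> calm h2 -> calm h.
Proof.
move=> mh m1 m2 hh; apply: (vanishes_le2 ltr01) => [t _|t|t]; try exact: wosc_ge0.
by rewrite mul1e; exact: wosc_le2.
Qed.

Lemma calmD h1 h2 : measurable_fun setT h1 -> measurable_fun setT h2 ->
  calm h1 -> calm h2 -> calm (fun x => h1 x + h2 x)%R.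
Proof.
move=> m1 m2; apply: calm_le2 => //; first exact: measurable_funD.
move=> x y; rewrite (_ : _ - _ = (h1 y - h1 x) + (h2 y - h2 x))%R ?ler_normD//; ring.
Qed.

Lemma calm_cst (c : R) : calm (fun=> c).
Proof.
move=> e e0; exists 1%R => [|t _]; first by rewrite ltr01 lexx.
rewrite /wosc integral0_eq ?lee_fin ?(ltW e0)// => x _.
by rewrite /osc conv0 ?mule0//; left => y; rewrite subrr normr0.
Qed.

Lemma calmZ (c : R) h : measurable_fun setT h -> calm h -> calm (fun x => c * h x)%R.
Proof.
move=> mh ch; have c1 : (0 < `|c| + 1)%R by rewrite ltr_pwDr.
apply: (vanishes_le2 c1 _ _ _ ch (@vanishes0 R)) => [t _|t|//]; last exact: wosc_ge0.
have ms : measurable_fun setT (fun x : X => (slow x)%:E) by exact: measurable_EFinf measurable_slow.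
have s0 x : 0 <= (slow x)%:E by rewrite lee_fin ltW ?slow_gt0.
have mo := measurable_osc t mh; have o0 := osc_ge0 h t.
rewrite adde0 /wosc -ge0_integralZl ?lee_fin ?(ltW c1)//; last 2 first.
- exact: emeasurable_funM.
- by move=> x _; rewrite mule_ge0.
apply: ge0_le_integral => //.
- by move=> x _; rewrite mule_ge0 ?osc_ge0.
- by apply: emeasurable_funM => //; apply: measurable_osc; exact: measurable_funM.
- by apply: measurable_funeM; exact: emeasurable_funM.
- move=> x _; rewrite [leRHS]muleCA; apply: lee_wpmul2l => //.
  have k0 := @hker_ge0 R N t; have mk := @measurable_hker R N t.
  rewrite /osc -convZ ?(ltW c1)//; last exact: measurable_osc_slice.
  apply: le_conv => //.
  + by apply: measurable_osc_slice; exact: measurable_funM.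
  + by apply: measurable_funeM; exact: measurable_osc_slice.
  + by move=> y; rewrite -EFinM lee_fin -mulrBr normrM ler_wpM2r// lerDl.
Qed.

Lemma calm_sum (n : nat) (h : nat -> X -> R) : (forall k, measurable_fun setT (h k)) ->
  (forall k, calm (h k)) -> calm (fun x => \sum_(k < n) h k x)%R.
Proof.
move=> mh ch; elim: n => [|n IH].
  rewrite (_ : (fun x => _) = fun=> 0%R); first exact: calm_cst.
  by apply/funext => x; rewrite big_ord0.
rewrite (_ : (fun x => _) = fun x => (\sum_(k < n) h k x + h n x)%R); last first.
  by apply/funext => x; rewrite big_ord_recr.
have msum : measurable_fun setT (fun x => \sum_(k < n) h k x)%R by exact: measurable_sum.
exact: (calmD msum (mh n) IH (ch n)).
Qed.

Lemma calm_lipschitz (L : R) h : (0 <= L)%R -> measurable_fun setT h ->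
  (forall x y, `|h y - h x| <= L * enorm (vsub x y))%R -> calm h.
Proof.
move=> L0 mh hL; have [C C0 HC] := osc_lipschitz L0 mh hL.
have ms : measurable_fun setT (fun x : X => (slow x)%:E) by exact: measurable_EFinf measurable_slow.
have s0 x : 0 <= (slow x)%:E by rewrite lee_fin ltW ?slow_gt0.
have [W WE] : exists W : R, \int[mu]_x (slow x)%:E = W%:E.
  exists (fine (\int[mu]_x (slow x)%:E)); rewrite fineK// ge0_fin_numE ?integral_slow//.
  exact: integral_ge0.
have k0 : (0 < 1 / 2 :> R)%R by [].
have one0 : (0 < 1 :> R)%R by [].
apply: (vanishes_le2 one0 _ _ _ (vanishes_powR (C * W) k0) (@vanishes0 R)) => [t|t|//]; last first.
  rewrite lee_fin mulr_ge0 ?powR_ge0// mulr_ge0//.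
  by rewrite -lee_fin -WE; exact: integral_ge0.
move=> /andP[t0 _]; rewrite adde0 mul1e /wosc.
have ct : (0 <= C * t `^ (1 / 2))%R by rewrite mulr_ge0 ?powR_ge0.
apply: (@le_trans _ _ (\int[mu]_x ((C * t `^ (1 / 2))%:E * (slow x)%:E))).
  apply: ge0_le_integral => //.
  - by move=> x _; rewrite mule_ge0 ?osc_ge0.
  - by apply: emeasurable_funM => //; exact: measurable_osc.
  - exact: measurable_funeM.
  - by move=> x _; rewrite [leRHS]muleC lee_wpmul2l// HC.
by rewrite ge0_integralZl// WE -EFinM lee_fin mulrAC.
Qed.

(** Write h = f_n + (h - f_n): the remainder is small in the weighted L^1 norm by monotone
    convergence, hence has small oscillation uniformly in t by [wosc_crude]. *)
Lemma calm_lim (f : nat -> X -> R) h : (forall n, measurable_fun setT (f n)) ->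
  measurable_fun setT h -> (forall n x, 0 <= f n x)%R ->
  (forall n x, f n x <= f n.+1 x)%R -> (forall n x, f n x <= h x)%R ->
  (forall x, (h x)%:E <= ereal_sup (range (fun n => (f n x)%:E))) ->
  \int[mu]_x (slow x * h x)%:E < +oo -> (forall n, calm (f n)) -> calm h.
Proof.
move=> mf mh f0 ndf fh suph hoo cf.
have [C C0 HC] := @wosc_crude R N.
have C1 : (0 < C + 1)%R by rewrite addr_gt0.
apply: (vanishes_tail C1) => e e0.
have s0 x : (0 <= slow x)%R by rewrite ltW ?slow_gt0.
have ms := @measurable_slow R N.
have [n hn] : exists n, \int[mu]_x (slow x * h x - slow x * f n x)%:E <= e%:E.
  apply: (@monotone_tail _ _ _ mu (fun n x => slow x * f n x)%R (fun x => slow x * h x)%R) => //.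
  - by move=> n; exact: measurable_funM.
  - exact: measurable_funM.
  - by move=> n x; rewrite mulr_ge0.
  - by move=> n x; rewrite ler_wpM2l.
  - by move=> n x; rewrite ler_wpM2l.
  - move=> x; rewrite EFinM; apply: le_trans (lee_wpmul2l _ (suph x)) _; rewrite ?lee_fin//.
    by rewrite ereal_sup_rangeZ.
exists (wosc (f n)); split; [exact: cf|by move=> t; exact: wosc_ge0|move=> t t01].
apply: (@le_trans _ _ (wosc (f n) t + C%:E * e%:E)).
  apply: (@le_trans _ _ (wosc (f n) t + wosc (fun x => h x - f n x)%R t)).
    apply: wosc_le2 => //; first exact: measurable_funB.
    move=> x y; rewrite (_ : _ - _ = (f n y - f n x) + ((h y - f n y) - (h x - f n x)))%R ?ler_normD//.
    by ring.
  rewrite leeD2l//; apply: le_trans (HC _ _ t01 (measurable_funB mh (mf n))) _.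
  rewrite lee_wpmul2l ?lee_fin ?(ltW C0)//; apply: le_trans hn.
  rewrite le_eqVlt; apply/orP; left; apply/eqP; apply: eq_integral => x _.
  by rewrite ger0_norm ?subr_ge0// mulrBr.
rewrite ge0_muleDr ?wosc_ge0 ?lee_fin ?(ltW e0)//; apply: leeD.
  by rewrite -[leLHS]mul1e; apply: lee_wpmul2r; rewrite ?wosc_ge0// lee_fin lerDr ltW.
by rewrite lee_wpmul2r ?lee_fin ?(ltW e0)// lerDl.
Qed.

Lemma integral_slow_le1 h : measurable_fun setT h -> (forall x, 0 <= h x <= 1)%R ->
  \int[mu]_x (slow x * h x)%:E < +oo.
Proof.
move=> mh h01; apply: le_lt_trans (integral_slow N0).
have s0 x : (0 <= slow x)%R by rewrite ltW ?slow_gt0.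
apply: ge0_le_integral => //.
- by move=> x _; rewrite lee_fin mulr_ge0//; case/andP: (h01 x).
- by apply: measurable_EFinf; apply: measurable_funM => //; exact: measurable_slow.
- exact: measurable_EFinf measurable_slow.
- by move=> x _; rewrite lee_fin ler_piMr//; case/andP: (h01 x).
Qed.

Lemma indic_le1 A x : (0 <= (\1_A x : R) <= 1)%R.
Proof. by rewrite indicE; case: (_ \in _); rewrite lexx ler01. Qed.

(* These sets contain the half-spaces and form a sigma-algebra, hence all Borel
   sets are among them: this replaces density of continuous functions. *)
Definition calm_sets : set (set X) :=
  [set A | measurable A /\ calm (\1_A : X -> R)].

Lemma calm_setC A : calm_sets A -> calm_sets (~` A).
Proof.
move=> [mA cA]; split; first exact: measurableC.
have m1 : measurable_fun setT (\1_(~` A) : X -> R) by apply: measurable_indic; exact: measurableC.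
have m2 : measurable_fun setT (\1_A : X -> R) by exact: measurable_indic.
apply: (calm_le2 m1 m2 (measurable_cst _) _ cA (calm_cst 0)).
move=> x y; rewrite subrr normr0 addr0 !indicE !in_setC.
by case: (x \in A); case: (y \in A); rewrite ?subrr ?normr0 ?subr0 ?sub0r ?normrN.
Qed.

Lemma calm_setU A B : calm_sets A -> calm_sets B -> calm_sets (A `|` B).
Proof.
move=> [mA cA] [mB cB]; split; first exact: measurableU.
have m0 : measurable_fun setT (\1_(A `|` B) : X -> R) by apply: measurable_indic; exact: measurableU.
have m1 : measurable_fun setT (\1_A : X -> R) by exact: measurable_indic.
have m2 : measurable_fun setT (\1_B : X -> R) by exact: measurable_indic.
apply: (calm_le2 m0 m1 m2 _ cA cB).
move=> x y; rewrite !indicE !in_setU.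
by case: (x \in A); case: (y \in A); case: (x \in B); case: (y \in B);
  rewrite /= ?subrr ?normr0 ?subr0 ?sub0r ?normrN ?normr1 ?addr0 ?add0r// ?ler01// lerDl.
Qed.

Lemma sigma_algebra_calm_sets : sigma_algebra setT calm_sets.
Proof.
split.
- split => //; rewrite (_ : \1_set0 = fun=> 0%R); first exact: calm_cst.
  by apply/funext => x; rewrite indic0.
- by move=> A cA; rewrite setTD; exact: calm_setC.
- move=> F cF; have mU : measurable (\bigcup_k F k).
    by apply: bigcup_measurable => k _; case: (cF k).
  pose G n := \big[setU/set0]_(i < n) F i.
  have cG n : calm_sets (G n).
    elim: n => [|n IH]; last by rewrite /G big_ord_recr; exact: (calm_setU IH (cF n)).
    rewrite /G big_ord0; split => //; rewrite (_ : \1_set0 = fun=> 0%R); first exact: calm_cst.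
    by apply/funext => x; rewrite indic0.
  split => //.
  have subG n : G n `<=` \bigcup_k F k.
    by move=> x; rewrite /G -bigcup_mkord => -[k _ Fk]; exists k.
  have in_le (C D : set X) x : C `<=` D -> ((\1_C x : R) <= \1_D x)%R.
    move=> CD; rewrite !indicE; case: (boolP (x \in C)) => // xC.
    by rewrite (mem_set (CD _ (set_mem xC))).
  apply: (@calm_lim (fun n => \1_(G n))) => //.
  + by move=> n; apply: measurable_indic; case: (cG n).
  + move=> n x; apply: in_le => y; rewrite /G -!bigcup_mkord => -[k kn Fk].
    by exists k => //=; exact: ltnW.
  + by move=> n x; apply: in_le.
  + move=> x; rewrite indicE; case: (boolP (x \in _)) => xU; last first.
      by apply: le_ereal_sup_tmp; exists ((\1_(G 0%N) x)%:E); [exists 0%N|rewrite lee_fin].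
    have [k _ Fk] := set_mem xU.
    apply: le_ereal_sup_tmp; exists ((\1_(G k.+1) x)%:E); first by exists k.+1.
    rewrite indicE mem_set//= /G -bigcup_mkord; exists k => //=.
  + by apply: integral_slow_le1; [exact: measurable_indic|move=> x; exact: indic_le1].
  + by move=> n; case: (cG n).
Qed.

(** The indicator is the increasing limit of the ramps min(1, n (x_i - c)+), which are Lipschitz
    with constant n. *)
Lemma calm_halfspace (i : 'I_N) (c : R) : calm_sets [set x | (c < tnth x i)%R].
Proof.
have mt : measurable_fun setT (fun x : X => tnth x i : R) by exact: measurable_tnth_comp.
have mA : measurable [set x : X | (c < tnth x i)%R].
  rewrite -[X in measurable X]setTI.
  have := measurable_fun_ltr (measurable_cst c) mt.
  by move=> /(_ measurableT [set true] I).
split => //.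
pose f n (x : X) : R := Num.min 1%R (n%:R * Num.max (tnth x i - c) 0)%R.
have mf n : measurable_fun setT (f n).
  apply: measurable_minr => //; apply: measurable_funM => //; apply: measurable_maxr => //.
  exact: measurable_funB.
have m0 (x : X) : (0 <= Num.max (tnth x i - c : R) 0)%R by rewrite le_max lexx orbT.
have f0 n x : (0 <= f n x)%R by rewrite le_min ler01 mulr_ge0.
have fA n x : (f n x <= \1_[set x : X | (c < tnth x i)%R] x)%R.
  rewrite indicE; case: (boolP (x \in _)) => xA; first by rewrite ge_min lexx.
  rewrite /f (_ : Num.max _ _ = 0%R) ?mulr0 ?ge_min ?lexx ?orbT//.
  apply/max_idPr; rewrite subr_le0 leNgt; apply/negP => h.
  by move/negP: xA; apply; exact: mem_set.
apply: (@calm_lim f) => //.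
- move=> n x; rewrite le_min !ge_min lexx /=; apply/orP; right.
  by rewrite ler_wpM2r// ler_nat.
- move=> x; rewrite indicE; case: (boolP (x \in _)) => xA; last first.
    by apply: le_ereal_sup_tmp; exists ((f 0%N x)%:E); [exists 0%N|rewrite lee_fin].
  have h : (0 < tnth x i - c)%R by rewrite subr_gt0; exact: (set_mem xA).
  have [n hn] : exists n : nat, ((tnth x i - c)^-1 <= n%:R)%R.
    by exists (Num.bound ((tnth x i - c)^-1)); rewrite ltW// archi_boundP// invr_ge0 ltW.
  apply: le_ereal_sup_tmp; exists ((f n x)%:E); first by exists n.
  rewrite lee_fin le_min lexx /=.
  have -> : Num.max (tnth x i - c : R)%R 0%R = (tnth x i - c)%R by apply/max_idPl; exact: ltW.
  by rewrite -ler_pdivrMr// div1r.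
- by apply: integral_slow_le1; [exact: measurable_indic|move=> x; exact: indic_le1].
- move=> n; apply: (@calm_lipschitz n%:R) => // x y.
  apply: (le_trans (dist_min_le _ _ _)); rewrite -mulrBr normrM ger0_norm// ler_wpM2l//.
  apply: (le_trans (dist_max_le _ _ _)).
  rewrite (_ : tnth y i - c - (tnth x i - c) = - tnth (vsub x y) i)%R.
    by rewrite normrN ler_norm_tnth.
  by rewrite tnth_vsub; ring.
Qed.

Lemma calm_measurable A : measurable A -> calm (\1_A : X -> R).
Proof.
suff : (measurable : set (set X)) `<=` calm_sets by move=> h /h[].
apply: smallest_sub; first exact: sigma_algebra_calm_sets.
move=> B; rewrite -bigcup_seq => -[i _] [Y mY <-].
(* The product sigma-algebra is generated by preimages under coordinates; for each coordinate the
   sets with calm preimage form a sigma-algebra that contains the rays. *)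
have pre_sigma : sigma_algebra setT [set Y : set R | calm_sets ((fun x : X => tnth x i : R) @^-1` Y)].
  have [s0 sC sU] := sigma_algebra_calm_sets; split => /=.
  - by rewrite preimage_set0.
  - by move=> Z cZ; rewrite setTD preimage_setC -setTD; exact: sC.
  - by move=> F cF; rewrite preimage_bigcup; exact: sU.
have : [set Y : set R | calm_sets ((fun x : X => tnth x i : R) @^-1` Y)] Y.
  have : (@RGenOInfty.G R).-sigma.-measurable Y by rewrite -RGenOInfty.measurableE.
  apply: smallest_sub => // _ [c ->] /=.
  rewrite (_ : _ @^-1` _ = [set x : X | (c < tnth x i)%R]); first exact: calm_halfspace.
  by apply/seteqP; split => x /=; rewrite in_itv/= andbT.
by rewrite /= setTI.
Qed.

End SmallOscillation.

Import HBNNSimple.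

Section SmallOscillationNorm.
Context {R : realType} {N : nat}.
Hypothesis N0 : (0 < N)%N.
Local Notation mu := (lebesgueN R N).
Local Notation X := (Rspace R N).
Implicit Types (x y z : X) (t : R) (h : X -> R).
Local Open Scope ereal_scope.

(** The dyadic simple approximations increase to h, and each is a finite combination of indicators
    of measurable sets. *)
Lemma calm_ge0 h : measurable_fun setT h -> (forall x, 0 <= h x)%R ->
  \int[mu]_x (slow x * h x)%:E < +oo -> calm h.
Proof.
move=> mh h0 hoo; pose H x : \bar R := (h x)%:E.
have mH : measurable_fun setT H by exact: measurable_EFinf.
pose f n : X -> R := approx setT H n.
have fE n : f n = (nnsfun_approx measurableT mH n : X -> R) by rewrite nnsfun_approxE.
have mf n : measurable_fun setT (f n) by rewrite fE; exact: measurable_funPT.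
have f0 n x : (0 <= f n x)%R by rewrite fE.
have ndf n x : (f n x <= f n.+1 x)%R by apply/lefP: x; exact: nd_approx.
have nds x : nondecreasing_seq (fun n => (f n x)%:E).
  by apply/nondecreasing_seqP => n; rewrite lee_fin.
have cvf x : (fun n => (f n x)%:E) @ \oo --> (h x)%:E.
  have := @cvg_nnsfun_approx _ _ _ setT measurableT H mH (fun x _ => h0 x) x I.
  by under eq_fun do rewrite /= nnsfun_approxE.
have supE x : (h x)%:E = ereal_sup (range (fun n => (f n x)%:E)).
  by apply: (cvg_unique _ (cvf x) (ereal_nondecreasing_cvgn (nds x))).
apply: (@calm_lim R N f) => //.
- by move=> n x; rewrite -lee_fin supE; apply: ereal_sup_ubound; exists n.
- by move=> x; rewrite -supE.
- move=> n; have mA k : measurable (dyadic_approx setT H n k).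
    rewrite /dyadic_approx; case: ifP => // _; rewrite setTI.
    rewrite (_ : [set x | _] = H @^-1` (EFin @` [set` @dyadic_itv R n k])); last first.
      by apply/seteqP; split => x /=; rewrite in_setE.
    rewrite -[X in measurable X]setTI; apply: (mH measurableT).
    by apply/measurable_image_EFin; exact: measurable_itv.
  have mB : measurable (integer_approx setT H n).
    rewrite /integer_approx; apply: emeasurable_fun_c_infty => //.
  have m1 : measurable_fun setT (fun x => \sum_(k < n * 2 ^ n)
      (k%:R * 2 ^- n * \1_(dyadic_approx setT H n k) x : R))%R.
    by apply: measurable_sum => k; apply: measurable_funM => //; exact: measurable_indic.
  have m2 : measurable_fun setT (fun x => n%:R * \1_(integer_approx setT H n) x : R)%R.
    by apply: measurable_funM => //; exact: measurable_indic.
  apply: (calmD m1 m2); last first.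
    by apply: calmZ; [exact: measurable_indic|exact: calm_measurable].
  apply: (@calm_sum R N _ (fun k x => (k%:R * 2 ^- n * \1_(dyadic_approx setT H n k) x)%R)).
    by move=> k; apply: measurable_funM => //; exact: measurable_indic.
  by move=> k; apply: calmZ; [exact: measurable_indic|exact: calm_measurable].
Qed.

Lemma calm_bounded (n : R) h : measurable_fun setT h -> (forall x, `|h x| <= n)%R -> calm h.
Proof.
move=> mh hn; have n0 : (0 <= n)%R := le_trans (normr_ge0 _) (hn [tuple 0%R | i < N]).
have s0 x : (0 <= slow x :> R)%R by rewrite ltW ?slow_gt0.
have Wfin : \int[mu]_x (slow x * n)%:E < +oo.
  have -> : \int[mu]_x (slow x * n)%:E = n%:E * \int[mu]_x (slow x)%:E.
    rewrite -ge0_integralZl ?lee_fin//; last 2 first.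
    - exact: measurable_EFinf measurable_slow.
    - by move=> x _; rewrite lee_fin.
    by apply: eq_integral => x _; rewrite -EFinM mulrC.
  have := @integral_slow R N N0; have : 0 <= \int[mu]_x (slow x : R)%:E by apply: integral_ge0 => x _; rewrite lee_fin.
  by case: (integral _ _ _) => [a| |]// _ _; rewrite -EFinM ltry.
have part (k : X -> R) : measurable_fun setT k -> (forall x, 0 <= k x <= n)%R -> calm k.
  move=> mk kn; apply: calm_ge0 => //; first by move=> x; case/andP: (kn x).
  apply: le_lt_trans Wfin; apply: ge0_le_integral => //.
  - by move=> x _; rewrite lee_fin mulr_ge0//; case/andP: (kn x).
  - by apply: measurable_EFinf; apply: measurable_funM => //; exact: measurable_slow.
  - by apply: measurable_EFinf; apply: measurable_funM => //; exact: measurable_slow.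
  - by move=> x _; rewrite lee_fin ler_wpM2l//; case/andP: (kn x).
have mp : measurable_fun setT (fun x => Num.max (h x) 0)%R by exact: measurable_maxr.
have mm : measurable_fun setT (fun x => Num.max (- h x) 0)%R.
  by apply: measurable_maxr => //; exact: measurableT_comp.
apply: (calm_le2 mh mp mm).
- move=> x y; have a := posp_sub_negp h y; have b := posp_sub_negp h x.
  move: a b; rewrite /posp /negp -!EFinB => -[a] [b].
  rewrite (_ : h y - h x = (Num.max (h y) 0 - Num.max (h x) 0) -
    (Num.max (- h y) 0 - Num.max (- h x) 0))%R ?ler_normB//.
  by rewrite -[in LHS]a -[in LHS]b; ring.
- apply: part => // x; rewrite le_max lexx orbT ge_max n0 andbT/=.
  exact: le_trans (ler_norm _) (hn x).
- apply: part => // x; rewrite le_max lexx orbT ge_max n0 andbT/=.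
  by apply: (le_trans (ler_norm _)); rewrite normrN; exact: hn.
Qed.

Lemma osc_le_cst (K : R) h t x : (0 < t)%R -> measurable_fun setT h ->
  (forall y, `|h y - h x| <= K)%R -> osc h t x <= K%:E.
Proof.
move=> t0 mh hK; have K0 : (0 <= K)%R := le_trans (normr_ge0 _) (hK x).
rewrite -(conv_hker_cst x t0 K0); have mk := @measurable_hker R N t.
apply: le_conv => //; [exact: measurable_osc_slice|exact: hker_ge0].
Qed.

Lemma enorm_le_double (n : R) x y : (0 <= n)%R -> (enorm y <= n)%R -> (2 * n < enorm x)%R ->
  (enorm x <= 2 * enorm (vsub x y))%R.
Proof.
move=> n0 yn xn; have h := enorm_vsub_le x y.
have x0 := enorm_ge0 x; have y0 := enorm_ge0 y; have d0 := enorm_ge0 (vsub x y).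
rewrite -(@ler_pXn2r _ 2) ?nnegrE ?mulr_ge0// exprMn.
have yx : (enorm y ^+ 2 <= enorm x ^+ 2 / 4)%R.
  rewrite ler_pdivlMr// (_ : 4 = 2 ^+ 2)%R; last by rewrite -natrX.
  rewrite -exprMn ler_pXn2r ?nnegrE ?mulr_ge0//.
  by rewrite mulrC (le_trans _ (ltW xn))// ler_wpM2l.
by rewrite (_ : 2 ^+ 2 = 4 :> R)%R -?natrX//; lra.
Qed.

(* Beyond twice the radius of the support the weight is absorbed by the kernel. *)
Lemma wosc_weight (n m : R) h : (0 <= n)%R -> (0 < m)%R -> measurable_fun setT h ->
  (forall x, `|h x| <= n)%R -> (forall x, (n < enorm x)%R -> h x = 0%R) ->
  vanishes (fun t => \int[mu]_x ((enorm x `^ m)%:E * osc h t x)).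
Proof.
move=> n0 m0 mh hn hsupp; have [C C0 HC] := @powR_enorm_hker_le R N m (ltW m0).
have s0 x : (0 < slow x :> R)%R by exact: slow_gt0.
have ms := @measurable_slow R N.
(* K1 serves |x| <= 2 n, where |x|^m is at most (2 n)^m and the inverse of [slow] at most 1 + (2
   n)^b. K2 serves larger x, where h x = 0 and only |y| <= n contributes, so |x| <= 2 |x - y|. *)
pose b : R := N.+1%:R; pose K1 := ((2 * n) `^ m * (1 + (2 * n) `^ b))%R.
pose K2 := (2 `^ m * (n * (1 + n `^ b)) * C)%R.
have K10 : (0 <= K1)%R by rewrite mulr_ge0 ?addr_ge0 ?powR_ge0.
have K20 : (0 <= K2)%R by rewrite !mulr_ge0 ?addr_ge0 ?powR_ge0.
have far x : (enorm x <= n)%R -> (1 <= (1 + n `^ b) * slow x)%R.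
  move=> xn; rewrite ler_pdivlMr ?ltr_pwDl ?powR_ge0// mul1r lerD2l.
  by rewrite ge0_ler_powR ?nnegrE ?enorm_ge0.
have mse : measurable_fun setT (fun x : X => (slow x)%:E) by exact: measurable_EFinf.
have se0 x : 0 <= (slow x : R)%:E by rewrite lee_fin ltW.
have pt t x : (0 < t)%R -> (enorm x `^ m)%:E * osc h t x <=
    K1%:E * ((slow x)%:E * osc h t x) +
    (K2 * t `^ (m / 2))%:E * conv (hker (2 * t)) (fun y => (slow y)%:E) x.
  move=> t0; have t20 : (0 < 2 * t)%R by rewrite mulr_gt0.
  have c0 : 0 <= conv (hker (2 * t)) (fun y : X => (slow y : R)%:E) x.
    by apply: conv_ge0 => [z|y]; [exact: hker_ge0|rewrite lee_fin ltW].
  have kt0 : (0 <= K2 * t `^ (m / 2))%R by rewrite mulr_ge0 ?powR_ge0.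
  have o0 := osc_ge0 h t x.
  have [xn|xn] := leP (enorm x) (2 * n)%R.
    apply: (@le_trans _ _ (K1%:E * ((slow x)%:E * osc h t x))); last first.
      by rewrite leeDl// mule_ge0// lee_fin.
    rewrite muleA -EFinM; apply: lee_wpmul2r => //; rewrite lee_fin.
    apply: (@le_trans _ _ ((2 * n) `^ m)%R).
      by rewrite ge0_ler_powR ?nnegrE ?enorm_ge0 ?mulr_ge0 ?(ltW m0).
    rewrite /K1 -mulrA ler_peMr ?powR_ge0// ler_pdivlMr ?ltr_pwDl ?powR_ge0// mul1r lerD2l.
    by rewrite ge0_ler_powR ?nnegrE ?enorm_ge0 ?mulr_ge0.
  apply: (@le_trans _ _ ((K2 * t `^ (m / 2))%:E * conv (hker (2 * t)) (fun y => (slow y)%:E) x)); last first.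
    by rewrite leeDr// mule_ge0 ?lee_fin// mule_ge0// lee_fin ltW.
  have hx : h x = 0%R by apply: hsupp; rewrite (le_lt_trans _ xn)// ler_peMl// ler1n.
  rewrite /osc -[leRHS](convZ x kt0 (measurable_hker _) mse (@hker_ge0 R N _) se0).
  rewrite /conv -ge0_integralZl//; last 3 first.
  - by apply: measurable_conv_integrand; [exact: measurable_hker|exact: measurable_osc_slice].
  - by move=> y _; rewrite mule_ge0 ?lee_fin ?hker_ge0.
  - by rewrite lee_fin powR_ge0.
  apply: ge0_le_integral => //.
  - by move=> y _; rewrite !mule_ge0 ?lee_fin ?hker_ge0 ?powR_ge0.
  - apply: measurable_funeM; apply: measurable_conv_integrand; [exact: measurable_hker|exact: measurable_osc_slice].
  - by apply: measurable_conv_integrand; [exact: measurable_hker|exact: measurable_funeM].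
  move=> y _; rewrite hx subr0 -!EFinM lee_fin.
  have [yn|yn] := leP (enorm y) n; last first.
    by rewrite (hsupp y yn) normr0 !mulr0; apply: mulr_ge0 (hker_ge0 _ _) (mulr_ge0 kt0 (ltW (s0 y))).
  have hd := enorm_le_double n0 yn xn; have H := HC t (vsub x y) t0.
  set d := enorm (vsub x y) in hd H; set p := hker t _ in H *; set q := hker _ _ in H *.
  have p0 : (0 <= p)%R by exact: hker_ge0.
  have xm : (enorm x `^ m <= 2 `^ m * d `^ m)%R.
    rewrite -powRM ?enorm_ge0// ge0_ler_powR ?nnegrE ?enorm_ge0 ?mulr_ge0 ?enorm_ge0// ltW//.
  (* On the support h is dominated by a multiple of [slow], so that the remaining convolution has
     finite integral. *)
  have hy : (`|h y| <= n * ((1 + n `^ b) * slow y))%R.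
    by apply: (le_trans (hn y)); rewrite ler_peMr// far.
  apply: (@le_trans _ _ (2 `^ m * d `^ m * (p * (n * ((1 + n `^ b) * slow y))))%R).
    by apply: ler_pM => //; rewrite ?powR_ge0 ?mulr_ge0// ler_wpM2l.
  have ns : (0 <= n * ((1 + n `^ b) * slow y))%R.
    by rewrite !mulr_ge0 ?(ltW (s0 _))// addr_ge0 ?powR_ge0.
  rewrite (_ : _ * _ = 2 `^ m * (n * ((1 + n `^ b) * slow y)) * (d `^ m * p))%R; last by ring.
  rewrite (_ : q * _ = 2 `^ m * (n * ((1 + n `^ b) * slow y)) * (C * t `^ (m / 2) * q))%R; last by rewrite /K2; ring.
  by rewrite ler_wpM2l// mulr_ge0 ?powR_ge0.
have [W WE] : exists W : R, \int[mu]_x (slow x : R)%:E = W%:E.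
  exists (fine (\int[mu]_x (slow x : R)%:E)); rewrite fineK// ge0_fin_numE ?(@integral_slow R N N0)//.
  by apply: integral_ge0 => x _; rewrite lee_fin ltW.
have W0 : (0 <= W)%R by rewrite -lee_fin -WE; apply: integral_ge0 => x _; rewrite lee_fin ltW.
have K11 : (0 < K1 + 1)%R by rewrite ltr_wpDl.
have m20 : (0 < m / 2)%R by rewrite divr_gt0.
apply: (vanishes_le2 K11 _ _ _ (calm_bounded mh hn) (vanishes_powR (K2 * W) m20)); last 2 first.
- by move=> t; exact: wosc_ge0.
- by move=> t; rewrite lee_fin mulr_ge0 ?powR_ge0// mulr_ge0.
move=> t /andP[t0 _]; have t20 : (0 < 2 * t)%R by rewrite mulr_gt0.
have k0 := @hker_ge0 R N (2 * t); have mk := @measurable_hker R N (2 * t).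
have mo := measurable_osc t mh; have o0 := osc_ge0 h t.
have mc := measurable_conv mk mse k0 se0.
have kt0 : (0 <= K2 * t `^ (m / 2))%R by rewrite mulr_ge0 ?powR_ge0.
apply: (@le_trans _ _ (\int[mu]_x (K1%:E * ((slow x)%:E * osc h t x) +
    (K2 * t `^ (m / 2))%:E * conv (hker (2 * t)) (fun y => (slow y)%:E) x))).
  apply: ge0_le_integral => //.
  - by move=> x _; rewrite mule_ge0 ?lee_fin ?powR_ge0.
  - by apply: emeasurable_funM => //; apply: measurable_EFinf; exact: measurable_powR_enorm.
  - by apply: emeasurable_funD; apply: measurable_funeM => //; exact: emeasurable_funM.
  - by move=> x _; exact: pt.
rewrite ge0_integralD//; last 4 first.
- by move=> x _; rewrite !mule_ge0.
- by apply: measurable_funeM; exact: emeasurable_funM.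
- by move=> x _; rewrite mule_ge0 ?conv_ge0.
- exact: measurable_funeM.
rewrite ge0_integralZl//; last 2 first.
- exact: emeasurable_funM.
- by move=> x _; rewrite mule_ge0.
rewrite ge0_integralZl//; last by move=> x _; exact: conv_ge0.
have q0 : 0 <= (K2 * W * t `^ (m / 2))%:E by rewrite lee_fin; exact: mulr_ge0 (mulr_ge0 K20 W0) (powR_ge0 _ _).
rewrite integral_conv_hker// WE -EFinM [leRHS](ge0_muleDr _ (wosc_ge0 h t) q0).
apply: leeD; first by rewrite lee_wpmul2r ?wosc_ge0// lee_fin lerDl.
rewrite -EFinM lee_fin (_ : K2 * t `^ (m / 2) * W = K2 * W * t `^ (m / 2))%R; last by ring.
by rewrite mulrDl mul1r lerDr; apply: mulr_ge0 K10 _; rewrite -lee_fin.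
Qed.

End SmallOscillationNorm.

(** * Vanishing of the oscillation in the weighted norm *)

Section OscillationVanishes.
Context {R : realType} {N : nat}.
Hypothesis N0 : (0 < N)%N.
Local Notation mu := (lebesgueN R N).
Local Notation X := (Rspace R N).
Implicit Types (x y z : X) (t : R) (h : X -> R).
Local Open Scope ereal_scope.
Variables (rho g : R).
Hypotheses (rho0 : (0 < rho)%R) (g0 : (0 < g)%R) (sub : (g + N%:R * rho < N%:R)%R).

Let rho1 : (rho < 1)%R.
Proof.
have N1 : (0 < N%:R :> R)%R by rewrite ltr0n.
by rewrite -(ltr_pM2l N1) mulr1 (lt_trans _ sub)// ltrDr.
Qed.

Let p1 : (1 < rho^-1)%R. Proof. by rewrite invf_gt1. Qed.
Let p0 : (0 < rho^-1)%R. Proof. by rewrite invr_gt0. Qed.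

Transparent bnd.

Lemma bndE (f : X -> \bar R) A :
  bnd rho g f A = (\int[mu]_x (wmul g f x `^ rho^-1) <= (A `^ rho^-1)%:E) :> Prop.
Proof. by rewrite /bnd gt_eqF. Qed.

Opaque bnd.

Lemma poweR_le_linear (a : \bar R) (K p : R) : (1 < p)%R -> 0 <= a -> (0 <= K)%R -> a <= K%:E ->
  a `^ p <= (K `^ (p - 1))%:E * a.
Proof.
move=> hp; case: a => [a| |]//; rewrite !lee_fin => a0 K0 aK.
have hp1 : (0 < p - 1)%R by rewrite subr_gt0.
have [->|an0] := eqVneq a 0%R.
  by rewrite powR0 ?mulr0// gt_eqF// (lt_trans ltr01).
have -> : (a `^ p = a `^ (p - 1) * a)%R.
  by rewrite -{3}[a]powRr1// -powRD ?subrK// an0 implybT.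
rewrite ler_wpM2r//.
by rewrite ge0_ler_powR ?nnegrE ?(ltW hp1).
Qed.

(** The oscillation is at most 2 n, so its power 1 / rho is at most a constant times the
    oscillation, and the norm reduces to the integral in [wosc_weight]. K = 2 n + 1 stays positive
    for n = 0. *)
Lemma osc_bnd_bounded (n : R) h : (0 <= n)%R -> measurable_fun setT h ->
  (forall x, `|h x| <= n)%R -> (forall x, (n < enorm x)%R -> h x = 0%R) ->
  forall e : R, (0 < e)%R -> exists2 d : R, (0 < d <= 1)%R & forall t, (0 < t < d)%R ->
    bnd rho g (osc h t) e.
Proof.
move=> n0 mh hn hs e e0.
have m0 : (0 < g * rho^-1)%R by rewrite mulr_gt0.
pose K := (2 * n + 1)%R; have K0 : (0 < K)%R by rewrite ltr_wpDl// mulr_ge0.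
have KK : (0 < K `^ (rho^-1 - 1))%R by rewrite powR_gt0.
have e1 : (0 < e `^ rho^-1 / K `^ (rho^-1 - 1))%R by rewrite divr_gt0// powR_gt0.
have [d d01 H] := wosc_weight N0 n0 m0 mh hn hs e1; exists d => // t t0d.
have [t0 _] := andP t0d; rewrite bndE.
have mo := measurable_osc t mh; have o0 := osc_ge0 h t.
apply: (@le_trans _ _ (\int[mu]_x ((K `^ (rho^-1 - 1))%:E * ((enorm x `^ (g * rho^-1))%:E * osc h t x)))).
  apply: ge0_le_integral => //.
  - by move=> x _; exact: poweR_ge0.
  - by apply: measurable_poweRf; exact: measurable_wmul.
  - apply: measurable_funeM; apply: emeasurable_funM => //.
    by apply: measurable_EFinf; exact: measurable_powR_enorm.
  - move=> x _; rewrite /wmul poweRM ?lee_fin ?powR_ge0//.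
    rewrite poweR_EFin -powRrM muleCA; apply: lee_wpmul2l; first by rewrite lee_fin powR_ge0.
    apply: poweR_le_linear => //; first exact: ltW.
    apply: osc_le_cst => // y; apply: (le_trans (ler_normB _ _)).
    by have := hn x; have := hn y; rewrite /K; lra.
rewrite ge0_integralZl//; last 3 first.
- apply: emeasurable_funM => //.
  by apply: measurable_EFinf; exact: measurable_powR_enorm.
- by move=> x _; rewrite mule_ge0 ?lee_fin ?powR_ge0.
- by rewrite lee_fin ltW.
apply: le_trans (lee_wpmul2l _ (H t t0d)) _; first by rewrite lee_fin ltW.
by rewrite -EFinM mulrC divfK ?gt_eqF.
Qed.

Lemma osc_bnd_crude : exists2 C : R, (0 < C)%R & forall h t A, (0 < t)%R -> (0 <= A)%R ->
  measurable_fun setT h -> bnd rho g (absp h) A -> bnd rho g (osc h t) (C * A).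
Proof.
have rr : (0 <= rho <= rho)%R by rewrite (ltW rho0) lexx.
have gg : (0 <= g <= g)%R by rewrite (ltW g0) lexx.
have [C C0 HC] := heat_bnd N0 rr gg sub.
exists (4 * (C + 1))%R; first by rewrite mulr_gt0// addr_gt0.
move=> h t A t0 A0 mh hA; have mah := measurable_absp mh.
have a0 x : 0 <= absp h x by rewrite lee_fin.
have := HC t (absp h) A t0 A0 mah a0 hA.
rewrite !subrr mulr0 mul0r addr0 oppr0 powRr0 mulr1 => H1.
have k0 := @hker_ge0 R N t; have mk := @measurable_hker R N t.
have mc := measurable_conv mk mah k0 a0.
have CA : (0 <= C * A)%R by rewrite mulr_ge0// ltW.
have r01 : (0 <= rho <= 1)%R by rewrite (ltW rho0) ltW.
have H2 := bndD r01 CA A0 mc mah (fun x => conv_ge0 x k0 a0) a0 H1 hA.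
have B0 : (0 <= 4 * (C * A + A))%R by rewrite mulr_ge0// addr_ge0.
apply: (bnd_le (ltW rho0) _ (measurable_osc t mh) (emeasurable_funD mc mah) (osc_ge0 h t) _ H2).
  by rewrite B0 le_eqVlt; apply/orP; left; apply/eqP; ring.
by move=> x; exact: osc_crude.
Qed.

Lemma osc_bnd_small (A : R) h : measurable_fun setT h -> bnd rho g (absp h) A ->
  forall e : R, (0 < e)%R -> exists2 d : R, (0 < d <= 1)%R & forall t, (0 < t < d)%R ->
    bnd rho g (osc h t) e.
Proof.
move=> mh hA e e0; have [C C0 HC] := osc_bnd_crude.
(* Both parts of h are to contribute e / 8, since [bndD] multiplies their sum by 4; for the
   remainder the crude bound costs the factor C. *)
have eta0 : (0 < e / (8 * C))%R by rewrite divr_gt0// mulr_gt0.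
(* Truncation in size and in space at once; the remainder tends to 0 in norm by monotone
   convergence. *)
pose S (n : nat) x := (`|h x| <= n%:R)%R && (enorm x <= n%:R)%R.
have mS n : measurable_fun setT (S n).
  apply: measurable_and; apply: measurable_fun_ler => //; last exact: measurable_enorm.
  exact: measurableT_comp.
have SS n x : S n x -> S n.+1 x.
  by move=> /andP[h1 h2]; rewrite /S (le_trans h1) ?(le_trans h2)// ler_nat.
pose F x := ((enorm x `^ g * `|h x|) `^ rho^-1)%R.
have F0 x : (0 <= F x)%R by exact: powR_ge0.
have mF : measurable_fun setT F.
  apply: measurable_powRf; apply: measurable_funM; first exact: measurable_powR_enorm.
  exact: measurableT_comp.
pose f n x := (if S n x then F x else 0)%R.
have mf n : measurable_fun setT (f n) by exact: measurable_fun_ifT.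
have Fsup x : (F x)%:E <= ereal_sup (range (fun n => (f n x)%:E)).
  have [n1 hn1] : exists n, (`|h x| <= n%:R)%R.
    by exists (Num.bound `|h x|); rewrite ltW// archi_boundP.
  have [n2 hn2] : exists n, (enorm x <= n%:R)%R.
    by exists (Num.bound (enorm x)); rewrite ltW// archi_boundP// enorm_ge0.
  apply: le_ereal_sup_tmp; exists (f (maxn n1 n2) x)%:E; first by exists (maxn n1 n2).
  rewrite /f /S (le_trans hn1) ?(le_trans hn2)// ler_nat ?leq_maxl ?leq_maxr//.
have Foo : \int[mu]_x (F x)%:E < +oo.
  move: hA; rewrite bndE => hA; apply: (le_lt_trans _ (ltry (A `^ rho^-1)%R)).
  apply: le_trans hA; rewrite le_eqVlt; apply/orP; left; apply/eqP.
  by apply: eq_integral => x _; rewrite /wmul /absp -EFinM poweR_EFin.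
have ep : (0 < (e / (8 * C)) `^ rho^-1)%R by rewrite powR_gt0.
have [n hn] : exists n, \int[mu]_x (F x - f n x)%:E <= ((e / (8 * C)) `^ rho^-1)%:E.
  apply: (monotone_tail mf mF _ _ _ Fsup Foo ep).
  - by move=> n x; rewrite /f; case: ifP.
  - move=> n x; rewrite /f; case: ifPn => [/SS ->//|_]; by case: ifP.
  - by move=> n x; rewrite /f; case: ifP.
pose h1 x := (if S n x then h x else 0)%R; pose h2 x := (if S n x then 0 else h x)%R.
have m1 : measurable_fun setT h1 by exact: measurable_fun_ifT.
have m2 : measurable_fun setT h2 by exact: measurable_fun_ifT.
have hE x : h x = (h1 x + h2 x)%R by rewrite /h1 /h2; case: ifP => _; rewrite ?addr0 ?add0r.
have b2 : bnd rho g (absp h2) (e / (8 * C)).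
  rewrite bndE; apply: le_trans hn; rewrite le_eqVlt; apply/orP; left; apply/eqP.
  apply: eq_integral => x _; rewrite /wmul /absp -EFinM poweR_EFin /h2 /f.
  case: ifP => _; last by rewrite subr0.
  by rewrite normr0 mulr0 powR0 ?subrr// gt_eqF.
have n0 : (0 <= n%:R :> R)%R by [].
have e8 : (0 < e / 8)%R by rewrite divr_gt0.
have [||d d01 Hd] := osc_bnd_bounded n0 m1 _ _ e8.
- by move=> x; rewrite /h1; case: ifPn => [/andP[]//|_]; rewrite normr0.
- by move=> x xn; rewrite /h1; case: ifPn => // /andP[_]; rewrite leNgt xn.
exists d => // t t0d; have [t0 _] := andP t0d.
have H1 := Hd t t0d; have H2 := HC h2 t _ t0 (ltW eta0) m2 b2.
have r01 : (0 <= rho <= 1)%R by rewrite (ltW rho0) ltW.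
have c2 : (0 <= C * (e / (8 * C)))%R by rewrite mulr_ge0 ?(ltW C0) ?(ltW eta0).
have mo1 := measurable_osc t m1; have mo2 := measurable_osc t m2.
have H := bndD r01 (ltW e8) c2 mo1 mo2 (osc_ge0 h1 t) (osc_ge0 h2 t) H1 H2.
apply: (bnd_le (ltW rho0) _ (measurable_osc t mh) (emeasurable_funD mo1 mo2) (osc_ge0 h t) _ H).
  apply/andP; split; first by rewrite mulr_ge0// addr_ge0// ltW.
  by rewrite le_eqVlt; apply/orP; left; apply/eqP; field; rewrite gt_eqF.
move=> x; apply: osc_le2 => // y z; rewrite !hE.
by rewrite (_ : _ - _ = (h1 z - h1 y) + (h2 z - h2 y))%R ?ler_normD//; ring.
Qed.

End OscillationVanishes.

Lemma fine_shift_le (R : realType) (a b w : \bar R) (c d : R) :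
  (0 <= a -> a < +oo -> 0 <= b -> b < +oo ->
  a + d%:E <= b + c%:E + w -> b + c%:E <= a + d%:E + w ->
  `|fine a - fine b - (c - d)|%:E <= w)%E.
Proof.
case: a b w => [a| |] [b| |] [w| |]//= _ _ _ _.
  by rewrite -!EFinD !lee_fin => h1 h2; rewrite ler_norml; apply/andP; split; lra.
by move=> _ _; exact: leey.
Qed.

(** * Existence of solutions *)

Section Regularity.
Context {R : realType} {N : nat}.
Hypothesis N0 : (0 < N)%N.
Local Notation mu := (lebesgueN R N).
Local Notation X := (Rspace R N).
Implicit Types (x y z : X) (s t r : R) (h : X -> R).
Local Open Scope ereal_scope.

Lemma measurable_heat h t : (0 < t)%R -> measurable_fun setT h -> measurable_fun setT (heat t h).
Proof.
move=> t0 mh; rewrite (_ : heat t h = fun x => fine (lin (posp h) t x - lin (negp h) t x)); last first.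
  by apply/funext => x; exact: heatE.
apply: (@measurableT_comp _ _ _ _ _ _ fine); first exact: fine_measurable.
apply: emeasurable_funB; apply: measurable_conv => //; try exact: measurable_hker;
  try exact: hker_ge0.
- exact: measurable_posp.
- exact: posp_ge0.
- exact: measurable_negp.
- exact: negp_ge0.
Qed.

(** As the kernel has mass 1, the difference averages h y - h x. The signed integral is avoided by
    adding to each part of h the constant opposite part of h x, constants being fixed by the heat
    kernel. *)
Lemma heat_osc_le h t x : (0 < t)%R -> measurable_fun setT h -> lin (absp h) t x < +oo ->
  `|heat t h x - h x|%:E <= osc h t x.
Proof.
move=> t0 mh fin; have mp := measurable_posp mh; have mn := measurable_negp mh.
have k0 := @hker_ge0 R N t; have mk := @measurable_hker R N t.
have lE : lin (absp h) t x = lin (posp h) t x + lin (negp h) t x.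
  rewrite /lin -(convD x mk mp mn k0 (posp_ge0 h) (negp_ge0 h)).
  by apply: eq_conv => y; exact: abspE.
have lp0 := lin_ge0 t x (posp_ge0 h); have ln0 := lin_ge0 t x (negp_ge0 h).
have fp : lin (posp h) t x < +oo by apply: le_lt_trans fin; rewrite lE leeDl.
have fn : lin (negp h) t x < +oo by apply: le_lt_trans fin; rewrite lE leeDr.
rewrite heatE// (fineB_ge0 lp0 fp ln0 fn).
pose cp := Num.max (h x) 0%R; pose cn := Num.max (- h x)%R 0%R.
have cp0 : (0 <= cp)%R by rewrite le_max lexx orbT.
have cn0 : (0 <= cn)%R by rewrite le_max lexx orbT.
have hE y : h y = (Num.max (h y) 0 - Num.max (- h y) 0)%R.
  by have := posp_sub_negp h y; rewrite /posp /negp -EFinB => -[].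
have mo := measurable_osc_slice x mh.
have o0 (y : X) : 0 <= `|h y - h x|%:E by rewrite lee_fin.
have key (f1 f2 : X -> R) (c1 c2 : R) : (0 <= c1)%R -> (0 <= c2)%R ->
    measurable_fun setT f1 -> measurable_fun setT f2 -> (forall y, 0 <= f1 y)%R ->
    (forall y, 0 <= f2 y)%R -> (forall y, f1 y + c2 <= f2 y + c1 + `|h y - h x|)%R ->
    conv (hker t) (EFin \o f1) x + c2%:E <= conv (hker t) (EFin \o f2) x + c1%:E + osc h t x.
  move=> c10 c20 m1 m2 f10 f20 H.
  have me1 : measurable_fun setT (EFin \o f1) by exact: measurable_EFinf.
  have me2 : measurable_fun setT (EFin \o f2) by exact: measurable_EFinf.
  rewrite -(conv_hker_cst x t0 c10) -(conv_hker_cst x t0 c20) /osc -!convD//; last 2 first.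
  - exact: emeasurable_funD.
  - by move=> y; rewrite adde_ge0 ?lee_fin.
  apply: le_conv => //.
  - exact: emeasurable_funD.
  - by apply: emeasurable_funD => //; exact: emeasurable_funD.
  - by move=> y; rewrite adde_ge0 ?lee_fin.
have mp' : measurable_fun setT (fun y => Num.max (h y) 0%R) by exact: measurable_maxr.
have mn' : measurable_fun setT (fun y => Num.max (- h y)%R 0%R).
  by apply: measurable_maxr => //; exact: measurableT_comp.
have p0 y : (0 <= Num.max (h y) 0)%R by rewrite le_max lexx orbT.
have n0 y : (0 <= Num.max (- h y) 0)%R by rewrite le_max lexx orbT.
have h1 : lin (posp h) t x + cn%:E <= lin (negp h) t x + cp%:E + osc h t x.
  apply: (key _ _ cp cn cp0 cn0 mp' mn' p0 n0) => y.
  have := ler_norm (h y - h x); rewrite {1}(hE y) {1}(hE x) /cp /cn; lra.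
have h2 : lin (negp h) t x + cp%:E <= lin (posp h) t x + cn%:E + osc h t x.
  apply: (key _ _ cn cp cn0 cp0 mn' mp' n0 p0) => y.
  have := ler_norm (- (h y - h x)); rewrite normrN {1}(hE y) {1}(hE x) /cp /cn; lra.
rewrite (hE x) -/cp -/cn; exact: (fine_shift_le lp0 fp ln0 fn h1 h2).
Qed.

Lemma cvge0_le (T : Type) (F : set_system T) {FF : Filter F} (f : T -> \bar R) :
  (forall a, 0 <= f a) ->
  (forall e : R, (0 < e)%R -> \forall a \near F, f a <= e%:E) ->
  f a @[a --> F] --> 0.
Proof.
move=> f0 h; apply/fine_cvgP; split.
  near=> x; rewrite ge0_fin_numE//; apply: (@le_lt_trans _ _ 1%R%:E); last exact: ltry.
  by near: x; apply: h.
apply/cvgr0Pnorm_le => e e0; near=> x.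
have : f x <= e%:E by near: x; exact: h.
by move: (f0 x) => /=; case: (f x) => [a| |]//; rewrite !lee_fin => a0; rewrite ger0_norm.
Unshelve. all: by end_near. Qed.

Lemma near_within (J : set R) t (P : R -> Prop) (d : R) : (0 < d)%R ->
  (forall s, J s -> (`|s - t| < d)%R -> P s) -> \forall s \near within J (nbhs t), P s.
Proof.
move=> d0 h; rewrite near_withinE; apply/nbhs_ballP; exists d => //= s.
by rewrite /ball/= distrC => hs Js; exact: h.
Qed.

Variables (q : \bar R) (l al g nu rho T L M : R) (phi phi0 : X -> R).
Local Notation qi := (rinv q).
Hypotheses (q1 : 1 < q) (al0 : (0 < al)%R) (g0 : (0 < g)%R) (qi0 : (0 <= qi)%R)
  (gq : (g + N%:R * qi < N%:R)%R) (sub : (al * (N%:R * qi + g) < 2 + l)%R)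
  (nug : (0 < nu < g)%R) (gs : (g < nu * (al + 1) - l)%R)
  (rhoq : (0 <= rho)%R /\ ((qi = 0 /\ rho = 0) \/ 0 < rho * (al + 1) < qi)%R)
  (low : (N%:R * qi + g < nu * (al + 1) - l + N%:R * (rho * (al + 1)) < N%:R)%R)
  (other : forall d : R, (0 < d)%R -> (N%:R * qi + g + l < (al + 1) * d)%R ->
      (N%:R * (rho * (al + 1)) + nu * (al + 1) - l - d < 2)%R)
  (T0 : (0 < T)%R) (L0 : (0 < L)%R) (M0 : (0 < M)%R).
Hypotheses (mphi : measurable_fun setT phi) (mphi0 : measurable_fun setT phi0)
  (pp : {ae mu, forall y, phi0 y = phi y}) (phiL : bnd qi g (absp phi) L)
  (vM : forall t, (0 < t <= T)%R -> bnd rho nu (dom l al phi t)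
     (M * t `^ (- (N%:R / 2 * (qi - rho) + (g - nu) / 2)))).

Local Notation u := (sol l al phi).
Local Notation v := (dom l al phi).

Let mabs := measurable_absp mphi.
Let abs0 y : 0 <= absp phi y. Proof. by rewrite lee_fin. Qed.
Let mv := jmeas_dom l al0 mphi.
Let v0 := dom_ge0 l al phi.
Let src0 s y : 0 <= src l al v s y. Proof. exact: src_ge0. Qed.
Let msrc := jmeas_src l al mv.
Let vN s y : (s <= 0)%R -> v s y = 0. Proof. exact: dom_le0. Qed.
Let q01 : (0 <= qi <= 1)%R.
Proof.
have N1 : (0 < N%:R :> R)%R by rewrite ltr0n.
by rewrite qi0/= -(ler_pM2l N1) mulr1 (le_trans _ (ltW gq))// lerDr ltW.
Qed.

Lemma dom_ae_fin t : (0 < t <= T)%R -> {ae mu, forall y, v t y < +oo}.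
Proof.
move=> tT; have [r0 _] := rhoq.
exact: (bnd_ae_fin N0 r0 (jmeas_slice t mv) (v0 t) (vM tT)).
Qed.

Let aefin t : (t <= T)%R -> forall s, (0 < s <= t)%R -> {ae mu, forall y, v s y < +oo}.
Proof. by move=> tT s /andP[s0 st]; apply: dom_ae_fin; rewrite s0 (le_trans st). Qed.

Lemma measurable_sol t : measurable_fun setT (u t).
Proof. exact: (measurableT_comp (jmeas_sol l al0 mphi) (measurable_pair1 t)). Qed.

Lemma sol_wLp t : (0 < t <= T)%R -> wLp q g (u t).
Proof.
move=> tT; have [t0 _] := andP tT; split; first exact: measurable_sol.
have qq : (0 <= qi <= qi)%R by rewrite qi0 lexx.
have gg : (0 <= g <= g)%R by rewrite (ltW g0) lexx.
have [C C0 HC] := heat_bnd N0 qq gg gq.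
have H1 := HC t (absp phi) L t0 (ltW L0) mabs abs0 phiL.
have [D [kap [eta [D0 kap0 eta0 HD]]]] := duh_bnd_qg N0 al0 g0 qi0 gq sub nug gs rhoq low T0.
have [H2 _] := HD M v mv v0 vN M0 vM.
have hk0 s (z : X) := hker_ge0 (t - s) z.
have a1 : (0 <= C * t `^ (- (N%:R / 2 * (qi - qi) + (g - g) / 2)) * L)%R.
  by rewrite !mulr_ge0 ?powR_ge0 ?(ltW C0) ?(ltW L0).
have a2 : (0 <= D * M `^ (al + 1) * t `^ kap)%R by rewrite !mulr_ge0 ?powR_ge0 ?(ltW D0).
have m1 := jmeas_slice t (jmeas_lin mabs abs0).
have m2 := measurable_duh (jmeas_hker t) msrc hk0 src0.
have H := bndD q01 a1 a2 m1 m2 (fun x => lin_ge0 t x abs0) (fun x => duh_ge0 x hk0 src0) H1 (H2 t tT).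
apply: (@le_lt_trans _ _ (4 * (C * t `^ (- (N%:R / 2 * (qi - qi) + (g - g) / 2)) * L +
   D * M `^ (al + 1) * t `^ kap))%:E); last exact: ltry.
apply: (wnorm_le q1 (measurable_sol t) (emeasurable_funD m1 m2) _ _ _ H).
- by move=> x; apply: adde_ge0; [exact: lin_ge0|exact: duh_ge0].
- apply: ae_mono (dom_ae_fin tT) => x vx.
  rewrite -domE//; apply: (@le_trans _ _ (fine (v t x))%:E); first by rewrite lee_fin sol_bound.
  by rewrite (fineK_ge0 (v0 t x) vx).
- by rewrite mulr_ge0// addr_ge0.
Qed.

Lemma sol_time_modulus : exists a b eta : R, [/\ (0 <= a)%R, (0 <= b)%R, (0 < eta)%R &
  forall r t, (0 < r < t)%R -> (t <= T)%R ->
    wnorm q g (u t \- u r)%R <= (a * ((t - r) / r) + b * (t - r) `^ eta)%:E /\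
    wnorm q g (u r \- u t)%R <= (a * ((t - r) / r) + b * (t - r) `^ eta)%:E].
Proof.
have [C C0 HC] := lin_bnd_diff N0 g0 qi0 gq.
have [D [kap [eta [D0 kap0 eta0 HD]]]] := duh_bnd_qg N0 al0 g0 qi0 gq sub nug gs rhoq low T0.
have [_ H2] := HD M v mv v0 vN M0 vM.
exists (4 * C * L)%R, (4 * D * M `^ (al + 1))%R, eta; split => //.
- by rewrite !mulr_ge0 ?(ltW C0) ?(ltW L0).
- by rewrite !mulr_ge0 ?(ltW D0) ?powR_ge0.
move=> r t rt tT; have [r0 rt'] := andP rt.
have h1 := HC r t (absp phi) L rt (ltW L0) mabs abs0 phiL.
have h2 := H2 r t rt tT.
have hd0 s (z : X) := hdiff_ge0 (t - s) (r - s) z.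
have a1 : (0 <= C * ((t - r) / r) * L)%R.
  by rewrite !mulr_ge0 ?(ltW C0) ?(ltW L0) ?subr_ge0 ?(ltW rt')// invr_ge0 ltW.
have a2 : (0 <= D * M `^ (al + 1) * (t - r) `^ eta)%R by rewrite !mulr_ge0 ?powR_ge0 ?(ltW D0).
have m1 := measurable_conv (measurable_hdiff t r) mabs (@hdiff_ge0 R N t r) abs0.
have m2 := measurable_duh (jmeas_hdiff t r) msrc hd0 src0.
have c1 x := conv_ge0 x (@hdiff_ge0 R N t r) abs0.
have c2 x := duh_ge0 x hd0 src0.
have H := bndD q01 a1 a2 m1 m2 c1 c2 h1 h2.
have -> : (4 * C * L * ((t - r) / r) + 4 * D * M `^ (al + 1) * (t - r) `^ eta =
  4 * (C * ((t - r) / r) * L + D * M `^ (al + 1) * (t - r) `^ eta))%R by ring.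
have B0 : (0 <= 4 * (C * ((t - r) / r) * L + D * M `^ (al + 1) * (t - r) `^ eta))%R.
  by rewrite mulr_ge0// addr_ge0.
have rT : (0 < r <= T)%R by rewrite r0 (le_trans (ltW rt')).
have tT' : (0 < t <= T)%R by rewrite (lt_trans r0).
have ae0 := ae_and (dom_ae_fin tT') (dom_ae_fin rT).
have W0 x : 0 <= conv (hdiff t r) (absp phi) x + duh (fun s => hdiff (t - s) (r - s)) (src l al v) x.
  exact: adde_ge0.
split; apply: (wnorm_le q1 _ (emeasurable_funD m1 m2) W0 _ B0 H).
- by apply: measurable_funB; exact: measurable_sol.
- apply: ae_mono ae0 => x [vt vr] /=.
  exact: (sol_dist_le al0 mphi rt (aefin tT) vt vr).
- by apply: measurable_funB; exact: measurable_sol.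
- apply: ae_mono ae0 => x [vt vr] /=; rewrite distrC.
  exact: (sol_dist_le al0 mphi rt (aefin tT) vt vr).
Qed.

Lemma sol_continuous t (e : R) : (0 < t <= T)%R -> (0 < e)%R ->
  exists2 d : R, (0 < d)%R & forall s, (s <= T)%R -> (`|s - t| < d)%R ->
    (0 < s)%R /\ wnorm q g (u s \- u t)%R <= e%:E.
Proof.
move=> /andP[t0 tT] e0; have [a [b [eta [a0 b0 eta0 H]]]] := sol_time_modulus.
have e2 : (0 < e / 2)%R by rewrite divr_gt0.
have [d1 /andP[d10 _] h1] := vanishes_powR (a * (2 / t)) ltr01 e2.
have [d2 /andP[d20 _] h2] := vanishes_powR b eta0 e2.
have t20 : (0 < t / 2)%R by rewrite divr_gt0.
(* Staying within t / 2 of t keeps the earlier of the two times above t / 2, so the factor 1 / r is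
   at most 2 / t. *)
exists (Num.min (t / 2)%R (Num.min d1 d2)); first by rewrite !lt_min t20 d10.
move=> s sT; rewrite !lt_min => /andP[st /andP[sd1 sd2]].
have s2 : (t / 2 < s)%R.
  by move: st; rewrite ltr_norml => /andP[st _]; move: st; lra.
have s0 : (0 < s)%R := lt_trans t20 s2; split => //.
have small (r r' : R) : (t / 2 < r)%R -> (0 < r' - r)%R -> (r' - r < d1)%R -> (r' - r < d2)%R ->
    (a * ((r' - r) / r) + b * (r' - r) `^ eta <= e)%R.
  move=> r2 k0 kd1 kd2; have r0 := lt_trans t20 r2.
  have q1' := h1 (r' - r)%R (introT andP (conj k0 kd1)).
  have q2' := h2 (r' - r)%R (introT andP (conj k0 kd2)).
  move: q1' q2'; rewrite !lee_fin powRr1 ?(ltW k0)// => q1' q2'.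
  apply: (@le_trans _ _ (e / 2 + e / 2)%R); last by lra.
  apply: lerD => //; apply: le_trans q1'; rewrite -mulrA ler_wpM2l// mulrC ler_wpM2r ?(ltW k0)//.
  by rewrite -[leRHS]invf_div lef_pV2 ?posrE// ltW.
have [ts|ts|->] := ltgtP s t.
- have rt : (0 < s < t)%R by rewrite s0.
  have [_ h] := H s t rt tT; apply: le_trans h _; rewrite lee_fin small ?subr_gt0//.
  + by rewrite distrC in sd1; apply: le_lt_trans sd1; exact: ler_norm.
  + by rewrite distrC in sd2; apply: le_lt_trans sd2; exact: ler_norm.
- have rt : (0 < t < s)%R by rewrite t0.
  have [h _] := H t s rt sT; apply: le_trans h _; rewrite lee_fin small ?subr_gt0//.
  + by move: t20; lra.
  + by apply: le_lt_trans sd1; exact: ler_norm.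
  + by apply: le_lt_trans sd2; exact: ler_norm.
- apply: (@wnorm_le _ _ q g (u t \- u t)%R (fun=> 0) e q1) => //.
  + by apply: measurable_funB; exact: measurable_sol.
  + by apply: aeW => x /=; rewrite subrr normr0.
  + exact: ltW.
  + apply: (bnd_mono qi0 _ _ _ (bnd0 qi g)) => //.
    by rewrite lexx ltW.
Qed.

Lemma sol_heat_le : exists b kap : R, [/\ (0 < b)%R, (0 < kap)%R &
  forall t, (0 < t <= T)%R -> wnorm q g (u t \- heat t phi0)%R <= (b * t `^ kap)%:E].
Proof.
have [D [kap [eta [D0 kap0 eta0 HD]]]] := duh_bnd_qg N0 al0 g0 qi0 gq sub nug gs rhoq low T0.
have [H1 _] := HD M v mv v0 vN M0 vM.
exists (D * M `^ (al + 1))%R, kap; split => //; first by rewrite mulr_gt0 ?powR_gt0.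
move=> t tT; have [t0 tT'] := andP tT.
have hk0 s (z : X) := hker_ge0 (t - s) z.
apply: (wnorm_le q1 _ (measurable_duh (jmeas_hker t) msrc hk0 src0) (fun x => duh_ge0 x hk0 src0) _ _ (H1 t tT)).
- by apply: measurable_funB; [exact: measurable_sol|exact: measurable_heat].
- apply: ae_mono (dom_ae_fin tT) => x vx /=; rewrite (ae_eq_heat x t0 mphi0 mphi pp).
  by case: (sol_lin_dist_le al0 mphi t0 (aefin tT') vx).
- by rewrite !mulr_ge0 ?powR_ge0 ?(ltW D0).
Qed.

(** Through the linear flow: u - heat is the Duhamel part, and heat - phi is bounded by the
    oscillation. The latter vanishes in norm only for q < +oo, whence the condition [0 < qi]. *)
Lemma sol_initial (e : R) : (0 < qi)%R -> (0 < e)%R ->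
  exists2 d : R, (0 < d)%R & forall t, (0 < t < d)%R -> (t <= T)%R ->
    wnorm q g (u t \- phi0)%R <= e%:E.
Proof.
move=> qp e0; have e8 : (0 < e / 8)%R by rewrite divr_gt0.
have [D [kap [eta [D0 kap0 eta0 HD]]]] := duh_bnd_qg N0 al0 g0 qi0 gq sub nug gs rhoq low T0.
have [H1 _] := HD M v mv v0 vN M0 vM.
have [d1 /andP[d10 _] h1] := vanishes_powR (D * M `^ (al + 1)) kap0 e8.
have [d2 /andP[d20 _] h2] := osc_bnd_small N0 qp g0 gq mphi phiL e8.
exists (Num.min d1 d2) => [|t /andP[t0]]; first by rewrite lt_min d10.
rewrite lt_min => /andP[td1 td2] tT; have tT' : (0 < t <= T)%R by rewrite t0.
have hk0 s (z : X) := hker_ge0 (t - s) z.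
have b1 := h1 t (introT andP (conj t0 td1)); have b2 := h2 t (introT andP (conj t0 td2)).
have m1 := measurable_duh (jmeas_hker t) msrc hk0 src0.
have m2 := measurable_osc t mphi.
have a1 : (0 <= D * M `^ (al + 1) * t `^ kap)%R by rewrite !mulr_ge0 ?powR_ge0 ?(ltW D0).
have H := bndD q01 a1 (ltW e8) m1 m2 (fun x => duh_ge0 x hk0 src0) (osc_ge0 phi t) (H1 t tT') b2.
apply: (@le_trans _ _ (4 * (D * M `^ (al + 1) * t `^ kap + e / 8))%:E); last first.
  by move: b1; rewrite !lee_fin; lra.
apply: (wnorm_le q1 _ (emeasurable_funD m1 m2) _ _ _ H).
- by apply: measurable_funB => //; exact: measurable_sol.
- by move=> x; apply: adde_ge0; [exact: duh_ge0|exact: osc_ge0].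
- apply: ae_mono (ae_and pp (dom_ae_fin tT')) => x [px vx] /=; rewrite px.
  have [lf hd] := sol_lin_dist_le al0 mphi t0 (aefin tT) vx.
  have ho := heat_osc_le t0 mphi lf.
  apply: le_trans (leeD hd ho); rewrite -EFinD lee_fin.
  by rewrite (_ : _ - _ = (u t x - heat t phi x) + (heat t phi x - phi x))%R ?ler_normD//; ring.
- by rewrite mulr_ge0// addr_ge0// ltW.
Qed.

End Regularity.

(** * Assembling a solution in the class of the theorem *)

Section Existence.
Context {R : realType} {N : nat}.
Hypothesis N0 : (0 < N)%N.
Local Notation X := (Rspace R N).
Implicit Types (x y z : X) (s t : R) (h : X -> R).
Local Open Scope ereal_scope.

Lemma rinv_ge0 (q : \bar R) : 1 < q -> (0 <= rinv q)%R.
Proof.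
case: q => [p| |]//.
by rewrite lte_fin => p1; rewrite rinvE// invr_ge0 ltW// (lt_trans ltr01).
Qed.

Lemma rinv_gt0 (q : \bar R) : 1 < q -> q != +oo -> (0 < rinv q)%R.
Proof.
case: q => [p| |]//; rewrite lte_fin => p1 _.
by rewrite rinvE// invr_gt0 (lt_trans ltr01).
Qed.

Lemma rinv_le (q r : \bar R) : 1 < q -> q < r \/ (q = +oo /\ r = +oo) ->
  1 < r /\ (0 <= rinv r <= rinv q)%R.
Proof.
move=> q1 [qr|[-> ->]]; last by split; [exact: ltry|rewrite rinvy lexx].
have r1 : 1 < r := lt_trans q1 qr; split => //; rewrite rinv_ge0//=.
case: q q1 qr => [p| |]; last by [].
  rewrite lte_fin => p1; case: r r1 => [b b1| |]; last by [].
    rewrite lte_fin => pb; have b1' := lt_trans p1 pb.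
    by rewrite !rinvE// lef_pV2 ?posrE ?(ltW pb) ?(lt_trans ltr01).
  by move=> _ _; rewrite rinvy rinv_ge0.
by move=> _ h; have := lt_le_trans h (leey r); rewrite ltxx.
Qed.

Lemma wnorm_subrr q g h (e : R) : 1 < q -> (0 <= e)%R -> measurable_fun setT h ->
  wnorm q g (h \- h)%R <= e%:E.
Proof.
move=> q1 e0 mh; apply: (@wnorm_le R N q g (h \- h)%R (fun=> 0) e q1) => //.
- exact: measurable_funB.
- by apply: aeW => x /=; rewrite subrr normr0.
- by apply: (bnd_mono (rinv_ge0 q1) _ _ _ (bnd0 _ g)) => //; rewrite lexx.
Qed.

Lemma wnorm_ge0 q g h : 0 <= wnorm q g h.
Proof. exact: Lnorm_ge0. Qed.

Lemma mild_at0 (al l : R) h (w : R -> X -> R) : w 0%R = h -> mild_at al l h w 0%R.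
Proof.
move=> w0; apply: aeW => x; rewrite set_itv1; split.
  apply/integrableP; split; first exact: measurable_fun_set1.
  by rewrite integral_set1 ltry.
by rewrite w0 /heat eqxx /Rintegral integral_set1 addr0.
Qed.

Lemma time_dom_ge0 (q : \bar R) (T t : R) : time_dom q T t ->
  (0 <= t <= T)%R /\ (q = +oo -> (0 < t)%R).
Proof.
rewrite /time_dom; case: eqP => [_|qn] /=; rewrite in_itv/=; last by move=> h; split.
by move=> /andP[t0 tT]; split => //; rewrite (ltW t0).
Qed.

(** Cleared of denominators, the lower bound on 1 / r in [admissible] is the condition on d = n p +
    nu in the last clause of [exists_exponents]. *)
Lemma admissible_lower (n al l g qi nu p : R) : (0 < n)%R -> (0 < al)%R ->
  (qi / (al + 1) - (nu * (al + 1) - l - g) / (n * (al + 1)) < p)%R ->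
  (n * qi + g + l < (al + 1) * (n * p + nu))%R.
Proof.
move=> n0 al0; have al1 : (0 < al + 1)%R by rewrite addr_gt0.
have -> : (qi / (al + 1) - (nu * (al + 1) - l - g) / (n * (al + 1)) =
  (n * qi - (nu * (al + 1) - l - g)) / (n * (al + 1)))%R.
  by field; rewrite !gt_eqF.
rewrite ltr_pdivrMr ?mulr_gt0// => h; rewrite -subr_gt0.
by move: h; rewrite -subr_gt0; congr (0 < _)%R; ring.
Qed.

(** The constant is fixed by the auxiliary pair before [nu] and [r] are introduced; the given pair
    only enters through [majorant_bnd_other], whose constant may depend on everything. *)
Lemma solution_exists (q : \bar R) (l al g : R) : 1 < q -> (0 < al)%R ->
  (- N%:R < l)%R -> (- 2 < l)%R -> (0 < g)%R -> (l < g * al)%R ->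
  (g + N%:R * rinv q < N%:R)%R -> (al * (N%:R * rinv q + g) < 2 + l)%R ->
  exists2 C : R, (0 < C)%R & forall (nu : R) (r : \bar R), admissible (N := N) al l g q nu r ->
    forall (T L : R) (phi : X -> R), (0 < T)%R -> (0 < L)%R ->
    (C * (L `^ al * T `^ (1 - (al * (N%:R * rinv q + g) - l) / 2)) <= 1)%R ->
    measurable_fun setT phi -> wnorm q g phi <= L%:E ->
    exists u, is_solution al l g q nu r phi T u.
Proof.
move=> q1 al0 ln l2 g0 lg gq sub; have qi0 := rinv_ge0 q1.
have n0 : (0 < N%:R :> R)%R by rewrite ltr0n.
have [nu0 [rho0 [nug gs rhoq low other]]] := exists_exponents n0 al0 ln l2 g0 lg qi0 gq sub.
have [C C0 HC] := majorant_exists N0 al0 gq sub nug gs rhoq low.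
exists C => // nu r [nu_g _ qr /andP[rlow _]] T L phi0 T0 L0 small mphi0 phiL.
have [phi [mphi pp philL]] := wnorm_representative q1 mphi0 (ltW L0) phiL.
have abs0 y : 0 <= absp phi y by rewrite lee_fin.
have mabs := measurable_absp mphi.
have [M M0 vM] := HC T L (absp phi) T0 L0 small mabs abs0 philL.
have [r1 pq] := rinv_le q1 qr.
have dlow := admissible_lower n0 al0 rlow.
have [K K0 HK] := majorant_bnd_other N0 al0 g0 qi0 gq sub nug gs rhoq low other
  pq nu_g dlow T0 L0 mabs abs0 philL M0 vM.
(* [sol] vanishes at time 0 by convention of the kernel, so the initial value is put in by hand; it
   is the original datum, not its representative. *)
pose w s := if s == 0%R then phi0 else sol l al phi s.
have wE s : (0 < s)%R -> w s = sol l al phi s by move=> s0; rewrite /w gt_eqF.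
have w0 : w 0%R = phi0 by rewrite /w eqxx.
have aefin := dom_ae_fin N0 al0 rhoq mphi vM.
exists w; split.
- split => t /time_dom_ge0[/andP[t0 tT] toy].
    have [->|tn0] := eqVneq t 0%R; first by rewrite w0; split => //; exact: le_lt_trans phiL (ltry _).
    have tp : (0 < t)%R by rewrite lt_neqAle eq_sym tn0.
    rewrite wE//; apply: (sol_wLp N0 q1 al0 g0 qi0 gq sub nug gs rhoq low T0 L0 M0 mphi philL vM).
    by rewrite tp.
  apply: cvge0_le => [s|e e0]; first exact: wnorm_ge0.
  have [tz|tn0] := eqVneq t 0%R.
    have qn : q != +oo by apply/eqP => /toy; rewrite tz ltxx.
    have [d d0 Hd] := sol_initial N0 q1 al0 g0 qi0 gq sub nug gs rhoq low T0 M0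
      mphi mphi0 pp philL vM (rinv_gt0 q1 qn) e0.
    apply: (near_within d0) => s /time_dom_ge0[/andP[s0 sT] _]; rewrite tz subr0 w0 => sd.
    have [->|sn0] := eqVneq s 0%R; first by rewrite w0; apply: wnorm_subrr => //; exact: ltW.
    have sp : (0 < s)%R by rewrite lt_neqAle eq_sym sn0.
    by rewrite wE//; apply: Hd => //; rewrite sp (le_lt_trans (ler_norm s)).
  have tp : (0 < t)%R by rewrite lt_neqAle eq_sym tn0.
  have tpT : (0 < t <= T)%R by rewrite tp.
  have [d d0 Hd] := sol_continuous N0 q1 al0 g0 qi0 gq sub nug gs rhoq low T0 L0 M0
      mphi philL vM tpT e0.
  apply: (near_within d0) => s /time_dom_ge0[/andP[s0 sT] _] sd.
  by have [sp h] := Hd s sT sd; rewrite !wE.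
- move=> t /time_dom_ge0[/andP[t0 tT] _].
  have [->|tn0] := eqVneq t 0%R; first exact: mild_at0.
  have tp : (0 < t)%R by rewrite lt_neqAle eq_sym tn0.
  apply: (sol_mild al0 mphi mphi0 pp tp wE) => s /andP[s0 st]; apply: aefin.
  by rewrite s0 (le_trans st).
- exists K => t tT; have [t0 _] := andP tT; rewrite wE//.
  have tb0 : (0 <= t `^ beta (N := N) g q nu r)%R by exact: powR_ge0.
  have Kt : (0 <= K * t `^ (- (N%:R / 2 * (rinv q - rinv r) + (g - nu) / 2)))%R.
    by rewrite mulr_ge0 ?powR_ge0// ltW.
  have H : wnorm r nu (sol l al phi t) <=
      (K * t `^ (- (N%:R / 2 * (rinv q - rinv r) + (g - nu) / 2)))%:E.
    have dt0 := dom_ge0 l al phi t.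
    apply: (wnorm_le r1 _ (jmeas_slice t (jmeas_dom l al0 mphi)) dt0 _ Kt (HK t tT)).
      exact: measurable_sol.
    apply: ae_mono (aefin t tT) => x vx; rewrite -(fineK_ge0 (dt0 x) vx) lee_fin.
    exact: sol_bound.
  apply: le_trans (lee_wpmul2l _ H) _; first by rewrite lee_fin.
  rewrite -EFinM lee_fin mulrCA /beta -powRD; last by rewrite (gt_eqF t0) implybT.
  by rewrite subrr powRr0 mulr1.
- move=> qy; apply: cvge0_le => [s|e e0]; first exact: wnorm_ge0.
  have [b [kap [b0 kap0 H]]] := sol_heat_le N0 q1 al0 g0 qi0 gq sub nug gs rhoq low T0 M0
    mphi mphi0 pp vM.
  have [d /andP[d0 _] hd] := vanishes_powR b kap0 e0.
  near=> t; have t0 : (0 < t)%R by [].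
  have tT : (t <= T)%R by near: t; exact: nbhs_right_le.
  have td : (t < d)%R by near: t; exact: nbhs_right_lt.
  rewrite wE//; apply: le_trans (H t _) _; first by rewrite t0.
  by apply: hd; rewrite t0.
Unshelve. all: by end_near. Qed.

End Existence.

(** * The lower bound for the existence time *)

Lemma powR_smallness (R : realType) (C al theta L : R) : 0 < C -> 0 < al -> 0 < theta -> 0 < L ->
  C * (L `^ al * (C `^ (- (al * theta)^-1) * L `^ (- theta^-1)) `^ (al * theta)) = 1.
Proof.
move=> C0 al0 th0 L0; have at0 : al * theta != 0 by rewrite mulf_neq0 ?gt_eqF.
rewrite [X in _ * (_ * X)]powRM ?powR_ge0// -!powRrM.
rewrite mulNr mulVf// mulNr (_ : theta^-1 * (al * theta) = al); last by field; rewrite gt_eqF.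
rewrite powRN (powRN L) powRr1 ?(ltW C0)//; field.
by rewrite !gt_eqF// powR_gt0.
Qed.

Lemma wnorm_scale_le (R : realType) (N : nat) (q : \bar R) (g lambda A : R)
    (phi : Rspace R N -> R) : (1 < q)%E -> 0 < lambda -> 0 <= A -> measurable_fun setT phi ->
  (wnorm q g phi <= A%:E -> wnorm q g (fun x => (lambda * phi x)%R) <= (lambda * A)%:E)%E.
Proof.
move=> q1 l0 A0 mphi phiA; have l0' := ltW l0.
have [psi [mpsi pp psiA]] := wnorm_representative q1 mphi A0 phiA.
have mabs := measurable_absp mpsi.
have abs0 y : (0 <= absp psi y)%E by rewrite lee_fin.
have H := bndZ (rinv_ge0 q1) l0' A0 mabs abs0 psiA.
apply: (wnorm_le q1 _ (measurable_funeM lambda%:E mabs) _ _ _ H).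
- exact: measurable_funM.
- by move=> x; rewrite mule_ge0// lee_fin.
- by apply: ae_mono pp => x ->; rewrite -EFinM lee_fin normrM ger0_norm.
- exact: mulr_ge0.
Qed.

Unset Implicit Arguments.

Theorem corollaryC2 (R : realType) (N : nat) (alpha l gamma : R) (q : \bar R)
  (hN : (1 <= N)%N)
  (halpha : 0 < alpha)
  (hl : - Num.min 2 N%:R < l < N%:R * alpha)
  (hq : (1 < q)%E)
  (hgamma : 0 < gamma < N%:R)
  (hgammal : l / alpha < gamma < (2 + l) / alpha)
  (hqgamma : gamma / N%:R <= rinv q + gamma / N%:R < 1)
  (hsub : N%:R * alpha / 2 * rinv q + gamma * alpha / 2 - l / 2 < 1) :
  exists C : R, 0 < C /\
    forall (nu : R) (r : \bar R),
      admissible (N := N) alpha l gamma q nu r ->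
    forall phi : Rspace R N -> R, wLp q gamma phi ->
    forall lambda : R, 0 < lambda ->
    (* x^-1 is taken in the extended reals, where 0^-1 = +oo *)
    (C%:E * ((lambda%:E * wnorm q gamma phi) `^
               ((2 + l) / (2 * alpha) - N%:R / 2 * rinv q - gamma / 2)^-1%R)^-1
     <= Tmax alpha l gamma q nu r (fun x => (lambda * phi x)%R))%E.
Proof.
have n0 : 0 < N%:R :> R by rewrite ltr0n.
have [l2 ln] : - 2 < l /\ - N%:R < l.
  by case/andP: hl; rewrite ltrNl lt_min => /andP[h1 h2] _; rewrite !(ltrNl _ l).
have [g0 _] := andP hgamma; have [lg _] := andP hgammal; have [_ qg] := andP hqgamma.
have lg' : l < gamma * alpha by rewrite -ltr_pdivrMr.
have gq : gamma + N%:R * rinv q < N%:R.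
  move: qg; rewrite -(ltr_pM2l n0) mulr1 mulrDr addrC (_ : N%:R * (gamma / N%:R) = gamma)//.
  by field; rewrite gt_eqF.
have sub : alpha * (N%:R * rinv q + gamma) < 2 + l by move: hsub; lra.
have [C2 C20 HC] := solution_exists hN hq halpha ln l2 g0 lg' gq sub.
set theta := (2 + l) / (2 * alpha) - N%:R / 2 * rinv q - gamma / 2.
(* The exponent of T in the smallness condition is alpha theta, which turns subcriticality into
   theta > 0 and puts the power -1 / theta on the norm. *)
have kE : 1 - (alpha * (N%:R * rinv q + gamma) - l) / 2 = alpha * theta.
  by rewrite /theta; field; rewrite gt_eqF.
have th0 : 0 < theta by rewrite -(pmulr_rgt0 _ halpha) -kE; move: sub; lra.
rewrite kE in HC.
(* With this constant T = C L^(-1/theta) solves C2 L^alpha T^(alpha theta) = 1, the limiting case of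
   the smallness condition. *)
exists (C2 `^ (- (alpha * theta)^-1)); split; first by rewrite powR_gt0.
move=> nu r adm phi [mphi phioo] lambda lambda0.
have [A A0 AE] : exists2 A : R, 0 <= A & wnorm q gamma phi = A%:E.
  exists (fine (wnorm q gamma phi)); first by rewrite fine_ge0// wnorm_ge0.
  by rewrite fineK_ge0// wnorm_ge0.
have mlphi : measurable_fun setT (fun x => lambda * phi x) by exact: measurable_funM.
have normle : (wnorm q gamma (fun x => (lambda * phi x)%R) <= (lambda * A)%:E)%E.
  by apply: wnorm_scale_le => //; rewrite AE.
have exist T L : 0 < T -> 0 < L -> lambda * A <= L -> C2 * (L `^ alpha * T `^ (alpha * theta)) <= 1 ->
    (T%:E <= Tmax alpha l gamma q nu r (fun x => (lambda * phi x)%R))%E.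
  move=> T0 L0 AL small; apply: ereal_sup_ubound; exists T => //; split => //.
  apply: (HC nu r adm T L _ T0 L0 small mlphi).
  by apply: le_trans normle _; rewrite lee_fin.
rewrite AE -EFinM.
have [A00|An0] := eqVneq A 0; last first.
  have L0 : 0 < lambda * A by rewrite mulr_gt0// lt_neqAle eq_sym An0.
  rewrite poweR_EFin inver gt_eqF ?powR_gt0// -powRN -EFinM.
  apply: (exist _ (lambda * A)) => //; first by rewrite mulr_gt0 ?powR_gt0.
  by rewrite powR_smallness.
(* For data of norm 0 the lower bound reads +oo. A solution must exist on every [0, T], and the
   condition is met by choosing L > 0 small in terms of T. *)
suff -> : Tmax alpha l gamma q nu r (fun x => (lambda * phi x)%R) = +oo%E by rewrite leey.
apply/eqyP => T T0.
pose P := C2 * T `^ (alpha * theta).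
have P0 : 0 < P by rewrite mulr_gt0 ?powR_gt0.
apply: (exist T (P^-1 `^ alpha^-1)) => //.
- by rewrite powR_gt0 ?invr_gt0.
- by rewrite A00 mulr0 powR_ge0.
- rewrite -powRrM mulVf ?gt_eqF// powRr1 ?invr_ge0 ?(ltW P0)// mulrCA.
  by rewrite -/P mulVf ?gt_eqF.
Qed.
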